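(* Let $n\ge 2$, let $\Omega\subset\mathbb{C}^n$ be a bounded domain, let $u$ be a negative maximal plurisubharmonic function in $\Omega$, and let $U,\tilde U$ be open subsets of $\Omega$ with $U\Subset\tilde U\Subset\Omega$. Assume that $(u_j)$ is a sequence in $PSH^-(\tilde U)\cap C(\tilde U)$ which is decreasing to $u$ in $\tilde U$. Then for every real $a>n-1$, $$\int_U |u_j|^{-a}(dd^c u_j)^n\longrightarrow 0\quad\text{as } j\to\infty.$$
   Context: For an open set $D\subset\mathbb{C}^n$, $PSH(D)$ denotes the set of plurisubharmonic functions on $D$ (not identically $-\infty$ on any component), $PSH^-(D)$ the set of negative ones (values in $[-\infty,0)$), and $C(D)$ the continuous real-valued functions. A function $u\in PSH(D)$ is called maximal if for every open set $G\Subset D$ and every upper semicontinuous function $v$ on $\overline{G}$ such that $v\in PSH(G)$ and $v|_{\partial G}\le u|_{\partial G}$, one has $v\le u$ on $G$. For continuous plurisubharmonic $u_j$, $(dd^c u_j)^n$ is the Bedford–Taylor Monge–Ampère measure. ''Decreasing to'' means pointwise monotone decreasing convergence. *)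

(* Defs.v *)
From mathcomp Require Import all_boot all_order all_algebra.
From mathcomp Require Import all_classical all_reals all_analysis.
From mathcomp Require Import complex.

Set Implicit Arguments.
Unset Strict Implicit.
Unset Printing Implicit Defensive.

Import Order.TTheory GRing.Theory Num.Theory.
Import numFieldNormedType.Exports.

Local Open Scope classical_set_scope.
Local Open Scope ring_scope.

(* Seen as a [numFieldType], [R[i]] carries the library's norm topology. *)
Definition Cplx (R : realType) : numFieldType := (R[i])%C.

Notation Cspace R n := 'rV[Cplx R]_n.

Definition rC (R : realType) (x y : R) : Cplx R := (x +i* y)%C.

(* The Borel sigma-algebra of C^n. *)
Notation Bspace R n := (g_sigma_algebraType (@open (Cspace R n))).

Section Plurisubharmonic.
Context {R : realType} {n : nat}.
Local Notation V := (Cspace R n).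
Implicit Types (D G Omega : set V) (f u v : V -> \bar R).

Definition domain D : Prop := [/\ open D, connected D & D !=set0].

Definition relatively_compact G D : Prop :=
  compact (closure G) /\ closure G `<=` D.

(* Values in [-oo, +oo[; the neighbourhoods are those of the subspace [D]. *)
Definition usc_on D f : Prop := forall z, D z ->
  (f z < +oo)%E /\
  forall b : R, (f z < b%:E)%E -> \forall y \near z, D y -> (f y < b%:E)%E.

Definition circle_mean f (z w : V) : \bar R :=
  (((2 * pi)^-1 : R)%:E *
   \int[lebesgue_measure]_(t in `[0%R, (2 * pi)%R])
      f (z + rC (cos t) (sin t) *: w)%R)%E.

Definition psh D f : Prop :=
  [/\ usc_on D f,
      forall z w : V, (forall s : Cplx R, `|s| <= 1 -> D (z + s *: w)) ->
        (f z <= circle_mean f z w)%E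
    & forall z, D z -> exists2 y, connected_component D z y & f y != -oo%E].

Definition psh_neg D f : Prop := psh D f /\ forall z, D z -> (f z < 0)%E.

Definition maximal_psh Omega u : Prop :=
  psh Omega u /\
  forall G v, open G -> relatively_compact G Omega ->
    usc_on (closure G) v -> psh G v ->
    (forall z, (closure G `\` G) z -> (v z <= u z)%E) ->
    forall z, G z -> (v z <= u z)%E.

End Plurisubharmonic.

(* The Bedford-Taylor power (dd^c u)^k is defined by induction on k as
   (dd^c u)^(k+1) = dd^c (u (dd^c u)^k) in the sense of currents, where
   d^c = i (dbar - d'), so that dd^c = 2 i d' dbar.  The product by the
   continuous function u makes sense because (dd^c u)^k is of order zero.

   A current of order zero is given by its coefficients in the basis dx_S of
   real forms, each being a Radon measure in the sense of Bourbaki: a linear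
   functional on compactly supported continuous functions, bounded for the
   uniform norm on functions supported in a given compact set. *)
Section MongeAmpere.
Context {R : realType} {n : nat}.
Local Notation V := (Cspace R n).
Implicit Types (D : set V) (phi psi u : V -> R).

(* Real coordinates of C^n: [(j, false)] is x_j = Re z_j and [(j, true)] is
   y_j = Im z_j. *)
Local Notation idx := ('I_n * bool)%type.

Definition real_dir (a : idx) : V :=
  (if a.2 then rC 0 1 else rC 1 0) *: delta_mx 0 a.1.

Definition along (a : idx) phi (z : V) : R -> R :=
  fun t => phi (z + rC t 0 *: real_dir a).

Definition pderiv (a : idx) phi : V -> R := fun z => derive1 (along a phi z) 0.

Definition pderivs (s : seq idx) phi : V -> R := foldr pderiv phi s.

Definition smooth phi : Prop := forall s : seq idx,
  continuous (pderivs s phi) /\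
  forall a z, derivable (along a (pderivs s phi) z) 0 1.

Definition supp phi : set V := closure [set z | phi z != 0].

Definition test_cont D phi : Prop :=
  [/\ continuous phi, compact (supp phi) & supp phi `<=` D].

Definition test_smooth D phi : Prop :=
  [/\ smooth phi, compact (supp phi) & supp phi `<=` D].

Definition bourbaki_measure D (L : (V -> R) -> R) : Prop :=
  (forall (c : R) phi psi, test_cont D phi -> test_cont D psi ->
     L (fun z => c * phi z + psi z) = c * L phi + L psi) /\
  (forall K : set V, compact K -> K `<=` D -> exists C : R,
     forall phi (M : R), test_cont D phi -> supp phi `<=` K ->
       (forall z, `|phi z| <= M) -> `|L phi| <= C * M).

(* dx_S is the wedge product over S in the order x_1, y_1, ..., x_n, y_n, so
   that dx_[set: idx] is the standard volume form of C^n. *)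
Definition idx_rank (a : idx) : nat := (a.1.*2 + a.2)%N.

(* dx_a /\ dx_S = wedge_sign a S * dx_(a |: S) when a \notin S. *)
Definition wedge_sign (a : idx) (S : {set idx}) : R :=
  (-1) ^+ #|[set s in S | (idx_rank s < idx_rank a)%N]|.

Definition conj_idx (a : idx) : idx := (a.1, ~~ a.2).

Definition current := {set idx} -> (V -> R) -> R.

(* The coefficient of dx_S in dd^c (u T).  On coefficients,
     d^c T = \sum_a (-1)^(a.2) (d_a T_S) dx_(conj_idx a) /\ dx_S,
     d T = \sum_b (d_b T_S) dx_b /\ dx_S,
   and the two integrations by parts contribute no sign. *)
Definition ddc_mul u (T : current) : current := fun S phi =>
  \sum_(a : idx) \sum_(b : idx | (b \in S) && (conj_idx a \in S :\ b))
    (-1) ^+ a.2 * wedge_sign b (S :\ b) *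
    wedge_sign (conj_idx a) (S :\ b :\ conj_idx a) *
    T (S :\ b :\ conj_idx a)%SET
      (fun z => u z * pderiv b (pderiv a phi) z).

End MongeAmpere.

(* Lebesgue integral of a compactly supported continuous function on C^m,
   as an iterated integral over the complex coordinates. *)
Fixpoint Cintegral {R : realType} (m : nat) : (Cspace R m -> R) -> R :=
  match m return (Cspace R m -> R) -> R with
  | 0 => fun f => f 0
  | p.+1 => fun f =>
      \int[(lebesgue_measure \x lebesgue_measure)%E]_(q in [set: R * R])
        Cintegral (fun z : Cspace R p =>
          f (row_mx (rC q.1 q.2)%:M z : Cspace R (1 + p)))
  end.

Section MongeAmpereMeasure.
Context {R : realType} {n : nat}.
Local Notation V := (Cspace R n).
Implicit Types (D : set V) (u : V -> R).

Fixpoint is_ddc_power D u (k : nat) (T : current) : Prop :=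
  (forall S, bourbaki_measure D (T S)) /\
  match k with
  | 0 => forall S phi, test_cont D phi ->
           T S phi = if S == finset.set0 then Cintegral phi else 0
  | l.+1 => exists2 T' : current, is_ddc_power D u l T' &
           forall S phi, test_smooth D phi -> T S phi = ddc_mul u T' S phi
  end.

(* [mu] is the measure (dd^c u)^n on [D]; its values on sets which are not
   contained in [D] are irrelevant. *)
Definition is_monge_ampere D u (mu : {measure set (Bspace R n) -> \bar R}) :
    Prop :=
  (forall K : set V, compact K -> K `<=` D -> (mu K < +oo)%E) /\
  exists2 T : current, is_ddc_power D u n T &
    forall phi, test_cont D phi ->
      T finset.setT phi = \int[mu]_(z in D) phi z.

End MongeAmpereMeasure.

(* Main.v *)
Require Import Defs.
From HB Require Import structures.
From mathcomp Require Import all_boot all_order all_algebra.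
From mathcomp Require Import all_classical all_reals all_analysis.
From mathcomp Require Import complex ring lra spectral.

Set Implicit Arguments.
Unset Strict Implicit.
Unset Printing Implicit Defensive.

Import Order.TTheory GRing.Theory Num.Theory.
Import numFieldNormedType.Exports.

Local Open Scope classical_set_scope.
Local Open Scope ring_scope.

(** Write β for dd^c of |z|^2/2, and W_p(f) for the integral of η^2 (-f)^(-(al-n+p)) (dd^c f)^p ∧
    β^(n-p), where η is a cutoff and n-1 < al < n. Replacing a by such an al ≤ a costs only a
    constant, because |u_j| is bounded below on compact sets.

    The first point is that W_n is almost nondecreasing in f among smooth negative plurisubharmonic
    functions ([Wd_lower], [comb], [functional_mono]). Its derivative in a direction w ≥ 0 contains
    dd^c w. Integration by parts moves dd^c onto η^2 (-f)^(-al), where the terms in the gradient of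
    f complete to a square. What remains is (n+1) al times a nonnegative integral carrying (dd^c
    f)^n, minus an error due to the derivatives of η, at most a constant times the integral of η'^2
    w (-f)^(-al) (dd^c f)^(n-1) ∧ β, with η' = 1 on the support of η. This is the leading term in
    the derivative of W_(n-1) for η', so a multiple of W_(n-1) absorbs it and leaves an error one
    level lower. The exponent stays positive down to p = 1 because al > n-1; at p = 0 the functional
    -W_0, in which -f has the power n-al in ]0,1[, is nondecreasing without error. Hence for some
    nonnegative combination A of the lower functionals both A and W_n + A are nondecreasing. Since
    (-f)^(n-al) ≤ 1 - f, A is bounded below where L^1 norms are bounded ([adm_lower], [L1_bound]).

    The second point uses maximality. Let f_j be smooth functions decreasing to u near the support
    of η, obtained by mollifying u_j, and let v_j be the largest continuous plurisubharmonic
    function between f_j and (1-ρ) f_j, ρ being a cutoff equal to 1 near the support of η. Then v_j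
    = f_j off the support of ρ, v_j has no Monge-Ampère mass near the support of η ([env_zero]), and
    v_j decreases to a plurisubharmonic function equal to u off the support of ρ. Maximality puts
    this limit below u ([w_le_u]), so v_j ≤ f_i + s for j large, by a Dini argument ([dini]). For g
    smooth and slightly above v_j this gives W_n(f_j) ≤ W_n(g) + A(g) - A(f_j) ≤ W_n(g) + A(f_i + s)
    - A(f_j), which is small once A(f_i) is close to the infimum of the A(f_j) ([Wi_cvg0]).

    The envelope v_j is handled without solving a Dirichlet problem. Its second differences are
    bounded, so its mollifications have bounded Hessians, which are Cauchy in L^2. Where the
    determinant of such a Hessian is not small, the Taylor polynomial is strictly plurisubharmonic;
    unless the remainder is large, which is rare in mean square, a bump of the envelope contradicts
    its maximality ([no_bump], [ma_zero]). Finally [link] shows, by induction on k, that the current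
    (dd^c u_j)^k is the limit of the smooth forms built on mollifications, which transfers the
    estimates to the given measures ([ma_upper]). *)

Section Cplx_facts.
Context {R : realType}.
Implicit Types (x y t : R) (c d : Cplx R).

(** * Complex scalars through real and imaginary parts *)

Definition cre (c : Cplx R) : R := complex.Re (c : R[i]%C).

Definition cim (c : Cplx R) : R := complex.Im (c : R[i]%C).

Lemma creE x y : cre (rC x y) = x. Proof. by []. Qed.

Lemma cimE x y : cim (rC x y) = y. Proof. by []. Qed.

Lemma rC_eta c : c = rC (cre c) (cim c). Proof. by case: c. Qed.

Lemma rCD x y x' y' : rC x y + rC x' y' = rC (x + x') (y + y').
Proof. by []. Qed.

Lemma rCM x y x' y' : rC x y * rC x' y' = rC (x * x' - y * y') (x * y' + y * x').
Proof. by []. Qed.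

Lemma rCN x y : - rC x y = rC (- x) (- y). Proof. by []. Qed.

Lemma rC0 : rC 0 0 = 0 :> Cplx R. Proof. by []. Qed.

Lemma rC1 : rC 1 0 = 1 :> Cplx R. Proof. by []. Qed.

Lemma cre_is_additive c d : cre (c + d) = cre c + cre d.
Proof. by case: c; case: d. Qed.

Lemma cim_is_additive c d : cim (c + d) = cim c + cim d.
Proof. by case: c; case: d. Qed.

Lemma creN c : cre (- c) = - cre c. Proof. by case: c. Qed.

Lemma cimN c : cim (- c) = - cim c. Proof. by case: c. Qed.

Lemma creM c d : cre (c * d) = cre c * cre d - cim c * cim d.
Proof. by case: c; case: d. Qed.

Lemma cimM c d : cim (c * d) = cre c * cim d + cim c * cre d.
Proof. by case: c; case: d. Qed.

Lemma Cplx_lt x y : (rC x 0 < rC y 0) = (x < y).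
Proof. by rewrite /rC ltcE/= eqxx. Qed.

Lemma Cplx_le x y : (rC x 0 <= rC y 0) = (x <= y).
Proof. by rewrite /rC lecE/= eqxx. Qed.

Lemma Cplx_gt0 (e : Cplx R) : 0 < e -> e = rC (cre e) 0 /\ 0 < cre e.
Proof. by case: e => a b; rewrite ltcE/= => /andP[/eqP<- a0]; split. Qed.

Definition cnorm (c : Cplx R) : R := Num.sqrt (cre c ^+ 2 + cim c ^+ 2).

Lemma cnormE c : `|c| = rC (cnorm c) 0.
Proof. by rewrite /cnorm; exact: normc_def. Qed.

End Cplx_facts.

(** * The norm of C^n as a real number *)

Section real_norm.
Context {R : realType} {n : nat}.
Local Notation V := (Cspace R n).
Implicit Types (x y z w : V) (t e : R) (f g : V -> R).

(** The norm on C^n takes values in [Cplx R]; [nr] is the real number behind it. It is the maximum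
    of the moduli of the coordinates, whence a factor 2n when it is compared with the Euclidean
    norm. *)
Definition nr z : R := cre `|z|.

Lemma nrE z : `|z| = rC (nr z) 0.
Proof.
have : 0 <= `|z| by apply: normr_ge0.
by rewrite /nr; case: (`|z|) => a b; rewrite lecE/= => /andP[/eqP<- _].
Qed.

Lemma nr_ge0 z : 0 <= nr z.
Proof. by have := normr_ge0 z; rewrite nrE -rC0 Cplx_le. Qed.

Lemma nr0 : nr (0 : V) = 0.
Proof. by rewrite /nr normr0. Qed.

Lemma nrD z w : nr (z + w) <= nr z + nr w.
Proof. by have := ler_normD z w; rewrite !nrE rCD addr0 Cplx_le. Qed.

Lemma nrN z : nr (- z) = nr z.
Proof. by rewrite /nr normrN. Qed.

Lemma nrB z w : nr (z - w) = nr (w - z).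
Proof. by rewrite -nrN opprB. Qed.

Lemma nrZ (c : Cplx R) z : nr (c *: z) = cnorm c * nr z.
Proof. by rewrite {1}/nr normrZ cnormE nrE rCM creE mul0r subr0. Qed.

Lemma cnorm_real t : cnorm (rC t 0) = `|t|.
Proof. by rewrite /cnorm creE cimE expr0n addr0 sqrtr_sqr. Qed.

Lemma nrZr t z : nr (rC t 0 *: z) = `|t| * nr z.
Proof. by rewrite nrZ cnorm_real. Qed.

Lemma cnorm_circle t : cnorm (rC (cos t) (sin t)) = 1.
Proof. by rewrite /cnorm creE cimE cos2Dsin2 sqrtr1. Qed.

Lemma nr_triangle x y z : nr (x - z) <= nr (x - y) + nr (y - z).
Proof. by rewrite (_ : x - z = (x - y) + (y - z)) ?nrD// addrA subrK. Qed.

Lemma nr_ler_sub z w : nr z - nr w <= nr (z - w).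
Proof. by rewrite lerBlDr -{1}(subrK w z) nrD. Qed.

Lemma cnorm_ge0 (c : Cplx R) : 0 <= cnorm c.
Proof. exact: sqrtr_ge0. Qed.

Lemma cre_le_cnorm (c : Cplx R) : `|cre c| <= cnorm c.
Proof. by rewrite -sqrtr_sqr ler_wsqrtr// lerDl sqr_ge0. Qed.

Lemma cim_le_cnorm (c : Cplx R) : `|cim c| <= cnorm c.
Proof. by rewrite -sqrtr_sqr ler_wsqrtr// lerDr sqr_ge0. Qed.

Lemma cnorm_le_abs (c : Cplx R) : cnorm c <= `|cre c| + `|cim c|.
Proof.
rewrite -[leRHS]ger0_norm ?addr_ge0// -sqrtr_sqr ler_wsqrtr//.
rewrite sqrrD !real_normK ?num_real// lerD2r lerDl.
by rewrite mulrn_wge0// mulr_ge0.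
Qed.

Lemma cnorm_le_nr z (j : 'I_n) : cnorm (z 0 j) <= nr z.
Proof.
rewrite -Cplx_le -cnormE -nrE [leRHS]/Num.norm/= mx_normE.
rewrite -[leLHS]nngE num_le.
exact: (le_bigmax _ (fun i : 'I_1 * 'I_n => `|z i.1 i.2|%:nng) (ord0, j)).
Qed.

Lemma nr_le z e : 0 <= e -> (forall j, cnorm (z 0 j) <= e) -> nr z <= e.
Proof.
move=> e0 h; rewrite -Cplx_le -nrE /Num.norm/= mx_normE.
have e0' : 0 <= rC e 0 by rewrite -rC0 Cplx_le.
rewrite -[leRHS]/((NngNum e0')%:num) num_le; apply/bigmax_leP; split => //=.
  by move=> [i j] _ /=; rewrite -num_le/= ord1 cnormE Cplx_le.
Qed.

Lemma nbhs_nrP z (P : set V) :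
  (\forall y \near z, P y) <-> exists2 d : R, 0 < d & forall y, nr (y - z) < d -> P y.
Proof.
split=> [/nbhs_normP[e /= e0 eP]|[d d0 dP]].
  have [ee e1] := Cplx_gt0 e0.
  exists (cre e) => // y yz; apply: eP => /=.
  by rewrite ee nrE Cplx_lt nrB.
apply/nbhs_normP; exists (rC d 0) => /=; first by rewrite -rC0 Cplx_lt.
by move=> y /=; rewrite nrE Cplx_lt => yz; apply: dP; rewrite nrB.
Qed.

Lemma cvg_nrP (f : V -> R) z :
  {for z, continuous f} <->
  forall e : R, 0 < e -> exists2 d : R, 0 < d & forall y, nr (y - z) < d -> `|f y - f z| < e.
Proof.
split=> [/cvgrPdist_lt fz e e0|fz].
  have /nbhs_nrP[d d0 dP] := fz e e0; exists d => // y /dP.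
  by rewrite distrC.
apply/(@cvgrPdist_lt _ _ _ (nbhs z) (nbhs_filter z)) => e e0; apply/nbhs_nrP.
have [d d0 dP] := fz e e0; exists d => // y /dP.
by rewrite distrC.
Qed.

End real_norm.

(** * Sequential compactness and functions of compact support *)

Section compactness.
Context {R : realType} {n : nat}.
Local Notation V := (Cspace R n).
Implicit Types (x y z w : V) (t e : R) (f g : V -> R) (K D : set V).

(** Compactness is used through cluster points of sequences: if a uniform statement fails,
    counterexamples for 1/(k+1) accumulate at a point that contradicts the pointwise statement. *)
Lemma compact_seq K (x : nat -> V) : compact K -> (forall k, K (x k)) ->
  exists2 z, K z & forall (d : R) N, 0 < d -> exists2 k, (N <= k)%N & nr (x k - z) < d.
Proof.
move=> cK Kx.
have [|z [Kz clz]] := cK (x @ \oo) _; first by exists 0%N => // k _ /=.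
exists z => // d N d0.
have [||y [[k/= Nk <-] yd]] := clz [set y | exists2 k, (N <= k)%N & x k = y] [set y | nr (y - z) < d].
- by exists N => // k Nk /=; exists k.
- by apply/nbhs_nrP; exists d.
- by exists k.
Qed.

Lemma continuous_Cplx2 : continuous (fun p : R * R => rC p.1 p.2).
Proof.
move=> [x y]; apply/(@cvgrPdist_lt _ (Cplx R)) => /= e e0.
have [-> {}e0] := Cplx_gt0 e0.
have e20 : 0 < cre e / 2 by rewrite divr_gt0.
have [h1 h2] : (\forall x' \near x, `|x - x'| < cre e / 2) /\
    (\forall y' \near y, `|y - y'| < cre e / 2).
  by split; apply: nbhsx_ballx.
exists ([set x' | `|x - x'| < cre e / 2], [set y' | `|y - y'| < cre e / 2]) => //=.
move=> [x' y'] /= [xx' yy'].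
rewrite cnormE Cplx_lt rCN rCD.
by apply: le_lt_trans (cnorm_le_abs _) _; rewrite (splitr (cre e)) ltrD.
Qed.

Lemma compact_nr_le (M : R) : compact [set z : V | nr z <= M].
Proof.
pose A := [set rC p.1 p.2 | p in `[- M, M]%classic `*` `[- M, M]%classic].
have cA : compact A.
  apply: continuous_compact; last by apply: compact_setX; apply: segment_compact.
  by move=> p; apply: continuous_subspaceT; exact: continuous_Cplx2.
apply: (@subclosed_compact _ _ _ _ (@rV_compact _ n (fun=> A) (fun=> cA))).
  move=> z clz; rewrite /= leNgt; apply/negP => Mz.
  have [|y [/= yM]] := clz [set y | nr (y - z) < nr z - M].
    by apply/nbhs_nrP; exists (nr z - M) => //; rewrite subr_gt0.
  rewrite ltNge => /negP; apply; rewrite nrB; apply: le_trans (nr_ler_sub _ _).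
  by rewrite lerD2l lerN2.
move=> z /= zM j; exists (cre (z 0 j), cim (z 0 j)); last by rewrite -rC_eta.
have h := le_trans (cnorm_le_nr z j) zM.
by split; rewrite /= in_itv/= -ler_norml; apply: le_trans h;
  [exact: cre_le_cnorm|exact: cim_le_cnorm].
Qed.

Lemma compact_seq2 K (a b : R) (t : nat -> R) (x : nat -> V) : compact K ->
  (forall k, a <= t k <= b) -> (forall k, K (x k)) ->
  exists s z, [/\ a <= s <= b, K z & forall (d : R) N, 0 < d ->
    exists k, [/\ (N <= k)%N, `|t k - s| < d & nr (x k - z) < d]].
Proof.
move=> cK tab Kx.
have cab : compact (`[a, b]%classic `*` K) by apply: compact_setX => //; apply: segment_compact.
have [|[s z] [[/= sab Kz] clz]] := cab ((fun k => (t k, x k)) @ \oo) _.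
  by exists 0%N => // k _ /=; split; rewrite /= ?in_itv//=; apply: tab.
exists s, z; split => //.
move=> d N d0.
have [||[s' y] [[k/= Nk [<- <-]] [/= h1 h2]]] :=
  clz [set p | exists2 k, (N <= k)%N & (t k, x k) = p]
      [set p | `|p.1 - s| < d /\ nr (p.2 - z) < d].
- by exists N => // k Nk /=; exists k.
- exists ([set x' | `|x' - s| < d], [set y | nr (y - z) < d]) => /=.
    split; last by apply/nbhs_nrP; exists d.
    have h : (\forall y \near s, `|s - y| < d) by apply: nbhsx_ballx.
    by apply: filterS h => y; rewrite distrC.
  by move=> p [].
- by exists k.
Qed.

Lemma archi_inv (d : R) : 0 < d -> exists N, forall k, (N <= k)%N -> k.+1%:R^-1 < d.
Proof.
move=> d0; have [N _ h] := near_infty_natSinv_lt (PosNum d0).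
by exists N => k Nk; exact: h.
Qed.

Lemma unif_cont K f : compact K -> (forall z, K z -> {for z, continuous f}) ->
  forall e : R, 0 < e -> exists2 d : R, 0 < d &
    forall x y, K x -> nr (y - x) < d -> `|f y - f x| < e.
Proof.
move=> cK fK e e0; apply: contrapT => h.
have /choice[p pP] : forall k : nat, exists p : V * V,
    [/\ K p.1, nr (p.2 - p.1) < k.+1%:R^-1 & e <= `|f p.2 - f p.1|].
  move=> k; apply: contrapT => hk; apply: h; exists k.+1%:R^-1 => //.
  move=> x y Kx xy; rewrite ltNge; apply/negP => hxy; apply: hk.
  by exists (x, y).
have Kp k : K (p k).1 by have [] := pP k.
have [z Kz zP] := compact_seq cK Kp.
have /cvg_nrP/(_ (e / 2)) := fK z Kz.
case=> [|d d0 dP]; first by rewrite divr_gt0.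
have d20 : 0 < d / 2 by rewrite divr_gt0.
have [N NP] := archi_inv d20.
have [k Nk kz] := zP (d / 2) N d20.
have [_ h1 h2] := pP k.
suff : `|f (p k).2 - f (p k).1| < e by rewrite ltNge h2.
rewrite (_ : _ - _ = (f (p k).2 - f z) - (f (p k).1 - f z)); last by ring.
apply: le_lt_trans (ler_normB _ _) _; rewrite (splitr e) ltrD// dP//.
  apply: le_lt_trans (nr_triangle _ (p k).1 _) _.
  by rewrite (splitr d) ltrD// (lt_trans h1)// NP.
by apply: lt_trans kz _; rewrite ltr_pdivrMr// ltr_pMr// ltr1n.
Qed.

Lemma compact_margin K D : compact K -> open D -> K `<=` D ->
  exists2 d : R, 0 < d & forall x y, K x -> nr (y - x) < d -> D y.
Proof.
move=> cK oD KD; apply: contrapT => h.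
have /choice[p pP] : forall k : nat, exists p : V * V,
    [/\ K p.1, nr (p.2 - p.1) < k.+1%:R^-1 & ~ D p.2].
  move=> k; apply: contrapT => hk; apply: h; exists k.+1%:R^-1 => //.
  by move=> x y Kx xy; apply: contrapT => Dy; apply: hk; exists (x, y).
have Kp k : K (p k).1 by have [] := pP k.
have [z Kz zP] := compact_seq cK Kp.
have /nbhs_nrP[d d0 dP] : \forall y \near z, D y by apply: open_nbhs_nbhs; split => //; exact: KD.
have d20 : 0 < d / 2 by rewrite divr_gt0.
have [N NP] := archi_inv d20.
have [k Nk kz] := zP (d / 2) N d20.
have [_ h1] := pP k; apply; apply: dP.
apply: le_lt_trans (nr_triangle _ (p k).1 _) _.
by rewrite (splitr d) ltrD// (lt_trans h1)// NP.
Qed.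

Lemma compact_nr_bounded K : compact K -> exists M : R, forall z, K z -> nr z < M.
Proof.
move=> cK; apply: contrapT => h.
have /choice[p pP] : forall k : nat, exists z, K z /\ k%:R <= nr z.
  move=> k; apply: contrapT => hk; apply: h; exists k%:R => z Kz.
  by rewrite ltNge; apply/negP => kz; apply: hk; exists z.
have Kp k : K (p k) by have [] := pP k.
have [z Kz zP] := compact_seq cK Kp.
pose N := `|Num.ceil (nr z + 1)|%N.
have [k Nk kz] := zP 1 N ltr01.
have := proj2 (pP k); rewrite leNgt => /negP; apply.
apply: (@lt_le_trans _ _ (nr z + 1)).
  by rewrite -ltrBlDl; apply: le_lt_trans (nr_ler_sub _ _) kz.
apply: (@le_trans _ _ N%:R); last by rewrite ler_nat.
rewrite /N natr_absz; apply: le_trans (ceil_ge _) _.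
by rewrite ler_int ler_norm.
Qed.

Lemma continuous_bounded K f : compact K -> (forall z, K z -> {for z, continuous f}) ->
  exists2 M : R, 0 < M & forall z, K z -> `|f z| <= M.
Proof.
move=> cK fK; apply: contrapT => h.
have /choice[p pP] : forall k : nat, exists z, K z /\ k%:R < `|f z|.
  move=> k; apply: contrapT => hk; apply: h; exists k.+1%:R => // z Kz.
  rewrite leNgt; apply/negP => kz; apply: hk; exists z; split => //.
  by apply: lt_trans kz; rewrite ltr_nat.
have Kp k : K (p k) by have [] := pP k.
have [z Kz zP] := compact_seq cK Kp.
have /cvg_nrP/(_ 1 ltr01)[d d0 dP] := fK z Kz.
pose N := `|Num.ceil (`|f z| + 1)|%N.
have [k Nk kz] := zP d N d0.
have := proj2 (pP k); rewrite ltNge => /negP; apply.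
apply: (@le_trans _ _ (`|f z| + 1)).
  by rewrite -lerBlDl; apply: le_trans (lerB_dist _ _) (ltW (dP _ kz)).
apply: (@le_trans _ _ N%:R); last by rewrite ler_nat.
rewrite /N natr_absz; apply: le_trans (ceil_ge _) _.
by rewrite ler_int ler_norm.
Qed.

(** The radius is kept explicit because integrals are bounded uniformly over the functions that
    share it. *)
Definition bsupp (M : R) f := forall z, M <= nr z -> f z = 0.

Definition Cc f := continuous f /\ exists M, bsupp M f.

Lemma Cc_unif f : Cc f -> forall e : R, 0 < e -> exists2 d : R, 0 < d &
    forall x y, nr (y - x) < d -> `|f y - f x| < e.
Proof.
move=> [cf [M fM]] e e0.
(* Steps are kept shorter than 1, so that outside the ball of radius M + 1 both values vanish. *)
have [d d0 dP] := unif_cont (@compact_nr_le (M + 1)) (fun z _ => cf z) e0.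
exists (Num.min d 1); first by rewrite lt_min d0 ltr01.
move=> x y; rewrite lt_min => /andP[h1 h2].
have [xM|Mx] := leP (nr x) (M + 1); first exact: dP.
rewrite (fM x) ?(fM y) ?subrr ?normr0//; last first.
  by apply: ltW; apply: le_lt_trans Mx; rewrite lerDl.
apply: ltW; rewrite -(ltrD2r 1); apply: lt_le_trans Mx _.
rewrite -lerBlDl; apply: le_trans (nr_ler_sub _ _) _.
by rewrite nrB ltW.
Qed.

Lemma Cc_bounded f : Cc f -> exists2 M : R, 0 < M & forall z, `|f z| <= M.
Proof.
move=> [cf [M fM]].
have [A A0 AP] := continuous_bounded (@compact_nr_le M) (fun z _ => cf z).
exists A => // z; have [zM|Mz] := leP (nr z) M; first exact: AP.
by rewrite fM ?normr0 ltW.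
Qed.

End compactness.

(** * Integration over the plane *)

Section plane_integral.
Context {R : realType}.
Implicit Types (F G : R * R -> R) (f g : R -> R).
Local Notation lam := (@lebesgue_measure R).
Local Notation lam2 := (lam \x lam)%E.

Definition Cc2 F := continuous F /\
  exists M : R, forall q, M <= `|q.1| \/ M <= `|q.2| -> F q = 0.

Definition plane_int F : R := \int[lam2]_(q in [set: R * R]) F q.

(* The measurable structure is inferred from the measure, which fixes its display. *)
Definition measurable_of d (T : measurableType d) (mu : set T -> \bar R) (A : set T) :=
  measurable A.

Definition measurable_fun_of d (T : measurableType d) (mu : set T -> \bar R) (F : T -> R) :=
  measurable_fun setT F.

(** The product measure lives on the product sigma-algebra, so an open set is exhibited as a
    countable union of rational boxes. *)
Lemma open_measurable_prod (A : set (R * R)) : open A ->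
  measurable_of lam2 A.
Proof.
move=> oA.
pose B0 (p : rat * rat * rat) : set (R * R) :=
  `](ratr p.1.1 - ratr p.2 : R), ratr p.1.1 + ratr p.2[%classic `*`
  `](ratr p.1.2 - ratr p.2 : R), ratr p.1.2 + ratr p.2[%classic.
pose B p := if `[< B0 p `<=` A >] then B0 p else set0.
have -> : A = \bigcup_p B p.
  rewrite predeqE => -[x y]; split => [Axy|[p _]]; last first.
    by rewrite /B; case: asboolP => // BA Bp; exact: BA.
  have /nbhs_ballP[e /= e0 eA] : nbhs (x, y) A by apply: open_nbhs_nbhs.
  (* A box of half-width in ]e/4, e/2[ whose centre is within e/4 of (x, y) contains (x, y) and
     stays within 3e/4 of it. *)
  have [|r /itvP hr] := @rat_in_itvoo R (e / 4) (e / 2); first lra.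
  have [|p1 /itvP h1] := @rat_in_itvoo R x (x + e / 4); first lra.
  have [|p2 /itvP h2] := @rat_in_itvoo R y (y + e / 4); first lra.
  have : e / 4 < ratr r < e / 2 by rewrite !hr.
  have : x < ratr p1 < x + e / 4 by rewrite !h1.
  have : y < ratr p2 < y + e / 4 by rewrite !h2.
  move=> /andP[q1 q2] /andP[q3 q4] /andP[q5 q6].
  exists (p1, p2, r) => //; rewrite /B; case: asboolP => [_|].
    by rewrite /B0; split; rewrite /= in_itv/=; lra.
  case => -[x' y'] [/=]; rewrite !in_itv/= => /andP[r1 r2] /andP[r3 r4].
  by apply: eA; split => /=; rewrite /ball/= ltr_norml; apply/andP; split; lra.
apply: countable_bigcupT_measurable => [|p]; first exact: countableP.
by rewrite /B; case: ifP => // _; apply: measurableX.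
Qed.

Lemma continuous2_measurable F : continuous F ->
  measurable_fun_of lam2 F.
Proof.
move=> cF; apply: (measurability _ (measurable_realfun.RGenOInfty.measurableE R)) => //.
move=> /= _ [_ [a ->] <-]; rewrite setTI; apply: open_measurable_prod.
by move/continuousP: cF; apply; exact: interval_open.
Qed.

Definition box (M : R) : set (R * R) :=
  [set` `[(- M)%R, M%R]] `*` `[(- M), M]%classic.

Lemma measurable_box M :
  measurable_of lam2 (box M).
Proof. by apply: measurableX. Qed.

Lemma box_measure M : (lam2 (box M) < +oo)%E.
Proof.
have lI : (lam [set` `[(- M)%R, M%R]] < +oo)%E.
  by rewrite lebesgue_measure_itv/=; case: ifPn => _; rewrite ?ltry// -EFinB ltry.
rewrite /box; have := @product_measure1E _ _ _ _ _ lam lam _ _ (measurable_itv `[(- M)%R, M%R]) (measurable_itv `[(- M)%R, M%R]).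
by move=> ->; rewrite lte_mul_pinfty// ge0_fin_numE.
Qed.

Lemma box_out M q : ~ box M q -> M <= `|q.1| \/ M <= `|q.2|.
Proof.
move=> h; apply: contrapT => /not_orP[/negP + /negP].
rewrite -!ltNge !ltr_norml => /andP[a1 a2] /andP[b1 b2].
by apply: h; split; rewrite /= in_itv/= !ltW.
Qed.

Lemma plane_int_box M F : (forall q, M <= `|q.1| \/ M <= `|q.2| -> F q = 0) ->
  plane_int F = \int[lam2]_(q in box M) F q.
Proof.
move=> FM; rewrite /plane_int [RHS]Rintegral_mkcond; congr Rintegral.
apply/funext => q; rewrite patchE; case: ifPn => //.
by move/negP; rewrite inE => /box_out; exact: FM.
Qed.

Lemma Cc2_bounded F : Cc2 F -> exists2 A : R, 0 < A & forall q, `|F q| <= A.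
Proof.
move=> [cF [M FM]].
have cB : compact (box M) by apply: compact_setX; apply: segment_compact.
have := continuous_compact (continuous_subspaceT cF) cB.
move=> /compact_bounded [A [Ar AP]].
exists (`|A| + 1) => [|q]; first by rewrite ltr_wpDl.
have [Bq|/box_out/FM->] := pselect (box M q); last by rewrite normr0 addr_ge0.
by apply: AP; [rewrite (le_lt_trans (ler_norm _))// ltrDl|exists q].
Qed.

Lemma Cc2_integrable_box F M : Cc2 F -> lam2.-integrable (box M) (EFin \o F).
Proof.
move=> F2; apply: measurable_bounded_integrable.
- exact: measurable_box.
- exact: box_measure.
- by apply: measurable_funTS; apply: continuous2_measurable; case: F2.
- have [A A0 AP] := Cc2_bounded F2.
  exists A; split; first exact: num_real.
  by move=> x Ax y _ /=; exact: le_trans (AP _) (ltW Ax).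
Qed.

Lemma Cc2_integrable F : Cc2 F -> lam2.-integrable setT (EFin \o F).
Proof.
move=> F2; have [_ [M FM]] := F2.
have := (@integrable_mkcond _ _ _ lam2 (box M) (EFin \o F) (measurable_box M)).1 (Cc2_integrable_box M F2).
congr (lam2.-integrable _ _); apply/funext => q; rewrite patchE/=; case: ifPn => //.
by move/negP; rewrite inE => /box_out/FM->.
Qed.

Lemma plane_int_lin (c : R) F G : Cc2 F -> Cc2 G ->
  plane_int (fun q => c * F q + G q) = c * plane_int F + plane_int G.
Proof.
move=> iF iG; rewrite /plane_int RintegralD//; last exact: Cc2_integrable.
  by rewrite RintegralZl//; exact: Cc2_integrable.
have := integrableZl measurableT c (Cc2_integrable iF).
by congr (lam2.-integrable _ _).
Qed.

Lemma plane_int_ge0 F : (forall q, 0 <= F q) -> 0 <= plane_int F.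
Proof. by move=> F0; apply: Rintegral_ge0. Qed.

Lemma plane_int_bound (M : R) : exists2 C : R, 0 <= C & forall F (A : R), Cc2 F ->
  (forall q, M <= `|q.1| \/ M <= `|q.2| -> F q = 0) -> (forall q, `|F q| <= A) ->
  `|plane_int F| <= C * A.
Proof.
exists (fine (lam2 (box M))); first exact: fine_ge0.
move=> F A F2 FM FA; rewrite (plane_int_box FM) mulrC.
apply: le_trans (le_normr_Rintegral (measurable_box M) (Cc2_integrable_box M F2)) _.
rewrite -Rintegral_cst; last exact: measurable_box.
apply: le_Rintegral => //; first exact: measurable_box.
- have := integrable_norm (Cc2_integrable_box M F2).
  by congr (lam2.-integrable _ _).
- apply: measurable_bounded_integrable; [exact: measurable_box|exact: box_measure| |].
    exact: measurable_cst.
  exact: bounded_cst.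
Qed.

Lemma plane_int_gt0 F q0 : Cc2 F -> (forall q, 0 <= F q) -> 0 < F q0 -> 0 < plane_int F.
Proof.
move=> F2 F0 Fq0; have [cF [M FM]] := F2.
have /cvgrPdist_lt/(_ (F q0 / 2)) := cF q0.
case=> [|/= [A B] [/nbhs_ballP[d1 d10 d1A] /nbhs_ballP[d2 d20 d2B]] AB].
  by rewrite divr_gt0.
pose d := Num.min d1 d2 / 2.
have m0 : 0 < Num.min d1 d2 by rewrite lt_min d10 d20.
have d0 : 0 < d by rewrite divr_gt0.
pose D : set (R * R) := `[(q0.1 - d), (q0.1 + d)]%classic `*` `[(q0.2 - d), (q0.2 + d)]%classic.
have mD : measurable_of lam2 D by apply: measurableX.
have [dd1 dd2] : d < d1 /\ d < d2.
  have [m1 m2] : Num.min d1 d2 <= d1 /\ Num.min d1 d2 <= d2.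
    by rewrite !ge_min !lexx orbT.
  by rewrite /d; move: (Num.min d1 d2) m0 m1 m2 => m *; split; lra.
have FD q : D q -> F q0 / 2 <= F q.
  move=> [/=]; rewrite !in_itv/= => /andP[x1 x2] /andP[y1 y2].
  have /AB : (A `*` B) q.
    split; [apply: d1A|apply: d2B]; rewrite /ball/= ltr_norml; apply/andP; split; lra.
  by rewrite /= ltr_norml => /andP[]; lra.
have lI c : lam [set` `[(c - d)%R, (c + d)%R]] = (2 * d)%:E.
  rewrite lebesgue_measure_itv/= lte_fin ifT; last lra.
  by rewrite -EFinB; congr EFin; ring.
have lD : lam2 D = (4 * d ^+ 2)%:E.
  rewrite /D.
  have -> := @product_measure1E _ _ _ _ _ lam lam _ _ (measurable_itv `[(q0.1 - d), (q0.1 + d)]) (measurable_itv `[(q0.2 - d), (q0.2 + d)]).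
  rewrite (_ : (4 * d ^+ 2)%:E = (2 * d)%:E * (2 * d)%:E)%E; last first.
    by rewrite -EFinM; congr EFin; ring.
  by congr (_ * _)%E; exact: lI.
have lDf : (lam2 D < +oo)%E by rewrite lD ltry.
apply: (@lt_le_trans _ _ (\int[lam2]_(q in D) (F q0 / 2))).
  rewrite Rintegral_cst// (_ : fine _ = 4 * d ^+ 2).
    by rewrite !mulr_gt0// exprn_gt0.
  by rewrite -[RHS]/(fine (4 * d ^+ 2)%:E); congr fine; exact: lD.
have iD : lam2.-integrable D (EFin \o (fun=> F q0 / 2)).
  by apply: measurable_bounded_integrable => //; exact: bounded_cst.
have iF := Cc2_integrable F2.
rewrite /plane_int Rintegral_mkcond; apply: le_Rintegral => //.
  have := (@integrable_mkcond _ _ _ lam2 D _ mD).1 iD.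
  congr (lam2.-integrable _ _); apply/funext => q.
  by rewrite /= !patchE; case: ifPn.
move=> q _; rewrite patchE; case: ifPn => [|_]; last exact: F0.
by rewrite inE; exact: FD.
Qed.

(* One-dimensional translations suffice for the rotation invariance: a plane rotation
   is a product of three shears. *)
Lemma line_int_shift f (s : R) : continuous f ->
  (\int[lam]_x (f (x + s))%:E = \int[lam]_x (f x)%:E)%E.
Proof.
move=> cf.
have cp s' : continuous (fun x : R => x + s').
  by move=> x; apply: cvgD; [exact: cvg_id|exact: cvg_cst].
have pos g : continuous g -> (forall x, 0 <= g x) ->
    (\int[lam]_x (g (x + s))%:E = \int[lam]_x (g x)%:E)%E.
  move=> cg g0.
  have dE : derive1 (fun x : R => x + s) = cst 1.
    by apply/funext => x; rewrite derive1E deriveD// derive_id derive_cst addr0.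
  rewrite [RHS](@increasing_ge0_integration_by_substitutionT _ (fun x => x + s)).
  - by rewrite dE; apply: eq_integral => x _ /=; rewrite mulr1.
  - by move=> x y; rewrite ltrD2r.
  - by rewrite dE; exact: cst_continuous.
  - by rewrite dE; exact: is_cvg_cst.
  - by rewrite dE; exact: is_cvg_cst.
  - by move=> x; apply: derivableD; [exact: derivable_id|exact: derivable_cst].
  - apply/cvgrNyPle => A; near=> x; rewrite -lerBrDr; near: x; apply: nbhs_ninfty_le; exact: num_real.
  - apply/cvgryPge => A; near=> x; rewrite -lerBlDr; near: x; apply: nbhs_pinfty_ge; exact: num_real.
  - exact: cg.
  - exact: g0.
have hm g : continuous g -> continuous (fun x => Num.max (g x) 0).
  by move=> cg x; apply: continuous_max; [exact: cg|exact: cst_continuous].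
have cNf : continuous (fun x => - f x) by move=> x; apply: cvgN; exact: cf.
rewrite integralE [RHS]integralE; congr (_ - _)%E.
- have h := pos (fun x => Num.max (f x) 0).
  transitivity (\int[lam]_x (Num.max (f (x + s)) 0)%:E)%E.
    by apply: eq_integral => x _; rewrite funeposE /= EFin_max.
  rewrite h.
  + by apply: eq_integral => x _; rewrite funeposE /= EFin_max.
  + by move=> x; apply: continuous_max; [exact: cf|exact: cst_continuous].
  + by move=> x; rewrite le_max lexx orbT.
- have h := pos (fun x => Num.max (- f x) 0).
  transitivity (\int[lam]_x (Num.max (- f (x + s)) 0)%:E)%E.
    by apply: eq_integral => x _; rewrite funenegE /= EFin_max.
  rewrite h.
  + by apply: eq_integral => x _; rewrite funenegE /= EFin_max.
  + exact: hm cNf.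
  + by move=> x; rewrite le_max lexx orbT.
Unshelve. all: end_near. Qed.

Lemma plane_intE F : Cc2 F -> ((plane_int F)%:E = \int[lam2]_q (F q)%:E)%E.
Proof.
by move=> F2; rewrite fineK//; apply: integrable_fin_num => //; exact: Cc2_integrable.
Qed.

Lemma plane_int12 F : Cc2 F ->
  ((plane_int F)%:E = \int[lam]_x \int[lam]_y (F (x, y))%:E)%E.
Proof.
move=> F2; rewrite plane_intE//.
by have := @integral12_prod_meas1 _ _ _ _ _ lam lam _ (Cc2_integrable F2).
Qed.

Lemma plane_int21 F : Cc2 F ->
  ((plane_int F)%:E = \int[lam]_y \int[lam]_x (F (x, y))%:E)%E.
Proof.
move=> F2; rewrite plane_intE//.
by have := @integral21_prod_meas1 _ _ _ _ _ lam lam _ (Cc2_integrable F2).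
Qed.

Lemma continuous_pair (T U W : topologicalType) (f : T -> U) (g : T -> W) :
  continuous f -> continuous g -> continuous (fun x => (f x, g x)).
Proof. by move=> cf cg x; exact: (cvg_pair (cf x) (cg x)). Qed.

Lemma continuous_compT (T U W : topologicalType) (f : T -> U) (g : U -> W) :
  continuous f -> continuous g -> continuous (fun x => g (f x)).
Proof. by move=> cf cg x; apply: (@continuous_comp _ _ _ f g); [exact: cf|exact: cg]. Qed.

Lemma continuous_fst2 : continuous (fun q : R * R => q.1).
Proof. by move=> q; exact: cvg_fst. Qed.

Lemma continuous_snd2 : continuous (fun q : R * R => q.2).
Proof. by move=> q; exact: cvg_snd. Qed.

Lemma Cc2_swap F : Cc2 F -> Cc2 (fun q => F (q.2, q.1)).
Proof.
move=> [cF [M FM]]; split.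
  exact: (continuous_compT (continuous_pair continuous_snd2 continuous_fst2) cF).
by exists M => q h; apply: FM => /=; case: h; [right|left].
Qed.

Lemma plane_int_swap F : Cc2 F -> plane_int (fun q => F (q.2, q.1)) = plane_int F.
Proof.
move=> F2; apply: EFin_inj; rewrite plane_int12; last exact: Cc2_swap.
by rewrite plane_int21.
Qed.

Lemma Cc2_shear (c s : R) F : Cc2 F -> Cc2 (fun q => F (q.1 + c * q.2 + s, q.2)).
Proof.
move=> [cF [M FM]]; split.
  apply: (continuous_compT (f := fun q : R * R => (q.1 + c * q.2 + s, q.2))) cF.
  apply: (continuous_pair _ continuous_snd2) => p.
  apply: cvgD; last exact: cvg_cst.
  by apply: cvgD; [exact: cvg_fst|apply: cvgM; [exact: cvg_cst|exact: cvg_snd]].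
exists (`|M| + `|c| * `|M| + `|s|) => -[x y] /= h; apply: FM => /=.
have [My|yM] := leP M `|y|; [by right|left].
case: h => h; last first.
  move: (le_lt_trans h yM); have := ler_norm M.
  have := mulr_ge0 (normr_ge0 c) (normr_ge0 M); have := normr_ge0 s; lra.
have cy : `|c * y| <= `|c| * `|M|.
  by rewrite normrM ler_wpM2l// (le_trans (ltW yM))// ler_norm.
have := ler_norm M.
have : `|x| <= `|x + c * y + s| + `|c * y| + `|s|.
  rewrite {1}(_ : x = (x + c * y + s) - c * y - s); last ring.
  by apply: le_trans (ler_normB _ _) _; rewrite lerD2r ler_normB.
lra.
Qed.

Lemma plane_int_shear (c s : R) F : Cc2 F ->
  plane_int (fun q => F (q.1 + c * q.2 + s, q.2)) = plane_int F.
Proof.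
move=> F2; apply: EFin_inj; rewrite plane_int21; last exact: Cc2_shear.
rewrite plane_int21//; apply: eq_integral => y _ /=.
under eq_integral do rewrite -addrA.
rewrite (@line_int_shift (fun x => F (x, y)))//.
apply: (continuous_compT (f := fun x : R => (x, y))); last by case: F2.
by apply: continuous_pair => z; [exact: cvg_id|exact: cvg_cst].
Qed.

Lemma plane_int_shear' (c s : R) F : Cc2 F ->
  plane_int (fun q => F (q.1, q.2 + c * q.1 + s)) = plane_int F.
Proof.
move=> F2; have := plane_int_shear c s (Cc2_swap F2); rewrite plane_int_swap// => <-.
by rewrite -plane_int_swap//; exact: (Cc2_swap (Cc2_shear c s (Cc2_swap F2))).
Qed.

Lemma Cc2_shear' (c s : R) F : Cc2 F -> Cc2 (fun q => F (q.1, q.2 + c * q.1 + s)).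
Proof. by move=> /Cc2_swap/(Cc2_shear c s)/Cc2_swap. Qed.

Lemma plane_int_shift (s t : R) F : Cc2 F ->
  plane_int (fun q => F (q.1 + s, q.2 + t)) = plane_int F.
Proof.
move=> F2; have F3 := Cc2_shear' 0 t F2.
rewrite -[RHS](plane_int_shear' 0 t F2) -[RHS](plane_int_shear 0 s F3)/=.
by congr plane_int; apply/funext => q /=; rewrite !mul0r !addr0.
Qed.

Definition rot2 (c s : R) (q : R * R) := (c * q.1 - s * q.2, s * q.1 + c * q.2).

(** For (c, s) = (cos t, sin t) the rotation is a shear of slope s between two shears of slope a =
    -tan(t/2). The half turn, where this tangent is infinite, is excluded. *)
Lemma Cc2_rot_int (c s : R) F : c ^+ 2 + s ^+ 2 = 1 -> c != -1 -> Cc2 F ->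
  Cc2 (F \o rot2 c s) /\ plane_int (F \o rot2 c s) = plane_int F.
Proof.
move=> cs c1 F2; have c10 : 1 + c != 0 by rewrite addrC -subr_eq0 opprK in c1 *.
pose a := - s / (1 + c).
have G1 := Cc2_shear a 0 F2; have G2 := Cc2_shear' s 0 G1; have G3 := Cc2_shear a 0 G2.
have E : F \o rot2 c s = (fun q => (fun q => (fun q => F (q.1 + a * q.2 + 0, q.2))
   (q.1, q.2 + s * q.1 + 0)) (q.1 + a * q.2 + 0, q.2)).
  apply/funext => -[x y] /=; rewrite /rot2/=; congr F.
  have e1 : s * a = c - 1.
    have e : s * a * (1 + c) = (c - 1) * (1 + c).
      rewrite /a mulrA divfK// mulrN -expr2.
      by rewrite (_ : s ^+ 2 = 1 - c ^+ 2); [ring|rewrite -cs; ring].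
    by apply: (mulIf c10).
  have e2 : a * (1 + c) = - s by rewrite /a divfK.
  have e3 : y + s * (x + a * y + 0) + 0 = s * x + c * y.
    by rewrite !addr0 mulrDr mulrA e1; ring.
  rewrite e3; congr pair; rewrite !addr0.
  rewrite (_ : x + a * y + a * (s * x + c * y) = x + (s * a) * x + a * (1 + c) * y).
    by rewrite e1 e2; ring.
  by ring.
by rewrite E; split; rewrite // (plane_int_shear a 0 G2) (plane_int_shear' s 0 G1) plane_int_shear.
Qed.

(** The half turn left out by [Cc2_rot_int] is the square of a quarter turn. *)
Lemma plane_int_rot (c s : R) F : c ^+ 2 + s ^+ 2 = 1 -> Cc2 F ->
  plane_int (F \o rot2 c s) = plane_int F.
Proof.
move=> cs F2; have [c1|c1] := eqVneq c (-1); last by have [] := Cc2_rot_int cs c1 F2.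
have s0 : s = 0.
  by apply/eqP; rewrite -sqrf_eq0; apply/eqP; move: cs; rewrite c1; lra.
have h : (0 : R) ^+ 2 + 1 ^+ 2 = 1 by ring.
have n1 : (0 : R) != -1 by rewrite eq_sym oppr_eq0 oner_eq0.
have [F3 E3] := Cc2_rot_int h n1 F2; have [F4 E4] := Cc2_rot_int h n1 F3.
rewrite (_ : F \o rot2 c s = F \o rot2 0 1 \o rot2 0 1) ?E4//.
by apply/funext => q /=; rewrite /rot2/= c1 s0; congr (F (_, _)); ring.
Qed.

End plane_integral.

(** * Splitting off one complex coordinate; the integral on C^n as an invariant functional *)

Section coordinates_split.
Context {R : realType} {p : nat}.
Local Notation V := (Cspace R p).
Local Notation W := (Cspace R p.+1).

Definition emb (q : R * R) (z : V) : W := row_mx (rC q.1 q.2)%:M z : Cspace R (1 + p).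

Lemma emb_entry (q : R * R) (z : V) (j : 'I_(1 + p)) :
  fun_of_matrix (emb q z) 0 j =
  match fintype.split j with inl _ => rC q.1 q.2 | inr k => z 0 k end.
Proof.
rewrite /emb mxE; case: (fintype.split j) => // k.
by rewrite mxE [k]ord1 eqxx mulr1n.
Qed.

Lemma embD q q' z z' : emb q z + emb q' z' = emb (q.1 + q'.1, q.2 + q'.2) (z + z').
Proof.
apply/(@rowP _ (1 + p)) => j; rewrite mxE !emb_entry; case: (fintype.split j) => // k.
by rewrite mxE.
Qed.

Lemma embZ (c s : R) q z : rC c s *: emb q z = emb (rot2 c s q) (rC c s *: z).
Proof.
apply/(@rowP _ (1 + p)) => j; rewrite mxE !emb_entry; case: (fintype.split j) => [_|k]; last by rewrite mxE.
by rewrite rCM /rot2/= addrC [s * q.1 + _]addrC.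
Qed.

Lemma embN q z : - emb q z = emb (- q.1, - q.2) (- z).
Proof.
apply/(@rowP _ (1 + p)) => j; rewrite mxE !emb_entry; case: (fintype.split j) => [_|k]; last by rewrite mxE.
by [].
Qed.

Lemma emb_surj (w : W) : exists q z, w = emb q z.
Proof.
exists (cre (w 0 ord0), cim (w 0 ord0)), (rsubmx (w : Cspace R (1 + p))).
apply/(@rowP _ (1 + p)) => j; rewrite emb_entry; case: (@splitP 1 p j) => k jk.
  by rewrite -rC_eta; congr (w 0 _); apply/val_inj; rewrite /= jk ord1.
by rewrite mxE; congr (w 0 _); apply/val_inj; rewrite /= jk.
Qed.

Lemma nr_emb_le q z : nr (emb q z) <= `|q.1| + `|q.2| + nr z.
Proof.
apply: nr_le => [|j]; first by rewrite !addr_ge0// nr_ge0.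
move: (j : 'I_(1 + p)) => {}j; rewrite emb_entry; case: (fintype.split j) => [_|k].
  by rewrite (le_trans (cnorm_le_abs _))// lerDl nr_ge0.
by rewrite (le_trans (cnorm_le_nr _ _))// lerDr addr_ge0.
Qed.

Lemma nr_emb_ge q z : [/\ `|q.1| <= nr (emb q z), `|q.2| <= nr (emb q z) & nr z <= nr (emb q z)].
Proof.
have h0 : emb q z 0 ord0 = rC q.1 q.2.
  rewrite (_ : ord0 = lshift p (ord0 : 'I_1) :> 'I_(1 + p)); last exact/val_inj.
  by rewrite emb_entry (unsplitK (inl _)).
have := cnorm_le_nr (emb q z) ord0; rewrite h0 => h; split.
- exact: le_trans (cre_le_cnorm (rC q.1 q.2)) h.
- exact: le_trans (cim_le_cnorm (rC q.1 q.2)) h.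
- apply: nr_le => [|j]; first exact: nr_ge0.
  have := cnorm_le_nr (emb q z) (rshift 1 j).
  by rewrite emb_entry (unsplitK (inr _)).
Qed.

Definition slice (f : W -> R) q : V -> R := fun z => f (emb q z).

Lemma slice_bsupp M f q : bsupp M f -> bsupp M (slice f q).
Proof. by move=> fM z Mz; apply: fM; have [_ _] := nr_emb_ge q z; exact: le_trans. Qed.

Lemma slice_Cc f q : Cc f -> Cc (slice f q).
Proof.
move=> [cf [M fM]]; split; last by exists M; exact: slice_bsupp.
move=> z; apply/cvg_nrP => e e0.
have /cvg_nrP/(_ e e0)[d d0 dP] := cf (emb q z).
exists d => // y yz; apply: dP.
rewrite embN embD; apply: le_lt_trans (nr_emb_le _ _) _.
by rewrite /= !subrr normr0 !add0r.
Qed.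

End coordinates_split.

(** The properties of Lebesgue integration on which the rest relies, bundled so that one induction
    on the dimension proves them together. Invariance under unit complex scalars is what the
    sub-mean value property of radial mollifiers will need. *)
Record haar (R : realType) (n : nat) (I : (Cspace R n -> R) -> R) : Prop := Haar {
  haar_lin : forall (c : R) f g, Cc f -> Cc g ->
    I (fun z => c * f z + g z) = c * I f + I g;
  haar_ge0 : forall f, (forall z, 0 <= f z) -> 0 <= I f;
  haar_bound : forall M : R, exists2 C : R, 0 <= C & forall f (A : R), Cc f -> bsupp M f ->
    (forall z, `|f z| <= A) -> `|I f| <= C * A;
  haar_shift : forall w f, Cc f -> I (fun z => f (z + w)) = I f;
  haar_rot : forall c s f, c ^+ 2 + s ^+ 2 = 1 -> Cc f ->
    I (fun z => f (rC c s *: z)) = I f;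
  haar_gt0 : forall f z0, Cc f -> (forall z, 0 <= f z) -> 0 < f z0 -> 0 < I f }.

Section continuity.
Context {R : realType} {T : topologicalType}.
Implicit Types f g : T -> R.

Lemma ctsD f g : continuous f -> continuous g -> continuous (fun z => f z + g z).
Proof. by move=> cf cg z; exact: (cvgD (cf z) (cg z)). Qed.

Lemma ctsM f g : continuous f -> continuous g -> continuous (fun z => f z * g z).
Proof. by move=> cf cg z; exact: (cvgM (cf z) (cg z)). Qed.

Lemma ctsN f : continuous f -> continuous (fun z => - f z).
Proof. by move=> cf z; exact: (cvgN (cf z)). Qed.

Lemma ctsB f g : continuous f -> continuous g -> continuous (fun z => f z - g z).
Proof. by move=> cf cg z; exact: (cvgB (cf z) (cg z)). Qed.

Lemma cts_cst (c : R) : continuous (fun _ : T => c).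
Proof. exact: cst_continuous. Qed.

Lemma ctsMl (c : R) f : continuous f -> continuous (fun z => c * f z).
Proof. by move=> cf; apply: ctsM => //; exact: cts_cst. Qed.

Lemma cts_max f g : continuous f -> continuous g ->
  continuous (fun z => Num.max (f z) (g z)).
Proof. by move=> cf cg z; apply: continuous_max; [exact: cf|exact: cg]. Qed.

Lemma cts_sum (J : Type) (r : seq J) (P : pred J) (F : J -> T -> R) :
  (forall j, continuous (F j)) -> continuous (fun z => \sum_(j <- r | P j) F j z).
Proof.
move=> cF; elim: r => [|j r IH].
  by under eq_fun do rewrite big_nil; exact: cts_cst.
by under eq_fun do rewrite big_cons; case: (P j) => //; exact: ctsD.
Qed.

End continuity.

Lemma Cc_lin (R : realType) (n : nat) (c : R) (f g : Cspace R n -> R) :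
  Cc f -> Cc g -> Cc (fun z => c * f z + g z).
Proof.
move=> [cf [M fM]] [cg [N gN]]; split.
  by apply: ctsD => //; exact: ctsMl.
exists (Num.max M N) => z; rewrite ge_max => /andP[Mz Nz].
by rewrite fM// gN// mulr0 addr0.
Qed.

Lemma Cc_shift (R : realType) (n : nat) w (f : Cspace R n -> R) :
  Cc f -> Cc (fun z => f (z + w)).
Proof.
move=> [cf [M fM]]; split.
  move=> z; apply/cvg_nrP => e e0; have /cvg_nrP/(_ e e0)[d d0 dP] := cf (z + w).
  by exists d => // y yz; apply: dP; rewrite opprD addrACA subrr addr0.
exists (M + nr w) => z Mz; apply: fM.
by rewrite -(lerD2r (nr w)) (le_trans Mz)// -{1}(addrK w z) (le_trans (nrD _ _))// nrN.
Qed.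

Lemma Cc_rot (R : realType) (n : nat) c s (f : Cspace R n -> R) :
  c ^+ 2 + s ^+ 2 = 1 -> Cc f -> Cc (fun z => f (rC c s *: z)).
Proof.
move=> cs [cf [M fM]].
have nrc z : nr (rC c s *: z) = nr z.
  by rewrite nrZ /cnorm creE cimE cs sqrtr1 mul1r.
split; last by exists M => z Mz; apply: fM; rewrite nrc.
move=> z; apply/cvg_nrP => e e0; have /cvg_nrP/(_ e e0)[d d0 dP] := cf (rC c s *: z).
by exists d => // y yz; apply: dP; rewrite -scalerBr nrc.
Qed.

(** By uniform continuity of f and the bound in dimension p, the integral over slices is a
    continuous compactly supported function on the plane. Each property is then its planar analogue
    applied to slices. *)
Lemma Cintegral_haar (R : realType) (n : nat) : haar (@Cintegral R n).
Proof.
elim: n => [|p IH].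
  have ev (z : Cspace R 0) : z = 0 by apply/rowP => -[].
  split => /=.
  - by [].
  - by [].
  - by move=> M; exists 1 => // f A _ _ fA; rewrite mul1r.
  - by move=> w f _; rewrite (ev (0 + w)).
  - by move=> c s f _ _; rewrite scaler0.
  - by move=> f z0; rewrite (ev z0).
pose G (f : Cspace R p.+1 -> R) q := Cintegral (slice f q).
have GE f : Cintegral f = plane_int (G f) by [].
have GCc f : Cc f -> Cc2 (G f).
  move=> fC; have [cf [M fM]] := fC.
  have [C C0 CP] := haar_bound IH M.
  split; last first.
    exists M => q h; rewrite /G.
    have s0 : slice f q = (fun=> 0).
      apply/funext => z; apply: fM; have [h1 h2 _] := nr_emb_ge q z.
      by case: h => h; apply: le_trans h _.
    have Cc0 : Cc (slice f q) by exact: slice_Cc.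
    have := haar_lin IH (-1) Cc0 Cc0; rewrite s0.
    by under eq_fun do rewrite mulr0 addr0; rewrite mulN1r addNr.
  move=> q; apply/cvgrPdist_le => e e0.
  have e1 : 0 < e / (C + 1) by rewrite divr_gt0// ltr_wpDl.
  have [d d0 dP] := Cc_unif fC e1.
  have d20 : 0 < d / 2 by rewrite divr_gt0.
  have [h1 h2] : (\forall x' \near q.1, `|q.1 - x'| < d / 2) /\
      (\forall y' \near q.2, `|q.2 - y'| < d / 2).
    by split; apply: nbhsx_ballx.
  exists ([set x' | `|q.1 - x'| < d / 2], [set y' | `|q.2 - y'| < d / 2]) => //=.
  move=> q' /= [qq1 qq2].
  have := haar_lin IH (-1) (slice_Cc q' fC) (slice_Cc q fC).
  rewrite mulN1r addrC => E; rewrite /G -E; apply: (@le_trans _ _ (C * (e / (C + 1)))).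
    apply: CP.
    - by apply: Cc_lin; exact: slice_Cc.
    - by move=> z Mz; rewrite !(slice_bsupp _ fM)// mulr0 addr0.
    - move=> z; rewrite mulN1r addrC; apply: ltW; apply: dP.
      rewrite embN embD subrr; apply: le_lt_trans (nr_emb_le _ _) _ => /=.
      by rewrite nr0 addr0 (splitr d) ltrD.
  have C1 : 0 < C + 1 by rewrite ltr_wpDl.
  by rewrite mulrA ler_pdivrMr// [C * e]mulrC ler_pM2l// lerDl.
split.
- move=> c f g fC gC; rewrite !GE -plane_int_lin; [|exact: GCc|exact: GCc].
  congr plane_int; apply/funext => q; rewrite /G -(haar_lin IH)//; exact: slice_Cc.
- move=> f f0; rewrite GE; apply: plane_int_ge0 => q; apply: haar_ge0 IH _ _ => z.
  exact: f0.
- move=> M; have [C C0 CP] := haar_bound IH M.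
  have [C' C'0 C'P] := plane_int_bound (R := R) M.
  exists (C' * C) => [|f A fC fM fA]; first by rewrite mulr_ge0.
  rewrite GE -mulrA; apply: C'P; first exact: GCc.
    move=> q h; have h0 z : `|slice f q z| <= 0.
      rewrite /slice fM ?normr0//; have [h1 h2 _] := nr_emb_ge q z.
      by case: h => h; apply: le_trans h _.
    have := CP (slice f q) 0 (slice_Cc q fC) (slice_bsupp q fM) h0.
    by rewrite mulr0 normr_le0 => /eqP.
  by move=> q; apply: CP; [exact: slice_Cc|exact: slice_bsupp|move=> z; exact: fA].
- move=> w f fC; have [q0 [z0 wE]] := emb_surj w.
  rewrite !GE -[RHS](plane_int_shift q0.1 q0.2 (GCc _ fC)); congr plane_int.
  apply/funext => q; rewrite /G -[RHS](haar_shift IH z0); last exact: slice_Cc.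
  by congr Cintegral; apply/funext => z; rewrite /slice wE embD.
- move=> c s f cs fC.
  rewrite !GE -[RHS](plane_int_rot cs (GCc _ fC)); congr plane_int.
  apply/funext => q; rewrite /G/= -[RHS](haar_rot IH cs); last exact: slice_Cc.
  by congr Cintegral; apply/funext => z; rewrite /slice embZ.
- move=> f w fC f0 fw; have [q0 [z0 wE]] := emb_surj w.
  rewrite GE; apply: (@plane_int_gt0 _ _ q0); first exact: GCc.
    by move=> q; apply: (haar_ge0 IH) => z; exact: f0.
  by apply: (@haar_gt0 _ _ _ IH _ z0); [exact: slice_Cc|move=> z; exact: f0|rewrite /slice -wE].
Qed.

(** * Derivatives in one variable *)

Section line_derivative.
Context {R : realType}.
Implicit Types (f g : R -> R) (x d : R).

Definition dv f x d := is_derive x (1 : R) f d.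

Lemma dvP f x d : dv f x d <-> forall e : R, 0 < e ->
  exists2 r : R, 0 < r & forall h, `|h| < r -> `|f (x + h) - f x - h * d| <= e * `|h|.
Proof.
split=> [fd e e0|H].
  have [dfx dval] := fd; move: dfx => /cvg_ex[l hl].
  have ld : l = d by rewrite -dval; symmetry; apply: cvg_lim hl.
  rewrite {}ld in hl.
  move: hl => /cvgrPdist_lt/(_ e e0)[r /= r0 rP]; exists r => // h hr.
  have [->|h0] := eqVneq h 0; first by rewrite addr0 subrr mul0r subr0 normr0 mulr0.
  have := rP h; rewrite /= sub0r normrN => /(_ hr h0).
  rewrite (_ : h *: 1 + x = x + h) => [/ltW hh|]; last by rewrite [_ *: _]mulr1 addrC.
  rewrite (_ : _ - _ = - (h * (d - h^-1 * (f (x + h) - f x)))).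
    by rewrite normrN normrM mulrC ler_wpM2r.
  by rewrite mulrBr mulrA divff// mul1r opprB.
have key : (h^-1 *: ((f \o shift x) (h *: (1 : R)) - f x) @[h --> 0^'] --> d)%classic.
  apply/cvgrPdist_le => e e0; have [r r0 rP] := H e e0.
  exists r => // h; rewrite /= sub0r normrN => hr h0.
  have hh := rP h hr.
  rewrite /= (_ : h *: 1 + x = x + h); last by rewrite [_ *: _]mulr1 addrC.
  have {}hh : `|h| * `|d - h^-1 * (f (x + h) - f x)| <= `|h| * e.
    rewrite -normrM mulrBr mulrA divff// mul1r distrC (mulrC `|h|).
    by [].
  by move: hh; rewrite ler_pM2l// normr_gt0.
by apply: DeriveDef; [apply/cvg_ex; exists d|exact: (cvg_lim _ key)].
Qed.

Lemma dv_eq f x d d' : dv f x d -> d = d' -> dv f x d'.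
Proof. by move=> h <-. Qed.

Lemma dv_ext f g x d d' : dv f x d -> (forall t, f t = g t) -> d = d' -> dv g x d'.
Proof. by move=> h fg <-; move/funext: fg => <-. Qed.

Lemma dv_derive1 f x d : dv f x d -> derive1 f x = d.
Proof. by move=> [_ h]; rewrite derive1E. Qed.

Lemma derivable_dv f x : derivable f x 1 -> dv f x (derive1 f x).
Proof. by move=> /derivableP; rewrite derive1E. Qed.

Lemma dv_cst c x : dv (fun=> c) x 0.
Proof. exact: is_derive_cst. Qed.

Lemma dv_id x : dv (fun y => y) x 1.
Proof. exact: is_derive_id. Qed.

Lemma dvD f g x d d' : dv f x d -> dv g x d' -> dv (fun y => f y + g y) x (d + d').
Proof. exact: is_deriveD. Qed.

Lemma dvN f x d : dv f x d -> dv (fun y => - f y) x (- d).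
Proof. exact: is_deriveN. Qed.

Lemma dvM f g x d d' : dv f x d -> dv g x d' ->
  dv (fun y => f y * g y) x (d * g x + f x * d').
Proof.
by move=> h1 h2; apply: (dv_eq (is_deriveM h1 h2)); rewrite addrC [d * _]mulrC.
Qed.

Lemma dvMl c f x d : dv f x d -> dv (fun y => c * f y) x (c * d).
Proof. by move=> h; apply: (dv_eq (dvM (dv_cst c x) h)); rewrite mul0r add0r. Qed.

Lemma dv_sum (J : Type) (r : seq J) (P : pred J) (F : J -> R -> R) (D : J -> R) x :
  (forall j, dv (F j) x (D j)) ->
  dv (fun y => \sum_(j <- r | P j) F j y) x (\sum_(j <- r | P j) D j).
Proof.
move=> FD; elim: r => [|j r IH].
  by rewrite big_nil; under eq_fun do rewrite big_nil; exact: dv_cst.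
by rewrite big_cons; under eq_fun do rewrite big_cons; case: (P j) => //; exact: dvD.
Qed.

Lemma dv_comp f g x d d' : dv f (g x) d -> dv g x d' -> dv (fun y => f (g y)) x (d * d').
Proof. exact: is_derive1_comp. Qed.

Lemma dv_continuous f x d : dv f x d -> {for x, continuous f}.
Proof. by move=> [h _]; apply: differentiable_continuous; apply/derivable1_diffP. Qed.

Lemma mvt f df (a b : R) : a <= b -> (forall x, a <= x <= b -> dv f x (df x)) ->
  exists2 c, a <= c <= b & f b - f a = df c * (b - a).
Proof.
move=> ab h; have [||c cab E] := @MVT_segment R f df a b ab.
- by move=> x; rewrite in_itv/= => /andP[x1 x2]; apply: h; rewrite !ltW.
- apply: derivable_within_continuous => x; rewrite in_itv/= => /h.
  by case.
by exists c => //; move: cab; rewrite in_itv.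
Qed.

Lemma mvt_pm f df (t : R) : (forall x, dv f x (df x)) ->
  exists2 c, `|c| <= `|t| & f t - f 0 = df c * t.
Proof.
move=> h; have [t0|t0] := leP 0 t.
  have [c /andP[c0 ct] E] := mvt t0 (fun x _ => h x).
  by exists c; [rewrite !ger0_norm|rewrite E subr0].
have [c /andP[c0 ct] E] := mvt (ltW t0) (fun x _ => h x).
exists c; first by rewrite ler0_norm// [leRHS]ler0_norm ?lerN2// ltW.
by rewrite -[LHS]opprB E sub0r mulrN opprK.
Qed.

(** Two mean value arguments, for g(t) - g'(0) t - c t^2/2 and then for g'(t) - c t. *)
Lemma taylor1 g dg ddg (c e : R) :
  (forall t, 0 <= t <= 1 -> dv g t (dg t)) -> (forall t, 0 <= t <= 1 -> dv dg t (ddg t)) ->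
  (forall t, 0 <= t <= 1 -> `|ddg t - c| <= e) ->
  `|g 1 - g 0 - dg 0 - c / 2| <= e.
Proof.
move=> h1 h2 h3.
pose k t := g t - dg 0 * t - c / 2 * t ^+ 2.
have kd t : 0 <= t <= 1 -> dv k t (dg t - dg 0 - c * t).
  move=> /h1 gt; apply: dv_eq.
    apply: dvD; [apply: dvD; [exact: gt|]|].
      by apply: dvN; apply: dvMl; exact: dv_id.
    by apply: dvN; apply: dvMl; apply: dvM; exact: dv_id.
  by rewrite !mulr1 mul1r; field.
have [s s01 E] := mvt ler01 kd.
have -> : g 1 - g 0 - dg 0 - c / 2 = k 1 - k 0 by rewrite /k expr1n expr0n /= !mulr1 !mulr0 !subr0; ring.
rewrite E subr0 mulr1; case/andP: s01 => s0 s1.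
pose m t := dg t - c * t.
have md t : 0 <= t <= s -> dv m t (ddg t - c).
  move=> /andP[t0 ts]; apply: dv_eq.
    apply: dvD; first by apply: h2; rewrite t0 (le_trans ts).
    by apply: dvN; apply: dvMl; exact: dv_id.
  by rewrite mulr1.
have [r /andP[r0 rs] E'] := mvt s0 md.
have -> : dg s - dg 0 - c * s = m s - m 0 by rewrite /m; ring.
rewrite E' subr0 normrM (ger0_norm s0).
have := h3 r; rewrite r0 (le_trans rs s1) => /(_ isT) hr.
by apply: le_trans hr; rewrite ler_piMr.
Qed.

End line_derivative.

(* Iterated derivatives of a one-variable function on a domain [P]. *)
Definition smooth_on (R : realType) (P : set R) (phi : R -> R) :=
  exists2 F : nat -> R -> R, F 0%N = phi & forall k x, P x -> dv (F k) x (F k.+1 x).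

(** * Functions of class C^k on C^n *)

Section Ck.
Context {R : realType} {n : nat}.
Local Notation V := (Cspace R n).
Local Notation idx := ('I_n * bool)%type.
Implicit Types (z w h : V) (f g phi : V -> R) (a b : idx) (k : nat).

(** The recursive form of C^k: regularity is propagated by structural induction, and [smooth] is the
    conjunction over all k ([smoothP]). *)
Fixpoint Ck k f : Prop := continuous f /\
  match k with
  | 0 => True
  | k'.+1 => forall a, (forall z, derivable (along a f z) 0 1) /\ Ck k' (pderiv a f)
  end.

Lemma Ck_cont k f : Ck k f -> continuous f. Proof. by case: k => [|k] []. Qed.

Lemma Ck_pderiv k a f : Ck k.+1 f -> Ck k (pderiv a f).
Proof. by move=> [_ /(_ a)[]]. Qed.

Lemma CkW k m f : (k <= m)%N -> Ck m f -> Ck k f.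
Proof.
elim: k m f => [|k IH] m f; first by move=> _ /Ck_cont.
case: m => // m km fC; split; first exact: Ck_cont fC.
move=> a; have [_ /(_ a)[fd fC']] := fC; split => //.
exact: IH fC'.
Qed.

Lemma smoothP f : smooth f <-> forall k, Ck k f.
Proof.
split=> [fs k|fC].
  suff : forall s, Ck k (pderivs s f) by move=> /(_ [::]).
  elim: k => [|k IH] s; first by have [] := fs s.
  split; first by have [] := fs s.
  by move=> a; split; [have [_] := fs s; exact|exact: (IH (a :: s))].
have fC' s : forall k, Ck k (pderivs s f).
  by elim: s => //= a s IH k; exact: (Ck_pderiv a (IH k.+1)).
by move=> s; split=> [|a z]; [exact: Ck_cont (fC' s 0%N)|have [_ /(_ a)[]] := fC' s 1%N].
Qed.

Lemma rC_addZ (s t : R) w : rC (s + t) 0 *: w = rC s 0 *: w + rC t 0 *: w.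
Proof. by rewrite -scalerDl rCD addr0. Qed.

Lemma rC_mulZ (s t : R) w : rC (s * t) 0 *: w = rC s 0 *: (rC t 0 *: w).
Proof. by rewrite scalerA rCM !mul0r !mulr0 subr0 addr0. Qed.

Lemma rC0Z w : rC 0 0 *: w = 0. Proof. by rewrite rC0 scale0r. Qed.

Lemma rC1Z w : rC 1 0 *: w = w. Proof. by rewrite rC1 scale1r. Qed.

Lemma rCNZ (t : R) w : rC (- t) 0 *: w = - (rC t 0 *: w).
Proof. by rewrite -scaleNr rCN oppr0. Qed.

(* derivability along [a] everywhere is equivalent to having [pderiv] as derivative *)
Lemma along_dv f a z t : (forall y, derivable (along a f y) 0 1) ->
  dv (along a f z) t (pderiv a f (z + rC t 0 *: real_dir a)).
Proof.
move=> fd; have /derivable_dv/dvP h := fd (z + rC t 0 *: real_dir a).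
apply/dvP => e e0; have [r r0 rP] := h e e0; exists r => // s sr; have := rP s sr.
by rewrite /along rC0Z !addr0 add0r rC_addZ addrA.
Qed.

Lemma pderiv_dv f a z d : dv (along a f z) 0 d -> pderiv a f z = d.
Proof. exact: dv_derive1. Qed.

Lemma Ck_dv k f a z : Ck k.+1 f -> dv (along a f z) 0 (pderiv a f z).
Proof. by move=> [_ /(_ a)[fd _]]; have := along_dv z 0 fd; rewrite rC0Z addr0. Qed.

Lemma CkS k f : continuous f ->
  (forall a, exists2 g, forall z, dv (along a f z) 0 (g z) & Ck k g) -> Ck k.+1 f.
Proof.
move=> cf H; split => // a; have [h hd hC] := H a; split.
  by move=> z; case: (hd z).
by rewrite (_ : pderiv a f = h)//; apply/funext => z; exact: pderiv_dv.
Qed.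

Lemma Ck_cst k (c : R) : Ck k (fun=> c).
Proof.
elim: k c => [|k IH] c; first by split => //; exact: cts_cst.
apply: CkS; first exact: cts_cst.
by move=> a; exists (fun=> 0) => // z; exact: dv_cst.
Qed.

Lemma CkD k f g : Ck k f -> Ck k g -> Ck k (fun z => f z + g z).
Proof.
elim: k f g => [|k IH] f g fC gC.
  by split => //; apply: ctsD; [exact: Ck_cont fC|exact: Ck_cont gC].
apply: CkS; first by apply: ctsD; [exact: Ck_cont fC|exact: Ck_cont gC].
move=> a; exists (fun z => pderiv a f z + pderiv a g z).
  by move=> z; apply: dvD; [exact: Ck_dv fC|exact: Ck_dv gC].
by apply: IH; exact: Ck_pderiv.
Qed.

Lemma CkM k f g : Ck k f -> Ck k g -> Ck k (fun z => f z * g z).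
Proof.
elim: k f g => [|k IH] f g fC gC.
  by split => //; apply: ctsM; [exact: Ck_cont fC|exact: Ck_cont gC].
apply: CkS; first by apply: ctsM; [exact: Ck_cont fC|exact: Ck_cont gC].
move=> a; exists (fun z => pderiv a f z * g z + f z * pderiv a g z).
  move=> z; have := dvM (Ck_dv a z fC) (Ck_dv a z gC).
  by rewrite /along rC0Z addr0.
by apply: CkD; apply: IH; [exact: Ck_pderiv|exact: CkW gC|exact: CkW fC|exact: Ck_pderiv].
Qed.

Lemma CkMl k c f : Ck k f -> Ck k (fun z => c * f z).
Proof. by apply: CkM; exact: Ck_cst. Qed.

Lemma CkN k f : Ck k f -> Ck k (fun z => - f z).
Proof. by move=> /(CkMl (-1)); under eq_fun do rewrite mulN1r. Qed.

Lemma CkB k f g : Ck k f -> Ck k g -> Ck k (fun z => f z - g z).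
Proof. by move=> fC gC; apply: CkD => //; exact: CkN. Qed.

Lemma CkX k m f : Ck k f -> Ck k (fun z => f z ^+ m).
Proof.
move=> fC; elim: m => [|m IH]; first by under eq_fun do rewrite expr0; exact: Ck_cst.
by under eq_fun do rewrite exprS; exact: CkM.
Qed.

Lemma Ck_sum k (J : Type) (r : seq J) (P : pred J) (F : J -> V -> R) :
  (forall j, Ck k (F j)) -> Ck k (fun z => \sum_(j <- r | P j) F j z).
Proof.
move=> FC; elim: r => [|j r IH].
  by under eq_fun do rewrite big_nil; exact: Ck_cst.
by under eq_fun do rewrite big_cons; case: (P j) => //; exact: CkD.
Qed.

Lemma Ck_comp k (P : set R) (phi1 : R -> R) f : smooth_on P phi1 -> (forall z, P (f z)) ->
  Ck k f -> Ck k (fun z => phi1 (f z)).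
Proof.
move=> [F <- FP] Pf.
suff H : forall k i, Ck k f -> Ck k (fun z => F i (f z)) by exact: H.
have cF i' : continuous f -> continuous (fun z => F i' (f z)).
  move=> cf z; apply: (@continuous_comp _ _ _ f (F i')); first exact: cf.
  exact: dv_continuous (FP i' _ (Pf z)).
elim=> {k} [|k IH] i fC; first by split => //; apply: cF; exact: Ck_cont fC.
apply: CkS; first by apply: cF; exact: Ck_cont fC.
move=> a; exists (fun z => F i.+1 (f z) * pderiv a f z).
  move=> z; apply: (@dv_comp _ (F i) (along a f z)); last exact: Ck_dv fC.
  by rewrite /along rC0Z addr0; exact: FP.
by apply: CkM; [apply: IH; exact: CkW fC|exact: Ck_pderiv].
Qed.

Lemma pderivD k a f g z : Ck k.+1 f -> Ck k.+1 g ->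
  pderiv a (fun z => f z + g z) z = pderiv a f z + pderiv a g z.
Proof. by move=> fC gC; apply: pderiv_dv; apply: dvD; [exact: Ck_dv fC|exact: Ck_dv gC]. Qed.

Lemma pderivM k a f g z : Ck k.+1 f -> Ck k.+1 g ->
  pderiv a (fun z => f z * g z) z = pderiv a f z * g z + f z * pderiv a g z.
Proof.
move=> fC gC; apply: pderiv_dv; have := dvM (Ck_dv a z fC) (Ck_dv a z gC).
by rewrite /along rC0Z addr0.
Qed.

Lemma pderivMl k a c f z : Ck k.+1 f -> pderiv a (fun z => c * f z) z = c * pderiv a f z.
Proof. by move=> fC; apply: pderiv_dv; apply: dvMl; exact: Ck_dv fC. Qed.

Lemma pderiv_cst a c z : pderiv a (fun=> c) z = 0.
Proof. by apply: pderiv_dv; exact: dv_cst. Qed.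

Lemma pderiv_comp k a (F F' : R -> R) f z : dv F (f z) (F' (f z)) -> Ck k.+1 f ->
  pderiv a (fun z => F (f z)) z = F' (f z) * pderiv a f z.
Proof.
move=> Fd fC; apply: pderiv_dv; apply: (@dv_comp _ F (along a f z)); last exact: Ck_dv fC.
by rewrite /along rC0Z addr0.
Qed.

Lemma pderiv_sum k a (J : Type) (r : seq J) (P : pred J) (F : J -> V -> R) z :
  (forall j, Ck k.+1 (F j)) ->
  pderiv a (fun z => \sum_(j <- r | P j) F j z) z = \sum_(j <- r | P j) pderiv a (F j) z.
Proof.
move=> FC; apply: pderiv_dv; rewrite /along.
apply: (@dv_sum _ _ r P (fun j => along a (F j) z) (fun j => pderiv a (F j) z) 0) => j.
exact: Ck_dv (FC j).
Qed.

Lemma dv_along_local a f g z d : (\forall y \near z, f y = g y) ->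
  dv (along a f z) 0 d -> dv (along a g z) 0 d.
Proof.
move=> /nbhs_nrP[r r0 rP] /dvP h; apply/dvP => e /h[r' r'0 r'P].
have k0 : 0 < nr (real_dir a : V) + 1 by rewrite ltr_wpDl// nr_ge0.
have E t : `|t| < r / (nr (real_dir a : V) + 1) -> along a f z t = along a g z t.
  move=> tr; apply: rP; rewrite addrC addKr nrZr.
  have : `|t| * (nr (real_dir a : V) + 1) < r by rewrite -ltr_pdivlMr.
  by apply: le_lt_trans; rewrite ler_wpM2l// lerDl.
exists (Num.min r' (r / (nr (real_dir a : V) + 1))).
  by rewrite lt_min r'0 divr_gt0.
move=> t; rewrite lt_min => /andP[h1 h2]; have := r'P t h1.
by rewrite !E// ?normr0 ?divr_gt0// add0r.
Qed.

Lemma pderiv_local k a f g z : (\forall y \near z, f y = g y) -> Ck k.+1 f ->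
  pderiv a g z = pderiv a f z.
Proof. by move=> fg fC; apply: pderiv_dv; apply: dv_along_local fg (Ck_dv a z fC). Qed.

End Ck.

(** * Real coordinates, second order expansion, symmetry of second derivatives *)

Section real_coordinates.
Context {R : realType} {n : nat}.
Local Notation V := (Cspace R n).
Local Notation idx := ('I_n * bool)%type.
Implicit Types (z w h : V) (f g phi : V -> R) (a b : idx) (k : nat).

Lemma addr2K z w h : z + w + h - z = w + h.
Proof. by rewrite -[z + w + h]addrA [z + (w + h)]addrC addrK. Qed.

Definition co a z : R := if a.2 then cim (z 0 a.1) else cre (z 0 a.1).

Lemma sum_idx (K : nmodType) (F : idx -> K) :
  \sum_(a : idx) F a = \sum_(j < n) (F (j, false) + F (j, true)).
Proof.
rewrite (eq_bigr (fun a => F (a.1, a.2))); last by case.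
rewrite -(pair_bigA _ (fun j (c : bool) => F (j, c)))/=; apply: eq_bigr => j _.
by rewrite big_bool/= addrC.
Qed.

Lemma coD a z w : co a (z + w) = co a z + co a w.
Proof. by rewrite /co mxE; case: a.2; rewrite (cre_is_additive, cim_is_additive). Qed.

Lemma coZ a (t : R) z : co a (rC t 0 *: z) = t * co a z.
Proof.
rewrite /co mxE; case: a.2; rewrite ?creM ?cimM creE cimE mul0r; last by rewrite subr0.
by rewrite addr0.
Qed.

Lemma co0 a : co a 0 = 0.
Proof. by rewrite -(rC0Z (0 : V)) coZ mul0r. Qed.

Lemma coN a z : co a (- z) = - co a z.
Proof. by rewrite -[z]rC1Z -rCNZ coZ mulN1r rC1Z. Qed.

Lemma real_dirE a (j : 'I_n) : (real_dir a : V) 0 j =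
  rC ((j == a.1) && ~~ a.2)%:R ((j == a.1) && a.2)%:R.
Proof.
rewrite /real_dir !mxE eqxx/=.
by case: a.2; case: (j == _); rewrite /= ?mulr1 ?mulr0.
Qed.

Lemma co_real_dir a b : co b (real_dir a : V) = (a == b)%:R.
Proof.
rewrite /co real_dirE creE cimE.
case: a => i c; case: b => j c'; rewrite xpair_eqE/= eq_sym.
by case: c; case: c'; rewrite /= ?andbT ?andbF.
Qed.

Lemma entryZ (c : Cplx R) z (j : 'I_n) : (c *: z) 0 j = c * z 0 j.
Proof. by rewrite mxE. Qed.

Lemma entryD z w (j : 'I_n) : (z + w) 0 j = z 0 j + w 0 j.
Proof. by rewrite mxE. Qed.

Lemma entryZ_dir (t : R) a (j : 'I_n) : (rC t 0 *: real_dir a : V) 0 j =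
  rC t 0 * rC ((j == a.1) && ~~ a.2)%:R ((j == a.1) && a.2)%:R.
Proof. by rewrite mxE real_dirE. Qed.

Lemma co_expand z : z = \sum_a rC (co a z) 0 *: real_dir a.
Proof.
apply/rowP => j; rewrite summxE sum_idx.
rewrite (eq_bigr (fun i => rC (co (i, false) z) 0 * rC (j == i)%:R 0 +
    rC (co (i, true) z) 0 * rC 0 (j == i)%:R)); last first.
  move=> i _; apply: (congr2 +%R (etrans (entryZ_dir _ (i, false) j) _)
    (etrans (entryZ_dir _ (i, true) j) _)); by rewrite /= ?andbT ?andbF.
rewrite (bigD1 j)// big1; last first.
  by move=> i /andP[_ ij]; rewrite eq_sym (negbTE ij)/= rC0 !mulr0 addr0.
rewrite [RHS]addr0 eqxx /co/= !rCM rCD.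
by rewrite !(mulr0, mulr1, mul0r, subr0, addr0, add0r) -rC_eta.
Qed.

Lemma co_le_nr a z : `|co a z| <= nr z.
Proof.
apply: le_trans (cnorm_le_nr z a.1); rewrite /co.
by case: a.2; [exact: cim_le_cnorm|exact: cre_le_cnorm].
Qed.

Lemma nr_real_dir a : nr (real_dir a : V) = 1.
Proof.
apply/eqP; rewrite eq_le; apply/andP; split; last first.
  by have := co_le_nr a (real_dir a); rewrite co_real_dir eqxx normr1.
apply: nr_le => // j; rewrite real_dirE /cnorm creE cimE.
by case: (j == _); case: a.2; rewrite /= ?expr0n ?expr1n/= ?addr0 ?add0r ?sqrtr1 ?sqrtr0.
Qed.

Lemma Ck_co k a : Ck k (co a).
Proof.
have cc : continuous (co a).
  move=> z; apply/cvg_nrP => e e0; exists e => // y; apply: le_lt_trans.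
  by rewrite -coN -coD co_le_nr.
case: k => [|k]; first by split.
apply: (CkS cc) => b; exists (fun=> (b == a)%:R); last exact: Ck_cst.
move=> z; rewrite /along.
under eq_fun do rewrite coD coZ co_real_dir.
apply: dv_eq; first by apply: dvD; [exact: dv_cst|apply: dvM; [exact: dv_id|exact: dv_cst]].
by rewrite add0r mulr0 addr0 mul1r.
Qed.

(** The squared Euclidean norm: smooth, unlike [nr], and the model of a strictly plurisubharmonic
    function. *)
Definition N2 z : R := \sum_a co a z ^+ 2.

Lemma Ck_N2 k : Ck k N2.
Proof. by apply: Ck_sum => a; apply: CkX; exact: Ck_co. Qed.

Lemma nr_N2 z : nr z ^+ 2 <= N2 z.
Proof.
have N0 : 0 <= N2 z by apply: sumr_ge0 => a _; exact: sqr_ge0.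
rewrite -(sqr_sqrtr N0) lerXn2r ?nnegrE ?nr_ge0 ?sqrtr_ge0//.
apply: nr_le => [|j]; first exact: sqrtr_ge0.
rewrite ler_wsqrtr// /N2 sum_idx (bigD1 j)//= /co/= lerDl.
by apply: sumr_ge0 => i _; rewrite addr_ge0// sqr_ge0.
Qed.

Lemma N2_le z : N2 z <= (2 * n%:R) * nr z ^+ 2.
Proof.
rewrite /N2; apply: (@le_trans _ _ (\sum_(a : idx) nr z ^+ 2)).
  apply: ler_sum => a _; rewrite -real_normK ?num_real// lerXn2r ?nnegrE ?nr_ge0//.
  exact: co_le_nr.
rewrite sumr_const card_prod card_ord card_bool -[leLHS]mulr_natl natrM.
by rewrite [n%:R * _]mulrC.
Qed.

Definition D1 f z h : R := \sum_a co a h * pderiv a f z.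

Definition D2 f z h : R := \sum_a \sum_b co a h * co b h * pderiv b (pderiv a f) z.

(* Moving from [z] to [z + h] one real coordinate at a time. *)
Lemma C1_frechet f z : Ck 1 f -> forall e : R, 0 < e -> exists2 d : R, 0 < d &
  forall h, nr h < d -> `|f (z + h) - f z - D1 f z h| <= e * nr h.
Proof.
move=> fC.
suff H (s : seq idx) : forall e : R, 0 < e -> exists2 d : R, 0 < d &
    forall h, nr h < d -> `|f (z + \sum_(a <- s) rC (co a h) 0 *: real_dir a) - f z -
      \sum_(a <- s) co a h * pderiv a f z| <= e * nr h.
  move=> e e0; have [d d0 dP] := H (enum {: idx}) e e0; exists d => // h hd.
  have := dP h hd; rewrite !big_enum/= -co_expand; apply: le_trans.
  by rewrite /D1.
elim: s => [|a s IH] e e0.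
  exists 1 => // h _; rewrite !big_nil addr0 subrr subr0 normr0.
  by rewrite mulr_ge0 ?nr_ge0 ?ltW.
have e20 : 0 < e / 2 by rewrite divr_gt0.
have [d d0 dP] := IH (e / 2) e20.
have ca : continuous (pderiv a f) := Ck_cont (Ck_pderiv a fC).
have /cvg_nrP/(_ (e / 2) e20)[d' d'0 d'P] := ca z.
pose N : R := (size s).+2%:R.
have N0 : 0 < N by rewrite ltr0n.
exists (Num.min d (d' / N)); first by rewrite lt_min d0 divr_gt0.
move=> h; rewrite lt_min => /andP[hd hd'].
rewrite !big_cons.
set p := \sum_(a <- s) _ *: _; set q := \sum_(a <- s) _ * _.
have pN : nr p <= (size s)%:R * nr h.
  rewrite /p; elim: (s) => [|b s' IH']; first by rewrite big_nil nr0 mul0r.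
  rewrite big_cons (le_trans (nrD _ _))// /= -natr1 mulrDl mul1r addrC lerD//.
  by rewrite nrZr nr_real_dir mulr1 co_le_nr.
have [c ct E] := mvt_pm (co a h) (fun t => along_dv (z + p) t (proj1 ((proj2 fC) a))).
have {}E : f (z + (rC (co a h) 0 *: real_dir a + p)) - f (z + p) =
    pderiv a f (z + p + rC c 0 *: real_dir a) * co a h.
  by rewrite -E /along rC0Z addr0 addrA [in LHS]addrAC.
have h1 : `|pderiv a f (z + p + rC c 0 *: real_dir a) - pderiv a f z| < e / 2.
  apply: d'P; rewrite addr2K.
  apply: le_lt_trans (nrD _ _) _; rewrite nrZr nr_real_dir mulr1.
  apply: le_lt_trans (lerD pN (le_trans ct (co_le_nr _ _))) _.
  rewrite -{2}[nr h]mul1r -mulrDl natr1 mulrC.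
  have : nr h * N < d' by rewrite -ltr_pdivlMr.
  by apply: le_lt_trans; rewrite ler_wpM2l ?nr_ge0// ler_nat.
rewrite (_ : _ - _ - _ = (pderiv a f (z + p + rC c 0 *: real_dir a) - pderiv a f z) * co a h
    + (f (z + p) - f z - q)); last first.
  by rewrite mulrBl -E; ring.
apply: le_trans (ler_normD _ _) _.
apply: (@le_trans _ _ (e / 2 * nr h + e / 2 * nr h)); last by rewrite -mulrDl -splitr.
apply: lerD; last exact: dP.
by rewrite normrM ler_pM ?co_le_nr// ltW.
Qed.

Lemma C1_line f z h t : Ck 1 f ->
  dv (fun s => f (z + rC s 0 *: h)) t (D1 f (z + rC t 0 *: h) h).
Proof.
move=> fC; apply/dvP => e e0.
have k0 : 0 < nr h + 1 by rewrite ltr_wpDl// nr_ge0.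
have e1 : 0 < e / (nr h + 1) by rewrite divr_gt0.
have [d d0 dP] := C1_frechet (z + rC t 0 *: h) fC e1.
exists (d / (nr h + 1)); first by rewrite divr_gt0.
move=> s sd; have := dP (rC s 0 *: h).
rewrite rC_addZ addrA.
have -> : D1 f (z + rC t 0 *: h) (rC s 0 *: h) = s * D1 f (z + rC t 0 *: h) h.
  by rewrite /D1 mulr_sumr; apply: eq_bigr => a _; rewrite coZ mulrA.
move=> hh; apply: le_trans (hh _) _; rewrite nrZr.
  have : `|s| * (nr h + 1) < d by rewrite -ltr_pdivlMr.
  by apply: le_lt_trans; rewrite ler_wpM2l// lerDl.
rewrite mulrCA [leRHS]mulrC ler_wpM2l// mulrAC ler_pdivrMr// ler_wpM2l ?ltW//.
by rewrite ltrDl.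
Qed.

Lemma C2_line f z h t : Ck 2 f ->
  dv (fun s => D1 f (z + rC s 0 *: h) h) t (D2 f (z + rC t 0 *: h) h).
Proof.
move=> fC; rewrite /D1 /D2.
apply: (@dv_sum _ _ _ _ (fun a s => co a h * pderiv a f (z + rC s 0 *: h))
  (fun a => \sum_b co a h * co b h * pderiv b (pderiv a f) (z + rC t 0 *: h))) => a.
under eq_bigr do rewrite -mulrA.
rewrite -mulr_sumr; apply: dvMl.
exact: C1_line (Ck_pderiv a fC).
Qed.

Lemma taylor2 f z h (c e : R) : Ck 2 f ->
  (forall t, 0 <= t <= 1 -> `|D2 f (z + rC t 0 *: h) h - c| <= e) ->
  `|f (z + h) - f z - D1 f z h - c / 2| <= e.
Proof.
move=> fC H.
have := @taylor1 _ (fun s => f (z + rC s 0 *: h)) (fun s => D1 f (z + rC s 0 *: h) h)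
  (fun s => D2 f (z + rC s 0 *: h) h) c e.
rewrite rC0Z rC1Z addr0; apply => // t _; [exact: C1_line (CkW _ fC)|exact: C2_line].
Qed.

Lemma ler_dist_half (e p q X : R) : `|X - p| < e / 2 -> `|X - q| < e / 2 -> `|p - q| <= e.
Proof.
move=> h1 h2; rewrite (_ : p - q = (X - q) - (X - p)); last by ring.
by apply: le_trans (ler_normB _ _) _; rewrite (splitr e); apply: lerD; exact: ltW.
Qed.

(** The second difference of f over a small square, evaluated by the mean value theorem in both
    orders, equals either mixed derivative at some nearby point, up to the area of the square;
    continuity concludes. *)
Lemma schwarz f a b z : Ck 2 f -> pderiv a (pderiv b f) z = pderiv b (pderiv a f) z.
Proof.
move=> fC; apply/eqP; rewrite -subr_eq0 -normr_le0; apply/ler_addgt0Pl => e e0.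
rewrite addr0.
have e20 : 0 < e / 2 by rewrite divr_gt0.
have cts a' b' : continuous (pderiv a' (pderiv b' f)).
  exact: Ck_cont (Ck_pderiv a' (Ck_pderiv b' fC)).
have /cvg_nrP/(_ _ e20)[d d0 dP] := cts a b z.
have /cvg_nrP/(_ _ e20)[d' d'0 d'P] := cts b a z.
pose s := Num.min d d' / 4.
have m0 : 0 < Num.min d d' by rewrite lt_min d0.
have s0 : 0 < s by rewrite divr_gt0.
have ss : s + s < Num.min d d' by rewrite /s; move: (Num.min d d') m0 => m m0; lra.
pose P (x y : R) := z + rC x 0 *: real_dir a + rC y 0 *: real_dir b.
have Pz x y : `|x| <= `|s| -> `|y| <= `|s| -> nr (P x y - z) < Num.min d d'.
  rewrite (gtr0_norm s0) => xs ys; rewrite /P addr2K.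
  apply: le_lt_trans (nrD _ _) _; rewrite !nrZr !nr_real_dir !mulr1.
  by apply: le_lt_trans (lerD xs ys) _; exact: ss.
have Pz' x y : `|x| <= `|s| -> `|y| <= `|s| -> nr (P x y - z) < d /\ nr (P x y - z) < d'.
  by move=> h1 h2; apply/andP; rewrite -lt_min; exact: Pz.
have Pa g x y : Ck 1 g -> dv (fun t => g (P t y)) x (pderiv a g (P x y)).
  move=> gC.
  have eP t : z + rC y 0 *: real_dir b + rC t 0 *: real_dir a = P t y by exact: addrAC.
  apply: (dv_ext (along_dv (z + rC y 0 *: real_dir b) x (proj1 ((proj2 gC) a)))).
    by move=> t; exact: (congr1 g (eP t)).
  exact: (congr1 (pderiv a g) (eP x)).
have Pb g x y : Ck 1 g -> dv (fun t => g (P x t)) y (pderiv b g (P x y)).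
  by move=> gC; exact: along_dv (z + rC x 0 *: real_dir a) y (proj1 ((proj2 gC) b)).
have f1 := CkW (isT : (1 <= 2)%N) fC.
have fa1 := Ck_pderiv a fC; have fb1 := Ck_pderiv b fC.
have [x1 x1s E1] := mvt_pm s (fun t => dvD (Pa f t s f1) (dvN (Pa f t 0 f1))).
have [y1 y1s E2] := mvt_pm s (fun t => Pb _ x1 t fa1).
have [y2 y2s E3] := mvt_pm s (fun t => dvD (Pb f s t f1) (dvN (Pb f 0 t f1))).
have [x2 x2s E4] := mvt_pm s (fun t => Pa _ t y2 fb1).
have E : pderiv b (pderiv a f) (P x1 y1) * s * s = pderiv a (pderiv b f) (P x2 y2) * s * s.
  have alg (p q r t : R) : p - q - (r - t) = p - r - (q - t) by ring.
  apply: etrans (etrans (congr1 (fun r => r * s) (esym E2)) (esym E1)) _.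
  apply: etrans (alg _ _ _ _) _.
  exact: (etrans E3 (congr1 (fun r => r * s) E4)).
have {}E : pderiv b (pderiv a f) (P x1 y1) = pderiv a (pderiv b f) (P x2 y2).
  by apply: (mulIf (lt0r_neq0 s0)); apply: (mulIf (lt0r_neq0 s0)).
have h1 := dP _ (proj1 (Pz' _ _ x2s y2s)).
have h2 := d'P _ (proj2 (Pz' _ _ x1s y1s)).
exact: ler_dist_half h1 (eq_ind _ (fun X => `|X - _| < _) h2 _ E).
Qed.

End real_coordinates.

(** * Smooth functions on the line *)

Section one_variable_smooth.
Context {R : realType}.
Implicit Types (x y t s : R) (P : {poly R}).

Lemma dv_local1 (f g : R -> R) x d r : 0 < r ->
  (forall y, `|y - x| < r -> f y = g y) -> dv f x d -> dv g x d.
Proof.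
move=> r0 fg /dvP h; apply/dvP => e /h[r' r'0 r'P].
exists (Num.min r r'); first by rewrite lt_min r0.
move=> t; rewrite lt_min => /andP[h1 h2]; have := r'P t h2.
rewrite !fg//; first by rewrite subrr normr0.
by rewrite addrC addKr.
Qed.

Lemma dv_horner P y : dv (fun x => P.[x]) y P^`().[y].
Proof.
elim/poly_ind: P => [|p c IH].
  by rewrite deriv0 horner0; under eq_fun do rewrite horner0; exact: dv_cst.
under eq_fun do rewrite hornerMXaddC.
apply: dv_eq; first by apply: dvD; [apply: dvM; [exact: IH|exact: dv_id]|exact: dv_cst].
by rewrite derivMXaddC hornerD hornerMX addr0 mulr1 addrC.
Qed.

Lemma dv_inv x : x != 0 -> dv (fun y => y^-1) x (- x ^- 2).
Proof.
move=> x0; apply: dv_eq; first exact: (is_deriveV (f := fun y => y) x0 (dv_id x)).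
by rewrite [_ *: _]mulr1.
Qed.

(* [flat P] extends [P(1/x) exp(-1/x)] by zero, smoothly across the origin. *)
Definition flat P x : R := if 0 < x then P.[x^-1] * expR (- x^-1) else 0.

(** The exponential of 1/x dominates (1/x)^(i+2)/(i+2)!. A quadratic bound is what makes the
    derivative at the origin vanish. *)
Lemma flat_bound P : exists2 C : R, 0 <= C & forall x, `|flat P x| <= C * x ^+ 2.
Proof.
exists (\sum_(i < size P) `|P`_i| * (i.+2)`!%:R).
  by apply: sumr_ge0 => i _; rewrite mulr_ge0.
move=> x; rewrite /flat; case: ifPn => x0; last first.
  rewrite normr0 mulr_ge0 ?sqr_ge0//.
  by apply: sumr_ge0 => i _; rewrite mulr_ge0.
set y := x^-1; have y0 : 0 < y by rewrite invr_gt0.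
have -> : x ^+ 2 = y ^- 2 by rewrite /y exprVn invrK.
rewrite ler_pdivlMr ?exprn_gt0// normrM (ger0_norm (expR_ge0 _)) expRN.
rewrite mulrAC ler_pdivrMr ?expR_gt0//.
rewrite horner_coef mulr_suml; apply: (@le_trans _ _ (\sum_(i < size P) `|P`_i * y ^+ i| * y ^+ 2)).
  apply: le_trans (_ : `|\sum_(i < size P) P`_i * y ^+ i| * y ^+ 2 <= _).
    by [].
  by rewrite -mulr_suml ler_wpM2r ?sqr_ge0// ler_norm_sum.
apply: ler_sum => i _; rewrite normrM (ger0_norm (exprn_ge0 _ (ltW y0))) -!mulrA -exprD addn2.
rewrite ler_wpM2l//.
have := expR_ge1Dxn i.+1 (ltW y0) => h.
rewrite mulrC -ler_pdivrMr ?ltr0n ?fact_gt0//.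
by apply: le_trans h; rewrite lerDr.
Qed.

(** Differentiating P(1/x) exp(-1/x) gives Q(1/x) exp(-1/x) with Q = X^2 (P - P'), so the family is
    stable under derivation. *)
Lemma dv_flat P x : dv (flat P) x (flat ('X^2 * (P - P^`())) x).
Proof.
have [x0|x0|->] := ltgtP x 0.
- rewrite {2}/flat ltNge (ltW x0)/=.
  apply: (@dv_local1 (fun=> 0) _ _ _ (- x)); first by rewrite oppr_gt0.
    move=> y yx; rewrite /flat ifF//; apply/negbTE; rewrite -leNgt.
    have := le_lt_trans (ler_norm _) yx; lra.
  exact: dv_cst.
- rewrite {2}/flat x0.
  apply: (@dv_local1 (fun y => P.[y^-1] * expR (- y^-1)) _ _ _ x) => //.
    move=> y yx; rewrite /flat ifT//.
    have := ler_norm (- (y - x)); rewrite normrN => /le_lt_trans/(_ yx); lra.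
  have xn0 : x != 0 by rewrite gt_eqF.
  apply: dv_eq.
    apply: dvM.
      by apply: (@dv_comp _ (fun y => P.[y])); [exact: dv_horner|exact: dv_inv].
    apply: (@dv_comp _ expR); first exact: is_derive_expR.
    by apply: dvN; exact: dv_inv.
  rewrite hornerM hornerXn hornerD hornerN exprVn; ring.
- rewrite {2}/flat ltxx; apply/dvP => e e0.
  have [C C0 CP] := flat_bound P.
  exists (e / (C + 1)); first by rewrite divr_gt0// ltr_wpDl.
  move=> h hr; rewrite add0r {2}/flat ltxx subr0 mulr0 subr0.
  apply: le_trans (CP h) _; rewrite -real_normK ?num_real// expr2 mulrA ler_wpM2r//.
  have C1 : 0 < C + 1 by rewrite ltr_wpDl.
  apply: (@le_trans _ _ ((C + 1) * `|h|)); first by rewrite ler_wpM2r// lerDl.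
  by rewrite mulrC -ler_pdivlMr// ltW.
Qed.

Lemma flat_smooth P : smooth_on setT (flat P).
Proof.
exists (fun k => flat (iter k (fun Q => 'X^2 * (Q - Q^`())) P)) => // k x _.
exact: dv_flat.
Qed.

Lemma powR_smooth s : smooth_on [set x | 0 < x] (fun x => x `^ s).
Proof.
exists (fun k x => (\prod_(i < k) (s - i%:R)) * x `^ (s - k%:R)).
  by apply/funext => x; rewrite big_ord0 mul1r subr0.
move=> k x /= x0; apply: dv_eq.
  by apply: dvMl; exact: (is_derive1_powR _ x0).
by rewrite big_ord_recr/= mulrA -natr1 opprD addrA.
Qed.

Definition flat1 : R -> R := flat 1.

Lemma flat1_gt0 x : 0 < x -> 0 < flat1 x.
Proof. by move=> x0; rewrite /flat1 /flat x0 hornerC mul1r expR_gt0. Qed.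

Lemma flat1_le0 x : x <= 0 -> flat1 x = 0.
Proof. by move=> x0; rewrite /flat1 /flat ltNge x0. Qed.

Lemma flat1_ge0 x : 0 <= flat1 x.
Proof. by have [/flat1_le0->|/flat1_gt0/ltW] := leP x 0. Qed.

(** The usual smooth transition from 0 to 1. The quotient is written with the real power -1 so that
    smoothness follows from [powR_smooth]. *)
Definition step x : R := flat1 x * (flat1 x + flat1 (1 - x)) `^ (-1).

Lemma step_den x : 0 < flat1 x + flat1 (1 - x).
Proof.
have [x0|x0] := leP x 0; last by rewrite ltr_wpDr ?flat1_ge0// flat1_gt0.
by rewrite ltr_wpDl ?flat1_ge0// flat1_gt0// subr_gt0 (le_lt_trans x0).
Qed.

Lemma step_ge0 x : 0 <= step x.
Proof. by rewrite mulr_ge0 ?flat1_ge0// powR_ge0. Qed.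

Lemma stepE x : step x = flat1 x / (flat1 x + flat1 (1 - x)).
Proof. by rewrite /step powR_inv1// ltW// step_den. Qed.

Lemma step_le1 x : step x <= 1.
Proof. by rewrite stepE ler_pdivrMr ?step_den// mul1r lerDl flat1_ge0. Qed.

Lemma step_le0 x : x <= 0 -> step x = 0.
Proof. by move=> x0; rewrite stepE flat1_le0// mul0r. Qed.

Lemma step_ge1 x : 1 <= x -> step x = 1.
Proof.
move=> x1; have x0 : 0 < x by apply: lt_le_trans x1.
by rewrite stepE (@flat1_le0 (1 - x)) ?subr_le0// addr0 divff// gt_eqF// flat1_gt0.
Qed.

End one_variable_smooth.

(** * Cutoff functions *)

Section cutoff.
Context {R : realType} {n : nat}.
Local Notation V := (Cspace R n).
Local Notation idx := ('I_n * bool)%type.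
Implicit Types (x y z w h : V) (f g phi : V -> R) (a b : idx) (k : nat) (K D : set V).

Lemma Ck_step k f : Ck k f -> Ck k (fun z => step (f z)).
Proof.
move=> fC.
have c1 : Ck k (fun z => flat1 (f z)) by apply: (Ck_comp (flat_smooth 1)).
have c2 : Ck k (fun z => flat1 (1 - f z)).
  apply: (Ck_comp (flat_smooth 1) (f := fun z => 1 - f z)) => //.
  by apply: CkB => //; exact: Ck_cst.
apply: CkM => //; apply: (Ck_comp (powR_smooth (-1)) (f := fun z => flat1 (f z) + flat1 (1 - f z))).
  by move=> z; exact: step_den.
exact: CkD.
Qed.

Lemma Ck_powR k s f : (forall z, 0 < f z) -> Ck k f -> Ck k (fun z => f z `^ s).
Proof. by move=> f0; apply: (Ck_comp (powR_smooth s)). Qed.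

Lemma Ck_shift k f w : Ck k f -> Ck k (fun z => f (z + w)).
Proof.
have E m g : Ck m g -> continuous (fun z => g (z + w)).
  move=> gC z; apply/cvg_nrP => e e0; have cg := Ck_cont gC.
  have /cvg_nrP/(_ e e0)[d d0 dP] := cg (z + w).
  by exists d => // y yz; apply: dP; rewrite opprD addrACA subrr addr0.
elim: k f => [|k IH] f fC; first by split => //; exact: E fC.
apply: (CkS (E _ _ fC)) => a; exists (fun z => pderiv a f (z + w)).
  move=> z; have := Ck_dv a (z + w) fC; congr (dv _ _ _).
  by apply/funext => t; exact: (congr1 f (addrAC _ _ _)).
by apply: IH; exact: Ck_pderiv.
Qed.

Lemma pderiv_shift a f w z : pderiv a (fun y => f (y + w)) z = pderiv a f (z + w).
Proof.
have E : along a (fun y => f (y + w)) z = along a f (z + w).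
  by apply/funext => t; exact: (congr1 f (addrAC z (rC t 0 *: real_dir a) w)).
exact: (congr1 (fun F => derive1 F 0) E).
Qed.

Definition sbump (r : R) x z : R := step (2 - N2 (z - x) / r).

Lemma Ck_sbump k r x : Ck k (sbump r x).
Proof.
apply: Ck_step; apply: CkB; first exact: Ck_cst.
under eq_fun do rewrite mulrC.
by apply: CkMl; apply: (@Ck_shift _ N2); exact: Ck_N2.
Qed.

Lemma sbump_eq1 r x z : 0 < r -> N2 (z - x) <= r -> sbump r x z = 1.
Proof.
move=> r0 h; apply: step_ge1; have : N2 (z - x) / r <= 1 by rewrite ler_pdivrMr// mul1r.
lra.
Qed.

Lemma sbump_neq0 r x z : 0 < r -> sbump r x z != 0 -> N2 (z - x) < 2 * r.
Proof.
move=> r0 h; rewrite ltNge; apply/negP => h'; move/eqP: h; apply.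
by rewrite /sbump step_le0// subr_le0 ler_pdivlMr.
Qed.

Lemma N2_ge0 z : 0 <= N2 z.
Proof. by apply: sumr_ge0 => a _; exact: sqr_ge0. Qed.

(** Otherwise points chosen greedily would form an r-separated sequence in K, which has no cluster
    point. *)
Lemma finite_net K (r : R) : compact K -> 0 < r -> exists s : seq V,
  (forall x, x \in s -> K x) /\ forall x, K x -> exists2 y, y \in s & nr (x - y) < r.
Proof.
move=> cK r0; apply: contrapT => H.
have ext (s : seq V) : (forall x, x \in s -> K x) ->
    exists x, K x /\ forall y, y \in s -> r <= nr (x - y).
  move=> sK; apply: contrapT => H'; apply: H; exists s; split => // x Kx.
  apply: contrapT => H''; apply: H'; exists x; split => // y ys.
  by rewrite leNgt; apply/negP => hy; apply: H''; exists y.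
have /choice[F FP] : forall s : seq V, exists x, (forall y, y \in s -> K y) ->
    K x /\ forall y, y \in s -> r <= nr (x - y).
  move=> s; have [h|h] := pselect (forall y, y \in s -> K y).
    by have [x xP] := ext s h; exists x.
  by exists 0 => h'.
pose S := fix S k := if k is k'.+1 then F (S k') :: S k' else [::].
have SK k : forall y, y \in S k -> K y.
  by elim: k => //= k IH y; rewrite inE => /predU1P[->|/IH//]; have [] := FP _ IH.
have mono j k : (j <= k)%N -> {subset S j <= S k}.
  move=> /subnK <-; elim: (k - j)%N => // m IH y /IH h.
  by change (y \in F (S (m + j)%N) :: S (m + j)%N); rewrite inE h orbT.
have Kx k : K (F (S k)) by have [] := FP _ (SK k).
have [z Kz zP] := compact_seq cK Kx.
have r20 : 0 < r / 2 by rewrite divr_gt0.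
have [j _ hj] := zP (r / 2) 0%N r20.
have [k jk hk] := zP (r / 2) j.+1 r20.
have [_ /(_ (F (S j)))] := FP _ (SK k).
have -> : F (S j) \in S k by apply: (mono _ _ jk); rewrite /= inE eqxx.
move=> /(_ isT); apply/negP; rewrite -ltNge.
apply: le_lt_trans (nr_triangle _ z _) _; rewrite (splitr r) ltrD//.
by rewrite nrB.
Qed.

Lemma supp_compact f M : bsupp M f -> compact (supp f).
Proof.
move=> fM; apply: subclosed_compact (@compact_nr_le _ _ M) _; first exact: closed_closure.
move=> z clz; rewrite /= leNgt; apply/negP => Mz.
have [|y [/= fy yz]] := clz [set y | nr (y - z) < nr z - M].
  by apply/nbhs_nrP; exists (nr z - M) => //; rewrite subr_gt0.
move/eqP: fy; apply; apply: fM.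
have := nr_ler_sub z y; rewrite nrB; have := yz; lra.
Qed.

Lemma supp_sub K D f (d e : R) : d < e -> (forall x y, K x -> nr (y - x) < e -> D y) ->
  (forall z, f z != 0 -> exists2 x, K x & nr (z - x) < d) -> supp f `<=` D.
Proof.
move=> de KD h z clz.
have [|y [/= /h[x Kx yx] yz]] := clz [set y | nr (y - z) < e - d].
  by apply/nbhs_nrP; exists (e - d) => //; rewrite subr_gt0.
apply: (KD x) => //; apply: le_lt_trans (nr_triangle _ y _) _.
rewrite nrB in yz; have := yz; have := yx; lra.
Qed.

Lemma suppP f z : f z != 0 -> supp f z.
Proof. by move=> fz; apply: subset_closure. Qed.

Lemma supp_out f z : ~ supp f z -> f z = 0.
Proof. by move=> h; apply/eqP; apply: contrapT => /negP/suppP. Qed.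

Lemma test_smooth_cont D f : test_smooth D f -> test_cont D f.
Proof. by move=> [fs h1 h2]; split => //; have := (smoothP f).1 fs 0%N; case. Qed.

Lemma test_cont_Cc D f : test_cont D f -> Cc f.
Proof.
move=> [fc sc _]; split => //; have [M MP] := compact_nr_bounded sc.
by exists M => z Mz; apply: supp_out => /MP; rewrite ltNge Mz.
Qed.

(** A smooth step applied to the sum of bumps centred at a finite net of K. *)
Lemma cutoff K D : compact K -> open D -> K `<=` D -> exists chi : V -> R,
  [/\ test_smooth D chi, forall z, 0 <= chi z <= 1 &
   exists2 d : R, 0 < d & forall x z, K x -> nr (z - x) < d -> chi z = 1].
Proof.
move=> cK oD KD; have [d d0 dP] := compact_margin cK oD KD.
(* The bumps are radial for [N2], which exceeds the square of [nr] by a factor up to 2n. With r =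
   d/(8(n+1)), the level [rho] below is large enough for a bump to be 1 on the ball of radius 2r
   about its centre, and small enough for it to vanish beyond d/2. *)
pose c : R := (8 * n.+1%:R)^-1.
have c0 : 0 < c by rewrite invr_gt0 mulr_gt0.
pose r := d * c.
have r0 : 0 < r by rewrite mulr_gt0.
have [s [sK sP]] := finite_net cK r0.
pose rho := (2 * n.+1%:R) * (2 * r) ^+ 2.
have rho0 : 0 < rho by rewrite !mulr_gt0// ?ltr0n// exprn_gt0// mulr_gt0.
have nr_rho z : N2 z < 2 * rho -> nr z < d / 2.
  move=> h; rewrite -(ltr_pXn2r (n := 2))// ?nnegrE ?nr_ge0 ?divr_ge0 ?ltW//.
  apply: le_lt_trans (nr_N2 z) (lt_le_trans h _).
  have cE : d = r * (8 * n.+1%:R) by rewrite /r -mulrA mulVf ?mulr1// gt_eqF// mulr_gt0.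
  rewrite /rho cE; have n1 : (1 : R) <= n.+1%:R by rewrite ler1n.
  rewrite [leLHS](_ : _ = 16 * r ^+ 2 * n.+1%:R); last by ring.
  rewrite [leRHS](_ : _ = 16 * r ^+ 2 * (n.+1%:R * n.+1%:R)); last by field.
  by rewrite ler_pM2l ?ler_peMr// mulr_gt0// exprn_gt0.
pose chi z := step (\sum_(x <- s) sbump rho x z).
have chiP z : chi z != 0 -> exists2 x, K x & nr (z - x) < d / 2.
  move=> h; apply: contrapT => H; move/eqP: h; apply.
  rewrite /chi big_seq big1 ?step_le0// => x xs; apply/eqP; apply: contrapT => /negP.
  by move=> /(sbump_neq0 rho0)/nr_rho hx; apply: H; exists x => //; exact: sK.
have d2 : d / 2 < d by rewrite ltr_pdivrMr// ltr_pMr// ltr1n.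
have [M MK] := compact_nr_bounded cK.
exists chi; split.
- split.
  + by apply/smoothP => k; apply: Ck_step; apply: Ck_sum => x; exact: Ck_sbump.
  + apply: (@supp_compact _ (M + d)) => z Mz; apply/eqP; apply: contrapT => /negP/chiP[x Kx zx].
    have := nr_ler_sub z x; have := MK _ Kx; have := zx; have := Mz; lra.
  + exact: (supp_sub d2 dP chiP).
- by move=> z; rewrite step_ge0 step_le1.
exists r => // x z Kx zx; have [y ys xy] := sP x Kx.
apply: step_ge1; rewrite (big_rem y)//= sbump_eq1//.
  by rewrite lerDl; apply: sumr_ge0 => ? _; exact: step_ge0.
have zy : nr (z - y) < 2 * r.
  apply: le_lt_trans (nr_triangle _ x _) _; have := zx; have := xy; lra.
apply: le_trans (N2_le _) _; apply: (@le_trans _ _ (2 * n%:R * (2 * r) ^+ 2)).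
  apply: ler_wpM2l; first by rewrite mulr_ge0.
  by rewrite lerXn2r ?nnegrE ?nr_ge0 ?ltW// mulr_gt0.
rewrite /rho; apply: ler_wpM2r; first exact: sqr_ge0.
by apply: ler_wpM2l; rewrite // ler_nat.
Qed.

End cutoff.

(** * Integration by parts, and integrals depending on a parameter *)

Section integral_facts.
Context {R : realType} {n : nat}.
Local Notation V := (Cspace R n).
Local Notation idx := ('I_n * bool)%type.
Local Notation I := (@Cintegral R n).
Implicit Types (x y z w h : V) (f g phi psi rho : V -> R) (a b : idx) (k : nat).

Let hI := Cintegral_haar R n.

Lemma Cc0 : Cc (fun _ : V => 0 : R).
Proof. by split; [exact: cts_cst|exists 0]. Qed.

Lemma CcD f g : Cc f -> Cc g -> Cc (fun z => f z + g z).
Proof. by move=> fC gC; have := Cc_lin 1 fC gC; under eq_fun do rewrite mul1r. Qed.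

Lemma CcMc f g : Cc f -> continuous g -> Cc (fun z => f z * g z).
Proof.
move=> [cf [M fM]] cg; split; first exact: ctsM.
by exists M => z /fM->; rewrite mul0r.
Qed.

Lemma CcMl c f : Cc f -> Cc (fun z => c * f z).
Proof. by move=> fC; have := Cc_lin c fC Cc0; under eq_fun do rewrite addr0. Qed.

Lemma CcN f : Cc f -> Cc (fun z => - f z).
Proof. by move=> /(CcMl (-1)); under eq_fun do rewrite mulN1r. Qed.

Lemma CcB f g : Cc f -> Cc g -> Cc (fun z => f z - g z).
Proof. by move=> fC gC; apply: CcD => //; exact: CcN. Qed.

Lemma Cc_sum (J : Type) (r : seq J) (P : pred J) (F : J -> V -> R) :
  (forall j, Cc (F j)) -> Cc (fun z => \sum_(j <- r | P j) F j z).
Proof.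
move=> FC; elim: r => [|j r IH]; first by under eq_fun do rewrite big_nil; exact: Cc0.
by under eq_fun do rewrite big_cons; case: (P j) => //; exact: CcD.
Qed.

Lemma I_0 : I (fun=> 0) = 0.
Proof.
have := haar_lin hI (-1) Cc0 Cc0; under eq_fun do rewrite mulr0 addr0.
by rewrite mulN1r addNr.
Qed.

Lemma I_D f g : Cc f -> Cc g -> I (fun z => f z + g z) = I f + I g.
Proof.
move=> fC gC; have := haar_lin hI 1 fC gC; rewrite mul1r => <-.
by apply: (congr1 I); apply/funext => z; rewrite mul1r.
Qed.

Lemma I_Ml c f : Cc f -> I (fun z => c * f z) = c * I f.
Proof.
move=> fC; have := haar_lin hI c fC Cc0; rewrite I_0 addr0 => <-.
by apply: (congr1 I); apply/funext => z; rewrite addr0.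
Qed.

Lemma I_N f : Cc f -> I (fun z => - f z) = - I f.
Proof.
move=> fC; rewrite -mulN1r -I_Ml//.
by apply: (congr1 I); apply/funext => z; rewrite mulN1r.
Qed.

Lemma I_B f g : Cc f -> Cc g -> I (fun z => f z - g z) = I f - I g.
Proof. by move=> fC gC; rewrite I_D ?I_N//; exact: CcN. Qed.

Lemma I_sum (J : Type) (r : seq J) (P : pred J) (F : J -> V -> R) :
  (forall j, Cc (F j)) ->
  I (fun z => \sum_(j <- r | P j) F j z) = \sum_(j <- r | P j) I (F j).
Proof.
move=> FC; elim: r => [|j r IH].
  rewrite big_nil -[RHS]I_0; apply: (congr1 I); apply/funext => z; exact: big_nil.
rewrite big_cons; case: ifP => Pj; last first.
  rewrite -IH; apply: (congr1 I); apply/funext => z; by rewrite big_cons Pj.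
rewrite -IH -I_D//; last exact: Cc_sum.
by apply: (congr1 I); apply/funext => z; rewrite big_cons Pj.
Qed.

Lemma I_ge0 f : (forall z, 0 <= f z) -> 0 <= I f.
Proof. exact: haar_ge0 hI f. Qed.

Lemma I_le f g : Cc f -> Cc g -> (forall z, f z <= g z) -> I f <= I g.
Proof.
move=> fC gC fg; rewrite -subr_ge0 -I_B//; apply: I_ge0 => z.
by rewrite subr_ge0.
Qed.

Lemma I_abs f g : Cc f -> Cc g -> (forall z, `|f z| <= g z) -> `|I f| <= I g.
Proof.
move=> fC gC fg; rewrite ler_norml -I_N//; apply/andP; split; apply: I_le => //.
- exact: CcN.
- by move=> z; have := fg z; rewrite ler_norml => /andP[].
- by move=> z; apply: le_trans (fg z); exact: ler_norm.
Qed.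

Lemma I_bound (M : R) : exists2 C : R, 0 <= C & forall f (A : R), Cc f -> bsupp M f ->
  (forall z, `|f z| <= A) -> `|I f| <= C * A.
Proof. exact: haar_bound hI M. Qed.

Lemma I_shift w f : Cc f -> I (fun z => f (z + w)) = I f.
Proof. exact: haar_shift hI w f. Qed.

Lemma Cc_pderiv a f : Ck 1 f -> Cc f -> Cc (pderiv a f) /\
  forall M, bsupp M f -> bsupp (M + 1) (pderiv a f).
Proof.
move=> fC [_ [M0 fM0]].
have H M : bsupp M f -> bsupp (M + 1) (pderiv a f).
  move=> fM z Mz; rewrite -(pderiv_cst (R := R) a 0 z).
  apply: (@pderiv_local _ _ 0); last exact: Ck_cst.
  apply/nbhs_nrP; exists 1 => // y yz; apply/esym/fM.
  have := nr_ler_sub z y; rewrite nrB; have := yz; lra.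
split=> //; split; first exact: Ck_cont (Ck_pderiv a fC).
by exists (M0 + 1); exact: H.
Qed.

(* uniform first order expansion along a real coordinate *)
Lemma unif_expand a f : Ck 1 f -> Cc f -> forall e : R, 0 < e -> exists2 d : R, 0 < d &
  forall t z, `|t| < d ->
    `|f (z + rC t 0 *: real_dir a) - f z - t * pderiv a f z| <= e * `|t|.
Proof.
move=> fC fc e e0; have [d d0 dP] := Cc_unif (proj1 (Cc_pderiv a fC fc)) e0.
exists d => // t z td.
have [s st E] := mvt_pm t (fun s => along_dv z s (proj1 ((proj2 fC) a))).
have {}E : f (z + rC t 0 *: real_dir a) - f z =
    pderiv a f (z + rC s 0 *: real_dir a) * t by rewrite -E /along rC0Z addr0.
rewrite E [t * _]mulrC -mulrBl normrM ler_wpM2r// ltW// dP//.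
by rewrite addrC addKr nrZr nr_real_dir mulr1 (le_lt_trans st).
Qed.

(** By translation invariance the difference quotients have integral zero, and they converge
    uniformly within a common bounded support. *)
Lemma I_pderiv a f : Ck 1 f -> Cc f -> I (pderiv a f) = 0.
Proof.
move=> fC fc; have [_ [M fM]] := fc.
have [dc dM] := Cc_pderiv a fC fc.
have [C C0 CP] := I_bound (M + 1).
apply/eqP; rewrite -normr_le0; apply/ler_addgt0Pl => e e0; rewrite addr0.
have C1 : 0 < C + 1 by rewrite ltr_wpDl.
have e1 : 0 < e / (C + 1) by rewrite divr_gt0.
have [d d0 dP] := unif_expand a fC fc e1.
pose t := Num.min d 1 / 2.
have m0 : 0 < Num.min d 1 by rewrite lt_min d0 ltr01.
have t0 : 0 < t by rewrite divr_gt0.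
have [td t1] : t < d /\ t < 1.
  have : t < Num.min d 1 by rewrite ltr_pdivrMr// ltr_pMr// ltr1n.
  by rewrite lt_min => /andP[].
have tn : `|t| = t by rewrite gtr0_norm.
pose g z := f (z + rC t 0 *: real_dir a) - f z - t * pderiv a f z.
have gc1 : Cc (fun z => f (z + rC t 0 *: real_dir a)) by exact: Cc_shift.
have gc2 := CcB gc1 fc.
have gc : Cc g by apply: CcB => //; exact: CcMl.
have gM : bsupp (M + 1) g.
  move=> z Mz; rewrite /g (dM _ fM)// (fM z) ?fM ?mulr0 ?subrr//; last first.
    by apply: le_trans Mz; rewrite lerDl.
  have := nr_ler_sub z (z + rC t 0 *: real_dir a).
  rewrite opprD addrA subrr sub0r nrN nrZr nr_real_dir mulr1 tn.
  have := t1; have := Mz; lra.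
have E : I g = - (t * I (pderiv a f)).
  by rewrite /g I_B//; [rewrite I_B// I_shift// subrr sub0r I_Ml|exact: CcMl].
have := CP g (e / (C + 1) * t) gc gM; rewrite E normrN normrM tn.
move=> /(_ _)H; have {H} : t * `|I (pderiv a f)| <= C * (e / (C + 1) * t).
  by apply: H => z; rewrite -[t in leRHS]tn; apply: dP; rewrite tn.
rewrite mulrA [leRHS]mulrC ler_pM2l// => H; apply: le_trans H _.
by rewrite mulrA ler_pdivrMr// [C * e]mulrC ler_pM2l// lerDl.
Qed.

Lemma I_parts a f g : Ck 1 f -> Ck 1 g -> Cc f ->
  I (fun z => pderiv a f z * g z) = - I (fun z => f z * pderiv a g z).
Proof.
move=> fC gC fc; have [dc _] := Cc_pderiv a fC fc.
have fgc : Cc (fun z => f z * g z) by apply: CcMc => //; exact: Ck_cont gC.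
have := I_pderiv a (CkM fC gC) fgc.
have -> : pderiv a (fun z => f z * g z) = (fun z => pderiv a f z * g z + f z * pderiv a g z).
  by apply/funext => z; exact: (pderivM a z fC gC).
rewrite I_D; last 2 first.
- by apply: CcMc => //; exact: Ck_cont gC.
- by apply: CcMc => //; exact: Ck_cont (Ck_pderiv a gC).
by move/eqP; rewrite addr_eq0 => /eqP.
Qed.

(** Uniform continuity in t, by compactness of [0,1] times a ball. *)
Lemma path_unif (M : R) (F : R -> V -> R) :
  (forall t, 0 <= t <= 1 -> bsupp M (F t)) ->
  (forall t z, 0 <= t <= 1 -> forall e : R, 0 < e -> exists2 d : R, 0 < d &
     forall s y, 0 <= s <= 1 -> `|s - t| < d -> nr (y - z) < d -> `|F s y - F t z| < e) ->
  forall e : R, 0 < e -> exists2 d : R, 0 < d &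
    forall s t z, 0 <= s <= 1 -> 0 <= t <= 1 -> `|s - t| < d -> `|F s z - F t z| <= e.
Proof.
move=> FM Fc e e0; apply: contrapT => H.
have /choice[p pP] : forall k : nat, exists p : R * R * V,
    [/\ 0 <= p.1.1 <= 1, 0 <= p.1.2 <= 1, `|p.1.1 - p.1.2| < k.+1%:R^-1 &
        nr p.2 <= M /\ e < `|F p.1.1 p.2 - F p.1.2 p.2|].
  move=> k; apply: contrapT => hk; apply: H; exists k.+1%:R^-1 => //.
  move=> s t z s01 t01 st; rewrite leNgt; apply/negP => hst; apply: hk.
  exists (s, t, z); split => //; split => //=; rewrite leNgt; apply/negP => /ltW Mz.
  by move: hst; rewrite !FM// subrr normr0 ltNge ltW.
have p1 k : 0 <= (p k).1.2 <= 1 by have [] := pP k.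
have p2 k : [set z | nr z <= M] (p k).2 by have [_ _ _ []] := pP k.
have [t [z [t01 _ tzP]]] := compact_seq2 (@compact_nr_le _ _ M) p1 p2.
have e20 : 0 < e / 2 by rewrite divr_gt0.
have [d d0 dP] := Fc t z t01 _ e20.
have d20 : 0 < d / 2 by rewrite divr_gt0.
have d2 : d / 2 < d by rewrite ltr_pdivrMr// ltr_pMr// ltr1n.
have [N NP] := archi_inv d20.
have [k [Nk kt kz]] := tzP _ N d20.
have [s01 s01' st [_]] := pP k; rewrite ltNge => /negP; apply.
have h1 : `|F (p k).1.1 (p k).2 - F t z| < e / 2.
  apply: dP => //; last exact: lt_trans d2.
  rewrite (_ : _ - t = ((p k).1.1 - (p k).1.2) + ((p k).1.2 - t)); last by ring.
  apply: le_lt_trans (ler_normD _ _) _; rewrite (splitr d) ltrD//.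
  by apply: lt_trans st _; exact: NP.
have h2 : `|F (p k).1.2 (p k).2 - F t z| < e / 2.
  by apply: dP => //; exact: lt_trans d2.
rewrite (_ : _ - _ = (F (p k).1.1 (p k).2 - F t z) - (F (p k).1.2 (p k).2 - F t z)); last by ring.
by apply: le_trans (ler_normB _ _) _; rewrite (splitr e); apply: lerD; exact: ltW.
Qed.

(* A one-parameter integral with nonnegative derivative increases; only increments
   inside [0, 1] are used, so the integrand need not make sense elsewhere. *)
Lemma path_mono (M : R) (F dF : R -> V -> R) :
  (forall t, 0 <= t <= 1 -> Cc (F t) /\ bsupp M (F t)) ->
  (forall t, 0 <= t <= 1 -> Cc (dF t) /\ bsupp M (dF t)) ->
  (forall t z, 0 <= t <= 1 -> dv (fun s => F s z) t (dF t z)) ->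
  (forall e : R, 0 < e -> exists2 d : R, 0 < d &
    forall s t z, 0 <= s <= 1 -> 0 <= t <= 1 -> `|s - t| < d -> `|dF s z - dF t z| <= e) ->
  (forall t, 0 <= t <= 1 -> 0 <= I (dF t)) -> I (F 0) <= I (F 1).
Proof.
move=> Fc dFc Fd dFu dF0.
have [C C0 CP] := I_bound M.
apply/ler_addgt0Pr => e e0.
have C1 : 0 < C + 1 by rewrite ltr_wpDl.
have [d d0 dP] := dFu _ (divr_gt0 e0 C1).
have [N NP] := archi_inv d0.
have := NP N (leqnn _); set m := N.+1%:R => md.
have m0 : 0 < m by rewrite ltr0n.
have inc t : 0 <= t <= 1 -> t + m^-1 <= 1 ->
    I (F t) <= I (F (t + m^-1)) + e / m.
  move=> t01 t1; have /andP[tge tle] := t01.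
  have t01' : 0 <= t + m^-1 <= 1 by rewrite t1 andbT addr_ge0// ltW// invr_gt0.
  have [c1 M1] := Fc _ t01; have [c2 M2] := Fc _ t01'; have [c3 M3] := dFc _ t01.
  pose g z := F (t + m^-1) z - F t z - m^-1 * dF t z.
  have gc1 := CcB c2 c1.
  have gc : Cc g by apply: CcB => //; exact: CcMl.
  have gM : bsupp M g by move=> z Mz; rewrite /g M1// M2// M3// mulr0 !subr0.
  have gb z : `|g z| <= e / (C + 1) * m^-1.
    have tt : t <= t + m^-1 by rewrite lerDl ltW// invr_gt0.
    have [|s /andP[s1 s2] E] := mvt tt (df := fun s => dF s z) (f := fun s => F s z).
      move=> s /andP[s1 s2]; apply: Fd.
      by rewrite (le_trans tge s1) (le_trans s2 t1).
    have gE : g z = (dF s z - dF t z) * m^-1 by rewrite /g E; ring.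
    have mi0 : 0 < m^-1 by rewrite invr_gt0.
    rewrite gE normrM (gtr0_norm mi0); apply: ler_wpM2r; first exact: ltW.
    apply: dP => //; first by rewrite (le_trans tge s1) (le_trans s2 t1).
    rewrite ger0_norm ?subr_ge0//; apply: le_lt_trans md.
    by rewrite lerBlDl.
  have := CP g _ gc gM gb.
  rewrite /g I_B//; last exact: CcMl.
  rewrite I_B// I_Ml// ler_norml => /andP[h' _].
  have h : - (C * (e / (C + 1) * m^-1)) <=
      I (F (t + m^-1)) - I (F t) - m^-1 * I (dF t) := h'.
  have h2 : 0 <= m^-1 * I (dF t) by rewrite mulr_ge0 ?dF0// invr_ge0 ltW.
  have h3 : C * (e / (C + 1) * m^-1) <= e / m.
    rewrite mulrA; apply: ler_wpM2r; first by rewrite invr_ge0 ltW.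
    by rewrite mulrA ler_pdivrMr// [C * e]mulrC ler_pM2l// lerDl.
  have alg (X Y A B E : R) : - X <= B - A - Y -> 0 <= Y -> X <= E -> A <= B + E by lra.
  exact: alg h h2 h3.
have step k : (k <= N.+1)%N -> I (F 0) <= I (F (k%:R / m)) + k%:R * (e / m).
  elim: k => [|k IH] kN; first by rewrite !mul0r addr0.
  have kN1 : (k.+1%:R / m) <= 1 by rewrite ler_pdivrMr// mul1r ler_nat.
  have k01 : 0 <= k%:R / m <= 1.
    apply/andP; split; first by apply: divr_ge0; [exact: ler0n|exact: ltW].
    by apply: le_trans kN1; rewrite ler_pM2r ?invr_gt0// ler_nat.
  have E : k%:R / m + m^-1 = k.+1%:R / m by rewrite -[k.+1%:R]natr1 mulrDl mul1r.
  have := inc _ k01; rewrite E => /(_ kN1) h.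
  have alg (X A B k' e' : R) : X <= A + k' * e' -> A <= B + e' -> X <= B + (k' + 1) * e' by lra.
  by rewrite -[k.+1%:R in X in _ <= _ + X]natr1; exact: alg (IH (ltnW kN)) h.
have := step N.+1 (leqnn _); rewrite -/m divff ?gt_eqF// mulrCA divff ?gt_eqF// mulr1.
by [].
Qed.

End integral_facts.

(** * Mollification *)

Section convolution.
Context {R : realType} {n : nat}.
Local Notation V := (Cspace R n).
Local Notation idx := ('I_n * bool)%type.
Local Notation I := (@Cintegral R n).
Implicit Types (x y z w h : V) (f g phi psi rho : V -> R) (a b : idx) (k : nat).

(** A correlation, with f evaluated at z + w, so that a derivative moved onto the kernel changes
    sign ([conv_dv]). *)
Definition cnv rho f z := I (fun w => rho w * f (z + w)).

Lemma cts_shift f z : continuous f -> continuous (fun w => f (z + w)).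
Proof.
move=> cf w; apply/cvg_nrP => e e0; have /cvg_nrP/(_ e e0)[d d0 dP] := cf (z + w).
by exists d => // y yw; apply: dP; rewrite opprD addrACA subrr add0r.
Qed.

Lemma conv_Cc_integrand rho f z : Cc rho -> continuous f -> Cc (fun w => rho w * f (z + w)).
Proof. by move=> rc fc; apply: CcMc => //; exact: cts_shift. Qed.

Lemma convE rho f z : Cc rho -> continuous f -> cnv rho f z = I (fun w => rho (w - z) * f w).
Proof.
move=> rc fc; rewrite /cnv -[LHS](I_shift (- z)); last exact: conv_Cc_integrand.
by apply: (congr1 I); apply/funext => w; congr (_ * f _); rewrite addrC subrK.
Qed.

Lemma convD rho f g z : Cc rho -> continuous f -> continuous g ->
  cnv rho (fun w => f w + g w) z = cnv rho f z + cnv rho g z.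
Proof.
move=> rc fc gc; rewrite /cnv -I_D; [|exact: conv_Cc_integrand|exact: conv_Cc_integrand].
by apply: (congr1 I); apply/funext => w; rewrite mulrDr.
Qed.

Lemma conv_le rho f g z : Cc rho -> (forall w, 0 <= rho w) -> continuous f -> continuous g ->
  (forall w, rho w != 0 -> f (z + w) <= g (z + w)) -> cnv rho f z <= cnv rho g z.
Proof.
move=> rc r0 fc gc fg; apply: I_le; [exact: conv_Cc_integrand|exact: conv_Cc_integrand|].
move=> w; have [->|rw] := eqVneq (rho w) 0; first by rewrite !mul0r.
by apply: ler_wpM2l; [exact: r0|exact: fg].
Qed.

Lemma conv_cst rho c z : Cc rho -> I rho = 1 -> cnv rho (fun=> c) z = c.
Proof.
move=> rc r1; rewrite /cnv -[RHS]mulr1 -r1 -I_Ml//.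
by apply: (congr1 I); apply/funext => w; rewrite mulrC.
Qed.

Lemma conv_sum rho (J : Type) (r : seq J) (c : J -> R) (F : J -> V -> R) z : Cc rho ->
  (forall j, continuous (F j)) ->
  cnv rho (fun w => \sum_(j <- r) c j * F j w) z = \sum_(j <- r) c j * cnv rho (F j) z.
Proof.
move=> rc Fc; transitivity (I (fun w => \sum_(j <- r) c j * (rho w * F j (z + w)))).
  apply: (congr1 I); apply/funext => w; rewrite mulr_sumr; apply: eq_bigr => j _.
  by rewrite mulrCA.
rewrite I_sum; last by move=> j; apply: CcMl; exact: conv_Cc_integrand.
by apply: eq_bigr => j _; rewrite I_Ml//; exact: conv_Cc_integrand.
Qed.

Lemma conv_shift rho f z h : cnv rho (fun w => f (w + h)) z = cnv rho f (z + h).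
Proof. by apply: (congr1 I); apply/funext => w; rewrite addrAC. Qed.

Lemma conv_dist rho f z (e : R) c : Cc rho -> (forall w, 0 <= rho w) -> I rho = 1 ->
  continuous f -> (forall w, rho w != 0 -> `|f (z + w) - c| <= e) -> `|cnv rho f z - c| <= e.
Proof.
move=> rc r0 r1 fc H; rewrite ler_distl; apply/andP; split.
  rewrite -(conv_cst (c - e) z rc r1); apply: conv_le => //; first exact: cts_cst.
  by move=> w /H; rewrite ler_distl => /andP[].
rewrite -(conv_cst (c + e) z rc r1); apply: conv_le => //; first exact: cts_cst.
by move=> w /H; rewrite ler_distl => /andP[].
Qed.

Lemma conv_bsupp rho f M N : bsupp M rho -> bsupp N f -> bsupp (M + N) (cnv rho f).
Proof.
move=> rM fN z Mz; rewrite /cnv -[RHS](@I_0 R n); apply: (congr1 I); apply/funext => w.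
have [wM|Mw] := leP M (nr w); first by rewrite rM// mul0r.
rewrite fN ?mulr0//.
have := nr_ler_sub z (- w); rewrite opprK nrN; have := Mz; have := Mw; lra.
Qed.

Lemma conv_dv rho f a z : Ck 1 rho -> Cc rho -> Cc f ->
  dv (along a (cnv rho f) z) 0 (- cnv (pderiv a rho) f z).
Proof.
move=> rCk rc fc; have [cf [N fN]] := fc.
have [A A0 AP] := Cc_bounded fc.
have [C C0 CP] := I_bound (R := R) (n := n) N.
have [dc dM] := Cc_pderiv a rCk rc.
apply/dvP => e e0.
have k0 : 0 < C * A + 1 by rewrite ltr_wpDl// mulr_ge0// ltW.
have e1 : 0 < e / (C * A + 1) by rewrite divr_gt0.
have [d d0 dP] := unif_expand a rCk rc e1; exists d => // t td.
rewrite add0r /along rC0Z addr0.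
pose g w := (rho (w - z + rC (- t) 0 *: real_dir a) - rho (w - z)
   - (- t) * pderiv a rho (w - z)) * f w.
have c1 : Cc (fun w => rho (w - z + rC (- t) 0 *: real_dir a) * f w).
  apply: CcMc => //; apply: (@Cc_shift _ _ (- z) (fun w => rho (w + rC (- t) 0 *: real_dir a))).
  exact: Cc_shift.
have c2 : Cc (fun w => rho (w - z) * f w) by apply: CcMc => //; exact: Cc_shift.
have c3 : Cc (fun w => pderiv a rho (w - z) * f w) by apply: CcMc => //; exact: Cc_shift.
have E : I g = cnv rho f (z + rC t 0 *: real_dir a) - cnv rho f z
    - t * (- cnv (pderiv a rho) f z).
  have q1 : cnv rho f (z + rC t 0 *: real_dir a) =
      I (fun w => rho (w - z + rC (- t) 0 *: real_dir a) * f w).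
    rewrite convE//; apply: (congr1 I); apply/funext => w; congr (rho _ * _).
    by rewrite opprD addrA rCNZ.
  rewrite q1 (convE z rc cf) (convE z dc cf) mulrN opprK.
  rewrite -(I_Ml t c3) -(I_B c1 c2) -I_D; [|exact: CcB|exact: CcMl].
  by apply: (congr1 I); apply/funext => w; rewrite /g; ring.
rewrite -E; apply: le_trans (_ : C * (e / (C * A + 1) * `|t| * A) <= _).
  apply: CP.
  - rewrite /g; under eq_fun do rewrite mulrBl mulrBl -mulrA.
    by apply: CcB; [exact: CcB|exact: CcMl].
  - by move=> w Nw; rewrite /g fN// mulr0.
  - move=> w; rewrite /g normrM; apply: ler_pM => //.
    by have := dP (- t) (w - z); rewrite normrN; apply.
rewrite (_ : C * _ = (C * A) * e / (C * A + 1) * `|t|); last by ring.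
apply: ler_wpM2r => //; rewrite ler_pdivrMr// [leRHS]mulrC.
by apply: ler_wpM2r; [exact: ltW|rewrite lerDl].
Qed.

Lemma conv_continuous rho f : Cc rho -> Cc f -> continuous (cnv rho f).
Proof.
move=> rc fc z; apply/cvg_nrP => e e0.
have [_ [M rM]] := rc; have [B B0 BP] := Cc_bounded rc.
have [C C0 CP] := I_bound (R := R) (n := n) M; have [cf _] := fc.
have k0 : 0 < C * B + 1 by rewrite ltr_wpDl// mulr_ge0// ltW.
have e1 : 0 < e / (C * B + 1) by rewrite divr_gt0.
have [d d0 dP] := Cc_unif fc e1; exists d => // y yz.
have c1 y' := conv_Cc_integrand y' rc cf.
rewrite /cnv -I_B//.
apply: le_lt_trans (_ : C * (B * (e / (C * B + 1))) < _).
  apply: CP; first exact: CcB.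
  - by move=> w Mw; rewrite rM// !mul0r subrr.
  - move=> w; rewrite -mulrBr normrM; apply: ler_pM => //; apply/ltW/dP.
    by rewrite opprD addrACA subrr addr0.
rewrite mulrA mulrA ltr_pdivrMr// mulrC ltr_pM2l//.
by rewrite ltrDl.
Qed.

Lemma conv_Cc rho f : Cc rho -> Cc f -> Cc (cnv rho f).
Proof.
move=> rc fc; split; first exact: conv_continuous.
have [_ [M rM]] := rc; have [_ [N fN]] := fc.
by exists (M + N); exact: conv_bsupp.
Qed.

Lemma conv_Ck k rho f : Ck k rho -> Cc rho -> Cc f -> Ck k (cnv rho f).
Proof.
elim: k rho => [|k IH] rho rCk rc fc; first by split => //; exact: conv_continuous.
apply: CkS; first exact: conv_continuous.
move=> a; exists (fun z => - cnv (pderiv a rho) f z).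
  by move=> z; apply: conv_dv => //; exact: CkW rCk.
apply: CkN; apply: IH => //; first exact: Ck_pderiv.
by have [] := Cc_pderiv a (CkW (isT : (1 <= k.+1)%N) rCk) rc.
Qed.

(* the derivative can be put on the other factor *)
Lemma conv_dv_r rho f a z : Cc rho -> Ck 1 f -> Cc f ->
  dv (along a (cnv rho f) z) 0 (cnv rho (pderiv a f) z).
Proof.
move=> rc fC fc; have [_ [M rM]] := rc; have [B B0 BP] := Cc_bounded rc.
have [C C0 CP] := I_bound (R := R) (n := n) M.
have [[dc _] _] := Cc_pderiv a fC fc; have [cf _] := fc.
apply/dvP => e e0.
have k0 : 0 < C * B + 1 by rewrite ltr_wpDl// mulr_ge0// ltW.
have e1 : 0 < e / (C * B + 1) by rewrite divr_gt0.
have [d d0 dP] := unif_expand a fC fc e1; exists d => // t td.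
rewrite add0r /along rC0Z addr0.
have c1 y := conv_Cc_integrand y rc cf.
have c2 := conv_Cc_integrand z rc dc.
pose g w := rho w * (f (z + w + rC t 0 *: real_dir a) - f (z + w) - t * pderiv a f (z + w)).
have E : I g = cnv rho f (z + rC t 0 *: real_dir a) - cnv rho f z - t * cnv rho (pderiv a f) z.
  rewrite /cnv -I_Ml// -I_B// -I_B; [|exact: CcB|exact: CcMl].
  apply: (congr1 I); apply/funext => w; rewrite /g.
  have -> : z + w + rC t 0 *: real_dir a = z + rC t 0 *: real_dir a + w by rewrite addrAC.
  by ring.
rewrite -E; apply: le_trans (_ : C * (B * (e / (C * B + 1) * `|t|)) <= _).
  apply: CP.
  - have -> : g = (fun w => rho w * f (z + rC t 0 *: real_dir a + w) - rho w * f (z + w)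
        - t * (rho w * pderiv a f (z + w))).
      apply/funext => w; rewrite /g.
      have -> : z + w + rC t 0 *: real_dir a = z + rC t 0 *: real_dir a + w by rewrite addrAC.
      by ring.
    by apply: CcB; [exact: CcB|exact: CcMl].
  - by move=> w Mw; rewrite /g rM// mul0r.
  - by move=> w; rewrite /g normrM; apply: ler_pM => //; exact: dP.
rewrite (_ : C * _ = (C * B) * e / (C * B + 1) * `|t|); last by ring.
apply: ler_wpM2r => //; rewrite ler_pdivrMr// [leRHS]mulrC.
by apply: ler_wpM2r; [exact: ltW|rewrite lerDl].
Qed.

Lemma pderiv_conv rho f a z : Cc rho -> Ck 1 f -> Cc f ->
  pderiv a (cnv rho f) z = cnv rho (pderiv a f) z.
Proof. by move=> rc fC fc; apply: pderiv_dv; exact: conv_dv_r. Qed.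

Record mollifier (e : R) rho : Prop := Mollifier {
  moll_smooth : smooth rho;
  moll_ge0 : forall w, 0 <= rho w;
  moll_I : I rho = 1;
  moll_supp : forall w, rho w != 0 -> nr w < e }.

Lemma moll_Cc e rho : mollifier e rho -> Cc rho.
Proof.
move=> [rs _ _ rsupp]; split; first by have := (smoothP rho).1 rs 0%N; case.
exists e => z ez; apply/eqP; apply: contrapT => /negP/rsupp.
by rewrite ltNge ez.
Qed.

Lemma moll_bsupp e rho : mollifier e rho -> bsupp e rho.
Proof.
move=> m z ez; apply/eqP; apply: contrapT => /negP/(moll_supp m).
by rewrite ltNge ez.
Qed.

Lemma mollifier_exists (e : R) : 0 < e -> exists rho, mollifier e rho.
Proof.
move=> e0; pose r := e ^+ 2 / 4.
have r0 : 0 < r by rewrite divr_gt0// exprn_gt0.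
pose b : V -> R := sbump r 0.
have bs : smooth b by apply/smoothP => k; exact: Ck_sbump.
have bsupp' w : b w != 0 -> nr w < e.
  move=> /(sbump_neq0 r0); rewrite subr0 => h.
  rewrite -(ltr_pXn2r (n := 2))// ?nnegrE ?nr_ge0 ?ltW//.
  apply: le_lt_trans (nr_N2 w) (lt_trans h _); rewrite /r.
  have : 0 < e ^+ 2 by rewrite exprn_gt0.
  lra.
have bc : Cc b.
  split; first by have := (smoothP b).1 bs 0%N; case.
  by exists e => z ez; apply/eqP; apply: contrapT => /negP/bsupp'; rewrite ltNge ez.
have b0 w : 0 <= b w by exact: step_ge0.
have b1 : b 0 = 1.
  apply: sbump_eq1 => //; rewrite subrr /N2 big1 ?ltW// => a _.
  by rewrite co0 expr0n.
have Ib : 0 < I b by apply: (haar_gt0 (Cintegral_haar R n) bc b0 (z0 := 0)); rewrite b1.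
exists (fun w => (I b)^-1 * b w); split.
- by apply/smoothP => k; apply: CkMl; exact: ((smoothP b).1 bs).
- by move=> w; rewrite mulr_ge0// invr_ge0 ltW.
- by rewrite I_Ml// mulVf// gt_eqF.
- by move=> w; rewrite mulf_eq0 negb_or => /andP[_]; exact: bsupp'.
Qed.

Lemma conv_smooth e rho f : mollifier e rho -> Cc f -> smooth (cnv rho f).
Proof.
move=> m fc; apply/smoothP => k; apply: conv_Ck => //; last exact: moll_Cc m.
by apply: (smoothP rho).1; exact: moll_smooth m.
Qed.

Lemma conv_approx f (d : R) : Cc f -> 0 < d -> exists2 e : R, 0 < e &
  forall rho e', e' <= e -> mollifier e' rho -> forall z, `|cnv rho f z - f z| <= d.
Proof.
move=> fc d0; have [e e0 eP] := Cc_unif fc d0; exists e => // rho e' e'e m z.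
have [cf _] := fc.
apply: (conv_dist (moll_Cc m) (moll_ge0 m) (moll_I m) cf) => w /(moll_supp m) we.
by apply/ltW/eP; rewrite addrC addKr (lt_le_trans we).
Qed.

(* A convolution is a uniform limit of finite averages of translates, the same average
   serving all functions with a given modulus of continuity. *)
Lemma conv_average e rho (d : R) : mollifier e rho -> 0 < d -> exists (s : seq V) (c : V -> R),
  [/\ forall w, 0 <= c w, \sum_(w <- s) c w = 1, forall w, w \in s -> nr w <= e &
   forall f (t : R), continuous f -> (forall x y, nr (y - x) < d -> `|f y - f x| <= t) ->
   forall z, `|cnv rho f z - \sum_(w <- s) c w * f (z + w)| <= t].
Proof.
move=> m d0; have [s [sK sP]] := finite_net (@compact_nr_le R n e) d0.
pose b x w := Num.max 0 (d - nr (w - x)).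
have nrc x : continuous (fun w => nr (w - x)).
  move=> w; apply/cvg_nrP => r r0; exists r => // y yw.
  rewrite ltr_distl; have h1 := nr_triangle y w x; have h2 := nr_triangle w y x.
  rewrite (nrB w y) in h2; move: h1 h2 yw; clear.
  move: (nr _) (nr _) (nr _) => A B C h1 h2 h3; apply/andP; split; lra.
have bc x : continuous (b x).
  apply: cts_max; first exact: cts_cst.
  by apply: ctsB; [exact: cts_cst|exact: nrc].
have b0 x w : 0 <= b x w by rewrite /b le_max lexx.
(* The denominator of a partition of unity subordinate to the net. The last term vanishes on the
   support of the kernel and keeps the sum positive everywhere else. *)
pose S w := \sum_(x <- s) b x w + Num.max 0 (nr w - e).
have Sc : continuous S.
  apply: ctsD; first exact: cts_sum.
  apply: cts_max; first exact: cts_cst.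
  apply: ctsB; last exact: cts_cst.
  by have := nrc 0; under eq_fun do rewrite subr0.
have sum0 w : 0 <= \sum_(x <- s) b x w by apply: sumr_ge0.
have S0 w : 0 < S w.
  have [we|ew] := leP (nr w) e; last first.
    by apply: ltr_wpDl => //; rewrite lt_max subr_gt0 ew orbT.
  have [x xs xw] := sP w we; apply: ltr_wpDr; first by rewrite le_max lexx.
  rewrite (big_rem x)//=; apply: ltr_wpDr; first by apply: sumr_ge0.
  by rewrite /b lt_max subr_gt0 xw orbT.
pose beta x w := rho w * (b x w / S w).
have betac x : Cc (beta x).
  apply: CcMc; first exact: moll_Cc m.
  apply: ctsM => // w; exact: (cvgV (lt0r_neq0 (S0 w)) (Sc w)).
have rc := moll_Cc m.
have betaS w : \sum_(x <- s) beta x w = rho w.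
  rewrite -mulr_sumr -mulr_suml; have [->|rw] := eqVneq (rho w) 0; first by rewrite mul0r.
  rewrite (_ : \sum_(x <- s) b x w = S w) ?divff ?mulr1 ?gt_eqF//.
  rewrite /S (max_idPl _) ?addr0// subr_le0 ltW//.
  exact: moll_supp m _ rw.
exists s, (fun x => I (beta x)); split.
- by move=> x; apply: I_ge0 => w; rewrite mulr_ge0 ?divr_ge0 ?(moll_ge0 m)// ltW.
- rewrite -I_sum// -(moll_I m); apply: (congr1 I); exact/funext.
- by move=> w /sK.
move=> f t cf fd z.
have -> : \sum_(w <- s) I (beta w) * f (z + w) = I (fun w => \sum_(x <- s) f (z + x) * beta x w).
  rewrite I_sum; last by move=> x; exact: CcMl.
  by apply: eq_bigr => x _; rewrite I_Ml// mulrC.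
have c1 := conv_Cc_integrand z rc cf.
have c2 : Cc (fun w => \sum_(x <- s) f (z + x) * beta x w) by apply: Cc_sum => x; exact: CcMl.
rewrite /cnv -I_B//.
have <- : I (fun w => t * rho w) = t by rewrite I_Ml// (moll_I m) mulr1.
apply: I_abs; [exact: CcB|exact: CcMl|move=> w].
have -> : rho w * f (z + w) - \sum_(x <- s) f (z + x) * beta x w =
   \sum_(x <- s) (f (z + w) - f (z + x)) * beta x w.
  by rewrite -[in LHS]betaS mulr_suml -sumrB; apply: eq_bigr => x _; ring.
apply: le_trans (ler_norm_sum _ _ _) _; rewrite -betaS mulr_sumr; apply: ler_sum => x _.
have be0 : 0 <= beta x w by rewrite mulr_ge0 ?divr_ge0 ?(moll_ge0 m)// ltW.
rewrite normrM (ger0_norm be0); move: be0; rewrite le_eqVlt => /predU1P[<-|be0].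
  by rewrite !mulr0.
apply: ler_wpM2r; first exact: ltW.
apply: fd; rewrite opprD addrACA subrr add0r ltNge; apply/negP => dx.
move: be0; rewrite /beta /b (max_idPl _) ?subr_le0//.
by rewrite mul0r mulr0 ltxx.
Qed.

End convolution.

(** * Exterior algebra and multiplication by a real (1,1)-form *)

Section exterior.
Context {R : realType} {n : nat}.
Local Notation idx := ('I_n * bool)%type.
Local Notation form := {ffun {set idx} -> R^o}.
Implicit Types (a b c s t : idx) (S T : {set idx}) (F G : form) (x y : idx -> R)
  (M L : idx -> idx -> R) (i j k : 'I_n).

(** Left multiplication by dx_a, a form being the family of its coefficients in the basis dx_S. *)
Definition ext a F : form :=
  [ffun S : {set idx} => if a \in S then wedge_sign a (S :\ a)%SET * F (S :\ a)%SET else 0].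

Lemma ext_is_linear a : linear (ext a).
Proof.
move=> c F G; apply/ffunP => S; rewrite !ffunE; case: ifP => _.
  by rewrite /= mulrDr -[c *: _]/(c * _) -[c *: _]/(c * _) mulrCA.
by rewrite -[c *: _]/(c * _) mulr0 addr0.
Qed.

HB.instance Definition _ a := GRing.isLinear.Build R form form _ (ext a) (ext_is_linear a).

Lemma extZ a (k : R) F : ext a (k *: F) = k *: ext a F.
Proof. exact: linearZ. Qed.

Lemma idx_rank_inj : injective (@idx_rank n).
Proof.
move=> [i b] [j c]; rewrite /idx_rank/= => h.
have bc : b = c by have := congr1 odd h; rewrite !oddD !odd_double; case: b c {h} => [] [].
have ij : i = j :> nat.
  by have := congr1 half h; rewrite ![(_ + nat_of_bool _)%N]addnC !half_bit_double.
by rewrite bc (val_inj ij).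
Qed.

Lemma wedge_sign_del a b S : a != b -> b \in S ->
  wedge_sign a S = (-1) ^+ (idx_rank b < idx_rank a)%N * wedge_sign a (S :\ b)%SET :> R.
Proof.
move=> ab bS; rewrite /wedge_sign -exprD; congr (_ ^+ _).
rewrite [LHS](cardsD1 b) inE bS /=; congr (_ + _)%N; apply: eq_card => c.
by rewrite !inE andbA.
Qed.

Lemma ext_anti a b F : ext a (ext b F) = - ext b (ext a F).
Proof.
apply/ffunP => S; rewrite !ffunE !inE.
have [->|ab] := eqVneq a b.
  by rewrite /=; case: ifP; rewrite ?mulr0 oppr0.
rewrite /=.
case aS: (a \in S); case bS: (b \in S); rewrite ?mulr0 ?oppr0//=.
have -> : (S :\ a :\ b)%SET = (S :\ b :\ a)%SET by apply/finset.setP => c; rewrite !inE andbCA.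
rewrite !mulrA -mulNr; congr (_ * _).
have ba : b != a by rewrite eq_sym.
rewrite (@wedge_sign_del a b (S :\ a)%SET)//; last by rewrite !inE ba bS.
rewrite (@wedge_sign_del b a (S :\ b)%SET)//; last by rewrite !inE ab aS.
have -> : (S :\ a :\ b)%SET = (S :\ b :\ a)%SET by apply/finset.setP => c; rewrite !inE andbCA.
have : (idx_rank a != idx_rank b)%N by apply: contra_neq ab => /idx_rank_inj.
case: (ltngtP (idx_rank b) (idx_rank a)) => //= _ _.
  by rewrite expr0 expr1; ring.
by rewrite expr0 expr1; ring.
Qed.

Definition extv x F : form := \sum_(a : idx) x a *: ext a F.

Lemma extv_is_linear x : linear (extv x).
Proof.
move=> c F G; rewrite /extv scaler_sumr -big_split/=; apply: eq_bigr => a _.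
by rewrite linearP scalerDr !scalerA mulrC.
Qed.

HB.instance Definition _ x := GRing.isLinear.Build R form form _ (extv x) (extv_is_linear x).

Lemma extv_extv x y F : extv x (extv y F) = \sum_(a : idx) \sum_(b : idx) (x a * y b) *: ext a (ext b F).
Proof.
rewrite /extv; apply: eq_bigr => a _; rewrite linear_sum scaler_sumr.
by apply: eq_bigr => b _; rewrite linearZ/= scalerA.
Qed.

Lemma extv_anti x y F : extv x (extv y F) = - extv y (extv x F).
Proof.
rewrite !extv_extv exchange_big -sumrN; apply: eq_bigr => a _.
rewrite -sumrN; apply: eq_bigr => b _.
by rewrite ext_anti scalerN mulrC.
Qed.

Lemma extv_sq x F : extv x (extv x F) = 0.
Proof.
have /eqP := extv_anti x x F; rewrite -addr_eq0 -mulr2n -scaler_nat scaler_eq0.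
by rewrite pnatr_eq0/= => /eqP.
Qed.

Lemma sum_sym_anti (J : finType) (m : J -> J -> R) (X : J -> J -> form) :
  (forall p q, m p q = m q p) -> (forall p q, X p q = - X q p) ->
  \sum_p \sum_q m p q *: X p q = 0.
Proof.
move=> ms Xa; set Y := (X in X = 0).
have : Y = - Y.
  rewrite {1}/Y exchange_big -sumrN; apply: eq_bigr => j _.
  by rewrite -sumrN; apply: eq_bigr => k _; rewrite Xa ms scalerN.
move/eqP; rewrite -addr_eq0 -mulr2n -scaler_nat scaler_eq0 pnatr_eq0/=.
by move/eqP.
Qed.

(** Multiplication by the 2-form whose value at the Hessian of f is dd^c f; [Q_coef] has the signs
    of [ddc_mul]. *)
Definition Q M F : form :=
  \sum_(a : idx) \sum_(b : idx) ((-1) ^+ a.2 * M b a) *: ext b (ext (conj_idx a) F).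

Lemma Q_is_linear M : linear (Q M).
Proof.
move=> c F G; rewrite /Q scaler_sumr -big_split/=; apply: eq_bigr => a _.
rewrite scaler_sumr -big_split/=; apply: eq_bigr => b _.
by rewrite (linearP (ext (conj_idx a))) (linearP (ext b)) scalerDr !scalerA [c * _]mulrC.
Qed.

HB.instance Definition _ M := GRing.isLinear.Build R form form _ (Q M) (Q_is_linear M).

Lemma QD (c : R) M L F : Q (fun a b => c * M a b + L a b) F = c *: Q M F + Q L F.
Proof.
rewrite /Q scaler_sumr -big_split/=; apply: eq_bigr => a _.
rewrite scaler_sumr -big_split/=; apply: eq_bigr => b _.
by rewrite scalerA -scalerDl; congr (_ *: _); ring.
Qed.

Lemma QZ (c : R) M F : Q (fun a b => c * M a b) F = c *: Q M F.
Proof.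
rewrite /Q scaler_sumr; apply: eq_bigr => a _; rewrite scaler_sumr; apply: eq_bigr => b _.
by rewrite scalerA mulrCA.
Qed.

Lemma Q_ext M a F : Q M (ext a F) = ext a (Q M F).
Proof.
rewrite /Q linear_sum; apply: eq_bigr => b _; rewrite linear_sum; apply: eq_bigr => c _.
by rewrite linearZ/= [ext (conj_idx b) _]ext_anti linearN/= ext_anti opprK.
Qed.

Lemma Q_comm M L F : Q M (Q L F) = Q L (Q M F).
Proof.
transitivity (\sum_(a : idx) \sum_(b : idx)
    ((-1) ^+ a.2 * M b a) *: Q L (ext b (ext (conj_idx a) F))).
  by rewrite {1}/Q; apply: eq_bigr => a _; apply: eq_bigr => b _; rewrite !Q_ext.
rewrite [X in _ = Q L X]/Q linear_sum; apply: eq_bigr => a _.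
by rewrite linear_sum; apply: eq_bigr => b _; rewrite linearZ.
Qed.

Lemma Q_coef M F S : Q M F S = \sum_(a : idx) \sum_(b : idx | (b \in S) && (conj_idx a \in S :\ b)%SET)
  (-1) ^+ a.2 * wedge_sign b (S :\ b)%SET * wedge_sign (conj_idx a) (S :\ b :\ conj_idx a)%SET
   * (M b a * F (S :\ b :\ conj_idx a)%SET).
Proof.
rewrite /Q sum_ffunE; apply: eq_bigr => a _; rewrite sum_ffunE [RHS]big_mkcond.
apply: eq_bigr => b _; rewrite ffunE !ffunE.
case: (b \in S) => /=; last by rewrite -[_ *: _]/(_ * _) mulr0.
case: (conj_idx a \in _) => /=; last by rewrite mulr0 -[_ *: _]/(_ * _) mulr0.
by rewrite -[_ *: _]/(_ * _); ring.
Qed.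

Definition fone : form := [ffun S : {set idx} => (S == finset.set0)%:R].

Definition delta a b : R := (a == b)%:R.

(** Multiplication by i in real coordinates. *)
Definition Jv x : idx -> R := fun a => (if a.2 then 1 else -1) * x (conj_idx a).

Lemma conj_idxK : involutive (@conj_idx n).
Proof. by move=> [i c]; rewrite /conj_idx/= negbK. Qed.

Lemma extv_Jv x F : extv (Jv x) F = \sum_(a : idx) ((-1) ^+ a.2 * x a) *: ext (conj_idx a) F.
Proof.
rewrite /extv (reindex_inj (inv_inj conj_idxK)); apply: eq_bigr => -[i c] _.
by rewrite /Jv conj_idxK /=; case: c; rewrite /= ?expr1 ?expr0.
Qed.

Definition bil M x y : R := \sum_(a : idx) \sum_(b : idx) x a * M a b * y b.

(** Four times the Levi form, when M is a Hessian. *)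
Definition levi M x : R := bil M x x + bil M (Jv x) (Jv x).

Section adapted_basis.
Variable u : idx -> idx -> R.
Hypothesis uJ : forall i, u (i, true) = Jv (u (i, false)).
Hypothesis uO : forall a b, \sum_(s : idx) u s a * u s b = delta a b.
Local Notation E s := (extv (u s)).

Lemma Jv_u t : Jv (u t) = (fun a => (-1) ^+ t.2 * u (conj_idx t) a).
Proof.
case: t => i []; apply/funext => a; rewrite /conj_idx/=; last by rewrite uJ expr0 mul1r.
rewrite uJ expr1 /Jv conj_idxK; case: a => j [] /=; ring.
Qed.

(** The form attached to M has the same expression in every orthonormal basis compatible with the
    complex structure. Expanding in coordinates, the orthogonality relations [uO] collapse the sums
    over the basis. *)
Lemma Q_basis M F :
  Q M F = \sum_(s : idx) \sum_(t : idx) (bil M (u s) (u t) * (-1) ^+ t.2) *: E s (E (conj_idx t) F).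
Proof.
transitivity (\sum_(s : idx) \sum_(t : idx) bil M (u s) (u t) *: E s (extv (Jv (u t)) F)); last first.
  apply: eq_bigr => s _; apply: eq_bigr => t _; rewrite Jv_u.
  have -> : extv (fun a => (-1) ^+ t.2 * u (conj_idx t) a) F = (-1) ^+ t.2 *: E (conj_idx t) F.
    by rewrite /extv scaler_sumr; apply: eq_bigr => a _; rewrite scalerA.
  by rewrite linearZ/= scalerA.
transitivity (\sum_(s : idx) \sum_(t : idx) \sum_(a : idx) \sum_b
   (bil M (u s) (u t) * u s b * ((-1) ^+ a.2 * u t a)) *: ext b (ext (conj_idx a) F)); last first.
  apply: eq_bigr => s _; apply: eq_bigr => t _; rewrite extv_Jv /extv.
  rewrite exchange_big scaler_sumr; apply: eq_bigr => b _.
  rewrite linear_sum !scaler_sumr; apply: eq_bigr => a _.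
  by rewrite /= extZ !scalerA ?mulrA.
have exch (G : idx -> idx -> idx -> idx -> form) :
    \sum_(s : idx) \sum_(t : idx) \sum_(a : idx) \sum_(b : idx) G s t a b = \sum_(a : idx) \sum_(b : idx) \sum_(s : idx) \sum_(t : idx) G s t a b.
  under eq_bigr do rewrite exchange_big.
  rewrite exchange_big; apply: eq_bigr => a _.
  under eq_bigr do rewrite exchange_big.
  by rewrite exchange_big.
rewrite exch /Q; apply: eq_bigr => a _; apply: eq_bigr => b _.
under eq_bigr do rewrite -scaler_suml.
rewrite -scaler_suml; congr (_ *: _).
transitivity ((-1) ^+ a.2 * \sum_(s : idx) \sum_(t : idx) bil M (u s) (u t) * u s b * u t a); last first.
  rewrite mulr_sumr; apply: eq_bigr => s _; rewrite mulr_sumr; apply: eq_bigr => t _.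
  by ring.
congr (_ * _).
transitivity (\sum_(s : idx) \sum_(t : idx) \sum_(c : idx) \sum_(d : idx) M c d * (u s c * u s b) * (u t d * u t a)); last first.
  apply: eq_bigr => s _; apply: eq_bigr => t _; rewrite /bil !mulr_suml.
  apply: eq_bigr => c _; rewrite !mulr_suml; apply: eq_bigr => d _; ring.
have exch' (G : idx -> idx -> idx -> idx -> R) :
    \sum_(s : idx) \sum_(t : idx) \sum_(a : idx) \sum_(b : idx) G s t a b = \sum_(a : idx) \sum_(b : idx) \sum_(s : idx) \sum_(t : idx) G s t a b.
  under eq_bigr do rewrite exchange_big.
  rewrite exchange_big; apply: eq_bigr => e _.
  under eq_bigr do rewrite exchange_big.
  by rewrite exchange_big.
rewrite exch'.
transitivity (\sum_(c : idx) \sum_(d : idx) M c d * delta c b * delta d a); last first.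
  apply: eq_bigr => c _; apply: eq_bigr => d _; rewrite -(uO c b) mulr_sumr mulr_suml.
  by apply: eq_bigr => s _; rewrite -(uO d a) mulr_sumr.
rewrite (bigD1 b)//= [X in _ + X]big1 ?addr0; last first.
  move=> c cb; apply: big1 => d _; rewrite /delta (negbTE cb) mulr0 mul0r; by [].
rewrite (bigD1 a)//= big1 ?addr0; first by rewrite /delta !eqxx !mulr1.
by move=> d da; rewrite /delta (negbTE da) mulr0.
Qed.

Definition D i F := E (i, false) (E (i, true) F).

Definition mxx M i j := bil M (u (i, false)) (u (j, false)) + bil M (u (i, true)) (u (j, true)).

Definition mxy M i j := bil M (u (i, false)) (u (j, true)).

Lemma bil_sym M x y : (forall a b, M a b = M b a) -> bil M x y = bil M y x.
Proof.
move=> Ms; rewrite /bil exchange_big; apply: eq_bigr => a _; apply: eq_bigr => b _.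
by rewrite Ms; ring.
Qed.

Lemma sum_idx2 (G : idx -> idx -> form) : \sum_(s : idx) \sum_(t : idx) G s t =
  \sum_i \sum_j (G (i, false) (j, false) + G (i, false) (j, true)
     + G (i, true) (j, false) + G (i, true) (j, true)).
Proof.
have h (H : idx -> form) : \sum_(s : idx) H s = \sum_i (H (i, false) + H (i, true)).
  rewrite (eq_bigr (fun a => H (a.1, a.2))); last by case.
  rewrite -(pair_bigA _ (fun j (c : bool) => H (j, c)))/=; apply: eq_bigr => j _.
  by rewrite big_bool/= addrC.
rewrite h; apply: eq_bigr => i _; rewrite !h -big_split/=; apply: eq_bigr => j _.
by rewrite !addrA.
Qed.

Lemma Q_split M F : (forall a b, M a b = M b a) ->
  Q M F = \sum_i \sum_j mxx M i j *: E (i, false) (E (j, true) F)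
    - \sum_i \sum_j mxy M i j *: (E (i, false) (E (j, false) F) + E (i, true) (E (j, true) F)).
Proof.
move=> Ms; rewrite Q_basis sum_idx2.
transitivity (\sum_i \sum_j ((bil M (u (i, false)) (u (j, false))) *: E (i, false) (E (j, true) F)
    - mxy M i j *: E (i, false) (E (j, false) F)
    + mxy M j i *: E (i, true) (E (j, true) F)
    - bil M (u (i, true)) (u (j, true)) *: E (i, true) (E (j, false) F))).
  apply: eq_bigr => i _; apply: eq_bigr => j _; rewrite /conj_idx/= !expr0 !expr1 !mulr1 !mulrN1.
  by rewrite !scaleNr /mxy (bil_sym (u (j, false)) (u (i, true)) Ms).
have s4 (G1 G2 G3 G4 : 'I_n -> 'I_n -> form) :
    \sum_i \sum_j (G1 i j - G2 i j + G3 i j - G4 i j) =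
    (\sum_i \sum_j G1 i j - \sum_i \sum_j G4 i j) + (- \sum_i \sum_j G2 i j + \sum_i \sum_j G3 i j).
  have s2 (H1 H2 : 'I_n -> 'I_n -> form) : \sum_i \sum_j (H1 i j + H2 i j) =
      \sum_i \sum_j H1 i j + \sum_i \sum_j H2 i j.
    by rewrite -big_split; apply: eq_bigr => i _; rewrite big_split.
  have sN (H1 : 'I_n -> 'I_n -> form) : \sum_i \sum_j - H1 i j = - \sum_i \sum_j H1 i j.
    by rewrite -sumrN; apply: eq_bigr => i _; rewrite sumrN.
  rewrite !s2 !sN -!addrA; congr (_ + _); rewrite addrA addrC.
  by [].
rewrite s4; congr (_ + _).
  rewrite [X in _ - X]exchange_big -sumrN -big_split; apply: eq_bigr => i _.
  rewrite -sumrN -big_split; apply: eq_bigr => j _ /=.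
  rewrite /mxx scalerDl; congr (_ + _).
  by rewrite (bil_sym (u (j, true)) (u (i, true)) Ms) extv_anti scalerN opprK.
rewrite [X in _ + X]exchange_big -!sumrN -big_split; apply: eq_bigr => i _.
rewrite -!sumrN -big_split; apply: eq_bigr => j _ /=.
by rewrite scalerDr opprD; congr (_ + _); rewrite extv_anti scalerN.
Qed.

(** When the hermitian part of M is diagonal in the basis, only products dx_i ∧ dy_i survive: the
    remaining coefficients are symmetric in i and j whereas the 2-forms they multiply are
    antisymmetric. *)
Lemma Q_diag M F : (forall a b, M a b = M b a) ->
  (forall i j, i != j -> mxx M i j = 0) -> (forall i j, mxy M i j = mxy M j i) ->
  Q M F = \sum_i mxx M i i *: D i F.
Proof.
move=> Ms Mxx Mxy; rewrite Q_split// [X in _ - X]sum_sym_anti ?subr0//.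
  apply: eq_bigr => i _; rewrite (bigD1 i)//= big1 ?addr0//.
  by move=> j ji; rewrite Mxx ?scale0r// eq_sym.
by move=> i j; rewrite (extv_anti (u (i, false))) (extv_anti (u (i, true))) opprD.
Qed.

Lemma D_linear i : linear (D i).
Proof. by move=> c F G; rewrite /D (linearP (extv (u (i, true)))) (linearP (extv (u (i, false)))). Qed.

HB.instance Definition _ i := GRing.isLinear.Build R form form _ (D i) (D_linear i).

Lemma E_D s i F : E s (D i F) = D i (E s F).
Proof.
by rewrite /D (extv_anti (u s) (u (i, false))) (extv_anti (u s) (u (i, true))) linearN/= opprK.
Qed.

Lemma D_comm i j F : D i (D j F) = D j (D i F).
Proof. by rewrite {1}/D !E_D. Qed.

Lemma E_D0 i (c : bool) F : E (i, c) (D i F) = 0.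
Proof.
case: c; rewrite /D; first by rewrite extv_anti extv_sq linear0 oppr0.
by rewrite extv_sq.
Qed.

Lemma D_D0 i F : D i (D i F) = 0.
Proof. by rewrite {1}/D E_D0 linear0. Qed.

Definition Dw (s : seq 'I_n) : form := foldr D fone s.

Lemma Dw_rem i (s : seq 'I_n) : i \in s -> Dw s = D i (Dw (rem i s)).
Proof.
elim: s => // j s IH; rewrite inE /=; have [->//|ji] := eqVneq j i.
by move=> /= /IH->; rewrite D_comm.
Qed.

Lemma Dw_perm (s s' : seq 'I_n) : perm_eq s s' -> Dw s = Dw s'.
Proof.
elim: s s' => [|i s IH] s' h; first by have /perm_nilP-> : perm_eq s' [::] by rewrite perm_sym.
have is' : i \in s' by rewrite -(perm_mem h) inE eqxx.
rewrite (Dw_rem is') /=; congr (D i _); apply: IH.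
by rewrite -(perm_cons i); apply: perm_trans h (perm_to_rem is').
Qed.

Lemma Dw_nuniq (s : seq 'I_n) : ~~ uniq s -> Dw s = 0.
Proof.
elim: s => //= i s IH; rewrite negb_and negbK => /orP[/Dw_rem->|/IH->].
  by rewrite D_D0.
by rewrite linear0.
Qed.

(** The volume form of the adapted basis relative to the standard one; it turns out to be 1
    ([tau1]). *)
Definition tau := Dw (enum 'I_n) [set: idx]%SET.

Lemma top_Dw (s : seq 'I_n) : size s = n -> Dw s [set: idx]%SET = if uniq s then tau else 0.
Proof.
move=> sn; case: ifPn => [us|/Dw_nuniq->]; last by rewrite ffunE.
congr (fun_of_fin _ _); apply: Dw_perm; apply: uniq_perm => //; first exact: enum_uniq.
have sub : {subset s <= enum 'I_n} by move=> i _; rewrite mem_enum.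
have sz : (size (enum 'I_n) <= size s)%N by rewrite size_enum_ord sn.
by have [_] := uniq_min_size us sub sz.
Qed.

(** Words index the expansion of the r-th power of a sum of the commuting operators [D i]. A word
    with a repeated letter contributes zero, since each [D i] has square zero. *)
Fixpoint words r : seq (seq 'I_n) :=
  if r is r'.+1 then [seq i :: w | i <- enum 'I_n, w <- words r'] else [:: [::]].

Lemma words_size r (s : seq 'I_n) : s \in words r -> size s = r.
Proof.
elim: r s => [|r IH] s; first by rewrite inE => /eqP->.
by move=> /allpairsP[[i s'] [_ /IH h ->]] /=; rewrite h.
Qed.

Lemma iter_words (mu : 'I_n -> R) (P : form -> form) r :
  (forall F, P F = \sum_i mu i *: D i F) ->
  iter r P fone = \sum_(w <- words r) (\prod_(i <- w) mu i) *: Dw w.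
Proof.
move=> PE; elim: r => [|r IH]; first by rewrite big_seq1 big_nil scale1r.
rewrite iterS IH PE /= big_allpairs_dep big_enum/=; apply: eq_bigr => i _.
rewrite [D i _]linear_sum scaler_sumr; apply: eq_bigr => w _.
by rewrite /= [D i (_ *: _)]linearZ/= scalerA big_cons.
Qed.

End adapted_basis.

End exterior.

(** * Positive forms *)

Section positivity.
Context {R : realType} {n : nat}.
Local Notation idx := ('I_n * bool)%type.
Local Notation form := {ffun {set idx} -> R^o}.
Implicit Types (a b c s t : idx) (S T : {set idx}) (F G : form) (x y : idx -> R)
  (M L : idx -> idx -> R) (i j k : 'I_n) (u : idx -> idx -> R) (w : seq 'I_n).

Definition top F : R := F [set: idx]%SET.

Lemma topD F G : top (F + G) = top F + top G. Proof. by rewrite /top ffunE. Qed.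

Lemma topZ (r : R) F : top (r *: F) = r * top F. Proof. by rewrite /top ffunE. Qed.

Lemma top_sum (J : Type) (r : seq J) (P : pred J) (H : J -> form) :
  top (\sum_(j <- r | P j) H j) = \sum_(j <- r | P j) top (H j).
Proof. by rewrite /top sum_ffunE. Qed.

Record adapted u : Prop := Adapted {
  ad_J : forall i, u (i, true) = Jv (u (i, false));
  ad_O : forall a b, \sum_(s : idx) u s a * u s b = delta a b;
  ad_O' : forall s t, \sum_(a : idx) u s a * u t a = delta s t }.

Lemma adapted_delta : adapted (@delta R n).
Proof.
split.
- move=> i; apply/funext => -[j c]; rewrite /Jv /delta /conj_idx/= !xpair_eqE.
  by case: c => /=; rewrite ?andbT ?andbF ?mul1r ?mulr0.
- move=> a b; rewrite (bigD1 a)//= big1 ?addr0; first by rewrite /delta eqxx mul1r.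
  by move=> s sa; rewrite /delta (negbTE sa) mul0r.
- move=> a b; rewrite (bigD1 a)//= big1 ?addr0.
    by rewrite /delta eqxx mul1r eq_sym.
  by move=> s sa; rewrite /delta eq_sym (negbTE sa) mul0r.
Qed.

Lemma extv_delta s F : extv (delta s) F = ext s F.
Proof.
rewrite /extv (bigD1 s)//= big1 ?addr0; first by rewrite /delta eqxx scale1r.
by move=> a sa; rewrite /delta eq_sym (negbTE sa) scale0r.
Qed.

Definition ind S : form := [ffun T : {set idx} => (T == S)%:R].

Lemma ext_ind a S : a \notin S -> ext a (ind S) = wedge_sign a S *: ind (a |: S)%SET.
Proof.
move=> aS; apply/ffunP => T; rewrite !ffunE -[_ *: _]/(_ * _).
have [->|TS] := eqVneq T (a |: S)%SET.
  by rewrite !inE eqxx/= finset.setU1K// eqxx.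
case: ifP => aT; last by rewrite mulr0.
rewrite (_ : (T :\ a == S)%SET = false) ?mulr0//.
by apply/negP => /eqP TaS; move/eqP: TS; apply; rewrite -TaS finset.setD1K.
Qed.

Lemma D_std i S : (i, false) \notin S -> (i, true) \notin S ->
  D (@delta R n) i (ind S) = ind ((i, false) |: ((i, true) |: S))%SET.
Proof.
move=> fS tS; rewrite /D !extv_delta ext_ind// extZ ext_ind; last first.
  by rewrite !inE xpair_eqE andbF.
rewrite scalerA -[RHS]scale1r; congr (_ *: _).
rewrite /wedge_sign -exprD.
set m := (X in (_ ^+ X)); suff -> : (m = #|[set s in S | (idx_rank s < idx_rank (i, false))%N]%SET|.*2)%N.
  by rewrite -mul2n exprM expr2 mulrNN mulr1 expr1n.
rewrite /m -addnn; congr (_ + _)%N; apply: eq_card => -[j c]; rewrite !inE.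
  case jc : ((j, c) \in S) => /=; last by [].
  rewrite /idx_rank/= addn0 addn1 ltnS leq_eqVlt.
  case: eqVneq => //= e; exfalso.
  have e' : (j, c) = (i, false) by apply: idx_rank_inj; rewrite /idx_rank/= addn0.
  by move: fS; rewrite -e' jc.
rewrite xpair_eqE; case: eqVneq => [->|ji] //=; case: c => //=.
by rewrite /idx_rank/= ltnNge leq_add2l (negbTE tS).
Qed.

Lemma tau_std : tau (@delta R n) = 1.
Proof.
suff H w : uniq w -> Dw (@delta R n) w = ind [set a | a.1 \in w]%SET.
  rewrite /tau H ?enum_uniq// ffunE (_ : _ == _ = true)//; apply/eqP/finset.setP => a.
  by rewrite !inE mem_enum.
elim: w => [_|i w IH] /=.
  by rewrite /fone /ind; congr finfun; apply/funext => T; congr (_ == _)%:R;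
    apply/finset.setP => a; rewrite !inE.
move=> /andP[iw uw]; rewrite IH// D_std ?inE//=.
by congr ind; apply/finset.setP => -[j c]; rewrite !inE !xpair_eqE/=;
  case: eqVneq => //= _; case: c.
Qed.

Lemma mxx_delta u i j : adapted u -> mxx u (@delta R n) i j = 2 * (i == j)%:R.
Proof.
move=> au; have bd x y : bil (@delta R n) x y = \sum_(a : idx) x a * y a.
  rewrite /bil; apply: eq_bigr => a _; rewrite (bigD1 a)//= big1 ?addr0.
    by rewrite /delta eqxx mulr1.
  by move=> b ba; rewrite /delta eq_sym (negbTE ba) mulr0 mul0r.
rewrite /mxx !bd !(ad_O' au) /delta !xpair_eqE !andbT; ring.
Qed.

Lemma mxy_delta u i j : adapted u -> mxy u (@delta R n) i j = 0.
Proof.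
move=> au; have bd x y : bil (@delta R n) x y = \sum_(a : idx) x a * y a.
  rewrite /bil; apply: eq_bigr => a _; rewrite (bigD1 a)//= big1 ?addr0.
    by rewrite /delta eqxx mulr1.
  by move=> b ba; rewrite /delta eq_sym (negbTE ba) mulr0 mul0r.
by rewrite /mxy !bd !(ad_O' au) /delta !xpair_eqE andbF.
Qed.

Lemma delta_sym a b : @delta R n a b = delta b a.
Proof. by rewrite /delta eq_sym. Qed.

Lemma Q_delta u F : adapted u -> Q (@delta R n) F = \sum_i 2 *: D u i F.
Proof.
move=> au; rewrite (Q_diag (ad_J au) (ad_O au)); last 3 first.
- exact: delta_sym.
- by move=> i j ij; rewrite mxx_delta// (negbTE ij) mulr0.
- by move=> i j; rewrite !mxy_delta.
by apply: eq_bigr => i _; rewrite mxx_delta// eqxx mulr1.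
Qed.

Lemma prod_cst (r : R) w : \prod_(i <- w) r = r ^+ size w.
Proof. by elim: w => [|i w IH]; rewrite ?big_nil ?big_cons ?IH ?exprS. Qed.

Lemma enum_words : enum 'I_n \in @words n n.
Proof.
suff H w r : size w = r -> w \in @words n r by apply: H; rewrite size_enum_ord.
elim: w r => [|i w IH] [|r]//= [wr]; apply/allpairsP; exists (i, w) => /=.
by rewrite mem_enum; split => //; exact: IH.
Qed.

Lemma top_words u (mu : 'I_n -> R) :
  top (\sum_(w <- @words n n) (\prod_(i <- w) mu i) *: Dw u w) =
  (\sum_(w <- @words n n | uniq w) \prod_(i <- w) mu i) * tau u.
Proof.
rewrite top_sum mulr_suml [RHS]big_mkcond !big_seq; apply: eq_bigr => w /words_size wn.
by rewrite topZ /top top_Dw//; case: ifP => _; rewrite ?mulr0.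
Qed.

(** The n-th power of the standard Kähler form, computed in the basis u and in the standard basis,
    is [N * tau u] and [N] with the same N > 0. *)
Lemma tau1 u : adapted u -> tau u = 1.
Proof.
move=> au; pose N : R := \sum_(w <- @words n n | uniq w) \prod_(i <- w) 2.
have key v : adapted v -> top (iter n (Q (@delta R n)) (fone : form)) = N * tau v.
  move=> av; rewrite (iter_words (u := v) (mu := fun=> 2)); last by move=> F; exact: Q_delta.
  exact: top_words.
have N0 : 0 < N.
  rewrite /N (big_rem (enum 'I_n)) ?enum_words//= enum_uniq.
  apply: ltr_wpDr; first by apply: sumr_ge0 => w _; rewrite prod_cst exprn_ge0.
  by rewrite prod_cst exprn_gt0.
have := key _ au; rewrite (key _ adapted_delta) tau_std => /(mulfI (lt0r_neq0 N0)) <-.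
by [].
Qed.

(** Positive forms of bidegree (r, r) that are diagonal in the basis u. Multiplication by a positive
    (1,1)-form diagonal in u preserves them ([cone_step]). *)
Definition cone u r F := exists l : seq (R * seq 'I_n),
  (forall p, p \in l -> 0 <= p.1 /\ size p.2 = r) /\ F = \sum_(p <- l) p.1 *: Dw u p.2.

Lemma cone_one u : cone u 0 fone.
Proof.
exists [:: (1, [::])]; split; last by rewrite big_seq1 scale1r.
by move=> p; rewrite inE => /eqP->.
Qed.

Lemma cone_step u r (mu : 'I_n -> R) F : (forall i, 0 <= mu i) -> cone u r F ->
  cone u r.+1 (\sum_i mu i *: D u i F).
Proof.
move=> mu0 [l [lP ->]]; exists [seq (mu i * p.1, i :: p.2) | i <- enum 'I_n, p <- l]; split.
  by move=> q /allpairsP[[i p] [_ /lP[p0 ps] ->]]/=; rewrite ps mulr_ge0.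
rewrite big_allpairs_dep big_enum/=; apply: eq_bigr => i _.
rewrite [D u i _]linear_sum scaler_sumr; apply: eq_bigr => p _.
by rewrite /= [D u i (_ *: _)]linearZ/= scalerA.
Qed.

Lemma cone_iter u r m (mu : 'I_n -> R) P F : (forall i, 0 <= mu i) ->
  (forall F, P F = \sum_i mu i *: D u i F) -> cone u r F -> cone u (m + r) (iter m P F).
Proof.
move=> mu0 PE cF; elim: m => // m IH.
by rewrite addSn iterS PE; exact: cone_step.
Qed.

Lemma E_Dw0 u i (c : bool) w : i \in w -> extv (u (i, c)) (Dw u w) = 0.
Proof. by move=> /Dw_rem->; rewrite E_D0. Qed.

(** A word of n-1 distinct letters misses exactly one index k, so M enters only through its diagonal
    coefficient at k, which is a value of its Levi form. *)
Lemma top_Q_Dw u M w : adapted u -> (forall a b, M a b = M b a) -> (forall x, 0 <= levi M x) ->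
  (size w).+1 = n -> 0 <= top (Q M (Dw u w)).
Proof.
move=> au Ms M0 wn; have [uw|/Dw_nuniq->] := boolP (uniq w); last first.
  by rewrite linear0 /top ffunE.
have cardw : #|[predC w]| = 1%N.
  have := cardC (mem w); rewrite (card_uniqP uw) card_ord -[in RHS]wn -addn1.
  by move/addnI.
have /eqP/card1P[k kP] := cardw.
have kw i : i != k -> i \in w.
  by move=> ik; have := kP i; rewrite !inE (negbTE ik) => /negbFE.
rewrite (Q_split (ad_J au) (ad_O au))// [X in _ - X]big1 ?subr0; last first.
  move=> i _; apply: big1 => j _; have [->|/kw iw] := eqVneq i k; last first.
    have z (c c' : bool) : extv (u (i, c)) (extv (u (j, c')) (Dw u w)) = 0.
      by rewrite extv_anti (E_Dw0 u c iw) linear0 oppr0.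
    by rewrite !z addr0 scaler0.
  have [->|/kw jw] := eqVneq j k; first by rewrite !extv_sq addr0 scaler0.
  by rewrite !(E_Dw0 u _ jw) !linear0 addr0 scaler0.
rewrite (bigD1 k)//= [X in _ + X]big1 ?addr0; last first.
  move=> i /kw iw; apply: big1 => j _.
  by rewrite extv_anti (E_Dw0 u _ iw) linear0 oppr0 scaler0.
rewrite (bigD1 k)//= [X in _ + X]big1 ?addr0; last first.
  by move=> j /kw jw; rewrite (E_Dw0 u _ jw) linear0 scaler0.
rewrite topZ; apply: mulr_ge0.
  by rewrite /mxx (ad_J au); exact: M0.
have -> : extv (u (k, false)) (extv (u (k, true)) (Dw u w)) = Dw u (k :: w) by [].
by rewrite /top top_Dw// ?tau1//; case: ifP.
Qed.

Lemma top_cone u M F : adapted u -> (forall a b, M a b = M b a) ->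
  (forall x, 0 <= levi M x) -> cone u n.-1 F -> (0 < n)%N -> 0 <= top (Q M F).
Proof.
move=> au Ms M0 [l [lP ->]] n0; rewrite linear_sum top_sum big_seq.
apply: sumr_ge0 => p /lP[p0 ps]; rewrite linearZ/= topZ mulr_ge0//.
by apply: top_Q_Dw => //; rewrite ps prednK.
Qed.

(** Every factor β can append to the word a letter not yet used, with coefficient 2, and all other
    contributions are nonnegative. *)
Lemma top_iter_delta u w m : adapted u -> (size w + m)%N = n ->
  (if uniq w then 1 else 0) <= top (iter m (Q (@delta R n)) (Dw u w)).
Proof.
move=> au; elim: m w => [|m IH] w.
  by rewrite addn0 => wn; rewrite /= /top top_Dw// tau1//; case: ifP.
move=> wm; rewrite iterSr (Q_delta _ au).
have itl m' (J : Type) (r : seq J) (H : J -> form) :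
    iter m' (Q (@delta R n)) (\sum_(j <- r) H j) = \sum_(j <- r) iter m' (Q (@delta R n)) (H j).
  by elim: m' => //= m' ->; rewrite linear_sum.
have itz m' (r : R) H : iter m' (Q (@delta R n)) (r *: H) = r *: iter m' (Q (@delta R n)) H.
  by elim: m' => //= m' ->; rewrite linearZ.
rewrite itl top_sum.
have IHi i : (if uniq (i :: w) then 1 else 0) <= top (iter m (Q (@delta R n)) (D u i (Dw u w))).
  by apply: (IH (i :: w)); rewrite addSn -addnS.
have h0 i : 0 <= top (iter m (Q (@delta R n)) (D u i (Dw u w))).
  by apply: le_trans (IHi i); case: ifP.
case: ifP => uw; last by apply: sumr_ge0 => i _; rewrite itz topZ mulr_ge0.
have [i iw] : exists i, i \notin w.
  apply/existsP; rewrite -negb_forall; apply/negP => /forallP aw.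
  have h : (#|'I_n| <= #|w|)%N by apply: subset_leq_card; apply/fintype.subsetP => j _; exact: aw.
  move: h; rewrite card_ord (card_uniqP uw).
  have lt : (size w < n)%N by rewrite -[ltnRHS]wm addnS ltnS leq_addr.
  by rewrite leqNgt lt.
rewrite (bigD1 i)//=; apply: ler_wpDr.
  by apply: sumr_ge0 => j _; rewrite itz topZ mulr_ge0.
rewrite itz topZ; have := IHi i; rewrite /= iw uw/= => h.
by apply: le_trans h _; rewrite ler_peMl// ler1n.
Qed.

Definition bounded_form (B : R) F := forall S, `|F S| <= B.

Lemma ext_bounded B a F : 0 <= B -> bounded_form B F -> bounded_form B (ext a F).
Proof.
move=> B0 FB S; rewrite ffunE; case: ifP => _; last by rewrite normr0.
by rewrite normrM /wedge_sign normrX normrN1 expr1n mul1r.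
Qed.

Lemma extv_bounded B u s F : adapted u -> 0 <= B -> bounded_form B F ->
  bounded_form ((2 * n%:R) * B) (extv (u s) F).
Proof.
move=> au B0 FB S; rewrite /extv sum_ffunE.
apply: le_trans (ler_norm_sum _ _ _) _.
apply: (@le_trans _ _ (\sum_(a : idx) B)).
  apply: ler_sum => a _; rewrite ffunE -[_ *: _]/(_ * _) normrM -[leRHS]mul1r.
  apply: ler_pM => //; last exact: ext_bounded.
  have d1 : delta s s = 1 :> R by rewrite /delta eqxx.
  have := ad_O' au s s; rewrite d1 (bigD1 a)//= -expr2 => h.
  rewrite -sqrtr_sqr -[leRHS]sqrtr1 ler_wsqrtr// -h lerDl.
  by apply: sumr_ge0 => b _; rewrite -expr2 sqr_ge0.
by rewrite sumr_const card_prod card_ord card_bool -[leLHS]mulr_natl natrM [n%:R * _]mulrC.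
Qed.

Lemma Dw_bounded u w : adapted u -> bounded_form ((2 * n%:R) ^+ (2 * size w)) (Dw u w).
Proof.
move=> au; elim: w => [|i w IH].
  by move=> S; rewrite muln0 expr0 ffunE; case: eqP => _; rewrite ?normr1 ?normr0.
rewrite /= mulnS exprD expr2 -mulrA.
have p0 : 0 <= (2 * n%:R : R) by rewrite mulr_ge0.
apply: (extv_bounded _ au); first by apply: mulr_ge0 => //; exact: exprn_ge0.
by apply: (extv_bounded _ au) => //; exact: exprn_ge0.
Qed.

(* trace bound: the coefficients of a positive form are dominated by its trace measure *)
Lemma cone_coef u (k : nat) F S : adapted u -> (k <= n)%N -> cone u k F ->
  `|F S| <= (2 * n%:R) ^+ (2 * k) * top (iter (n - k) (Q (@delta R n)) F).
Proof.
move=> au kn [l [lP FE]].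
have itl m' (J : Type) (r : seq J) (H : J -> form) :
    iter m' (Q (@delta R n)) (\sum_(j <- r) H j) = \sum_(j <- r) iter m' (Q (@delta R n)) (H j).
  by elim: m' => //= m' ->; rewrite linear_sum.
have itz m' (r : R) H : iter m' (Q (@delta R n)) (r *: H) = r *: iter m' (Q (@delta R n)) H.
  by elim: m' => //= m' ->; rewrite linearZ.
rewrite FE itl top_sum mulr_sumr sum_ffunE.
apply: le_trans (ler_norm_sum _ _ _) _; rewrite !big_seq; apply: ler_sum => p /lP[p0 ps].
rewrite ffunE itz topZ -[_ *: _]/(_ * _) normrM (ger0_norm p0) mulrCA ler_wpM2l//.
have wm : (size p.2 + (n - k) = n)%N by rewrite ps subnKC.
have := top_iter_delta au wm; case: ifP => uw h.
  rewrite -[leLHS]mulr1; apply: ler_pM => //.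
  by have := Dw_bounded p.2 au S; rewrite ps.
have c0 : 0 <= (2 * n%:R : R) ^+ (2 * k) by rewrite exprn_ge0// mulr_ge0.
by rewrite {1}(Dw_nuniq u (negbT uw)) ffunE normr0; apply: mulr_ge0 c0 h.
Qed.

(** Each surviving word contains every letter, so the determinant is at most a constant times
    B^(n-1) times any chosen eigenvalue. In [levi_lower] this turns a lower bound on the determinant
    into one on each eigenvalue. *)
Lemma top_diag_le u (mu : 'I_n -> R) (B : R) (P : form -> form) k : adapted u -> (forall i, 0 <= mu i <= B) ->
  (forall F, P F = \sum_i mu i *: D u i F) ->
  top (iter n P fone) <= (size (@words n n))%:R * (B ^+ n.-1 * mu k).
Proof.
move=> au muB PE; rewrite (iter_words n PE) top_words tau1// mulr1 big_mkcond big_seq.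
have B0 : 0 <= B by have /andP[h1 h2] := muB k; exact: le_trans h2.
have mk0 : 0 <= mu k by have /andP[] := muB k.
apply: (@le_trans _ _ (\sum_(w <- @words n n) B ^+ n.-1 * mu k)); last first.
  by rewrite big_const_seq count_predT iter_addr_0 mulr_natl.
rewrite [leRHS]big_seq; apply: ler_sum => w /words_size wn.
case: ifP => uw; last by rewrite mulr_ge0// exprn_ge0.
have kw : k \in w.
  have sub : {subset w <= enum 'I_n} by move=> i _; rewrite mem_enum.
  have sz : (size (enum 'I_n) <= size w)%N by rewrite size_enum_ord wn.
  by have [_ ->] := uniq_min_size uw sub sz; rewrite mem_enum.
rewrite (big_rem k)//= mulrC ler_wpM2r//.
rewrite -[X in B ^+ X](_ : size (rem k w) = n.-1); last by rewrite size_rem// wn.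
elim: (rem k w) => [|i w' IH]; first by rewrite big_nil.
rewrite big_cons exprS; have /andP[h1 h2] := muB i; apply: ler_pM => //.
by apply: prodr_ge0 => j _; have /andP[] := muB j.
Qed.

End positivity.

(** * Diagonalisation of the Levi form *)

Section spectral_basis.
Context {R : realType} {n : nat}.
Local Notation idx := ('I_n * bool)%type.
Local Notation form := {ffun {set idx} -> R^o}.
Local Notation C := (R[i])%C.
Implicit Types (a b s t : idx) (x y : idx -> R) (M L : idx -> idx -> R) (i j k : 'I_n) (c d : 'I_n -> C).

Definition cvec c : idx -> R := fun a => if a.2 then complex.Im (c a.1) else complex.Re (c a.1).

(** The hermitian matrix whose quadratic form is [levi M]: see [herm_Re] with equal arguments. *)
Definition hmx M : 'M[C]_n := \matrix_(j, k)
  ((M (j, false) (k, false) + M (j, true) (k, true)) +i* (M (j, false) (k, true) - M (j, true) (k, false)))%C.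

Lemma Re_sum (J : Type) (r : seq J) (H : J -> C) :
  complex.Re (\sum_(j <- r) H j) = \sum_(j <- r) complex.Re (H j).
Proof. by elim: r => [|j r IH]; rewrite ?big_nil ?big_cons// -IH; case: (H j) (\sum_(_ <- _) _) => [? ?] []. Qed.

Lemma Im_sum (J : Type) (r : seq J) (H : J -> C) :
  complex.Im (\sum_(j <- r) H j) = \sum_(j <- r) complex.Im (H j).
Proof. by elim: r => [|j r IH]; rewrite ?big_nil ?big_cons// -IH; case: (H j) (\sum_(_ <- _) _) => [? ?] []. Qed.

Lemma bil_idx M x y : bil M x y = \sum_j \sum_k
  (x (j, false) * M (j, false) (k, false) * y (k, false) + x (j, false) * M (j, false) (k, true) * y (k, true)
   + (x (j, true) * M (j, true) (k, false) * y (k, false) + x (j, true) * M (j, true) (k, true) * y (k, true))).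
Proof.
rewrite /bil sum_idx; apply: eq_bigr => j _.
by rewrite !sum_idx -!big_split.
Qed.

Lemma herm_Re M c d : complex.Re (\sum_j \sum_k c j * hmx M j k * (d k)^*) =
  bil M (cvec c) (cvec d) + bil M (Jv (cvec c)) (Jv (cvec d)).
Proof.
rewrite !bil_idx Re_sum -big_split; apply: eq_bigr => j _; rewrite Re_sum -big_split.
apply: eq_bigr => k _; rewrite /Jv /cvec /conj_idx/= mxE.
by case: (c j) (d k) => [x y] [p q]; rewrite /=; ring.
Qed.

Lemma herm_Im M c d : complex.Im (\sum_j \sum_k c j * hmx M j k * (d k)^*) =
  bil M (cvec c) (Jv (cvec d)) - bil M (Jv (cvec c)) (cvec d).
Proof.
rewrite !bil_idx Im_sum -sumrB; apply: eq_bigr => j _; rewrite Im_sum -sumrB.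
apply: eq_bigr => k _; rewrite /Jv /cvec /conj_idx/= mxE.
by case: (c j) (d k) => [x y] [p q]; rewrite /=; ring.
Qed.

Lemma adapted_unitary (P : 'M[C]_n) : P \is unitarymx ->
  adapted (fun s => if s.2 then Jv (cvec (P s.1)) else cvec (P s.1)).
Proof.
move=> PU.
have PP : P *m (map_mx Num.conj P^T) = 1%:M by apply/unitarymxP.
have PP' : (map_mx Num.conj P^T) *m P = 1%:M by apply: mulmx1C.
have e1 i j : \sum_k (P i k) * (P j k)^* = (i == j)%:R.
  have := congr1 (fun A : 'M[C]_n => A i j) PP; rewrite !mxE => <-.
  by apply: eq_bigr => k _; rewrite !mxE.
have e2 i j : \sum_k (P k i)^* * P k j = (i == j)%:R.
  have := congr1 (fun A : 'M[C]_n => A i j) PP'; rewrite !mxE => <-.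
  by apply: eq_bigr => k _; rewrite !mxE.
have nR (b : bool) : complex.Re (b%:R : C) = b%:R by case: b.
have nI (b : bool) : complex.Im (b%:R : C) = 0 by case: b.
split.
- by [].
- move=> [j c] [k d]; rewrite sum_idx /=.
  have r := congr1 (@complex.Re R) (e2 j k); have i := congr1 (@complex.Im R) (e2 j k).
  move: r i; rewrite Re_sum Im_sum nR nI /delta xpair_eqE => r i.
  case: c; case: d; rewrite /Jv /cvec /conj_idx/= ?andbT ?andbF;
    [rewrite -r | rewrite -[RHS]oppr0 -[in RHS]i -sumrN | rewrite -[RHS]i | rewrite -r];
    apply: eq_bigr => l _; case: (P l j) (P l k) => [x y] [p q] /=; ring.
- move=> [j c] [k d]; rewrite sum_idx /=.
  have r := congr1 (@complex.Re R) (e1 j k); have i := congr1 (@complex.Im R) (e1 j k).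
  move: r i; rewrite Re_sum Im_sum nR nI /delta xpair_eqE => r i.
  case: c; case: d; rewrite /Jv /cvec /conj_idx/= ?andbT ?andbF;
    [rewrite -r | rewrite -[RHS]oppr0 -[in RHS]i -sumrN | rewrite -[RHS]i | rewrite -r];
    apply: eq_bigr => l _; case: (P j l) (P k l) => [x y] [p q] /=; ring.
Qed.

(** The spectral theorem for [hmx M]: the rows of the diagonalising unitary matrix, read as real
    vectors together with their multiples by i, form the basis. *)
Lemma spectral_basis M : (forall a b, M a b = M b a) -> exists u,
  [/\ adapted u, forall i j, i != j -> mxx u M i j = 0 & forall i j, mxy u M i j = mxy u M j i].
Proof.
move=> Ms; pose H := hmx M.
have Hh : H \is hermsymmx.
  rewrite is_hermitianmxE expr0 scale1r; apply/eqP/matrixP => j k; rewrite !mxE.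
  by congr (_ +i* _)%C; rewrite ?(Ms (k, _)) ?opprB//; congr (_ - _); rewrite Ms.
have /hermitian_normalmx/orthomx_spectralP HE := Hh.
pose P := spectralmx H; pose sp := spectral_diag H.
have PU : P \is unitarymx by apply: spectral_unitarymx.
exists (fun s => if s.2 then Jv (cvec (P s.1)) else cvec (P s.1)).
have au := adapted_unitary PU.
have PP : P *m (map_mx Num.conj P^T) = 1%:M by apply/unitarymxP.
have dg : P *m H *m (map_mx Num.conj P^T) = diag_mx sp.
  by rewrite HE (invmx_unitary PU) -!mulmxA PP mulmx1 !mulmxA PP mul1mx.
have dgE i j : \sum_k \sum_l P i k * H k l * (P j l)^* = sp 0 i *+ (i == j).
  have := congr1 (fun A : 'M[C]_n => A i j) dg; rewrite !mxE => <-.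
  rewrite exchange_big; apply: eq_bigr => k _; rewrite !mxE mulr_suml.
  by apply: eq_bigr => l _; rewrite !mxE.
split => // i j.
  move=> ij; have := herm_Re M (P i) (P j); rewrite dgE (negbTE ij) mulr0n /mxx /= => <-.
  by [].
have [->//|ij] := eqVneq i j.
have := herm_Im M (P i) (P j); rewrite dgE (negbTE ij) mulr0n /mxy /= => /eqP.
by rewrite eq_sym subr_eq0 => /eqP->; apply: bil_sym.
Qed.

Lemma sumr_delta (f : idx -> R) s : \sum_(t : idx) delta s t * f t = f s.
Proof.
rewrite (bigD1 s)//= big1 ?addr0; first by rewrite /delta eqxx mul1r.
by move=> t ts; rewrite /delta eq_sym (negbTE ts) mul0r.
Qed.

Lemma Jv_sum (T : Type) (r : seq T) (al : T -> R) (w : T -> idx -> R) :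
  Jv (fun a => \sum_(p <- r) al p * w p a) = (fun a => \sum_(p <- r) al p * Jv (w p) a).
Proof.
by apply/funext => a; rewrite /Jv mulr_sumr; apply: eq_bigr => p _; rewrite mulrCA.
Qed.

Lemma bil_suml (T : Type) (r : seq T) (al : T -> R) (w : T -> idx -> R) M y :
  bil M (fun a => \sum_(p <- r) al p * w p a) y = \sum_(p <- r) al p * bil M (w p) y.
Proof.
rewrite /bil; transitivity (\sum_(a : idx) \sum_(b : idx) \sum_(p <- r) al p * (w p a * M a b * y b)).
  apply: eq_bigr => a _; apply: eq_bigr => b _; rewrite !mulr_suml.
  by apply: eq_bigr => p _; rewrite !mulrA.
transitivity (\sum_(a : idx) \sum_(p <- r) \sum_(b : idx) al p * (w p a * M a b * y b)).
  by apply: eq_bigr => a _; rewrite exchange_big.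
rewrite exchange_big; apply: eq_bigr => p _; rewrite mulr_sumr; apply: eq_bigr => a _.
by rewrite mulr_sumr.
Qed.

Lemma bil_sumr (T : Type) (r : seq T) (al : T -> R) (w : T -> idx -> R) M x :
  bil M x (fun a => \sum_(p <- r) al p * w p a) = \sum_(p <- r) al p * bil M x (w p).
Proof.
have tr N (y1 y2 : idx -> R) : bil N y1 y2 = bil (fun a b => N b a) y2 y1.
  rewrite /bil exchange_big; apply: eq_bigr => a _; apply: eq_bigr => b _; ring.
by rewrite tr bil_suml; apply: eq_bigr => p _; rewrite -tr.
Qed.

Lemma basis_expand u x : adapted u -> x = (fun a => \sum_(s : idx) (\sum_(b : idx) u s b * x b) * u s a).
Proof.
move=> au; apply/funext => a; transitivity (\sum_(s : idx) \sum_(b : idx) u s a * u s b * x b).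
  rewrite exchange_big -[LHS]sumr_delta; apply: eq_bigr => b _; rewrite -(ad_O au) mulr_suml.
  by [].
by apply: eq_bigr => s _; rewrite mulr_suml; apply: eq_bigr => b _; ring.
Qed.

Lemma levi_diag u M x : adapted u -> (forall a b, M a b = M b a) ->
  (forall i j, i != j -> mxx u M i j = 0) -> (forall i j, mxy u M i j = mxy u M j i) ->
  levi M x = \sum_i mxx u M i i * ((\sum_b u (i, false) b * x b) ^+ 2 + (\sum_b u (i, true) b * x b) ^+ 2).
Proof.
move=> au Ms Mxx Mxy; pose al s := \sum_b u s b * x b.
pose La s t := bil M (u s) (u t) + bil M (Jv (u s)) (Jv (u t)).
have bN (p q : idx -> R) : bil M (fun a => -1 * p a) q = - bil M p q.
  by have := bil_suml [:: tt] (fun=> -1) (fun=> p) M q; rewrite !big_seq1 mulN1r => <-;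
    congr bil; apply/funext => a; rewrite big_seq1.
have bN' (p q : idx -> R) : bil M p (fun a => -1 * q a) = - bil M p q.
  by rewrite (bil_sym _ _ Ms) bN (bil_sym _ _ Ms).
have b1 (p : idx -> R) : (fun a => 1 * p a) = p by apply/funext => a; rewrite mul1r.
have LE i j (c d : bool) : La (i, c) (j, d) = mxx u M i i * (((i, c) == (j, d))%:R).
  rewrite /La !(Jv_u (ad_J au)) /conj_idx xpair_eqE /=.
  have hx : mxx u M i j = mxx u M i i * (i == j)%:R.
    by case: eqVneq => [<-|/Mxx->]; rewrite ?mulr1 ?mulr0.
  have := Mxy i j; rewrite /mxy => hy.
  case: c; case: d; rewrite /= ?expr1 ?expr0 ?bN ?bN' ?b1 ?andbT ?andbF ?mulr0 -?hx /mxx ?opprK //.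
  - by rewrite addrC.
  - by rewrite (bil_sym (u (i, true)) _ Ms) hy subrr.
  - by rewrite (bil_sym (u (i, true)) _ Ms) hy subrr.
have -> : levi M x = \sum_s \sum_t al s * al t * La s t.
  rewrite /levi [in LHS](basis_expand x au) Jv_sum !bil_suml -big_split; apply: eq_bigr => s _.
  rewrite !bil_sumr !mulr_sumr -big_split; apply: eq_bigr => t _.
  by rewrite /La /al /=; ring.
rewrite sum_idx; apply: eq_bigr => i _.
have key (c : bool) : \sum_t al (i, c) * al t * La (i, c) t = mxx u M i i * al (i, c) ^+ 2.
  rewrite (eq_bigr (fun t => delta (i, c) t * (mxx u M i i * (al (i, c) * al t)))); last first.
    by move=> [j d] _; rewrite LE /delta; ring.
  by rewrite sumr_delta expr2.
by rewrite !key mulrDr.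
Qed.

Lemma basis_norm u x : adapted u -> \sum_a x a ^+ 2 =
  \sum_i ((\sum_b u (i, false) b * x b) ^+ 2 + (\sum_b u (i, true) b * x b) ^+ 2).
Proof.
move=> au; rewrite -(sum_idx (fun s => (\sum_b u s b * x b) ^+ 2)).
transitivity (\sum_a \sum_b delta a b * x b * x a).
  by apply: eq_bigr => a _; rewrite -mulr_suml sumr_delta expr2.
transitivity (\sum_(a : idx) \sum_(b : idx) \sum_(s : idx) u s a * x a * (u s b * x b)).
  apply: eq_bigr => a _; apply: eq_bigr => b _; rewrite -(ad_O au) !mulr_suml.
  by apply: eq_bigr => s _; ring.
transitivity (\sum_(a : idx) \sum_(s : idx) u s a * x a * \sum_(b : idx) (u s b * x b)).
  by apply: eq_bigr => a _; rewrite exchange_big; apply: eq_bigr => s _; rewrite mulr_sumr.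
by rewrite exchange_big; apply: eq_bigr => s _; rewrite -mulr_suml expr2.
Qed.

Lemma levi_delta x : levi (@delta R n) x = 2 * \sum_a x a ^+ 2.
Proof.
have bd y : bil (@delta R n) y y = \sum_(a : idx) y a ^+ 2.
  rewrite /bil; apply: eq_bigr => a _; rewrite (eq_bigr (fun b => delta a b * (y a * y b))).
    by rewrite sumr_delta expr2.
  by move=> b _; ring.
rewrite /levi !bd mulr2n mulrDl !mul1r; congr (_ + _).
rewrite (reindex_inj (inv_inj (@conj_idxK n))); apply: eq_bigr => a _.
rewrite /Jv conj_idxK; case: (conj_idx a).2; ring.
Qed.

Lemma levi_bound M B x : (forall a b, `|M a b| <= B) -> `|levi M x| <= 4 * n%:R * B * \sum_a x a ^+ 2.
Proof.
move=> MB.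
have b1 y : `|bil M y y| <= 2 * n%:R * B * \sum_a y a ^+ 2.
  have h a b : `|y a * M a b * y b| <= B * ((y a ^+ 2 + y b ^+ 2) / 2).
    rewrite [_ * M a b]mulrC -mulrA normrM; apply: ler_pM => //.
    rewrite ler_norml; have := sqr_ge0 (y a + y b); have := sqr_ge0 (y a - y b).
    by rewrite !expr2; move: (y a) (y b) => p q; lra.
  apply: le_trans (ler_norm_sum _ _ _) _.
  apply: (@le_trans _ _ (\sum_(a : idx) \sum_(b : idx) B * ((y a ^+ 2 + y b ^+ 2) / 2))).
    apply: ler_sum => a _; apply: le_trans (ler_norm_sum _ _ _) _.
    by apply: ler_sum => b _; exact: h.
  rewrite (eq_bigr (fun a => B / 2 * ((2 * n%:R) * y a ^+ 2 + \sum_b y b ^+ 2))); last first.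
    move=> a _; rewrite -mulr_sumr -mulr_suml big_split/= sumr_const card_prod card_ord card_bool.
    by rewrite -[_ ^+ 2 *+ _]mulr_natl natrM; field.
  rewrite -mulr_sumr big_split/= sumr_const -mulr_sumr card_prod card_ord card_bool.
  by rewrite -[(\sum_(i : idx) _) *+ _]mulr_natl natrM; set S := \sum_a _; rewrite le_eqVlt; apply/orP; left; apply/eqP; field.
rewrite /levi; apply: le_trans (ler_normD _ _) _.
have := levi_delta x; rewrite /levi.
have bd y : bil (@delta R n) y y = \sum_(a : idx) y a ^+ 2.
  rewrite /bil; apply: eq_bigr => a _; rewrite (eq_bigr (fun b => delta a b * (y a * y b))).
    by rewrite sumr_delta expr2.
  by move=> b _; ring.
rewrite !bd => h; apply: le_trans (lerD (b1 x) (b1 (Jv x))) _.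
by rewrite -mulrDr h le_eqVlt; apply/orP; left; apply/eqP; ring.
Qed.

Lemma levi_lin (r : R) M L x : levi (fun a b => r * M a b + L a b) x = r * levi M x + levi L x.
Proof.
have b1 y : bil (fun a b => r * M a b + L a b) y y = r * bil M y y + bil L y y.
  rewrite /bil mulr_sumr -big_split; apply: eq_bigr => a _; rewrite mulr_sumr -big_split.
  by apply: eq_bigr => b _ /=; ring.
by rewrite /levi !b1; ring.
Qed.

Lemma iter_delta_cone u m : adapted u -> cone u m (iter m (Q (@delta R n)) fone).
Proof.
move=> au; rewrite -[X in cone u X](addn0 m); apply: (@cone_iter R n u 0 m (fun=> 2)) => //.
- by move=> F; exact: Q_delta.
- exact: cone_one.
Qed.

Lemma mxx_ge0 u M i : adapted u -> (forall x, 0 <= levi M x) -> 0 <= mxx u M i i.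
Proof. by move=> au M0; rewrite /mxx (ad_J au); exact: M0. Qed.

(** A basis that diagonalises L also diagonalises β, whose expression is the same in every adapted
    basis ([Q_delta]). *)
Lemma iter_cone L (k m : nat) : (forall a b, L a b = L b a) -> (forall x, 0 <= levi L x) ->
  exists2 u, adapted u & cone u (k + m) (iter k (Q L) (iter m (Q (@delta R n)) fone)).
Proof.
move=> Ls L0; have [u [au Lxx Lxy]] := spectral_basis Ls; exists u => //.
apply: (@cone_iter R n u m k (fun i => mxx u L i i)).
- by move=> i; exact: mxx_ge0.
- by move=> F; apply: (Q_diag (ad_J au) (ad_O au)).
- exact: iter_delta_cone.
Qed.

Lemma top_pos M L (k m : nat) : (forall a b, M a b = M b a) -> (forall x, 0 <= levi M x) ->
  (forall a b, L a b = L b a) -> (forall x, 0 <= levi L x) -> (k + m).+1 = n ->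
  0 <= top (Q M (iter k (Q L) (iter m (Q (@delta R n)) fone))).
Proof.
move=> Ms M0 Ls L0 kn; have [u au cu] := iter_cone k m Ls L0.
have e : n.-1 = (k + m)%N by move: kn; case: (n) => // n' [].
apply: (top_cone au) => //; first by rewrite e.
by move: kn; case: (n).
Qed.

Lemma top_pos' L (k m : nat) : (forall a b, L a b = L b a) -> (forall x, 0 <= levi L x) -> (k + m)%N = n ->
  0 <= top (iter k (Q L) (iter m (Q (@delta R n)) fone)).
Proof.
move=> Ls L0 kn; have [u au [l [lP ->]]] := iter_cone k m Ls L0.
rewrite top_sum big_seq; apply: sumr_ge0 => p /lP[p0 ps]; rewrite topZ mulr_ge0//.
rewrite /top top_Dw; last by rewrite ps.
by rewrite tau1//; case: ifP.
Qed.

Lemma form_coef L (k : nat) S : (forall a b, L a b = L b a) -> (forall x, 0 <= levi L x) -> (k <= n)%N ->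
  `|(iter k (Q L) fone : form) S| <= (2 * n%:R) ^+ (2 * k) * top (iter (n - k) (Q (@delta R n)) (iter k (Q L) fone)).
Proof.
move=> Ls L0 kn; have [u au] := iter_cone k 0 Ls L0; rewrite addn0 => cu.
exact: (cone_coef S au).
Qed.

(** The eigenvalues of L are at most 4nB by [levi_bound]; a determinant at least m then bounds each
    of them from below. *)
Lemma levi_lower (B m : R) : 0 <= B -> 0 < m -> exists2 c, 0 < c & forall L,
  (forall a b, L a b = L b a) -> (forall x, 0 <= levi L x) -> (forall a b, `|L a b| <= B) ->
  m <= top (iter n (Q L) (fone : form)) -> forall x, c * (\sum_a x a ^+ 2) <= levi L x.
Proof.
move=> B0 m0; pose K := (size (@words n n))%:R * (4 * n%:R * B) ^+ n.-1.
have K0 : 0 <= K by rewrite mulr_ge0// exprn_ge0// !mulr_ge0.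
have K1 : 0 < K + 1 by lra.
exists (m / (K + 1)); first by rewrite divr_gt0.
move=> L Ls L0 LB mt x; have [u [au Lxx Lxy]] := spectral_basis Ls.
rewrite (levi_diag x au Ls Lxx Lxy) (basis_norm x au) mulr_sumr; apply: ler_sum => i _.
apply: ler_wpM2r; first by rewrite addr_ge0// sqr_ge0.
rewrite ler_pdivrMr//.
have muB j : 0 <= mxx u L j j <= 4 * n%:R * B.
  rewrite mxx_ge0//=.
  have -> : mxx u L j j = levi L (u (j, false)) by rewrite /mxx (ad_J au).
  apply: le_trans (ler_norm _) _; apply: le_trans (levi_bound _ LB) _.
  rewrite (_ : \sum_a _ = 1) ?mulr1//.
  have d1 : delta (j, false) (j, false) = 1 :> R by rewrite /delta eqxx.
  by rewrite -d1 -(ad_O' au); apply: eq_bigr => a _; rewrite expr2.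
have := top_diag_le i au muB (fun F => Q_diag (ad_J au) (ad_O au) F Ls Lxx Lxy).
rewrite mulrA => h; apply: le_trans mt (le_trans h _).
have /andP[mi _] := muB i; rewrite mulrC ler_wpM2l// /K; lra.
Qed.

End spectral_basis.

(** * Closed forms and integration by parts *)

Section forms.
Context {R : realType} {n : nat}.
Local Notation V := (Cspace R n).
Local Notation idx := ('I_n * bool)%type.
Local Notation form := {ffun {set idx} -> R^o}.
Local Notation I := (@Cintegral R n).
Implicit Types (a b c : idx) (S : {set idx}) (F : form) (f g phi : V -> R) (A : V -> form)
  (M : idx -> idx -> R) (z : V).

Definition hs f z : idx -> idx -> R := fun b a => pderiv b (pderiv a f) z.

Lemma hs_sym f z : Ck 2 f -> forall a b, hs f z a b = hs f z b a.
Proof. by move=> fC a b; rewrite /hs schwarz. Qed.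

Lemma ext_closed (T : Type) (P : (T -> R) -> Prop) (A : T -> form) a S :
  (forall c : R, P (fun=> c)) -> (forall f g : T -> R, P f -> P g -> P (fun t => f t * g t)) ->
  (forall S, P (fun t => A t S)) -> P (fun t => ext a (A t) S).
Proof.
move=> Pc PM PA; rewrite (_ : (fun t => _) = fun t => (if a \in S then wedge_sign a (S :\ a)%SET else 0) * A t (S :\ a)%SET).
  by apply: PM.
by apply/funext => t; rewrite ffunE; case: ifP => _; rewrite ?mul0r.
Qed.

Lemma Q_coords M F S : Q M F S =
  \sum_(a : idx) \sum_(b : idx) ((-1) ^+ a.2 * M b a) * ext b (ext (conj_idx a) F) S.
Proof.
rewrite /Q sum_ffunE; apply: eq_bigr => a _; rewrite sum_ffunE; apply: eq_bigr => b _.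
by rewrite ffunE.
Qed.

(** The coefficients of [Q] are polynomial in those of M and A, so they belong to any class of
    functions that contains the constants and is stable under sums and products. The classes used
    are C^k functions and functions continuous at a point. *)
Lemma Q_closed (T : Type) (P : (T -> R) -> Prop) (M : T -> idx -> idx -> R) (A : T -> form) S :
  (forall c : R, P (fun=> c)) -> (forall f g : T -> R, P f -> P g -> P (fun t => f t + g t)) ->
  (forall f g : T -> R, P f -> P g -> P (fun t => f t * g t)) ->
  (forall a b, P (fun t => M t a b)) -> (forall S, P (fun t => A t S)) ->
  P (fun t => Q (M t) (A t) S).
Proof.
move=> Pc PD PM PMM PA.
rewrite (_ : (fun t => _) = fun t => \sum_(a : idx) \sum_(b : idx)
    ((-1) ^+ a.2 * M t b a) * ext b (ext (conj_idx a) (A t)) S); last first.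
  by apply/funext => t; exact: Q_coords.
have Ps (J : Type) (r : seq J) (H : J -> T -> R) : (forall j, P (H j)) -> P (fun t => \sum_(j <- r) H j t).
  move=> PH; elim: r => [|j r IH].
    by have -> : (fun t => \sum_(j <- [::]) H j t) = fun=> 0 by apply/funext => t; rewrite big_nil.
  have -> : (fun t => \sum_(k <- j :: r) H k t) = fun t => H j t + \sum_(k <- r) H k t.
    by apply/funext => t; rewrite big_cons.
  by apply: PD => //; exact: PH.
apply: (Ps) => a; apply: (Ps) => b; apply: (PM); first by apply: (PM).
by apply: ext_closed => // S'; apply: ext_closed.
Qed.

Lemma iter_Q_closed (T : Type) (P : (T -> R) -> Prop) (M : T -> idx -> idx -> R) F (k : nat) S :
  (forall c : R, P (fun=> c)) -> (forall f g : T -> R, P f -> P g -> P (fun t => f t + g t)) ->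
  (forall f g : T -> R, P f -> P g -> P (fun t => f t * g t)) ->
  (forall a b, P (fun t => M t a b)) -> P (fun t => iter k (Q (M t)) F S).
Proof.
move=> Pc PD PM PMM; elim: k S => [|k IH] S; first exact: Pc.
exact: (@Q_closed T P M (fun t => iter k (Q (M t)) F)).
Qed.

Definition CkF k A := forall S, Ck k (fun z => A z S).

Lemma CkF_Q k (M : V -> idx -> idx -> R) A : (forall a b, Ck k (fun z => M z a b)) -> CkF k A ->
  CkF k (fun z => Q (M z) (A z)).
Proof.
move=> MC AC S; apply: Q_closed => //; [exact: Ck_cst|exact: CkD|exact: CkM].
Qed.

Lemma CkF_ext k a A : CkF k A -> CkF k (fun z => ext a (A z)).
Proof. by move=> AC S; apply: ext_closed => //; [exact: Ck_cst|exact: CkM]. Qed.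

Lemma Ck_hs k f a b : Ck k.+2 f -> Ck k (fun z => hs f z a b).
Proof. by move=> fC; do 2!apply: Ck_pderiv. Qed.

Definition dform c A z : form := [ffun S => pderiv c (fun y => A y S) z].

Lemma pderiv_ext c a A S z : CkF 1 A ->
  pderiv c (fun y => ext a (A y) S) z = ext a (dform c A z) S.
Proof.
move=> AC; rewrite ffunE; have [aS|aS] := boolP (a \in S).
  rewrite ffunE -(pderivMl _ _ _ (AC _)); congr (pderiv _ _ _); apply/funext => y.
  by rewrite ffunE aS.
rewrite -(pderiv_cst c 0 z); congr (pderiv _ _ _); apply/funext => y.
by rewrite ffunE (negbTE aS).
Qed.

Lemma dform_ext c a A z : CkF 1 A -> dform c (fun y => ext a (A y)) z = ext a (dform c A z).
Proof. by move=> AC; apply/ffunP => S; rewrite ffunE; exact: pderiv_ext. Qed.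

(** Closed for both d and d^c: moving dd^c from one factor to the other takes two integrations by
    parts, and each of them uses one of the two conditions. *)
Record dclosed A : Prop := Closed {
  cl_C : CkF 1 A;
  cl_d : forall z, \sum_c ext c (dform c A z) = 0;
  cl_dc : forall z, \sum_(c : idx) (-1) ^+ c.2 *: ext (conj_idx c) (dform c A z) = 0 }.

Lemma closed_cst F : dclosed (fun=> F).
Proof.
have d0 c z : dform c (fun=> F) z = 0 by apply/ffunP => S; rewrite !ffunE pderiv_cst.
split.
- by move=> S; exact: Ck_cst.
- by move=> z; apply: big1 => c _; rewrite d0 linear0.
- by move=> z; apply: big1 => c _; rewrite d0 linear0 scaler0.
Qed.

Lemma dform_Q c g A z : Ck 3 g -> CkF 1 A -> dform c (fun y => Q (hs g y) (A y)) z =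
  Q (fun b a => pderiv c (pderiv b (pderiv a g)) z) (A z) + Q (hs g z) (dform c A z).
Proof.
move=> gC AC; apply/ffunP => S; rewrite ffunE [in RHS]ffunE !Q_coords.
have gC' a b : Ck 1 (fun y => hs g y b a) by apply: Ck_hs.
have EC a b : Ck 1 (fun y => ext b (ext (conj_idx a) (A y)) S) by apply: CkF_ext; apply: CkF_ext.
have tC a b : Ck 1 (fun y => (-1) ^+ a.2 * hs g y b a * ext b (ext (conj_idx a) (A y)) S).
  by apply: CkM => //; apply: CkMl.
transitivity (pderiv c (fun y => \sum_(a : idx) \sum_(b : idx)
    (-1) ^+ a.2 * hs g y b a * ext b (ext (conj_idx a) (A y)) S) z).
  by congr (pderiv _ _ _); apply/funext => y; exact: Q_coords.
rewrite (@pderiv_sum _ _ 0); last by move=> a; apply: Ck_sum.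
rewrite -big_split; apply: eq_bigr => a _; rewrite (@pderiv_sum _ _ 0)//.
rewrite -big_split; apply: eq_bigr => b _ /=.
rewrite (@pderivM _ _ 0)//; last by apply: CkMl.
rewrite (@pderivMl _ _ 0)// pderiv_ext; last by apply: CkF_ext.
by rewrite dform_ext.
Qed.

(** Third derivatives of g are symmetric while the exterior product is antisymmetric, so the
    derivatives falling on g cancel; those falling on A vanish because A is closed. *)
Lemma closed_Q g A : Ck 3 g -> dclosed A -> dclosed (fun z => Q (hs g z) (A z)).
Proof.
move=> gC [AC Ad Adc].
have gs z a b c : pderiv a (pderiv b (pderiv c g)) z = pderiv b (pderiv a (pderiv c g)) z.
  by apply: schwarz; exact: Ck_pderiv.
have gs' z a b c : pderiv a (pderiv b (pderiv c g)) z = pderiv a (pderiv c (pderiv b g)) z.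
  have -> // : pderiv b (pderiv c g) = pderiv c (pderiv b g).
  by apply/funext => y; apply: schwarz; exact: (CkW (isT : (2 <= 3)%N) gC).
have zero2 (m : idx -> idx -> R) (X : idx -> idx -> form) : (forall a b, m a b = m b a) ->
    (forall a b, X a b = - X b a) -> \sum_a \sum_b m a b *: X a b = 0.
  exact: sum_sym_anti.
split.
- by apply: CkF_Q => // a b; exact: Ck_hs.
- move=> z; under eq_bigr do rewrite dform_Q// linearD/=; rewrite big_split/=.
  rewrite [X in _ + X](_ : _ = 0) ?addr0; last first.
    by under eq_bigr do rewrite -Q_ext; rewrite -linear_sum Ad linear0.
  transitivity (\sum_c \sum_(a : idx) \sum_b ((-1) ^+ a.2 * pderiv c (pderiv b (pderiv a g)) z) *:
      ext c (ext b (ext (conj_idx a) (A z)))).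
    apply: eq_bigr => c _; rewrite /Q linear_sum; apply: eq_bigr => a _.
    by rewrite linear_sum; apply: eq_bigr => b _; rewrite linearZ.
  rewrite exchange_big; apply: big1 => a _; apply: zero2 => [b c|b c]; last exact: ext_anti.
  by rewrite gs.
- move=> z; under eq_bigr do rewrite dform_Q// linearD/= scalerDr; rewrite big_split/=.
  rewrite [X in _ + X](_ : _ = 0) ?addr0; last first.
    transitivity (Q (hs g z) (\sum_(c : idx) (-1) ^+ c.2 *: ext (conj_idx c) (dform c A z))).
      by rewrite linear_sum; apply: eq_bigr => c _; rewrite linearZ/= Q_ext.
    by rewrite Adc linear0.
  transitivity (\sum_b \sum_(c : idx) \sum_(a : idx) (pderiv c (pderiv b (pderiv a g)) z) *:
      (((-1) ^+ c.2 * (-1) ^+ a.2) *: ext (conj_idx c) (ext b (ext (conj_idx a) (A z))))).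
    rewrite exchange_big; apply: eq_bigr => c _; rewrite exchange_big /Q linear_sum scaler_sumr; apply: eq_bigr => a _.
    rewrite linear_sum scaler_sumr; apply: eq_bigr => b _.
    by rewrite linearZ/= !scalerA; congr (_ *: _); rewrite [in RHS]mulrC mulrA.
  apply: big1 => b _; apply: zero2 => [a c|a c].
    by rewrite gs gs' gs.
  rewrite -scalerN; congr (_ *: _); first by rewrite mulrC.
  rewrite (ext_anti (conj_idx c) b) (ext_anti (conj_idx a) b) opprK.
  by rewrite (ext_anti (conj_idx a) (conj_idx c)) [ext b (- _)]linearN opprK.
Qed.

Lemma closed_iter g F (k : nat) : Ck 3 g -> dclosed (fun z => iter k (Q (hs g z)) F).
Proof.
move=> gC; elim: k => [|k IH]; first exact: closed_cst.
exact: (closed_Q gC IH).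
Qed.

(** The integral of φ dd^c g ∧ A is minus that of dφ ∧ d^c g ∧ A, the derivatives of A cancelling by
    d-closedness. *)
Lemma ibp1 g phi A S : Ck 2 g -> Ck 1 phi -> Cc phi -> dclosed A ->
  I (fun z => phi z * Q (hs g z) (A z) S) =
  - I (fun z => Q (fun b a => pderiv b phi z * pderiv a g z) (A z) S).
Proof.
move=> gC phiC phic [AC Ad Adc].
pose E a b z := (-1) ^+ a.2 * ext b (ext (conj_idx a) (A z)) S.
have EC a b : Ck 1 (E a b) by apply: CkMl; apply: CkF_ext; apply: CkF_ext.
pose E' a b z := (-1) ^+ a.2 * ext b (ext (conj_idx a) (dform b A z)) S.
have dE a b z : pderiv b (E a b) z = E' a b z.
  rewrite (@pderivMl _ _ 0); last by apply: CkF_ext; apply: CkF_ext.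
  rewrite pderiv_ext; last by apply: CkF_ext.
  by rewrite dform_ext.
have E'0 a z : \sum_b E' a b z = 0.
  rewrite -mulr_sumr [X in _ * X](_ : _ = (\sum_b ext b (ext (conj_idx a) (dform b A z))) S).
    rewrite [X in fun_of_fin X S](_ : _ = 0) ?ffunE ?mulr0//.
    under eq_bigr do rewrite ext_anti.
    by rewrite sumrN -linear_sum Ad linear0 oppr0.
  by rewrite sum_ffunE.
have gC1 a : Ck 1 (pderiv a g) by apply: Ck_pderiv.
have c1 a b : Cc (fun z => phi z * E a b z).
  by apply: CcMc => //; apply: Ck_cont (EC a b).
have c2 a b : Cc (fun z => pderiv b phi z * E a b z * pderiv a g z).
  apply: CcMc; last exact: Ck_cont (gC1 a).
  by apply: CcMc; [case: (Cc_pderiv b phiC phic)|exact: Ck_cont (EC a b)].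
have c3 a b : Cc (fun z => phi z * pderiv a g z * E' a b z).
  apply: CcMc; first by apply: CcMc => //; exact: Ck_cont (gC1 a).
  have -> : E' a b = pderiv b (E a b) by apply/funext => z; rewrite dE.
  by apply: (@Ck_cont _ _ 0); apply: Ck_pderiv.
have c4 a b : Cc (fun z => phi z * E a b z * pderiv b (pderiv a g) z).
  by apply: CcMc => //; apply: (@Ck_cont _ _ 0); do 2!apply: Ck_pderiv.
transitivity (\sum_a \sum_b I (fun z => phi z * E a b z * pderiv b (pderiv a g) z)).
  transitivity (I (fun z => \sum_a \sum_b phi z * E a b z * pderiv b (pderiv a g) z)).
    congr I; apply/funext => z; rewrite Q_coords mulr_sumr; apply: eq_bigr => a _.
    by rewrite mulr_sumr; apply: eq_bigr => b _; rewrite /E /hs; ring.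
  rewrite I_sum; last by move=> a; apply: Cc_sum.
  by apply: eq_bigr => a _; rewrite I_sum.
have step a b : I (fun z => phi z * E a b z * pderiv b (pderiv a g) z) =
    - I (fun z => pderiv b phi z * E a b z * pderiv a g z) - I (fun z => phi z * pderiv a g z * E' a b z).
  apply: oppr_inj; rewrite -(I_parts b (f := fun z => phi z * E a b z) (g := pderiv a g))//; last by apply: CkM.
  rewrite opprD !opprK -I_D//; congr I; apply/funext => z.
  by rewrite (@pderivM _ _ 0)// dE; ring.
under eq_bigr do under eq_bigr do rewrite step.
transitivity (- (\sum_a \sum_b I (fun z => pderiv b phi z * E a b z * pderiv a g z))
   - \sum_a I (fun z => \sum_b phi z * pderiv a g z * E' a b z)).
  rewrite -!sumrN -big_split; apply: eq_bigr => a _; rewrite I_sum//= -!sumrN -big_split.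
  by [].
rewrite [X in _ - X]big1 ?subr0; last first.
  move=> a _; rewrite -[RHS](I_0 (R := R) (n := n)); congr I; apply/funext => z.
  by rewrite -mulr_sumr E'0 mulr0.
congr (- _); transitivity (I (fun z => \sum_a \sum_b pderiv b phi z * E a b z * pderiv a g z)).
  rewrite I_sum; last by move=> a; apply: Cc_sum.
  by apply: eq_bigr => a _; rewrite I_sum.
congr I; apply/funext => z; rewrite Q_coords; apply: eq_bigr => a _.
by apply: eq_bigr => b _; rewrite /E; ring.
Qed.

(** Symmetry of dd^c: a second integration by parts, this time using d^c-closedness, brings the left
    side to the expression in [ibp1]. *)
Lemma ibp2 g phi A S : Ck 2 g -> Ck 2 phi -> Cc phi -> dclosed A ->
  I (fun z => g z * Q (hs phi z) (A z) S) = I (fun z => phi z * Q (hs g z) (A z) S).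
Proof.
move=> gC phiC phic cA; rewrite [RHS](ibp1 S gC (CkW (isT : (1 <= 2)%N) phiC) phic cA).
case: cA => AC Ad Adc.
pose E a b z := (-1) ^+ a.2 * ext b (ext (conj_idx a) (A z)) S.
have EC a b : Ck 1 (E a b) by apply: CkMl; apply: CkF_ext; apply: CkF_ext.
pose E' a b z := (-1) ^+ a.2 * ext b (ext (conj_idx a) (dform a A z)) S.
have dE a b z : pderiv a (E a b) z = E' a b z.
  rewrite (@pderivMl _ _ 0); last by apply: CkF_ext; apply: CkF_ext.
  rewrite pderiv_ext; last by apply: CkF_ext.
  by rewrite dform_ext.
have E'0 b z : \sum_a E' a b z = 0.
  transitivity ((ext b (\sum_(a : idx) (-1) ^+ a.2 *: ext (conj_idx a) (dform a A z))) S).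
    rewrite linear_sum sum_ffunE; apply: eq_bigr => a _.
    by rewrite linearZ/= [in RHS]ffunE.
  by rewrite Adc linear0 ffunE.
have gC1 : Ck 1 g by exact: (CkW (isT : (1 <= 2)%N) gC).
have pC1 b : Ck 1 (pderiv b phi) by apply: Ck_pderiv.
have pc1 b : Cc (pderiv b phi) by case: (Cc_pderiv b (CkW (isT : (1 <= 2)%N) phiC) phic).
have gEC a b : Ck 1 (fun z => g z * E a b z) by apply: CkM.
have c2 a b : Cc (fun z => pderiv b phi z * E a b z * pderiv a g z).
  apply: CcMc; last by apply: (@Ck_cont _ _ 0); apply: Ck_pderiv.
  by apply: CcMc => //; exact: Ck_cont (EC a b).
have c3 a b : Cc (fun z => pderiv b phi z * g z * E' a b z).
  apply: CcMc; first by apply: CcMc => //; exact: Ck_cont gC1.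
  have -> : E' a b = pderiv a (E a b) by apply/funext => z; rewrite dE.
  by apply: (@Ck_cont _ _ 0); apply: Ck_pderiv.
have c4 a b : Cc (fun z => pderiv a (pderiv b phi) z * (g z * E a b z)).
  apply: CcMc; last exact: Ck_cont (gEC a b).
  by case: (Cc_pderiv a (pC1 b) (pc1 b)).
transitivity (\sum_a \sum_b I (fun z => pderiv a (pderiv b phi) z * (g z * E a b z))).
  transitivity (I (fun z => \sum_a \sum_b pderiv a (pderiv b phi) z * (g z * E a b z))).
    congr I; apply/funext => z; rewrite Q_coords mulr_sumr; apply: eq_bigr => a _.
    by rewrite mulr_sumr; apply: eq_bigr => b _; rewrite /E (hs_sym _ phiC) /hs; ring.
  rewrite I_sum; last by move=> a; apply: Cc_sum.
  by apply: eq_bigr => a _; rewrite I_sum.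
have step a b : I (fun z => pderiv a (pderiv b phi) z * (g z * E a b z)) =
    - I (fun z => pderiv b phi z * E a b z * pderiv a g z) - I (fun z => pderiv b phi z * g z * E' a b z).
  rewrite (@I_parts R n a (pderiv b phi) (fun z => g z * E a b z))// -opprD -I_D//; congr (- I _); apply/funext => z.
  by rewrite (@pderivM _ _ 0)// dE; ring.
under eq_bigr do under eq_bigr do rewrite step.
transitivity (- (\sum_a \sum_b I (fun z => pderiv b phi z * E a b z * pderiv a g z))
   - \sum_b I (fun z => \sum_a pderiv b phi z * g z * E' a b z)).
  rewrite exchange_big [X in _ = - X - _]exchange_big -!sumrN -big_split; apply: eq_bigr => b _.
  by rewrite I_sum//= -!sumrN -big_split.
rewrite [X in _ - X]big1 ?subr0; last first.
  move=> b _; rewrite -[RHS](I_0 (R := R) (n := n)); congr I; apply/funext => z.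
  by rewrite -mulr_sumr E'0 mulr0.
congr (- _); transitivity (I (fun z => \sum_a \sum_b pderiv b phi z * E a b z * pderiv a g z)).
  rewrite I_sum; last by move=> a; apply: Cc_sum.
  by apply: eq_bigr => a _; rewrite I_sum.
congr I; apply/funext => z; rewrite Q_coords; apply: eq_bigr => a _.
by apply: eq_bigr => b _; rewrite /E; ring.
Qed.

End forms.

Opaque Ck pderiv.

(** * Hessians of powers, and local bounds for the mass of (dd^c f)^k *)

Section hessian.
Context {R : realType} {n : nat}.
Local Notation V := (Cspace R n).
Local Notation idx := ('I_n * bool)%type.
Local Notation form := {ffun {set idx} -> R^o}.
Local Notation I := (@Cintegral R n).
Implicit Types (a b c : idx) (S : {set idx}) (F : form) (f g phi : V -> R) (A : V -> form)
  (M L : idx -> idx -> R) (z : V) (k m : nat) (D : set V).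

Lemma hs_lin (r : R) f g z : Ck 2 f -> Ck 2 g ->
  hs (fun z => r * f z + g z) z = (fun b a => r * hs f z b a + hs g z b a).
Proof.
move=> fC gC; apply/funext => b; apply/funext => a; rewrite /hs.
have -> : pderiv a (fun z => r * f z + g z) = (fun z => r * pderiv a f z + pderiv a g z).
  apply/funext => y; rewrite (@pderivD _ _ 1 a _ _ y (CkMl r fC) gC).
  by rewrite (@pderivMl _ _ 1 a r _ y fC).
have h1 : Ck 1 (pderiv a f) by exact: Ck_pderiv.
have h2 : Ck 1 (pderiv a g) by exact: Ck_pderiv.
rewrite (@pderivD _ _ 0 b _ _ z (CkMl r h1) h2).
by rewrite (@pderivMl _ _ 0 b r _ z h1).
Qed.

Lemma hsM f g z a b : Ck 2 f -> Ck 2 g -> hs (fun z => f z * g z) z b a =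
  hs f z b a * g z + (pderiv a f z * pderiv b g z + pderiv b f z * pderiv a g z) + f z * hs g z b a.
Proof.
move=> fC gC; rewrite /hs.
have f1 : Ck 1 f := CkW (isT : (1 <= 2)%N) fC; have g1 : Ck 1 g := CkW (isT : (1 <= 2)%N) gC.
have h1 : Ck 1 (pderiv a f) by exact: Ck_pderiv.
have h2 : Ck 1 (pderiv a g) by exact: Ck_pderiv.
have -> : pderiv a (fun z => f z * g z) = (fun z => pderiv a f z * g z + f z * pderiv a g z).
  by apply/funext => y; rewrite (@pderivM _ _ 1 a _ _ y fC gC).
rewrite (@pderivD _ _ 0 b _ _ z (CkM h1 g1) (CkM f1 h2)).
rewrite (@pderivM _ _ 0 b _ _ z h1 g1) (@pderivM _ _ 0 b _ _ z f1 h2).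
have alg (x1 x2 x3 x4 : R) : x1 + x2 + (x3 + x4) = x1 + (x2 + x3) + x4 by ring.
exact: alg.
Qed.

Definition Pw (r : R) f : V -> R := fun z => (- f z) `^ r.

Lemma Pw_gt0 (r : R) f z : f z < 0 -> 0 < Pw r f z.
Proof. by move=> f0; rewrite powR_gt0// oppr_gt0. Qed.

Lemma PwB1 (r : R) f z : f z < 0 -> Pw (r - 1) f z = Pw r f z / - f z.
Proof.
move=> f0; have f0' : 0 < - f z by rewrite oppr_gt0.
have e : - f z != 0 by rewrite gt_eqF.
have i : (r == 1) ==> (- f z != 0) by rewrite e implybT.
by rewrite /Pw (powRB i) powRr1// ltW.
Qed.

Lemma Ck_Pw k (r : R) f : (forall z, f z < 0) -> Ck k f -> Ck k (Pw r f).
Proof.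
move=> f0 fC; apply: (@Ck_powR _ _ k r (fun z => - f z)) => [z|]; first by rewrite oppr_gt0.
exact: CkN.
Qed.

Lemma pderiv_Pw (r : R) f a z : (forall z, f z < 0) -> Ck 1 f ->
  pderiv a (Pw r f) z = - r * Pw (r - 1) f z * pderiv a f z.
Proof.
move=> f0 fC; have f0' : 0 < - f z by rewrite oppr_gt0.
have -> : Pw r f = (fun z => (fun x => (- x) `^ r) (f z)) by [].
rewrite (@pderiv_comp _ _ 0 a (fun x => (- x) `^ r) (fun x => - r * (- x) `^ (r - 1)))//.
apply: dv_eq; first apply: (@dv_comp _ (fun x => x `^ r) (fun x => - x)).
- by apply: (is_derive1_powR r f0').
- by apply: dvN; exact: dv_id.
- by rewrite mulrN1 mulNr.
Qed.

Lemma hs_Pw (r : R) f z : (forall z, f z < 0) -> Ck 2 f ->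
  hs (Pw r f) z = (fun b a => r * (r - 1) * Pw (r - 1 - 1) f z * (pderiv b f z * pderiv a f z)
    - r * Pw (r - 1) f z * hs f z b a).
Proof.
move=> f0 fC; apply/funext => b; apply/funext => a; rewrite /hs.
have f1 : Ck 1 f := CkW (isT : (1 <= 2)%N) fC.
have h1 : Ck 1 (pderiv a f) by exact: Ck_pderiv.
have -> : pderiv a (Pw r f) = (fun z => - r * Pw (r - 1) f z * pderiv a f z).
  by apply/funext => y; exact: pderiv_Pw.
have h2 : Ck 1 (Pw (r - 1) f) by exact: Ck_Pw.
rewrite (@pderivM _ _ 0 b _ _ z (CkMl (- r) h2) h1) (@pderivMl _ _ 0 b _ _ z h2) (pderiv_Pw _ _ _ f0 f1).
have alg (P2 P1 x y h : R) : - r * (- (r - 1) * P2 * x) * y + - r * P1 * h = r * (r - 1) * P2 * (x * y) - r * P1 * h by ring.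
exact: alg.
Qed.

Definition psh2 D f := forall z, D z -> forall x, 0 <= levi (hs f z) x.

(** The form (dd^c f)^k ∧ β^m, with β = dd^c(|z|^2/2). *)
Definition Xf k m f z : form := iter k (Q (hs f z)) (iter m (Q (@delta R n)) fone).

Lemma iter_Q_comm L M k F : Q L (iter k (Q M) F) = iter k (Q M) (Q L F).
Proof. by elim: k => //= k IH; rewrite Q_comm IH. Qed.

Lemma Q_delta_Xf k m f z : Q (@delta R n) (Xf k m f z) = Xf k m.+1 f z.
Proof. by rewrite /Xf iter_Q_comm. Qed.

Lemma Q_Xf k m f z : Q (hs f z) (Xf k m f z) = Xf k.+1 m f z.
Proof. by []. Qed.

Lemma Xf_closed k m f : Ck 3 f -> dclosed (Xf k m f).
Proof. exact: closed_iter. Qed.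

Lemma Xf_C k m f S : Ck 2 f -> continuous (fun z => Xf k m f z S).
Proof.
move=> fC; apply: (@Ck_cont _ _ 0); apply: iter_Q_closed => [c|f1 g1|f1 g1|a b].
- exact: Ck_cst.
- exact: CkD.
- exact: CkM.
- exact: Ck_hs.
Qed.

Lemma Xf_ge0 D k m f z : Ck 2 f -> psh2 D f -> D z -> (k + m)%N = n -> 0 <= top (Xf k m f z).
Proof. move=> fC fp Dz kn; exact: (@top_pos' R n (hs f z) k m (hs_sym z fC) (fp z Dz) kn). Qed.

Lemma Q_Xf_ge0 M D k m f z : (forall a b, M a b = M b a) -> (forall x, 0 <= levi M x) ->
  Ck 2 f -> psh2 D f -> D z -> (k + m).+1 = n -> 0 <= top (Q M (Xf k m f z)).
Proof.
move=> Ms M0 fC fp Dz kn.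
exact: (@top_pos R n M (hs f z) k m Ms M0 (hs_sym z fC) (fp z Dz) kn).
Qed.

Lemma topQ_lin (r : R) M L F : top (Q (fun b a => r * M b a + L b a) F) = r * top (Q M F) + top (Q L F).
Proof. by rewrite QD topD topZ. Qed.

(** If the entries of M are at most B, then cβ plus or minus the form of M is positive for c = 2nB,
    by [levi_bound]; it is multiplied by the positive form (dd^c f)^k ∧ β^m. *)
Lemma topQ_abs M B D k m f z : (forall a b, M a b = M b a) -> (forall a b, `|M a b| <= B) ->
  Ck 2 f -> psh2 D f -> D z -> (k + m).+1 = n ->
  `|top (Q M (Xf k m f z))| <= 2 * n%:R * B * top (Xf k m.+1 f z).
Proof.
move=> Ms MB fC fp Dz kn; pose c := 2 * n%:R * B.
have key (s : R) : `|s| = 1 -> 0 <= c * top (Xf k m.+1 f z) + s * top (Q M (Xf k m f z)).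
  move=> s1.
  have := @Q_Xf_ge0 (fun b a => c * delta b a + s * M b a) D k m f z.
  rewrite topQ_lin Q_delta_Xf QZ topZ; apply => //.
    by move=> a b; rewrite delta_sym Ms.
  move=> x; rewrite levi_lin levi_delta.
  have -> : levi (fun a b => s * M a b) x = s * levi M x.
    have := levi_lin s M (fun _ _ => 0) x.
    have -> : levi (fun _ _ : idx => 0) x = 0 :> R.
      by rewrite /levi /bil !big1 ?addr0// => a _; apply: big1 => b _; rewrite mulr0 mul0r.
    by rewrite addr0 => <-; congr levi; apply/funext => a; apply/funext => b; rewrite addr0.
  have h : `|s * levi M x| <= 4 * n%:R * B * \sum_a x a ^+ 2.
    by rewrite normrM s1 mul1r; exact: levi_bound.
  move: h; rewrite ler_norml => /andP[h _].
  have e : c * (2 * \sum_a x a ^+ 2) = 4 * n%:R * B * \sum_a x a ^+ 2 by rewrite /c; ring.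
  by rewrite e; move: h; move: (_ * _) (_ * levi M x) => p q h; lra.
have := key 1 (normr1 _); have := key (-1); rewrite normrN1 => /(_ erefl).
rewrite ler_norml -/c; move: (c * top _) (top (Q _ _)) => p q; lra.
Qed.

Lemma hs_out chi z : ~ supp chi z -> hs chi z = (fun _ _ => 0).
Proof.
move=> oz.
have nz : \forall y \near z, ~ supp chi y.
  have h : open (~` supp chi) by apply: closed_openC; exact: closed_closure.
  exact: (open_nbhs_nbhs (conj h oz)).
have h0 : \forall y \near z, (fun=> 0 : R) y = chi y.
  by near=> y; apply/esym/supp_out; near: y; exact: nz.
apply/funext => b; apply/funext => a; rewrite /hs -(pderiv_cst b 0 z).
apply: (@pderiv_local _ _ 0); last exact: Ck_cst.
have [d d0 dP] := (nbhs_nrP _ _).1 nz.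
apply/nbhs_nrP; exists (d / 2); first by rewrite divr_gt0.
move=> y yz; apply/esym; rewrite -(pderiv_cst a 0 y); apply: (@pderiv_local _ _ 0); last exact: Ck_cst.
apply/nbhs_nrP; exists (d / 2); first by rewrite divr_gt0.
move=> x xy; apply/esym/supp_out; apply: dP.
by apply: le_lt_trans (nr_triangle _ y _) _; rewrite [ltRHS](splitr d); apply: ltrD.
Unshelve. all: by end_near.
Qed.

Lemma pderiv_out chi z a : ~ supp chi z -> pderiv a chi z = 0.
Proof.
move=> oz; rewrite -(pderiv_cst a 0 z); apply: (@pderiv_local _ _ 0); last exact: Ck_cst.
have h : open (~` supp chi) by apply: closed_openC; exact: closed_closure.
have := open_nbhs_nbhs (conj h oz); apply: filterS => y /= oy.
by rewrite supp_out.
Qed.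

Lemma fin_bound (J : finType) (F : J -> V -> R) : (forall j, exists K : R, forall z, `|F j z| <= K) ->
  exists2 K : R, 0 <= K & forall j z, `|F j z| <= K.
Proof.
move=> /choice[K KP]; have K0 j : 0 <= K j by apply: le_trans (KP j 0).
exists (\sum_j K j); first by apply: sumr_ge0.
move=> j z; apply: le_trans (KP j z) _; rewrite (bigD1 j)//= lerDl.
by apply: sumr_ge0.
Qed.

Lemma Cc_hs a b f : Ck 2 f -> Cc f -> Cc (fun z => hs f z b a).
Proof.
move=> fC fc; have [c1 _] := Cc_pderiv a (CkW (isT : (1 <= 2)%N) fC) fc.
by have [] := @Cc_pderiv _ _ b (pderiv a f) (Ck_pderiv a fC) c1.
Qed.

Lemma hs_bounded f : Ck 2 f -> Cc f -> exists2 B, 0 <= B & forall z a b, `|hs f z a b| <= B.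
Proof.
move=> fC fc; have [B B0 BP] : exists2 K : R, 0 <= K & forall (j : idx * idx) z, `|hs f z j.1 j.2| <= K.
  by apply: fin_bound => j; have [K _ KP] := Cc_bounded (Cc_hs j.2 j.1 fC fc); exists K.
by exists B => // z a b; exact: (BP (a, b)).
Qed.

Lemma test_Ck D chi k : test_smooth D chi -> Ck k chi.
Proof. by case=> /smoothP h _ _; exact: h. Qed.

Lemma test_Cc D chi : test_smooth D chi -> Cc chi.
Proof. by move=> /test_smooth_cont/test_cont_Cc. Qed.

Lemma Cc_top k m f phi : Ck 2 f -> Cc phi -> Cc (fun z => phi z * top (Xf k m f z)).
Proof. by move=> fC pc; apply: CcMc => //; exact: Xf_C. Qed.

Lemma Q_Xf_C k m f phi : Ck 2 f -> Ck 2 phi -> continuous (fun z => top (Q (hs phi z) (Xf k m f z))).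
Proof.
move=> fC pC; apply: (@Ck_cont _ _ 0); apply: CkF_Q => [a b|S]; first exact: Ck_hs.
apply: iter_Q_closed => [c|f1 g1|f1 g1|a b]; [exact: Ck_cst|exact: CkD|exact: CkM|exact: Ck_hs].
Qed.

(** The Chern-Levine-Nirenberg inequality, by induction on k: one dd^c is moved from f to χ, f is
    bounded by [Mb], dd^c χ by a multiple of β, and a cutoff equal to 1 on the support of χ takes
    over. *)
Lemma cln D k (Mb : R) chi : open D -> (k <= n)%N -> 0 <= Mb -> test_smooth D chi -> (forall z, 0 <= chi z) ->
  exists C : R, forall f, Ck 3 f -> psh2 D f -> (forall z, D z -> `|f z| <= Mb) ->
    I (fun z => chi z * top (Xf k (n - k) f z)) <= C.
Proof.
move=> oD; elim: k chi => [|k IH] chi kn Mb0 tchi chi0.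
  (* For k = 0 the form is β^n whatever f is, so any function may stand in its place. *)
  exists (I (fun z => chi z * top (Xf 0 n (fun=> 0) z))) => f _ _ _.
  by rewrite subn0.
have [_ chiK chiD] := tchi.
have [chi' [tchi' chi'01 [d d0 chi'1]]] := cutoff chiK oD chiD.
have chi'0 z : 0 <= chi' z by have /andP[] := chi'01 z.
have [C CP] := IH chi' (ltnW kn) Mb0 tchi' chi'0.
have chiC := test_Ck 2 tchi.
have [B B0 BP] := hs_bounded chiC (test_Cc tchi).
exists (Mb * (2 * n%:R * B) * C) => f fC3 fp fM.
have fC : Ck 2 f := CkW (isT : (2 <= 3)%N) fC3.
have kn' : (k + (n - k.+1)).+1 = n by rewrite -addSn subnKC.
have kn2 : (n - k.+1).+1 = (n - k)%N by rewrite -subSn.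
have -> : I (fun z => chi z * top (Xf k.+1 (n - k.+1) f z)) =
    I (fun z => f z * top (Q (hs chi z) (Xf k (n - k.+1) f z))).
  exact: (esym (@ibp2 R n f chi (Xf k (n - k.+1) f) finset.setT fC chiC (test_Cc tchi) (Xf_closed k (n - k.+1) fC3))).
apply: (@le_trans _ _ (I (fun z => Mb * (2 * n%:R * B) * (chi' z * top (Xf k (n - k) f z))))); last first.
  rewrite I_Ml; last by apply: Cc_top => //; exact: (test_Cc tchi').
  by apply: ler_wpM2l; [rewrite !mulr_ge0|exact: CP].
apply: I_le.
- have -> : (fun z => f z * top (Q (hs chi z) (Xf k (n - k.+1) f z))) =
     (fun z => (chi' z * f z) * top (Q (hs chi z) (Xf k (n - k.+1) f z))).
    apply/funext => z; have [cz|/hs_out cz] := pselect (supp chi z).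
      by rewrite (chi'1 z z)// ?subrr ?nr0// mul1r.
    rewrite cz; have -> : Q (fun _ _ : idx => 0) (Xf k (n - k.+1) f z) = 0.
      by rewrite /Q big1// => a _; rewrite big1// => b _; rewrite mulr0 scale0r.
    by rewrite /top ffunE !mulr0.
  apply: CcMc; last exact: Q_Xf_C.
  by apply: CcMc; [exact: (test_Cc tchi')|exact: Ck_cont fC].
- by apply: CcMl; apply: Cc_top => //; exact: (test_Cc tchi').
move=> z; have [cz|cz] := pselect (supp chi z).
  have Dz := chiD _ cz.
  rewrite (chi'1 z z)// ?subrr ?nr0// mul1r -kn2.
  apply: le_trans (ler_norm _) _; rewrite normrM -mulrA; apply: ler_pM => //; first exact: fM.
  by apply: (topQ_abs _ (BP z) fC fp Dz kn'); exact: hs_sym.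
rewrite (hs_out cz); have -> : Q (fun _ _ : idx => 0) (Xf k (n - k.+1) f z) = 0.
  by rewrite /Q big1// => a _; rewrite big1// => b _; rewrite mulr0 scale0r.
rewrite {1}/top ffunE mulr0; apply: mulr_ge0; first by rewrite !mulr_ge0.
have [->|c'z] := eqVneq (chi' z) 0; first by rewrite mul0r.
apply: mulr_ge0 => //; apply: (Xf_ge0 fC fp); last by rewrite subnKC// ltnW.
by case: tchi' => _ _; apply; exact: suppP.
Qed.

End hessian.

Definition ctsat (R : realType) (T : topologicalType) (F : T -> R) (x : T) : Prop := {for x, continuous F}.

(** * Integrals along a path of functions *)

Section paths.
Context {R : realType} {n : nat}.
Local Notation V := (Cspace R n).
Local Notation idx := ('I_n * bool)%type.
Local Notation form := {ffun {set idx} -> R^o}.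
Local Notation I := (@Cintegral R n).
Implicit Types (F dF G dG : R -> V -> R) (z : V) (f g v w : V -> R).

Definition jcont F := forall t z, 0 <= t <= 1 ->
  ctsat (fun p : R * V => F p.1 p.2) (t, z).

Lemma jcont_eps F t z : ctsat (fun p : R * V => F p.1 p.2) (t, z) ->
  forall e : R, 0 < e -> exists2 d : R, 0 < d & forall s y, `|s - t| < d -> nr (y - z) < d ->
    `|F s y - F t z| < e.
Proof.
move=> Fc e e0.
have nF : nbhs (F t z) (ball (F t z) e) by exact: nbhsx_ballx.
have [[A B] [/= /nbhs_ballP[d1 /= d10 dA] /nbhs_nrP[d2 d20 dB]] AB] := (Fc : {for _, continuous _}) _ nF.
exists (Num.min d1 d2); first by rewrite lt_min d10.
move=> s y; rewrite !lt_min => /andP[s1 _] /andP[_ y2].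
have : ball (F t z) e (F s y).
  by apply: (AB (s, y)); split => /=; [apply: dA; rewrite /ball/= distrC|exact: dB].
by rewrite /ball/= distrC.
Qed.

(** What allows integrals to be compared along the path: a common bounded support, joint continuity
    of the integrand and of its t-derivative. Everything is asked only for t in [0,1], where the
    segment stays among negative functions. *)
Record pathok F dF : Prop := Pathok {
  po_M : exists M : R, forall t, 0 <= t <= 1 -> bsupp M (F t) /\ bsupp M (dF t);
  po_F : jcont F;
  po_dF : jcont dF;
  po_dv : forall t z, 0 <= t <= 1 -> dv (fun s => F s z) t (dF t z) }.

Lemma jcont_cts F t : jcont F -> 0 <= t <= 1 -> continuous (F t).
Proof.
move=> jF t01 z; apply/cvg_nrP => e e0; have [d d0 dP] := jcont_eps (jF t z t01) e0.
by exists d => // y yz; apply: dP => //; rewrite subrr normr0.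
Qed.

Lemma pathok_Cc F dF t : pathok F dF -> 0 <= t <= 1 -> Cc (F t) /\ Cc (dF t).
Proof.
move=> [[M MP] h1 h2 _] t01; have [b1 b2] := MP t t01.
by split; split; [exact: jcont_cts|exists M|exact: jcont_cts|exists M].
Qed.

Lemma pathok_mono F dF : pathok F dF -> (forall t, 0 <= t <= 1 -> 0 <= I (dF t)) -> I (F 0) <= I (F 1).
Proof.
move=> pk; have := pk; case=> [[M MP] h1 h2 h3] h4.
apply: (@path_mono R n M F dF) => //.
- by move=> t t01; split; [case: (pathok_Cc pk t01)|case: (MP t t01)].
- by move=> t t01; split; [case: (pathok_Cc pk t01)|case: (MP t t01)].
- move=> e e0; have [||d d0 dP] := @path_unif R n M dF _ _ e e0.
  + by move=> t t01; case: (MP t t01).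
  + move=> t z t01 e' e'0; have [d d0 dP] := jcont_eps (h2 t z t01) e'0.
    by exists d => // s y _; exact: dP.
  by exists d => // s t z s01 t01 st; apply: dP.
Qed.

Lemma for_cts_cst (T : topologicalType) (x : T) (c : R) : ctsat (fun=> c) x.
Proof. exact: cvg_cst. Qed.

Lemma for_ctsD (T : topologicalType) (x : T) (f g : T -> R) :
  ctsat f x -> ctsat g x -> ctsat (fun t => f t + g t) x.
Proof. by move=> hf hg; apply: cvgD. Qed.

Lemma for_ctsM (T : topologicalType) (x : T) (f g : T -> R) :
  ctsat f x -> ctsat g x -> ctsat (fun t => f t * g t) x.
Proof. by move=> hf hg; apply: cvgM. Qed.

Lemma pathok_lin (K : R) F dF G dG : pathok F dF -> pathok G dG ->
  pathok (fun t z => K * F t z + G t z) (fun t z => K * dF t z + dG t z).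
Proof.
move=> [[M MP] h1 h2 h3] [[N NP] k1 k2 k3]; split.
- exists (Num.max M N) => t t01; have [a1 a2] := MP t t01; have [b1 b2] := NP t t01.
  by split => z; rewrite ge_max => /andP[Mz Nz]; rewrite ?a1 ?a2 ?b1 ?b2// mulr0 addr0.
- by move=> t z t01; apply: for_ctsD; [apply: for_ctsM; [exact: for_cts_cst|exact: h1]|exact: k1].
- by move=> t z t01; apply: for_ctsD; [apply: for_ctsM; [exact: for_cts_cst|exact: h2]|exact: k2].
- by move=> t z t01; apply: dvD; [apply: dvMl; exact: h3|exact: k3].
Qed.

Lemma pathok0 : pathok (fun _ _ => 0) (fun _ _ => 0).
Proof.
split.
- by exists 0.
- by move=> t z _; exact: for_cts_cst.
- by move=> t z _; exact: for_cts_cst.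
- by move=> t z _; exact: dv_cst.
Qed.

Definition dvF (A : R -> form) t (B : form) := forall S, dv (fun s => A s S) t (B S).

Lemma dvF_ext a (A : R -> form) t (B : form) : dvF A t B -> dvF (fun s => ext a (A s)) t (ext a B).
Proof.
move=> AB S; have [aS|aS] := boolP (a \in S).
  apply: dv_ext; first by apply: (dvMl (wedge_sign a (S :\ a)%SET)); exact: (AB (S :\ a)%SET).
    by move=> s; rewrite ffunE aS.
  by rewrite ffunE aS.
apply: dv_ext; first exact: (dv_cst 0).
  by move=> s; rewrite ffunE (negbTE aS).
by rewrite ffunE (negbTE aS).
Qed.

Lemma dvF_Q (M : R -> idx -> idx -> R) (N : idx -> idx -> R) (A : R -> form) t (B : form) :
  (forall a b, dv (fun s => M s a b) t (N a b)) -> dvF A t B ->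
  dvF (fun s => Q (M s) (A s)) t (Q N (A t) + Q (M t) B).
Proof.
move=> MN AB S; apply: dv_ext; last 2 first.
- by move=> s; rewrite Q_coords.
- by rewrite ffunE !Q_coords -big_split.
apply: dv_sum => a; rewrite -big_split; apply: dv_sum => b.
apply: dv_eq; first apply: dvM.
- by apply: dvMl; exact: MN.
- by apply: dvF_ext; apply: dvF_ext; exact: AB.
- by [].
Qed.

(** As the operators commute, the derivative of the p-th power of dd^c(f + t w) is p dd^c w times
    the (p-1)-th power. *)
Lemma dvF_iter (M N : idx -> idx -> R) (F0 : form) p t :
  dvF (fun s => iter p (Q (fun a b => s * N a b + M a b)) F0) t
    (p%:R *: Q N (iter p.-1 (Q (fun a b => t * N a b + M a b)) F0)).
Proof.
elim: p => [|p IH] S.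
  apply: dv_eq; first exact: dv_cst.
  by rewrite ffunE -[_ *: _]/(_ * _) mul0r.
apply: dv_eq; first apply: (dvF_Q (N := N) _ IH).
  move=> a b; apply: dv_eq; first by apply: dvD; [apply: dvM; [exact: dv_id|exact: dv_cst]|exact: dv_cst].
  by rewrite mul1r mulr0 !addr0.
congr (fun_of_fin _ S); rewrite linearZ/= Q_comm -natr1 scalerDl scale1r addrC; congr (_ + _).
by case: p {IH} => [|p]; rewrite ?scale0r.
Qed.

End paths.

(** * The weighted energies and their monotonicity *)

Section functional.
Context {R : realType} {n : nat}.
Local Notation V := (Cspace R n).
Local Notation idx := ('I_n * bool)%type.
Local Notation form := {ffun {set idx} -> R^o}.
Local Notation I := (@Cintegral R n).
Variables (al : R) (D : set V).
Hypotheses (al1 : n%:R - 1 < al) (al2 : al < n%:R) (oD : open D).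
Implicit Types (z : V) (f g v w eta : V -> R) (p q : nat).

(** The exponent paired with (dd^c f)^p; it drops by one with each lost power of dd^c f. It is al at
    p = n, positive for p ≥ 1 since al > n-1, negative at p = 0 since al < n. *)
Definition bq p : R := al - n%:R + p%:R.

(** At p = 0 the weight is a positive power of -f, which decreases as f grows; the sign makes the
    energy nondecreasing. *)
Definition sg p : R := if p is 0 then -1 else 1.

Definition Wi p eta f z := sg p * (eta z ^+ 2 * Pw (- bq p) f z * top (Xf p (n - p) f z)).

(** The derivative of [Wi] at f in the direction w: one term from the weight, one from the power of
    dd^c f. *)
Definition Wd p eta f w z := sg p * (eta z ^+ 2 * (bq p * Pw (- bq p - 1) f z * w z) * top (Xf p (n - p) f z)
   + eta z ^+ 2 * Pw (- bq p) f z * (p%:R * top (Q (hs w z) (Xf p.-1 (n - p) f z)))).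

(** The density, nonnegative when w ≥ 0, that measures both the gain at level p and, since the
    exponent is - [bq p.+1], the error of level p+1. *)
Definition Gi p eta f w z := w z * eta z ^+ 2 * Pw (- bq p - 1) f z * top (Xf p (n - p) f z).

Record good f : Prop := Good {
  gd_C : Ck 3 f; gd_neg : forall z, f z < 0; gd_psh : psh2 D f }.

Definition cutfun eta := test_smooth D eta /\ forall z, 0 <= eta z.

Lemma bqS_gt0 p : 0 < bq p.+1.
Proof.
rewrite /bq -natr1; have := ler0n R p; move: al1; move: (p%:R : R) (n%:R : R) => x y; lra.
Qed.

Lemma bq_step p : - bq p - 1 = - bq p.+1.
Proof. by rewrite /bq -natr1; ring. Qed.

Lemma Cc_eta2 eta : cutfun eta -> Cc (fun z => eta z ^+ 2).
Proof.
move=> [te _]; apply: (CcMc (g := eta)); first exact: (test_Cc te).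
exact: (@Ck_cont _ _ 0 _ (test_Ck 0 te)).
Qed.

Lemma Cc_Gi p eta f w : cutfun eta -> good f -> Ck 2 w -> Cc (Gi p eta f w).
Proof.
move=> ce [fC f0 fp] wC; rewrite /Gi.
have -> : (fun z => w z * eta z ^+ 2 * Pw (- bq p - 1) f z * top (Xf p (n - p) f z)) =
  (fun z => eta z ^+ 2 * (w z * Pw (- bq p - 1) f z) * top (Xf p (n - p) f z)).
  by apply/funext => z; ring.
apply: CcMc; last by apply: Xf_C; exact: (CkW (isT : (2 <= 3)%N) fC).
apply: CcMc; first exact: Cc_eta2.
apply: ctsM; first exact: Ck_cont wC.
exact: (Ck_cont (Ck_Pw (- bq p - 1) f0 fC)).
Qed.

Lemma Wd_zero eta f w : cutfun eta -> good f -> Ck 2 w ->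
  I (Wd 0 eta f w) = (n%:R - al) * I (Gi 0 eta f w).
Proof.
move=> ce gf wC; rewrite -I_Ml; last exact: Cc_Gi.
congr I; apply/funext => z; rewrite /Wd /Gi /sg mul0r mulr0 addr0 [X in X * Pw _ _ _ * _](_ : _ = al - n%:R).
  by move: (Pw _ _ _) (top _) => P X; ring.
by rewrite /bq addr0.
Qed.

Lemma levi_rank1 (x y : idx -> R) : 0 <= levi (fun b a => x b * x a) y.
Proof.
have b1 u : bil (fun b a => x b * x a) u u = (\sum_a u a * x a) ^+ 2.
  rewrite /bil expr2 mulr_suml; apply: eq_bigr => a _; rewrite mulr_sumr.
  by apply: eq_bigr => b _; ring.
by rewrite /levi !b1 addr_ge0// sqr_ge0.
Qed.

Lemma I_lincomb (r s : R) f g : Cc f -> Cc g -> I (fun z => r * f z + s * g z) = r * I f + s * I g.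
Proof.
by move=> fc gc; rewrite -!I_Ml// -I_D//; exact: CcMl.
Qed.

(** After dd^c has been moved from w to η^2 P with P = (-f)^(-b), the Hessian of the latter is a
    square, plus a positive multiple of the Hessian of f, plus P times a matrix depending on η
    alone. The square is positive, the second term adds to the leading one, the third is bounded
    through [topQ_abs]. *)
Lemma Wd_lower p eta eta' : (p < n)%N -> cutfun eta -> cutfun eta' ->
  (forall z, supp eta z -> eta' z = 1) ->
  exists2 C : R, 0 <= C & forall f w, good f -> Ck 2 w -> (forall z, D z -> 0 <= w z) ->
    p.+2%:R * bq p.+1 * I (Gi p.+1 eta f w) - C * I (Gi p eta' f w) <= I (Wd p.+1 eta f w).
Proof.
move=> pn ce ce' e'1; have [te e0] := ce; have [te' e'0] := ce'.
have eC := test_Ck 2 te; have e1C := test_Ck 1 te.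
set b := bq p.+1; have b0 : 0 < b := bqS_gt0 p.
have b10 : 0 < b + 1 by lra.
pose phi z := eta z * eta z.
have phiC : Ck 2 phi by exact: CkM.
have phic : Cc phi by have := Cc_eta2 ce; congr Cc; apply/funext => z; rewrite expr2.
(* 4b/(b+1) = b(b+1) (2/(b+1))^2 is the multiple of dη ⊗ dη used up in completing the square. *)
pose kk := 4 * b / (b + 1).
pose N z (x a : idx) := hs phi z x a - kk * (pderiv x eta z * pderiv a eta z).
have [B1 B10 B1P] := hs_bounded phiC phic.
have [B2 B20 B2P] : exists2 K : R, 0 <= K & forall (j : idx) z, `|pderiv j eta z| <= K.
  apply: fin_bound => j; have [pc _] := Cc_pderiv j e1C (test_Cc te).
  by have [K _ KP] := Cc_bounded pc; exists K.
have kk0 : 0 <= kk by apply: divr_ge0; [apply: mulr_ge0 => //; exact: ltW|exact: ltW].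
pose B := B1 + kk * (B2 * B2).
have NB z x a : `|N z x a| <= B.
  apply: le_trans (ler_normB _ _) _; apply: lerD; first exact: B1P.
  rewrite normrM (ger0_norm kk0) normrM; apply: ler_wpM2l => //.
  by apply: ler_pM.
have Ns z x a : N z x a = N z a x.
  exact: (f_equal2 (fun u1 u2 : R => u1 - kk * u2) (hs_sym z phiC x a) (mulrC _ _)).
have B0 : 0 <= B by apply: addr_ge0 => //; apply: mulr_ge0 => //; exact: mulr_ge0.
pose C0 := 2 * n%:R * B.
have C00 : 0 <= C0 by rewrite !mulr_ge0.
exists (p.+1%:R * C0); first exact: mulr_ge0.
move=> f w gf wC w0; have [fC3 f0 fp] := gf.
have fC : Ck 2 f := CkW (isT : (2 <= 3)%N) fC3.
pose m := (n - p.+1)%N.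
have pm : (p + m).+1 = n by rewrite /m -addSn subnKC.
have mE : (n - p)%N = m.+1 by rewrite /m -subSn.
pose P := Pw (- b) f.
have PC : Ck 2 P by exact: Ck_Pw.
have phPC : Ck 2 (fun z => phi z * P z) by exact: CkM.
have phPc : Cc (fun z => phi z * P z) by apply: CcMc => //; exact: Ck_cont PC.
have P1 z : Pw (- b - 1) f z = P z / - f z by rewrite PwB1.
have P2 z : Pw (- b - 1 - 1) f z = P z / - f z / - f z by rewrite PwB1// P1.
(* With the factor b(b+1)P, the square of this covector accounts for the squared gradient of f and
   for both cross terms with dη. *)
pose vv z (a : idx) := eta z * pderiv a f z / - f z + 2 / (b + 1) * pderiv a eta z.
have Mdec z : hs (fun z => phi z * P z) z = (fun x a => P z * N z x a +
    ((b * (b + 1) * P z) * (vv z x * vv z a) + (eta z ^+ 2 * (b * (P z / - f z))) * hs f z x a)).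
  apply/funext => x; apply/funext => a.
  rewrite (hsM _ _ _ phiC PC) (pderiv_Pw _ _ _ f0 (CkW (isT : (1 <= 2)%N) fC)) (pderiv_Pw _ _ _ f0 (CkW (isT : (1 <= 2)%N) fC)).
  rewrite /phi !(@pderivM _ _ 0 _ _ _ _ e1C e1C) -/phi (hs_Pw _ _ f0 fC) P1 P2 /N /vv /kk.
  have fz : - f z != 0 by rewrite oppr_eq0 lt_eqF.
  have alg (y Pz h1 h2 ea ex fa fx et : R) : y != 0 ->
    h1 * Pz + ((ea * et + et * ea) * (- - b * (Pz / y) * fx) + (ex * et + et * ex) * (- - b * (Pz / y) * fa))
     + et * et * (- b * (- b - 1) * (Pz / y / y) * (fx * fa) - - b * (Pz / y) * h2) =
    Pz * (h1 - 4 * b / (b + 1) * (ex * ea)) +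
    (b * (b + 1) * Pz * ((et * fx / y + 2 / (b + 1) * ex) * (et * fa / y + 2 / (b + 1) * ea)) +
     et ^+ 2 * (b * (Pz / y)) * h2).
    by move=> y0; field; rewrite y0 gt_eqF.
  exact: alg.
have topdec z : top (Q (hs (fun z => phi z * P z) z) (Xf p m f z)) =
  P z * top (Q (N z) (Xf p m f z)) + ((b * (b + 1) * P z) * top (Q (fun x a => vv z x * vv z a) (Xf p m f z))
    + (eta z ^+ 2 * (b * (P z / - f z))) * top (Xf p.+1 m f z)).
  rewrite Mdec topQ_lin; congr (_ + _).
  rewrite (topQ_lin (b * (b + 1) * P z) (fun x a => vv z x * vv z a)
     (fun x a => eta z ^+ 2 * (b * (P z / - f z)) * hs f z x a)).
  by congr (_ + _); rewrite QZ topZ.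
pose T1 z := w z * (eta z ^+ 2 * (b * (P z / - f z)) * top (Xf p.+1 m f z)).
(* Off the support of η everything vanishes, so the factor η'^2 can be inserted to obtain compact
   support. *)
have off z : ~ supp eta z -> top (Q (hs (fun z => phi z * P z) z) (Xf p m f z)) = 0.
  move=> ez; have z0 : eta z = 0 by exact: supp_out.
  have p0 a : pderiv a eta z = 0 by exact: pderiv_out.
  have Q0 : top (Q (fun _ _ : idx => 0) (Xf p m f z)) = 0 :> R.
    rewrite /top /Q big1 ?ffunE// => a _; rewrite big1// => x _.
    by rewrite mulr0 scale0r.
  rewrite topdec; have -> : N z = (fun _ _ : idx => 0).
    apply/funext => x; apply/funext => a.
    by rewrite /N (hsM _ _ _ eC eC) !p0 z0 (hs_out ez) !mulr0 !addr0 subr0.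
  have -> : (fun x a => vv z x * vv z a) = (fun _ _ : idx => 0).
    have v0 a : vv z a = 0 by rewrite /vv p0 z0 !mul0r mulr0 addr0.
    by apply/funext => x; apply/funext => a; rewrite v0 mul0r.
  by rewrite Q0 z0 expr2 !mul0r !mulr0 !addr0.
have point z : T1 z - C0 * Gi p eta' f w z <= w z * top (Q (hs (fun z => phi z * P z) z) (Xf p m f z)).
  have P0 : 0 < P z by exact: Pw_gt0.
  have GE : Gi p eta' f w z = w z * eta' z ^+ 2 * P z * top (Xf p m.+1 f z) by rewrite /Gi bq_step mE.
  rewrite GE /T1; have [ez|ez] := pselect (supp eta z).
    have Dz : D z by case: te => _ _; apply.
    have h1 := topQ_abs (Ns z) (NB z) fC fp Dz pm.
    have h2 : 0 <= top (Q (fun x a => vv z x * vv z a) (Xf p m f z)).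
      apply: (Q_Xf_ge0 _ _ fC fp Dz pm) => [x a|y]; [exact: mulrC|exact: levi_rank1].
    have wz := w0 z Dz.
    have h3 : 0 <= w z * (b * (b + 1) * P z * top (Q (fun x a => vv z x * vv z a) (Xf p m f z))).
      by apply: mulr_ge0 => //; apply: mulr_ge0 => //; apply: mulr_ge0; [apply: mulr_ge0; exact: ltW|exact: ltW].
    have h4 : 0 <= w z * P z * (C0 * top (Xf p m.+1 f z) + top (Q (N z) (Xf p m f z))).
      apply: mulr_ge0; first by apply: mulr_ge0 => //; exact: ltW.
      by move: h1; rewrite ler_norml -/C0 => /andP[h _]; rewrite addrC -lerBlDr sub0r.
    have alg (W e2 PP Z Y1 Y2 Y3 Y4 : R) : e2 = 1 -> Z = PP * Y2 + (Y1 + Y4) -> 0 <= W * Y1 ->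
        0 <= W * PP * (C0 * Y3 + Y2) -> W * Y4 - C0 * (W * e2 ^+ 2 * PP * Y3) <= W * Z.
      move=> -> -> u1 u2; rewrite -subr_ge0; apply: le_trans (addr_ge0 u1 u2) _.
      by rewrite le_eqVlt; apply/orP; left; apply/eqP; ring.
    exact: alg (e'1 z ez) (topdec z) h3 h4.
  have alg (W e1 Z X T Y : R) : e1 = 0 -> Z = 0 -> 0 <= C0 * Y -> W * (e1 ^+ 2 * X * T) - C0 * Y <= W * Z.
    by move=> -> -> u; rewrite expr2 !mul0r !mulr0 sub0r oppr_le0.
  apply: (alg _ _ _ _ _ _ (supp_out ez) (off z ez)); apply: mulr_ge0 => //.
  have [->|e'z] := eqVneq (eta' z) 0; first by rewrite expr2 !mul0r mulr0 !mul0r.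
  have Dz : D z by case: te' => _ _; apply; exact: suppP.
  apply: mulr_ge0; last by apply: (Xf_ge0 fC fp Dz); rewrite addnS.
  by apply: mulr_ge0; [apply: mulr_ge0; [exact: w0|exact: sqr_ge0]|exact: ltW].
have cG1 := Cc_Gi p.+1 ce gf wC.
have cG2 := Cc_Gi p ce' gf wC.
have cS : Cc (fun z => w z * top (Q (hs (fun z => phi z * P z) z) (Xf p m f z))).
  have -> : (fun z => w z * top (Q (hs (fun z => phi z * P z) z) (Xf p m f z))) =
    (fun z => eta' z ^+ 2 * (w z * top (Q (hs (fun z => phi z * P z) z) (Xf p m f z)))).
    apply/funext => z; have [ez|ez] := pselect (supp eta z).
      by rewrite (e'1 z ez) expr1n mul1r.
    by rewrite (off z ez) !mulr0.
  by apply: CcMc (Cc_eta2 ce') _; apply: ctsM; [exact: Ck_cont wC|exact: Q_Xf_C].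
have T1E z : T1 z = b * Gi p.+1 eta f w z.
  by rewrite /T1 /Gi -/b P1; move: (P z / _) (top _) => x y; ring.
(* The factor p+1 comes from differentiating (dd^c f)^(p+1); by [ibp2] the integral no longer
   involves derivatives of w. *)
have E1 : I (Wd p.+1 eta f w) = b * I (Gi p.+1 eta f w) +
    p.+1%:R * I (fun z => w z * top (Q (hs (fun z => phi z * P z) z) (Xf p m f z))).
  have cw : Cc (fun z => phi z * P z * top (Q (hs w z) (Xf p m f z))).
    by apply: CcMc phPc _; exact: Q_Xf_C.
  have ib := @ibp2 R n w (fun z => phi z * P z) (Xf p m f) finset.setT wC phPC phPc (Xf_closed p m fC3).
  have hW : Wd p.+1 eta f w = (fun z => b * Gi p.+1 eta f w z +
      p.+1%:R * (phi z * P z * top (Q (hs w z) (Xf p m f z)))).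
    apply/funext => z.
    have alg (et Y1 Y2 W T1' T2 c : R) : 1 * (et ^+ 2 * (b * Y1 * W) * T1' + et ^+ 2 * Y2 * (c * T2)) =
      b * (W * et ^+ 2 * Y1 * T1') + c * (et * et * Y2 * T2) by ring.
    exact: alg.
  have e1 := I_lincomb b p.+1%:R cG1 cw.
  exact: etrans (congr1 I hW) (etrans e1 (congr1 (fun x => b * I (Gi p.+1 eta f w) + p.+1%:R * x) (esym ib))).
have le1 : b * I (Gi p.+1 eta f w) - C0 * I (Gi p eta' f w) <=
    I (fun z => w z * top (Q (hs (fun z => phi z * P z) z) (Xf p m f z))).
  have e2 := I_lincomb b (- C0) cG1 cG2.
  have cL : Cc (fun z => b * Gi p.+1 eta f w z + - C0 * Gi p eta' f w z).
    by apply: CcD; exact: CcMl.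
  have pt z : b * Gi p.+1 eta f w z + - C0 * Gi p eta' f w z <=
      w z * top (Q (hs (fun z => phi z * P z) z) (Xf p m f z)).
    have := point z; rewrite (T1E z) mulNr; by [].
  have l := I_le cL cS pt.
  by apply: le_trans l; rewrite [leRHS]e2 mulNr.
have p10 : 0 <= p.+1%:R :> R by [].
have le2 := ler_wpM2l p10 le1.
have alg (X Y Z q q2 W : R) : W = b * X + q * Z -> q2 = q + 1 -> q * (b * X - C0 * Y) <= q * Z ->
    q2 * b * X - q * C0 * Y <= W.
  move=> -> -> h; rewrite -subr_ge0 in h; rewrite -subr_ge0; apply: le_trans h _.
  by rewrite le_eqVlt; apply/orP; left; apply/eqP; ring.
exact: alg E1 (esym (natr1 _)) le2.
Qed.

Lemma Gi_ge0 p eta f w : (p <= n)%N -> cutfun eta -> good f -> (forall z, D z -> 0 <= w z) ->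
  0 <= I (Gi p eta f w).
Proof.
move=> pn [te e0] [fC f0 fp] w0; apply: I_ge0 => z; rewrite /Gi.
have [->|ez] := eqVneq (eta z) 0; first by rewrite expr2 mul0r mulr0 !mul0r.
have Dz : D z by case: te => _ _; apply; exact: suppP.
apply: mulr_ge0; last by apply: (Xf_ge0 (CkW (isT : (2 <= 3)%N) fC) fp Dz); rewrite subnKC.
apply: mulr_ge0; first by apply: mulr_ge0; [exact: w0|exact: sqr_ge0].
by apply: ltW; exact: Pw_gt0.
Qed.

Lemma Cc_Wi p eta f : cutfun eta -> good f -> Cc (Wi p eta f).
Proof.
move=> ce [fC f0 fp]; apply: CcMl; apply: CcMc; last by apply: Xf_C; exact: (CkW (isT : (2 <= 3)%N) fC).
by apply: CcMc (Cc_eta2 ce) _; exact: (Ck_cont (Ck_Pw (- bq p) f0 fC)).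
Qed.

Lemma Cc_Wd p eta f w : cutfun eta -> good f -> Ck 2 w -> Cc (Wd p eta f w).
Proof.
move=> ce [fC f0 fp] wC; have fC2 := CkW (isT : (2 <= 3)%N) fC.
have cw := Ck_cont wC.
apply: CcMl; apply: CcD.
  apply: CcMc; last exact: Xf_C.
  apply: CcMc (Cc_eta2 ce) _; apply: ctsM => //; apply: ctsMl.
  exact: (Ck_cont (Ck_Pw (- bq p - 1) f0 fC)).
apply: CcMc; last by apply: ctsMl; exact: Q_Xf_C.
by apply: CcMc (Cc_eta2 ce) _; exact: (Ck_cont (Ck_Pw (- bq p) f0 fC)).
Qed.

Section segment.
Variables f v : V -> R.
Hypotheses (gf : good f) (gv : good v).

Let w z := v z - f z.

Definition seg t z := t * (v z - f z) + f z.

Lemma segC : Ck 3 w.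
Proof. by apply: CkB; [exact: gd_C|exact: gd_C]. Qed.

Lemma hs_seg t z : hs (seg t) z = (fun b a => t * hs w z b a + hs f z b a).
Proof.
by apply: hs_lin; apply: (CkW (isT : (2 <= 3)%N)); [exact: segC|exact: gd_C].
Qed.

Lemma good_seg t : 0 <= t <= 1 -> good (seg t).
Proof.
move=> /andP[t0 t1]; split.
- by apply: CkD; [apply: CkMl; exact: segC|exact: gd_C].
- move=> z; have h1 := gd_neg gf z; have h2 := gd_neg gv z; rewrite /seg.
  move: (f z) (v z) h1 h2 => x y h1 h2; nra.
- move=> z Dz x; rewrite hs_seg levi_lin.
  have alg (X Y : R) : 0 <= X -> 0 <= 1 * Y + X -> 0 <= t * Y + X.
    move=> h1 h2; have -> : t * Y + X = t * (1 * Y + X) + (1 - t) * X by ring.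
    by rewrite addr_ge0// mulr_ge0// subr_ge0.
  apply: alg (gd_psh gf Dz x) _; have := gd_psh gv Dz x.
  have -> : v = seg 1 by apply/funext => y; rewrite /seg mul1r subrK.
  by rewrite (hs_seg 1 z) (levi_lin 1 (hs w z) (hs f z) x).
Qed.

Lemma for_cts_comp (T : topologicalType) (x : T) (h : T -> R) (g : R -> R) :
  ctsat h x -> ctsat g (h x) -> ctsat (fun t => g (h t)) x.
Proof. by move=> ch cg; apply: (@continuous_comp _ _ _ h g). Qed.

Lemma for_snd (x : R * V) (g : V -> R) : continuous g -> ctsat (fun p : R * V => g p.2) x.
Proof. by move=> cg; apply: (@continuous_comp _ _ _ snd g); [exact: cvg_snd|exact: cg]. Qed.

Lemma for_fst (x : R * V) : ctsat (fun p : R * V => p.1) x.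
Proof. exact: cvg_fst. Qed.

Lemma for_ctsN (T : topologicalType) (x : T) (h : T -> R) :
  ctsat h x -> ctsat (fun t => - h t) x.
Proof. by move=> ch; apply: cvgN. Qed.

Lemma for_seg (x : R * V) : ctsat (fun p : R * V => seg p.1 p.2) x.
Proof.
have c1 : continuous w by exact: Ck_cont segC.
have c2 : continuous f by exact: Ck_cont (gd_C gf).
have A1 := @for_ctsM _ (R * V)%type x _ _ (@for_fst x) (@for_snd x _ c1).
have A2 := @for_ctsD _ (R * V)%type x _ _ A1 (@for_snd x _ c2).
exact: A2.
Qed.

Lemma for_Pw (r : R) (x : R * V) : 0 <= x.1 <= 1 -> ctsat (fun p : R * V => Pw r (seg p.1) p.2) x.
Proof.
move=> x01; apply: (@for_cts_comp _ x (fun p : R * V => - seg p.1 p.2) (fun y => y `^ r)).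
  by apply: for_ctsN; exact: for_seg.
by apply: dv_continuous; apply: is_derive1_powR; rewrite oppr_gt0; exact: gd_neg (good_seg x01) _.
Qed.

Lemma for_Xf k m S (x : R * V) : ctsat (fun p : R * V => Xf k m (seg p.1) p.2 S) x.
Proof.
have -> : (fun p : R * V => Xf k m (seg p.1) p.2 S) = (fun p : R * V =>
    iter k (Q (fun b a => p.1 * hs w p.2 b a + hs f p.2 b a)) (iter m (Q (@delta R n)) fone) S).
  by apply/funext => p; rewrite /Xf hs_seg.
apply: (@iter_Q_closed R n (R * V)%type (fun F => ctsat F x)) => [c|f1 g1|f1 g1|a b].
- exact: for_cts_cst.
- exact: for_ctsD.
- exact: for_ctsM.
- have c1 : continuous (fun z => hs w z a b).
    by apply: (@Ck_cont _ _ 0); apply: Ck_hs; exact: (CkW (isT : (2 <= 3)%N) segC).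
  have c2 : continuous (fun z => hs f z a b).
    by apply: (@Ck_cont _ _ 0); apply: Ck_hs; exact: (CkW (isT : (2 <= 3)%N) (gd_C gf)).
  exact: (@for_ctsD _ (R * V)%type x _ _ (@for_ctsM _ (R * V)%type x _ _ (@for_fst x) (@for_snd x _ c1)) (@for_snd x _ c2)).
Qed.

Lemma for_QXf k m S (x : R * V) : ctsat (fun p : R * V => Q (hs w p.2) (Xf k m (seg p.1) p.2) S) x.
Proof.
apply: (@Q_closed R n (R * V)%type (fun F => ctsat F x)) => [c|f1 g1|f1 g1|a b|S'].
- exact: for_cts_cst.
- exact: for_ctsD.
- exact: for_ctsM.
- apply: for_snd; apply: (@Ck_cont _ _ 0); apply: Ck_hs.
  exact: (CkW (isT : (2 <= 3)%N) segC).
- exact: for_Xf.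
Qed.

Lemma pathok_W p eta : cutfun eta -> pathok (fun t => Wi p eta (seg t)) (fun t => Wd p eta (seg t) w).
Proof.
move=> ce; have [ec [M eM]] := Cc_eta2 ce.
split.
- exists M => t _; split => z Mz; rewrite /Wi /Wd (eM z Mz) !mul0r ?addr0 mulr0//.
- move=> t z t01; pose x : R * V := (t, z).
  have P1 := @for_Pw (- bq p) x t01.
  have X1 := @for_Xf p (n - p) finset.setT x.
  exact: (@for_ctsM _ (R * V)%type x _ _ (@for_cts_cst _ _ x (sg p))
    (@for_ctsM _ (R * V)%type x _ _ (@for_ctsM _ (R * V)%type x _ _ (@for_snd x _ ec) P1) X1)).
- move=> t z t01; pose x : R * V := (t, z).
  have P1 := @for_Pw (- bq p) x t01.
  have P2 := @for_Pw (- bq p - 1) x t01.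
  have X1 := @for_Xf p (n - p) finset.setT x.
  have X2 := @for_QXf p.-1 (n - p) finset.setT x.
  have cw : continuous w by exact: Ck_cont segC.
  have A1 := @for_ctsM _ (R * V)%type x _ _ (@for_ctsM _ (R * V)%type x _ _ (@for_cts_cst _ _ x (bq p)) P2) (@for_snd x _ cw).
  have A2 := @for_ctsM _ (R * V)%type x _ _ (@for_ctsM _ (R * V)%type x _ _ (@for_snd x _ ec) A1) X1.
  have A3 := @for_ctsM _ (R * V)%type x _ _ (@for_ctsM _ (R * V)%type x _ _ (@for_snd x _ ec) P1)
     (@for_ctsM _ (R * V)%type x _ _ (@for_cts_cst _ _ x (p%:R)) X2).
  exact: (@for_ctsM _ (R * V)%type x _ _ (@for_cts_cst _ _ x (sg p)) (@for_ctsD _ (R * V)%type x _ _ A2 A3)).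
- move=> t z t01; apply: dvMl.
  have y0 : 0 < - seg t z by rewrite oppr_gt0; exact: gd_neg (good_seg t01) _.
  have d1 : dv (fun s => - seg s z) t (- w z).
    apply: dvN; apply: dv_eq; first by apply: dvD; [apply: dvM; [exact: dv_id|exact: dv_cst]|exact: dv_cst].
    by rewrite mul1r mulr0 !addr0.
  have d2 : dv (fun s => Pw (- bq p) (seg s) z) t (bq p * Pw (- bq p - 1) (seg t) z * w z).
    apply: dv_eq; first by apply: (@dv_comp _ (fun x => x `^ (- bq p)) (fun s => - seg s z)); [exact: is_derive1_powR|exact: d1].
    by rewrite /Pw mulrN mulNr mulNr opprK.
  have d3 : dv (fun s => top (Xf p (n - p) (seg s) z)) t (p%:R * top (Q (hs w z) (Xf p.-1 (n - p) (seg t) z))).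
    apply: dv_ext; first exact: (dvF_iter (hs f z) (hs w z) (iter (n - p) (Q (@delta R n)) fone) p t finset.setT).
      by move=> s; rewrite /top /Xf hs_seg.
    by rewrite ffunE /top /Xf hs_seg.
  apply: dv_ext; first by apply: dvM; [apply: (dvMl (eta z ^+ 2)); exact: d2|exact: d3].
    by [].
  by [].
Qed.

End segment.

(** Nonnegative combinations of energies, each with its own cutoff, recorded together with their
    derivatives in a direction w. The cutoffs must be free to vary because the support grows at each
    step of the descent in p. *)
Inductive adm : ((V -> R) -> V -> R) -> ((V -> R) -> (V -> R) -> V -> R) -> Prop :=
| adm0 : adm (fun _ _ => 0) (fun _ _ _ => 0)
| admS (K : R) q eta F dF : 0 <= K -> (q <= n)%N -> cutfun eta -> adm F dF ->
    adm (fun f z => K * Wi q eta f z + F f z) (fun f w z => K * Wd q eta f w z + dF f w z).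

Lemma adm_Cc F dF : adm F dF -> forall f w, good f -> Ck 2 w -> Cc (F f) /\ Cc (dF f w).
Proof.
elim=> [|K q eta {}F {}dF K0 qn ce _ IH] f w gf wC; first by split; exact: Cc0.
have [c1 c2] := IH f w gf wC.
by split; apply: CcD => //; apply: CcMl; [exact: Cc_Wi|exact: Cc_Wd].
Qed.

Lemma adm_path F dF f v : adm F dF -> good f -> good v ->
  pathok (fun t => F (seg f v t)) (fun t => dF (seg f v t) (fun z => v z - f z)).
Proof.
move=> aF gf gv; elim: aF => [|K q eta {}F {}dF K0 qn ce _ IH]; first exact: pathok0.
by apply: (pathok_lin K _ IH); exact: pathok_W.
Qed.

(** The coefficient of [Gi p] in the lower bound for [Wd p], given by [Wd_zero] and [Wd_lower]. *)
Definition cq p : R := if p is 0 then n%:R - al else p.+1%:R * bq p.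

Lemma cq_gt0 p : 0 < cq p.
Proof. by case: p => [|p] /=; rewrite ?subr_gt0// mulr_gt0// bqS_gt0. Qed.

(** Descent on p: the error of level p+1 is the gain of level p for a larger cutoff, and level 0 has
    no error. *)
Lemma comb p (k : R) eta : (p <= n)%N -> 0 <= k -> cutfun eta -> exists F dF, adm F dF /\
  forall f w, good f -> Ck 2 w -> (forall z, D z -> 0 <= w z) -> 0 <= I (dF f w) /\
    k * cq p * I (Gi p eta f w) <= k * I (Wd p eta f w) + I (dF f w).
Proof.
elim: p k eta => [|p IH] k eta pn k0 ce.
  exists (fun _ _ => 0), (fun _ _ _ => 0); split; first exact: adm0.
  move=> f w gf wC w0; rewrite I_0; split => //.
  by rewrite Wd_zero// addr0 mulrA.
have [[_ eK eD] _] := ce.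
have [eta' [te' e'01 [d d0 e'1]]] := cutoff eK oD eD.
have ce' : cutfun eta' by split=> // z; case/andP: (e'01 z).
have e'1' z : supp eta z -> eta' z = 1 by move=> ez; apply: (e'1 z z ez); rewrite subrr nr0.
have [C C0 CP] := Wd_lower pn ce ce' e'1'.
have k'0 : 0 <= k * C / cq p by apply: divr_ge0; [exact: mulr_ge0|apply: ltW; exact: cq_gt0].
have [F [dF [aF FP]]] := IH _ eta' (ltnW pn) k'0 ce'.
(* The multiplier makes the gain of the added energy, of coefficient [cq p], equal to the error
   kC. *)
exists (fun f z => k * C / cq p * Wi p eta' f z + F f z), (fun f w z => k * C / cq p * Wd p eta' f w z + dF f w z).
split; first by apply: admS => //; exact: ltnW.
move=> f w gf wC w0; have [h1 h2] := FP f w gf wC w0.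
have [_ cdF] := adm_Cc aF gf wC.
have cWd := Cc_Wd p ce' gf wC.
rewrite I_D//; last exact: CcMl.
rewrite I_Ml//; have G0 := Gi_ge0 (ltnW pn) ce' gf w0.
have q0 : cq p != 0 by rewrite gt_eqF// cq_gt0.
have e1 : k * C / cq p * cq p = k * C by rewrite divfK.
rewrite e1 in h2; split; first by apply: le_trans h2; apply: mulr_ge0 => //; exact: mulr_ge0.
have h3 := ler_wpM2l k0 (CP f w gf wC w0).
have alg (c X1 X2 Y Z : R) : k * (c * X1 - C * X2) <= k * Y -> k * C * X2 <= Z ->
    k * c * X1 <= k * Y + Z.
  move=> u1 u2; apply: le_trans (lerD u1 u2); rewrite le_eqVlt; apply/orP; left; apply/eqP; ring.
exact: alg h3 h2.
Qed.

(** On the segment from f to v, which stays among good functions, the direction v - f is nonnegative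
    on D, so [comb] makes both derivatives nonnegative. *)
Lemma functional_mono eta : (0 < n)%N -> cutfun eta -> exists F dF, adm F dF /\
  forall f v, good f -> good v -> (forall z, D z -> f z <= v z) ->
    I (F f) <= I (F v) /\ I (Wi n eta f) + I (F f) <= I (Wi n eta v) + I (F v).
Proof.
move=> n0 ce; have [F [dF [aF FP]]] := comb (leqnn n) ler01 ce.
exists F, dF; split => // f v gf gv fv.
have w0 z : D z -> 0 <= v z - f z by move=> Dz; rewrite subr_ge0 fv.
have wC : Ck 2 (fun z => v z - f z) by apply: (CkW (isT : (2 <= 3)%N)); exact: (segC gf gv).
have s0 : seg f v 0 = f by apply/funext => z; rewrite /seg mul0r add0r.
have s1 : seg f v 1 = v by apply/funext => z; rewrite /seg mul1r subrK.
have pF := adm_path aF gf gv.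
have pW := pathok_W gf gv n ce.
have [cFf _] := adm_Cc aF gf wC; have [cFv _] := adm_Cc aF gv wC.
split.
  have := pathok_mono pF; rewrite s0 s1; apply=> t t01.
  by have [] := FP _ _ (good_seg gf gv t01) wC w0.
have cWf := Cc_Wi n ce gf; have cWv := Cc_Wi n ce gv.
have I_lin1 (A B : V -> R) : Cc A -> Cc B -> I (fun z => 1 * A z + B z) = I A + I B.
  move=> cA cB; rewrite -(I_D cA cB); congr I; apply/funext => z; by rewrite mul1r.
have H := pathok_mono (pathok_lin 1 pW pF).
have E0 : I (fun z => 1 * Wi n eta (seg f v 0) z + F (seg f v 0) z) = I (Wi n eta f) + I (F f).
  by rewrite s0; exact: I_lin1.
have E1 : I (fun z => 1 * Wi n eta (seg f v 1) z + F (seg f v 1) z) = I (Wi n eta v) + I (F v).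
  by rewrite s1; exact: I_lin1.
have tr (x1 x2 x3 x4 : R) : x1 = x2 -> x3 = x4 -> x1 <= x3 -> x2 <= x4 by move=> -> ->.
apply: (tr _ _ _ _ E0 E1 (H _)) => t t01; have gs := good_seg gf gv t01; have [h1 h2] := FP _ _ gs wC w0.
have [_ cdF] := adm_Cc aF gs wC.
have cWd := Cc_Wd n ce gs wC.
rewrite (I_lin1 _ _ cWd cdF).
apply: le_trans (le_trans h2 _); last by rewrite mul1r.
rewrite mul1r; apply: mulr_ge0; first by apply: ltW; exact: cq_gt0.
exact: Gi_ge0.
Qed.

(** Only energies with p = 0 can be negative, and these are controlled by the L^1 norm of f. *)
Lemma adm_lower F dF (S : set (V -> R)) : adm F dF -> (forall f, S f -> good f) ->
  (forall eta, cutfun eta -> exists B : R, forall f, S f -> I (fun z => eta z ^+ 2 * - f z) <= B) ->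
  exists B : R, forall f, S f -> - B <= I (F f).
Proof.
move=> aF Sg hS; elim: aF => [|K q eta {}F {}dF K0 qn ce aF [B BP]].
  by exists 0 => f _; rewrite I_0 oppr0.
have [B2 B2P] : exists B : R, forall f, S f -> - B <= I (Wi q eta f).
  case: q qn => [_|q qn]; last first.
    exists 0 => f Sf; rewrite oppr0; apply: I_ge0 => z; have [fC f0 fp] := Sg f Sf.
    rewrite /Wi mul1r; have [->|ez] := eqVneq (eta z) 0; first by rewrite expr2 !mul0r.
    have Dz : D z by case: ce => [[_ _ h] _]; apply: h; exact: suppP.
    apply: mulr_ge0; last by apply: (Xf_ge0 (CkW (isT : (2 <= 3)%N) fC) fp Dz); rewrite subnKC.
    by apply: mulr_ge0; [exact: sqr_ge0|apply: ltW; exact: Pw_gt0].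
  have [B' B'P] := hS eta ce.
  pose c0 : R := top (iter n (Q (@delta R n)) fone).
  exists (`|c0| * (I (fun z => eta z ^+ 2) + B')) => f Sf.
  have gf := Sg f Sf; have [fC f0 fp] := gf.
  have ce2 := Cc_eta2 ce.
  have cef : Cc (fun z => eta z ^+ 2 * - f z).
    by apply: CcMc => //; apply: ctsN; exact: Ck_cont fC.
  apply: (@le_trans _ _ (- (`|c0| * I (fun z => eta z ^+ 2 + eta z ^+ 2 * - f z)))).
    rewrite lerN2; apply: ler_wpM2l => //; rewrite I_D//; apply: lerD => //; exact: B'P.
  have cs : Cc (fun z => eta z ^+ 2 + eta z ^+ 2 * - f z) by exact: CcD.
  rewrite -I_Ml// -I_N; last exact: CcMl.
  apply: I_le; [by apply: CcN; exact: CcMl|exact: Cc_Wi|move=> z].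
  rewrite /Wi mulN1r lerN2 subn0 -[top (Xf 0 n f z)]/c0.
  (* Since n - al lies in [0,1], y^(n-al) ≤ 1 + y for y > 0. *)
  have h1 : Pw (- bq 0) f z <= 1 + - f z.
    rewrite /Pw; have y0 : 0 < - f z by rewrite oppr_gt0.
    have r01 : 0 <= - bq 0 <= 1.
      rewrite /bq addr0 opprB; move: al1 al2; move: (n%:R : R) => N h1 h2; lra.
    have /andP[r0 r1] := r01.
    have [y1|y1] := leP (- f z) 1.
      apply: (@le_trans _ _ 1); last by rewrite lerDl ltW.
      have -> : 1 = 1 `^ (- bq 0) :> R by rewrite powR1.
      by apply: ge0_ler_powR => //; rewrite nnegrE ?ltW.
    apply: (@le_trans _ _ (- f z)); last by rewrite lerDr.
    have := ler_powR (ltW y1) r1; rewrite powRr1//; exact: ltW.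
  have h2 : 0 <= eta z ^+ 2 by exact: sqr_ge0.
  apply: (@le_trans _ _ (eta z ^+ 2 * Pw (- bq 0) f z * `|c0|)).
    apply: ler_wpM2l; last exact: ler_norm.
    by apply: mulr_ge0 => //; apply: ltW; exact: Pw_gt0.
  rewrite [leLHS]mulrC; apply: ler_wpM2l => //.
  have -> : eta z ^+ 2 + eta z ^+ 2 * - f z = eta z ^+ 2 * (1 + - f z) by rewrite mulrDr mulr1.
  exact: ler_wpM2l.
exists (K * B2 + B) => f Sf; have gf := Sg f Sf.
have [cF _] := adm_Cc aF gf (Ck_cst 2 0).
have cW := Cc_Wi q ce gf.
rewrite I_D//; last exact: CcMl.
rewrite I_Ml// opprD -mulrN; apply: lerD; last exact: BP.
by apply: ler_wpM2l => //; exact: B2P.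
Qed.

(** Continuity at t = 0 of the energy along f + t s0, which is the segment from f to f + s0. *)
Lemma adm_shift F dF f (s0 : R) : adm F dF -> good f -> 0 < s0 -> (forall z, f z + s0 < 0) ->
  forall e : R, 0 < e -> exists s, [/\ 0 < s, s <= s0, good (fun z => f z + s) & I (F (fun z => f z + s)) <= I (F f) + e].
Proof.
move=> aF gf s00 fs e e0.
have gv : good (fun z => f z + s0).
  split => //; first by apply: CkD; [exact: gd_C|exact: Ck_cst].
  move=> z Dz x; have e1 : hs (fun z => f z + s0) z = hs f z.
    have := @hs_lin R n 1 f (fun=> s0) z (CkW (isT : (2 <= 3)%N) (gd_C gf)) (Ck_cst 2 s0).
    have -> : (fun z => 1 * f z + s0) = (fun z => f z + s0) by apply/funext => y; rewrite mul1r.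
    move=> ->; apply/funext => b; apply/funext => a; rewrite mul1r [X in _ + X](_ : _ = 0) ?addr0//.
    rewrite /hs; have -> : pderiv a (fun=> s0) = (fun=> 0) by apply/funext => y; exact: pderiv_cst.
    exact: pderiv_cst.
  by rewrite e1; exact: (gd_psh gf Dz x).
have pF := adm_path aF gf gv.
have [[M MP] jF _ _] := pF.
have [C C0 CP] := @I_bound R n M.
have C1 : 0 < C + 1 by lra.
have [||d d0 dP] := @path_unif R n M (fun t => F (seg f (fun z => f z + s0) t)) _ _ _ (divr_gt0 e0 C1).
- by move=> t t01; case: (MP t t01).
- move=> t z t01 e' e'0; have [d d0 dP] := jcont_eps (jF t z t01) e'0.
  by exists d => // s y _; exact: dP.
pose t := Num.min (d / 2) 1.
have t0 : 0 < t by rewrite lt_min ltr01 divr_gt0.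
have t01 : 0 <= t <= 1 by rewrite ltW//= ge_min lexx orbT.
have z01 : 0 <= (0 : R) <= 1 by rewrite lexx ler01.
have td : t < d by rewrite gt_min ltr_pdivrMr// ltr_pMr// ltr1n.
have sE r : seg f (fun z => f z + s0) r = (fun z => f z + r * s0).
  by apply/funext => z; rewrite /seg; ring.
have gs : good (fun z => f z + t * s0) by rewrite -sE; exact: good_seg.
exists (t * s0); split => //; first exact: mulr_gt0.
  by apply: ler_piMl; [exact: ltW|case/andP: t01].
have [cs _] := pathok_Cc pF t01.
have [c0 _] := pathok_Cc pF z01.
have [b1 _] := MP _ t01; have [b0 _] := MP _ z01.
have cB : Cc (fun z => F (seg f (fun z => f z + s0) t) z - F (seg f (fun z => f z + s0) 0) z) by exact: CcB.
have := CP _ (e / (C + 1)) cB.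
have bB : bsupp M (fun z => F (seg f (fun z => f z + s0) t) z - F (seg f (fun z => f z + s0) 0) z).
  by move=> z Mz; rewrite b1// b0// subrr.
move=> /(_ bB); rewrite I_B//.
have -> : seg f (fun z => f z + s0) 0 = f by rewrite sE; apply/funext => z; rewrite mul0r addr0.
rewrite sE => h.
have {}h : `|I (F (fun z => f z + t * s0)) - I (F f)| <= C * (e / (C + 1)).
  apply: h => z; have := dP t 0 z t01 z01; rewrite subr0 ger0_norm; last by case/andP: t01.
  by move=> /(_ td); rewrite !sE; congr (`|_ - F _ z| <= _); apply/funext => y; rewrite mul0r addr0.
have h2 : C * (e / (C + 1)) <= e by rewrite mulrA ler_pdivrMr// [C * e]mulrC ler_pM2l// lerDl.
move: (le_trans (ler_norm _) (le_trans h h2)); rewrite lerBlDl addrC.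
by [].
Qed.

End functional.

(** * Roots of unity *)

Section circle.
Context {R : realType}.
Implicit Types (s t : R) (c d : Cplx R) (N k : nat).

Definition cis t : Cplx R := rC (cos t) (sin t).

Definition iC : Cplx R := rC 0 1.

Lemma cisD s t : cis (s + t) = cis s * cis t.
Proof. by rewrite /cis rCM cosD sinD; congr rC; rewrite addrC. Qed.

Lemma cnormM c d : cnorm (c * d) = cnorm c * cnorm d.
Proof.
rewrite /cnorm creM cimM -sqrtrM; last by rewrite addr_ge0// sqr_ge0.
by congr Num.sqrt; ring.
Qed.

Lemma cnorm_cis t : cnorm (cis t) = 1.
Proof. exact: cnorm_circle. Qed.

Lemma cis_lip s t : cnorm (cis s - cis t) <= 2 * `|s - t|.
Proof.
apply: le_trans (cnorm_le_abs _) _; rewrite !cre_is_additive !cim_is_additive creN cimN !creE !cimE.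
have dc (x : R) : dv cos x (- sin x) by exact: is_derive_cos.
have ds (x : R) : dv sin x (cos x) by exact: is_derive_sin.
have gen (f df : R -> R) : (forall x, dv f x (df x)) -> (forall x, `|df x| <= 1) ->
    `|f s - f t| <= `|s - t|.
  move=> fd fb; have h (a b : R) : a <= b -> `|f b - f a| <= `|b - a|.
    move=> ab; have [x _ ->] := mvt ab (fun x _ => fd x).
    by rewrite normrM ler_piMl.
  by have [/h|/ltW/h//] := leP s t; rewrite distrC (distrC t).
have b1 x : `|- sin x| <= 1 :> R by rewrite normrN ler_norml sin_geN1 sin_le1.
have b2 x : `|cos x| <= 1 :> R by rewrite ler_norml cos_geN1 cos_le1.
by rewrite mulr2n mulrDl !mul1r; apply: lerD; [exact: (gen _ _ dc b1)|exact: (gen _ _ ds b2)].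
Qed.

Lemma unit_cis c : cnorm c = 1 -> exists2 t, 0 <= t <= 2 * pi & c = cis t.
Proof.
move=> c1; have sq : cre c ^+ 2 + cim c ^+ 2 = 1.
  have h : 0 <= cre c ^+ 2 + cim c ^+ 2 by rewrite addr_ge0// sqr_ge0.
  by rewrite -(sqr_sqrtr h) -/(cnorm c) c1 expr1n.
have x1 : -1 <= cre c <= 1.
  by rewrite -ler_norml -[leRHS]c1; exact: cre_le_cnorm.
have [/andP[a0 api] ca] := acos_def x1.
set t := acos (cre c) in a0 api ca.
have /eqP : sin t ^+ 2 = cim c ^+ 2.
  by apply: (addrI (cre c ^+ 2)); rewrite sq -ca cos2Dsin2.
rewrite eqf_sqr => /orP[] /eqP st.
  exists t; last by rewrite /cis ca st -rC_eta.
  by rewrite a0/=; move: api; have := @pi_ge0 R; lra.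
exists (2 * pi - t); first by move: a0 api; have := @pi_ge0 R; move: (pi : R) t {ca st} => p t; lra.
rewrite /cis cosB sinB mulr_natl cos2pi sin2pi !mul1r !mul0r addr0 sub0r ca st opprK.
by rewrite -rC_eta.
Qed.

(** The number of roots is a multiple of 4 so that multiplication by i permutes them. *)
Definition rt N k : Cplx R := cis (2 * pi * (k%:R / (4 * N.+1)%:R)).

Lemma rtD N k m : rt N (k + m) = rt N k * rt N m.
Proof. by rewrite /rt -cisD -mulrDr -mulrDl -natrD. Qed.

Lemma rt0 N : rt N 0 = 1.
Proof. by rewrite /rt mul0r mulr0 /cis cos0 sin0 rC1. Qed.

Lemma cnorm_rt N k : cnorm (rt N k) = 1.
Proof. exact: cnorm_cis. Qed.

Lemma M0 N : (4 * N.+1)%:R != 0 :> R.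
Proof. by rewrite pnatr_eq0. Qed.

Lemma rt_full N : rt N (4 * N.+1) = 1.
Proof. by rewrite /rt divff ?M0// mulr1 mulr_natl /cis cos2pi sin2pi rC1. Qed.

Lemma rt_i N : rt N N.+1 = iC.
Proof.
rewrite /rt (_ : 2 * pi * _ = pi / 2); first by rewrite /cis cos_pihalf sin_pihalf.
have x0 : N.+1%:R != 0 :> R by rewrite pnatr_eq0.
by rewrite natrM; move: (N.+1%:R : R) x0 => x x0; field.
Qed.

Lemma mean_cst N (r : R) : (4 * N.+1)%:R^-1 * (\sum_(j < 4 * N.+1) r) = r.
Proof. by rewrite sumr_const card_ord mulrnAr -mulrnAl -(mulr_natr _^-1) mulVf ?M0// mul1r. Qed.

Lemma rt_shift1 N (F : Cplx R -> R) : \sum_(j < 4 * N.+1) F (rt N 1 * rt N j) = \sum_(j < 4 * N.+1) F (rt N j).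
Proof.
rewrite (eq_bigr (fun j : 'I_(4 * N.+1) => F (rt N j.+1))); last first.
  by move=> j _; rewrite -rtD add1n.
have e : (4 * N.+1 = (4 * N.+1).-1.+1)%N by [].
rewrite e big_ord_recr [RHS]big_ord_recl /= addrC; congr (_ + _).
by rewrite -e rt_full rt0.
Qed.

Lemma rt_shift N k (F : Cplx R -> R) : \sum_(j < 4 * N.+1) F (rt N k * rt N j) = \sum_(j < 4 * N.+1) F (rt N j).
Proof.
elim: k F => [|k IH] F; first by apply: eq_bigr => j _; rewrite rt0 mul1r.
rewrite -(IH F) -(rt_shift1 N (fun c => F (rt N k * c))); apply: eq_bigr => j _.
by rewrite -addn1 rtD mulrA.
Qed.

End circle.

(** * Discrete circle means *)

Section means.
Context {R : realType} {n : nat}.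
Local Notation V := (Cspace R n).
Local Notation idx := ('I_n * bool)%type.
Implicit Types (f g : V -> R) (z w : V) (N : nat) (c : Cplx R) (D K : set V).

Definition dm N f z w : R := (4 * N.+1)%:R^-1 * \sum_(j < 4 * N.+1) f (z + rt N j *: w).

(** The sub-mean value inequality on the circle of centre z and radius vector w, stated with limits
    of discrete means. For continuous f it amounts to the integral inequality ([psh_sub],
    [sub_circle]), and finite sums suffice to handle it. *)
Definition sub f z w := forall e : R, 0 < e -> exists N0, forall N, (N0 <= N)%N -> f z <= dm N f z w + e.

Lemma dm_lin N (r : R) f g z w : dm N (fun y => r * f y + g y) z w = r * dm N f z w + dm N g z w.
Proof. by rewrite /dm big_split/= -mulr_sumr mulrDr mulrCA. Qed.

Lemma dm_cst N (r : R) z w : dm N (fun=> r) z w = r.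
Proof.
exact: mean_cst.
Qed.

Lemma dm_le N f g z w : (forall c, cnorm c = 1 -> f (z + c *: w) <= g (z + c *: w)) ->
  dm N f z w <= dm N g z w.
Proof.
by move=> fg; apply: ler_wpM2l; [rewrite invr_ge0|apply: ler_sum => j _; apply: fg; exact: cnorm_rt].
Qed.

Lemma dm_le_cst N f z w (r : R) : (forall c, cnorm c = 1 -> f (z + c *: w) <= r) -> dm N f z w <= r.
Proof. by move=> fr; rewrite -[leRHS](dm_cst N r z w); exact: dm_le. Qed.

Lemma dm_rot N k f z w : dm N f z (rt N k *: w) = dm N f z w.
Proof.
rewrite /dm -(rt_shift N k (fun c => f (z + c *: w))); congr (_ * _).
by apply: eq_bigr => j _; rewrite scalerA mulrC.
Qed.

Lemma sub_le f g z w : f z = g z -> sub f z w ->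
  (forall c, cnorm c = 1 -> f (z + c *: w) <= g (z + c *: w)) -> sub g z w.
Proof.
move=> fg fs h e e0; have [N0 NP] := fs e e0; exists N0 => N /NP hN.
by rewrite -fg; apply: le_trans hN _; rewrite lerD2r; exact: dm_le.
Qed.

Lemma sub_ext f g z w : (forall y, f y = g y) -> sub f z w -> sub g z w.
Proof. by move=> fg; have -> : f = g by apply/funext. Qed.

Lemma sub_lin (r : R) f g z w : 0 <= r -> sub f z w -> sub g z w -> sub (fun y => r * f y + g y) z w.
Proof.
move=> r0 fs gs e e0; have r1 : 0 < r + 1 by lra.
have [N1 P1] := fs _ (divr_gt0 e0 (addr_gt0 r1 r1)).
have e20 : 0 < e / 2 by rewrite divr_gt0.
have [N2 P2] := gs (e / 2) e20.
exists (maxn N1 N2) => N; rewrite geq_max => /andP[/P1 h1 /P2 h2].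
rewrite dm_lin; have h3 := ler_wpM2l r0 h1.
have h4 : r * (e / (r + 1 + (r + 1))) <= e / 2.
  have -> : r * (e / (r + 1 + (r + 1))) = e / 2 * (r / (r + 1)) by field; rewrite gt_eqF//; lra.
  by apply: ler_piMr; [rewrite divr_ge0// ltW|rewrite ler_pdivrMr// mul1r lerDl].
move: h2 h3 h4; rewrite mulrDr; move: (r * dm _ _ _ _) (r * f z) (r * (e / _)) => x1 x2 x3; lra.
Qed.

Lemma sub_cst (r : R) z w : sub (fun=> r) z w.
Proof. by move=> e e0; exists 0%N => N _; rewrite dm_cst lerDl ltW. Qed.

Lemma sub_sum (J : eqType) (s : seq J) (k : J -> R) (F : J -> V -> R) z w :
  (forall j, 0 <= k j) -> (forall j, j \in s -> sub (F j) z w) ->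
  sub (fun y => \sum_(j <- s) k j * F j y) z w.
Proof.
move=> k0; elim: s => [|j s IH] h.
  by apply: (@sub_ext (fun=> 0)) => [y|]; [rewrite big_nil|exact: sub_cst].
apply: (@sub_ext (fun y => k j * F j y + \sum_(j <- s) k j * F j y)) => [y|]; first by rewrite big_cons.
apply: sub_lin => //; first by apply: h; rewrite inE eqxx.
by apply: IH => i si; apply: h; rewrite inE si orbT.
Qed.

Definition cov z : idx -> R := fun a => co a z.

Lemma co_scale a c w : co a (c *: w) = cre c * co a w + cim c * Jv (cov w) a.
Proof.
case: a => j b; rewrite /Jv /cov /co /conj_idx /= entryZ.
by case: b; rewrite /= ?creM ?cimM; ring.
Qed.

Lemma levi_rot (M : idx -> idx -> R) c w : cnorm c = 1 -> levi M (cov (c *: w)) = levi M (cov w).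
Proof.
move=> c1; have sq : cre c ^+ 2 + cim c ^+ 2 = 1.
  have h : 0 <= cre c ^+ 2 + cim c ^+ 2 by rewrite addr_ge0// sqr_ge0.
  by rewrite -(sqr_sqrtr h) -/(cnorm c) c1 expr1n.
have E : cov (c *: w) = (fun a => cre c * cov w a + cim c * Jv (cov w) a).
  by apply/funext => a; rewrite /cov co_scale.
have JJ a : Jv (Jv (cov w)) a = - cov w a.
  by case: a => j []; rewrite /Jv /conj_idx/=; ring.
rewrite /levi /bil E -!big_split; apply: eq_bigr => a _; rewrite -!big_split; apply: eq_bigr => b _ /=.
have JE d : Jv (fun a => cre c * cov w a + cim c * Jv (cov w) a) d = cre c * Jv (cov w) d - cim c * cov w d.
  by rewrite -[X in _ - X](opprK) -mulrN -JJ opprK /Jv; ring.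
rewrite !JE; move: (cov w a) (cov w b) (Jv (cov w) a) (Jv (cov w) b) (M a b) (cre c) (cim c) sq.
move=> x y p q m u v h.
transitivity ((u ^+ 2 + v ^+ 2) * (x * m * y + p * m * q)); first ring.
by rewrite h mul1r.
Qed.

(** The mean over z ± w and z ± iw. On quadratic polynomials it equals the value at z plus a quarter
    of [levi], so discrete circle means of quadratic polynomials are exact ([dm_quad]). *)
Definition q4 f z w : R := (f (z + w) + f (z + iC *: w) + f (z - w) + f (z - iC *: w)) / 4.

Lemma dm_q4 N f z w : dm N f z w = (4 * N.+1)%:R^-1 * \sum_(j < 4 * N.+1) q4 f z (rt N j *: w).
Proof.
have e1 : \sum_(j < 4 * N.+1) f (z + iC *: (rt N j *: w)) = \sum_(j < 4 * N.+1) f (z + rt N j *: w).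
  rewrite -(rt_shift N N.+1 (fun c => f (z + c *: w))) rt_i.
  by apply: eq_bigr => j _; rewrite scalerA.
have iN : iC * iC = -1 :> Cplx R by rewrite /iC rCM -rC1 rCN; congr rC; ring.
have e2 : \sum_(j < 4 * N.+1) f (z - rt N j *: w) = \sum_(j < 4 * N.+1) f (z + rt N j *: w).
  rewrite -(rt_shift N (N.+1 + N.+1) (fun c => f (z + c *: w))) rtD rt_i iN.
  by apply: eq_bigr => j _; rewrite mulN1r scaleNr.
have e3 : \sum_(j < 4 * N.+1) f (z - iC *: (rt N j *: w)) = \sum_(j < 4 * N.+1) f (z + rt N j *: w).
  rewrite -(rt_shift N (N.+1 + N.+1 + N.+1) (fun c => f (z + c *: w))) !rtD rt_i iN.
  by apply: eq_bigr => j _; rewrite mulN1r mulNr scaleNr scalerA.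
congr (_ * _); rewrite /q4 -mulr_suml !big_split/= e1 e2 e3.
by move: (\sum_(j < _) _) => X; field.
Qed.

Definition quad (r : R) (l : idx -> R) (M : idx -> idx -> R) y : R :=
  r + \sum_a l a * co a y + bil M (cov y) (cov y) / 2.

Lemma q4_quad r l M z w : q4 (quad r l M) z w = quad r l M z + levi M (cov w) / 4.
Proof.
have Ji : cov (iC *: w) = Jv (cov w).
  by apply/funext => a; rewrite /cov co_scale creE cimE mul0r add0r mul1r.
have lE (s : R) v : \sum_a l a * co a (z + rC s 0 *: v) = \sum_a l a * co a z + s * \sum_a l a * co a v.
  by rewrite mulr_sumr -big_split; apply: eq_bigr => a _; rewrite coD coZ/=; ring.
have bE (s : R) v : bil M (cov (z + rC s 0 *: v)) (cov (z + rC s 0 *: v)) = bil M (cov z) (cov z) +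
    s * (bil M (cov z) (cov v) + bil M (cov v) (cov z)) + s ^+ 2 * bil M (cov v) (cov v).
  rewrite /bil !mulrDr !mulr_sumr -!big_split; apply: eq_bigr => a _.
  rewrite !mulr_sumr -!big_split; apply: eq_bigr => b _ /=.
  by rewrite /cov !coD !coZ; ring.
have qE (s : R) v : quad r l M (z + rC s 0 *: v) = quad r l M z + s * (\sum_a l a * co a v +
    (bil M (cov z) (cov v) + bil M (cov v) (cov z)) / 2) + s ^+ 2 * (bil M (cov v) (cov v) / 2).
  by rewrite /quad lE bE; move: (bil _ _ _) (bil _ _ _) (bil _ _ _) (bil _ _ _) (\sum_a _) (\sum_a _) => *; field.
have p v : quad r l M (z + v) = quad r l M z + 1 * (\sum_a l a * co a v +
    (bil M (cov z) (cov v) + bil M (cov v) (cov z)) / 2) + 1 ^+ 2 * (bil M (cov v) (cov v) / 2).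
  by rewrite -qE rC1Z.
have m v : quad r l M (z - v) = quad r l M z + -1 * (\sum_a l a * co a v +
    (bil M (cov z) (cov v) + bil M (cov v) (cov z)) / 2) + (-1) ^+ 2 * (bil M (cov v) (cov v) / 2).
  by rewrite -qE rCNZ rC1Z.
rewrite /q4 (p w) (m w) (p (iC *: w)) (m (iC *: w)) Ji /levi.
by move: (bil _ _ _) (bil _ _ _) (bil _ _ _) (bil _ _ _) (bil _ _ _) (bil _ _ _) (\sum_a _) (\sum_a _) (quad _ _ _ _) => *; field.
Qed.

Lemma dm_quad N r l M z w : dm N (quad r l M) z w = quad r l M z + levi M (cov w) / 4.
Proof.
rewrite dm_q4 (eq_bigr (fun=> quad r l M z + levi M (cov w) / 4)).
  exact: mean_cst.
by move=> j _; rewrite q4_quad levi_rot// cnorm_rt.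
Qed.

Lemma N2_quad : @N2 R n = quad 0 (fun=> 0) (fun a b => 2 * delta a b).
Proof.
apply/funext => z; rewrite /quad big1 => [|a _]; last by rewrite mul0r.
rewrite addr0 add0r /bil mulr_suml /N2; apply: eq_bigr => a _.
rewrite (eq_bigr (fun b => delta a b * (2 * co a z * co b z))); last by move=> b _; rewrite /cov; ring.
by rewrite sumr_delta; field.
Qed.

Lemma dm_N2 N z w : dm N (@N2 R n) z w = N2 z + N2 w.
Proof.
rewrite N2_quad dm_quad; congr (_ + _).
rewrite -N2_quad; have -> : levi (fun a b => 2 * delta a b) (cov w) = 2 * levi (@delta R n) (cov w).
  have := levi_lin 2 (@delta R n) (fun _ _ => 0) (cov w).
  have -> : levi (fun _ _ : idx => 0) (cov w) = 0 :> R.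
    by rewrite /levi /bil !big1 ?addr0// => a _; apply: big1 => b _; rewrite mulr0 mul0r.
  by rewrite addr0 => <-; congr levi; apply/funext => a; apply/funext => b; rewrite addr0.
by rewrite levi_delta /N2 /cov; move: (\sum_a _) => X; field.
Qed.

End means.

(** * Continuous plurisubharmonic functions and the maximum principle *)

Section subharmonic.
Context {R : realType} {n : nat}.
Local Notation V := (Cspace R n).
Implicit Types (f g : V -> R) (z w : V) (N : nat) (c : Cplx R) (D K B : set V).

Definition disc D z w := forall c, cnorm c <= 1 -> D (z + c *: w).

Definition PC D f := forall z w, disc D z w -> sub f z w.

Definition loc D f := forall z, D z -> exists2 r : R, 0 < r & forall w, nr w < r -> sub f z w.

Lemma fin_pos (J : finType) (P : J -> R -> Prop) :
  (forall j, exists2 r : R, 0 < r & forall t, t < r -> P j t) ->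
  exists2 r : R, 0 < r & forall j t, t < r -> P j t.
Proof.
move=> h; have /choice[r rP] : forall j, exists r : R, 0 < r /\ forall t, t < r -> P j t.
  by move=> j; have [r r0 rP] := h j; exists r.
have r0 j : 0 < r j by have [] := rP j.
have S0 : 0 <= \sum_j (r j)^-1 by apply: sumr_ge0 => j _; rewrite invr_ge0 ltW.
have S1 : 0 < 1 + \sum_j (r j)^-1 by lra.
exists (1 + \sum_j (r j)^-1)^-1; first by rewrite invr_gt0.
move=> j t tr; have [_] := rP j; apply; apply: lt_le_trans tr _.
rewrite -[leRHS]invrK lef_pV2 ?posrE ?invr_gt0//.
rewrite (bigD1 j)//= addrCA lerDl addr_ge0//.
by apply: sumr_ge0 => i _; rewrite invr_ge0 ltW.
Qed.

Lemma PC_loc D f : open D -> PC D f -> loc D f.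
Proof.
move=> oD fP z Dz; have [d d0 dP] := (nbhs_nrP z D).1 (open_nbhs_nbhs (conj oD Dz)).
exists d => // w wd; apply: fP => c c1; apply: dP.
rewrite addrAC subrr add0r nrZ; apply: le_lt_trans wd.
by apply: ler_piMl => //; exact: nr_ge0.
Qed.

(** Adding a small multiple of [N2] makes the sub-mean inequality strict, which is impossible at a
    maximum point. *)
Lemma maxp K B f (m : R) : (0 < n)%N -> compact K -> continuous f ->
  (forall z, K z -> B z -> f z <= m) ->
  (forall z, K z -> ~ B z -> exists2 r : R, 0 < r & forall w, nr w < r -> sub f z w /\
     forall c, cnorm c = 1 -> K (z + c *: w) \/ f (z + c *: w) <= m) ->
  forall z, K z -> f z <= m.
Proof.
move=> n0 cK cf fB fK z1 Kz1; rewrite leNgt; apply/negP => mz1.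
have [M MP] := compact_nr_bounded cK.
have M0 : 0 <= M by apply: le_trans (nr_ge0 z1) _; exact: ltW (MP _ Kz1).
(* A bound for [N2] on the ball of radius M + 1, which contains the circles used below; it makes
   [eta * N2] smaller than f z1 - m there. *)
pose L := 2 * n%:R * (M + 1) ^+ 2.
have L0 : 0 <= L by apply: mulr_ge0; [exact: mulr_ge0|exact: sqr_ge0].
pose eta := (f z1 - m) / (L + 1).
have L1 : 0 < L + 1 by lra.
have eta0 : 0 < eta by rewrite divr_gt0// subr_gt0.
have etaL (y : V) : nr y <= M + 1 -> m + eta * N2 y < f z1.
  move=> yM; apply: (@le_lt_trans _ _ (m + eta * L)).
    rewrite lerD2l ler_wpM2l ?(ltW eta0)//; apply: le_trans (N2_le y) _.
    rewrite /L ler_wpM2l ?mulr_ge0// ler_sqr ?nnegrE ?nr_ge0//; lra.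
  by rewrite -ltrBrDl /eta mulrAC ltr_pdivrMr// ltr_pM2l ?subr_gt0// ltrDl.
pose F y := eta * N2 y + f y.
have cN2 : continuous (@N2 R n) by exact: (Ck_cont (Ck_N2 0)).
have cF : continuous F by apply: ctsD => //; exact: ctsMl.
have [|z0 /set_mem Kz0 z0P] := compact_EVT_max (ex_intro _ _ Kz1) cK (f := F).
  by apply: continuous_subspaceT.
have {}z0P y : K y -> F y <= F z0 by move=> Ky; apply: z0P; rewrite inE.
have Fz1 : f z1 <= F z0.
  by apply: le_trans (z0P _ Kz1); rewrite /F lerDr mulr_ge0 ?N2_ge0 ?(ltW eta0).
have nB : ~ B z0.
  move=> /(fB _ Kz0) fz0; have := etaL z0; have := MP _ Kz0; move: Fz1; rewrite /F => h1 h2.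
  have h3 : nr z0 <= M + 1 by lra.
  by move=> /(_ h3); lra.
have [r r0 rP] := fK z0 Kz0 nB.
pose a0 : 'I_n * bool := (Ordinal n0, false).
pose t := Num.min (r / 2) 1.
have t0 : 0 < t by rewrite lt_min ltr01 divr_gt0.
have tr : t < r by rewrite gt_min ltr_pdivrMr// ltr_pMr// ltr1n.
have t1 : t <= 1 by rewrite ge_min lexx orbT.
pose w : V := rC t 0 *: real_dir a0.
have nw : nr w = t by rewrite nrZr nr_real_dir mulr1 gtr0_norm.
have w0 : 0 < N2 w by apply: lt_le_trans (nr_N2 w); rewrite nw exprn_gt0.
have [|sw cw] := rP w; first by rewrite nw.
have e0 : 0 < eta * N2 w / 2 by rewrite divr_gt0// mulr_gt0.
have [N NP] := sw _ e0; have {}NP := NP N (leqnn _).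
have h1 : dm N F z0 w <= F z0.
  apply: dm_le_cst => c c1; have [Kc|fc] := cw c c1; first exact: z0P.
  have nc : nr (z0 + c *: w) <= M + 1.
    apply: le_trans (nrD _ _) _; rewrite nrZ c1 mul1r nw; apply: lerD => //; exact: ltW (MP _ Kz0).
  have := etaL _ nc; move: fc Fz1; rewrite /F; lra.
move: h1; rewrite /F dm_lin dm_N2; move: NP e0; move: (dm N f z0 w) (N2 w) (N2 z0) => x1 x2 x3.
rewrite mulrDr; move: (eta * x2) (eta * x3) => y1 y2; lra.
Qed.

End subharmonic.

(** * Local characterisations of plurisubharmonicity *)

Section local_global.
Context {R : realType} {n : nat}.
Local Notation V := (Cspace R n).
Implicit Types (f g : V -> R) (z w : V) (N : nat) (c : Cplx R) (D K B : set V).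

Lemma dm_comp p (f : V -> R) z w (x v : Cspace R p) (A : Cspace R p -> V) N :
  (forall c, cnorm c = 1 -> A (x + c *: v) = z + c *: w) -> dm N (fun y => f (A y)) x v = dm N f z w.
Proof. by move=> h; rewrite /dm; congr (_ * _); apply: eq_bigr => j _; rewrite h// cnorm_rt. Qed.

Lemma sub_comp p (f : V -> R) z w (x v : Cspace R p) (A : Cspace R p -> V) :
  A x = z -> (forall c, cnorm c = 1 -> A (x + c *: v) = z + c *: w) ->
  sub f z w -> sub (fun y => f (A y)) x v.
Proof.
move=> Ax Ac fs e e0; have [N0 NP] := fs e e0; exists N0 => N /NP.
by rewrite (dm_comp _ _ Ac) Ax.
Qed.

Lemma entryMx p (c : Cplx R) (s t : Cspace R p) (j : 'I_p) :
  (s + c *: t) 0 j = s 0 j + c * t 0 j.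
Proof. by rewrite entryD entryZ. Qed.

Lemma line_aff (z w : V) (a b c d : Cplx R) : z + (a * (b + c * d)) *: w = z + (a * b) *: w + c *: ((a * d) *: w).
Proof. by rewrite mulrDr scalerDl addrA scalerA mulrCA. Qed.

(** The discrete mean over the circle of radius vector s w, as a function of s in the unit disc of
    C, is locally subharmonic. The maximum principle in one variable compares its value f z at s = 0
    with its values at |s| = 1, which are nearly equal to the mean over the original circle. *)
Lemma loc_glob D f : open D -> continuous f -> loc D f -> PC D f.
Proof.
move=> oD cf fl z w dzw e e0.
have e20 : 0 < e / 2 by rewrite divr_gt0.
have [d d0 dP] := unif_cont (@compact_nr_le R n (nr z + nr w)) (fun y _ => cf y) e20.
have w10 : 0 < nr w + 1 by rewrite ltr_wpDl ?nr_ge0.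
have pi0 : 0 < (pi : R) := pi_gt0 R.
have [N0 N0P] := archi_inv (divr_gt0 d0 (mulr_gt0 pi0 w10)).
exists N0 => N /N0P NP.
pose g (s : Cspace R 1) := dm N f z (s 0 0 *: w).
have g0 : g 0 = f z by rewrite /g mxE scale0r -[RHS](dm_cst N (f z) z 0) /dm; congr (_ * _);
  apply: eq_bigr => j _; rewrite scaler0 addr0.
pose F (j : 'I_(4 * N.+1)) (s : Cspace R 1) := f (z + (rt N j * s 0 0) *: w).
have gE s : g s = \sum_j (4 * N.+1)%:R^-1 * F j s.
  by rewrite /g /dm mulr_sumr; apply: eq_bigr => j _; rewrite /F scalerA.
have Fc j : continuous (F j).
  move=> s; apply/cvg_nrP => t t0; have /cvg_nrP/(_ t t0)[r r0 rP] := cf (z + (rt N j * s 0 0) *: w).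
  exists (r / (nr w + 1)); first by rewrite divr_gt0.
  move=> y yr; apply: rP.
  have -> : z + (rt N j * y 0 0) *: w - (z + (rt N j * s 0 0) *: w) = (rt N j * (y - s) 0 0) *: w.
    rewrite opprD addrACA subrr add0r -scalerBl -mulrBr; congr ((_ * _) *: _).
    by rewrite !mxE.
  rewrite nrZ cnormM cnorm_rt mul1r; move: yr; rewrite ltr_pdivlMr//; apply: le_lt_trans.
  apply: ler_pM; [exact: cnorm_ge0|exact: nr_ge0|exact: cnorm_le_nr|by rewrite lerDl].
have gc : continuous g.
  have -> : g = (fun s => \sum_j (4 * N.+1)%:R^-1 * F j s) by apply/funext.
  by apply: cts_sum => j; apply: ctsMl; exact: Fc.
suff : g 0 <= dm N f z w + e / 2.
  by rewrite g0 => h; apply: le_trans h _; rewrite lerD2l ler_pdivrMr// ler_pMr// ler1n.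
have H0 := @maxp R 1 [set s | nr s <= 1] [set s | nr s = 1] g (dm N f z w + e / 2) isT.
have H1 := H0 (@compact_nr_le R 1 1).
have H2 := H1 gc.
apply: (H2 _ _ 0); last by rewrite /= nr0; exact: ler01.
- move=> s _ /= s1.
  have cs : cnorm (s 0 0) = 1.
    apply/eqP; rewrite eq_le -{1}s1 cnorm_le_nr/= -s1; apply: nr_le; first exact: cnorm_ge0.
    by move=> j; rewrite (ord1 j).
  have [th /andP[th0 th2] sE] := unit_cis cs.
  pose M : R := (4 * N.+1)%:R.
  have M0' : 0 < M by rewrite ltr0n.
  pose k := Num.truncn (th * M / (2 * pi)).
  have p20 : 0 < 2 * (pi : R) by rewrite mulr_gt0.
  have q0 : 0 <= th * M / (2 * pi) by rewrite divr_ge0 ?mulr_ge0// ltW.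
  have /andP[k1 k2] := truncn_itv q0.
  (* The grid angle just below th. Rotating by a grid angle permutes the roots and leaves the mean
     unchanged, so only the small difference of angles matters. *)
  pose th' : R := 2 * pi * (k%:R / M).
  have dth : `|th - th'| <= pi / N.+1%:R / 2.
    have e1 : th - th' = (th * M / (2 * pi) - k%:R) * (2 * pi / M).
      have alg (x p m q : R) : p != 0 -> m != 0 -> x - 2 * p * (q / m) = (x * m / (2 * p) - q) * (2 * p / m).
        by move=> p1 m1; field; rewrite p1 m1.
      by apply: alg; rewrite gt_eqF.
    rewrite e1 ger0_norm; last by rewrite mulr_ge0 ?subr_ge0 ?divr_ge0// ltW.
    have -> : pi / N.+1%:R / 2 = 1 * (2 * pi / M) :> R.
      rewrite /M natrM; have x0 : N.+1%:R != 0 :> R by rewrite pnatr_eq0.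
      by move: (N.+1%:R : R) x0 => x x0; field.
    apply: ler_wpM2r; first by rewrite divr_ge0// ltW.
    by rewrite lerBlDr addrC natr1; exact: ltW.
  rewrite /g sE -(dm_rot N k f z w) -/(rt N k) /dm.
  rewrite -[X in _ + X](mean_cst N) -mulrDr -big_split/=.
  apply: ler_wpM2l; first by rewrite invr_ge0.
  apply: ler_sum => j _; rewrite -lerBlDl; apply: le_trans (ler_norm _) _; apply: ltW.
  apply: dP => /=.
    apply: le_trans (nrD _ _) _; rewrite lerD2l !nrZ !cnorm_rt !mul1r; exact: lexx.
  have -> : z + rt N j *: (cis th *: w) - (z + rt N j *: (rt N k *: w)) = (rt N j * (cis th - cis th')) *: w.
    by rewrite opprD addrACA subrr add0r !scalerA -scalerBl -mulrBr.
  rewrite nrZ cnormM cnorm_rt mul1r.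
  apply: (@le_lt_trans _ _ (2 * (pi / N.+1%:R / 2) * nr w)).
    apply: ler_wpM2r; first exact: nr_ge0.
    by apply: le_trans (cis_lip _ _) _; rewrite ler_wpM2l.
  have -> : 2 * (pi / N.+1%:R / 2) * nr w = N.+1%:R^-1 * (pi * nr w) :> R.
    have x0 : N.+1%:R != 0 :> R by rewrite pnatr_eq0.
    by move: (N.+1%:R : R) x0 => x x0; field.
  move: NP; rewrite ltr_pdivlMr ?mulr_gt0//; apply: le_lt_trans.
  by rewrite ler_wpM2l ?invr_ge0// ler_wpM2l ?(ltW pi0)// lerDl.
- move=> s /= s1 sn1; have {sn1}s1 : nr s < 1 by rewrite lt_neqAle s1 andbT; apply/eqP.
  have [r r0 rP] : exists2 r : R, 0 < r & forall (j : 'I_(4 * N.+1)) t, t < r ->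
      forall v : V, nr v < t -> sub f (z + (rt N j * s 0 0) *: w) v.
    apply: fin_pos => j; have [|r r0 rP] := fl (z + (rt N j * s 0 0) *: w).
      by apply: dzw; rewrite cnormM cnorm_rt mul1r; apply: le_trans (cnorm_le_nr _ _) (ltW s1).
    by exists r => // t tr v vt; apply: rP; exact: lt_trans tr.
  exists (Num.min (1 - nr s) (r / 2 / (nr w + 1))).
    by rewrite lt_min subr_gt0 s1 !divr_gt0.
  move=> t; rewrite lt_min => /andP[t1 t2]; split.
    apply: (@sub_ext _ _ (fun y => \sum_j (4 * N.+1)%:R^-1 * F j y)) => [y|]; first by rewrite gE.
    apply: (@sub_sum R 1 'I_(4 * N.+1) _ (fun=> (4 * N.+1)%:R^-1) F) => [j|j _].
      by rewrite invr_ge0.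
    apply: (@sub_comp 1 f (z + (rt N j * s 0 0) *: w) ((rt N j * t 0 0) *: w) s t (fun y => z + (rt N j * y 0 0) *: w)) => //.
      by move=> c _; rewrite entryMx; exact: line_aff.
    apply: (rP j (r / 2)); first by rewrite ltr_pdivrMr// ltr_pMr// ltr1n.
    rewrite nrZ cnormM cnorm_rt mul1r; move: t2; rewrite ltr_pdivlMr//; apply: le_lt_trans.
    apply: ler_pM; [exact: cnorm_ge0|exact: nr_ge0|exact: cnorm_le_nr|by rewrite lerDl].
  move=> c c1; left; rewrite /=; apply: le_trans (nrD _ _) _.
  by rewrite nrZ c1 mul1r -lerBrDl ltW.
Qed.

Definition unifc f := forall t : R, 0 < t -> exists2 d : R, 0 < d & forall x y, nr (y - x) < d -> `|f y - f x| <= t.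

Lemma sub_shift f z w h : sub f (z + h) w -> sub (fun y => f (y + h)) z w.
Proof.
apply: (@sub_comp n f (z + h) w z w (fun y => y + h)) => // c _.
exact: addrAC.
Qed.

(** A mollification is uniformly approximated by finite convex combinations of translates, each of
    which satisfies the sub-mean inequality. *)
Lemma conv_PC D D' f (e : R) rho : mollifier e rho -> continuous f -> unifc f ->
  (forall z h, D' z -> nr h <= e -> D (z + h)) -> PC D f -> PC D' (cnv rho f).
Proof.
move=> m cf uf DD fP z w dzw e1 e10; have t0 : 0 < e1 / 4 by rewrite divr_gt0.
have [d d0 dP] := uf _ t0.
have [s [k [k0 k1 se kP]]] := conv_average m d0.
pose h y := \sum_(x <- s) k x * f (y + x).
have hP y : `|cnv rho f y - h y| <= e1 / 4 by apply: kP.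
have hs : sub h z w.
  apply: (@sub_sum R n V s k (fun x y => f (y + x))) => // x xs; apply: sub_shift; apply: fP.
  move=> c c1; rewrite addrAC; apply: DD; [exact: dzw|exact: se].
have [N0 NP] := hs _ t0; exists N0 => N /NP hN.
have h1 : dm N h z w <= dm N (fun y => 1 * cnv rho f y + e1 / 4) z w.
  by apply: dm_le => c _; have := hP (z + c *: w); rewrite mul1r ler_norml; lra.
move: h1; rewrite dm_lin dm_cst mul1r => h1.
have := hP z; rewrite ler_norml; move: h1 hN; lra.
Qed.

Lemma bil_D2 f z h : bil (hs f z) (cov h) (cov h) = D2 f z h.
Proof.
rewrite /bil /D2 exchange_big; apply: eq_bigr => a _; apply: eq_bigr => b _.
by rewrite /hs /cov; ring.
Qed.

Definition tquad f z : V -> R := quad (f z) (fun a => pderiv a f z) (hs f z).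

Lemma tquadE f z h : tquad f z h = f z + D1 f z h + D2 f z h / 2.
Proof.
rewrite /tquad /quad bil_D2 /D1; congr (_ + _ + _); apply: eq_bigr => a _; exact: mulrC.
Qed.

Lemma D2_close f z (z' : V) h (e : R) : 0 <= e -> (forall a b, `|hs f z' a b - hs f z a b| <= e) ->
  `|D2 f z' h - D2 f z h| <= 4 * n%:R ^+ 2 * e * nr h ^+ 2.
Proof.
move=> e0 H; rewrite /D2 -sumrB; apply: le_trans (ler_norm_sum _ _ _) _.
have step (a : 'I_n * bool) : `|\sum_b co a h * co b h * pderiv b (pderiv a f) z' -
    \sum_b co a h * co b h * pderiv b (pderiv a f) z| <= 2 * n%:R * (e * nr h ^+ 2).
  rewrite -sumrB; apply: le_trans (ler_norm_sum _ _ _) _.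
  apply: (@le_trans _ _ (\sum_(b : 'I_n * bool) e * nr h ^+ 2)).
    apply: ler_sum => b _; rewrite -mulrBr normrM mulrC.
    apply: ler_pM => //; first exact: (H b a).
    by rewrite normrM expr2; apply: ler_pM => //; exact: co_le_nr.
  by rewrite sumr_const card_prod card_ord card_bool -(mulr_natl (e * _)) natrM [n%:R * 2]mulrC.
apply: (@le_trans _ _ (\sum_(a : 'I_n * bool) 2 * n%:R * (e * nr h ^+ 2))).
  by apply: ler_sum => a _; exact: step.
rewrite sumr_const card_prod card_ord card_bool -(mulr_natl (2 * _ * _)) natrM le_eqVlt; apply/orP; left; apply/eqP; ring.
Qed.

Lemma taylor_quad f z : Ck 2 f -> forall e : R, 0 < e -> exists2 d : R, 0 < d &
  forall h, nr h < d -> `|f (z + h) - tquad f z h| <= e * nr h ^+ 2.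
Proof.
move=> fC e e0; pose e1 := e / (4 * n%:R ^+ 2 + 1).
have n40 : 0 <= 4 * n%:R ^+ 2 :> R by rewrite mulr_ge0// sqr_ge0.
have n41 : 0 < 4 * n%:R ^+ 2 + 1 :> R by lra.
have e10 : 0 < e1 by rewrite divr_gt0.
have [d d0 dP] : exists2 d : R, 0 < d & forall (p : ('I_n * bool) * ('I_n * bool)) t, t < d ->
    forall y, nr (y - z) <= t -> `|hs f y p.1 p.2 - hs f z p.1 p.2| <= e1.
  apply: fin_pos => -[a b]; have ch : continuous (fun y => hs f y a b) := Ck_cont (Ck_hs a b fC).
  have /cvg_nrP/(_ e1 e10)[d d0 dP] := ch z.
  by exists d => // t td y yt; apply: ltW; apply: dP; exact: le_lt_trans td.
exists d => // h hd.
have := @taylor2 R n f z h (D2 f z h) (e * nr h ^+ 2) fC; rewrite tquadE.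
have -> : f (z + h) - (f z + D1 f z h + D2 f z h / 2) = f (z + h) - f z - D1 f z h - D2 f z h / 2.
  by rewrite !opprD !addrA.
apply=> t /andP[t0 t1].
apply: le_trans (@D2_close f z (z + rC t 0 *: h) h e1 (ltW e10) _) _.
  move=> a b; apply: (dP (a, b) _ hd); rewrite addrAC subrr add0r nrZr ger0_norm//.
  by apply: ler_piMl => //; exact: nr_ge0.
rewrite ler_wpM2r ?sqr_ge0// /e1 mulrA ler_pdivrMr// [leLHS]mulrC ler_wpM2l ?(ltW e0)//.
by rewrite lerDl.
Qed.

Definition vco (x : 'I_n * bool -> R) : V := \sum_a rC (x a) 0 *: real_dir a.

Lemma cov_vco x : cov (vco x) = x.
Proof.
apply/funext => a; rewrite /cov /vco.
have -> : co a (\sum_b rC (x b) 0 *: real_dir b) = \sum_b x b * co a (real_dir b : V).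
  elim/big_ind2: _ => [|y1 y2 z1 z2 h1 h2|b _]; first exact: co0.
    by rewrite coD h1 h2.
  by rewrite coZ.
rewrite (bigD1 a)//= big1 ?addr0; first by rewrite co_real_dir eqxx mulr1.
by move=> b ba; rewrite co_real_dir (negbTE ba) mulr0.
Qed.

(** On a circle of small radius t the discrete mean of f is that of its Taylor polynomial up to
    o(t^2), and the latter exceeds f z by t^2 [levi]/4 exactly. *)
Lemma sub_levi f z (r : R) : Ck 2 f -> 0 < r -> (forall w, nr w < r -> sub f z w) ->
  forall x, 0 <= levi (hs f z) x.
Proof.
move=> fC r0 fs x; pose w := vco x.
have key (e : R) : 0 < e -> 0 <= levi (hs f z) x / 4 + e * nr w ^+ 2.
  move=> e0; have [d d0 dP] := @taylor_quad f z fC e e0.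
  have w1 : 0 < nr w + 1 by rewrite ltr_wpDl ?nr_ge0.
  pose t := Num.min r d / 2 / (nr w + 1).
  have m0 : 0 < Num.min r d by rewrite lt_min r0.
  have t0 : 0 < t by rewrite !divr_gt0.
  have tw : nr (rC t 0 *: w) < Num.min r d.
    rewrite nrZr gtr0_norm// /t mulrAC ltr_pdivrMr//.
    apply: (@le_lt_trans _ _ (Num.min r d / 2 * (nr w + 1))).
      by rewrite ler_wpM2l ?lerDl// ltW// divr_gt0.
    by rewrite ltr_pM2r// ltr_pdivrMr// ltr_pMr// ltr1n.
  have [twr twd] : nr (rC t 0 *: w) < r /\ nr (rC t 0 *: w) < d by move: tw; rewrite lt_min => /andP[].
  have t20 : 0 < t ^+ 2 by rewrite exprn_gt0.
  suff h : 0 <= t ^+ 2 * (levi (hs f z) x / 4 + e * nr w ^+ 2) by rewrite -(pmulr_rge0 _ t20).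
  apply/ler_addgt0Pl => e1 e10; have [N NP] := fs _ twr e1 e10.
  have {}NP := NP N (leqnn _).
  have h1 : dm N f z (rC t 0 *: w) <= dm N (fun y => 1 * tquad f z y + e * (t * nr w) ^+ 2) 0 (rC t 0 *: w).
    rewrite /dm; apply: ler_wpM2l; first by rewrite invr_ge0.
    apply: ler_sum => j _; rewrite add0r mul1r.
    have nj : nr (rt N j *: (rC t 0 *: w)) = t * nr w by rewrite nrZ cnorm_rt mul1r nrZr gtr0_norm.
    have := dP (rt N j *: (rC t 0 *: w)); rewrite nj => /(_ _); rewrite ler_norml => h.
    have hh : t * nr w < d by rewrite -nj nrZ cnorm_rt mul1r.
    by have /andP[_] := h hh; rewrite lerBlDl.
  rewrite dm_lin dm_cst dm_quad mul1r in h1.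
  have q0 : tquad f z 0 = f z.
    rewrite tquadE /D1 /D2 !big1 ?mul0r ?addr0// => [a _|a _]; last by rewrite co0 mul0r.
    by rewrite big1// => b _; rewrite co0 !mul0r.
  have lt : levi (hs f z) (cov (rC t 0 *: w)) = t ^+ 2 * levi (hs f z) x.
    have E : cov (rC t 0 *: w) = (fun a => t * x a).
      by apply/funext => a; rewrite /cov coZ -[co a w]/(cov w a) cov_vco.
    rewrite /levi /bil E mulrDr !mulr_sumr; congr (_ + _); apply: eq_bigr => a _; rewrite mulr_sumr;
      apply: eq_bigr => b _; rewrite /Jv; ring.
  have h := le_trans NP (lerD h1 (lexx e1)); rewrite -/(tquad f z) q0 lt in h.
  have E2 : (t * nr w) ^+ 2 = t ^+ 2 * nr w ^+ 2 by exact: exprMn.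
  have alg (fz T X Y E : R) : E = T * Y -> fz <= fz + T * X / 4 + e * E + e1 -> 0 <= e1 + T * (X / 4 + e * Y).
    move=> -> u; have -> : T * (X / 4 + e * Y) = T * X / 4 + e * (T * Y) by ring.
    by move: u; move: (T * X / 4) (e * (T * Y)) => p q u; lra.
  exact: alg E2 h.
have w1 : 0 < nr w ^+ 2 + 1 by rewrite ltr_wpDl ?sqr_ge0.
suff : 0 <= levi (hs f z) x / 4 by rewrite pmulr_lge0// invr_gt0.
apply/ler_addgt0Pl => e e0; have e'0 : 0 < e / (nr w ^+ 2 + 1) by rewrite divr_gt0.
have := key _ e'0 => h; apply: le_trans h _; rewrite addrC lerD2r.
rewrite mulrAC ler_pdivrMr// ler_wpM2l ?(ltW e0)// lerDl; exact: ler01.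
Qed.

End local_global.

(** * Discrete means and the integral mean of the definition *)

Section circle_mean_link.
Context {R : realType} {n : nat}.
Local Notation V := (Cspace R n).
Local Notation mu := (@lebesgue_measure R).
Implicit Types (f g : V -> R) (z w : V) (N : nat) (c : Cplx R) (D K B : set V).

Definition Fc f z w : R -> R := fun t => f (z + cis t *: w).

Lemma Fc_cts f z w : continuous f -> continuous (Fc f z w).
Proof.
move=> cf t; apply/cvgrPdist_lt => e e0.
have /cvg_nrP/(_ e e0)[d d0 dP] := cf (z + cis t *: w).
have w10 : 0 < 2 * (nr w + 1) by rewrite mulr_gt0// ltr_wpDl ?nr_ge0.
near=> s; rewrite distrC; apply: dP.
have -> : z + cis s *: w - (z + cis t *: w) = (cis s - cis t) *: w.
  by rewrite opprD addrACA subrr add0r -scalerBl.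
rewrite nrZ; apply: (@le_lt_trans _ _ (2 * `|s - t| * (nr w + 1))).
  apply: ler_pM; [exact: cnorm_ge0|exact: nr_ge0|exact: cis_lip|by rewrite lerDl].
rewrite mulrAC -ltr_pdivlMl// mulrC distrC.
near: s; apply: (@cvgr_dist_lt _ R^o); [exact: cvg_id|by rewrite divr_gt0].
Unshelve. all: by end_near.
Qed.

Lemma primitive (F : R -> R) (b : R) : continuous F -> 0 < b -> exists2 G : R -> R,
  forall x, 0 <= x <= b -> dv G x (F x) &
  (\int[mu]_(t in `[0%R, b]) (F t)%:E = (G b - G 0)%:E)%E.
Proof.
move=> cF b0; pose G x := (\int[mu]_(t in [set` `[-1, x]]) (F t))%R.
have iF : mu.-integrable `[-1, b + 1] (EFin \o F).
  apply: continuous_compact_integrable; first exact: segment_compact.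
  exact: continuous_subspaceT.
have dG x : 0 <= x <= b -> dv G x (F x).
  move=> /andP[x0 xb].
  have [||dG G'] := @continuous_FTC1_closed R F (-1) x (b + 1) _ iF _ (cF x); try lra.
  by apply: dv_eq; [exact: derivable_dv|exact: G'].
exists G => //.
rewrite (@continuous_FTC2 R F G 0 b)//.
- exact: continuous_subspaceT.
- split.
  + move=> x; rewrite in_itv/= => /andP[x0 xb].
    by have [] := dG x (introT andP (conj (ltW x0) (ltW xb))).
  + by apply: cvg_at_right_filter; apply: (dv_continuous (dG 0 _)); rewrite lexx ltW.
  + by apply: cvg_at_left_filter; apply: (dv_continuous (dG b _)); rewrite lexx ltW.
- move=> x; rewrite in_itv/= => /andP[x0 xb].
  by apply: dv_derive1; apply: dG; rewrite !ltW.
Qed.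

Lemma pi20 : 0 < 2 * (pi : R).
Proof. by rewrite mulr_gt0// pi_gt0. Qed.

(** The discrete mean is a Riemann sum: on each arc the mean value theorem, applied to a primitive,
    gives a value of f close to the one at the root. *)
Lemma circle_dm f z w : continuous f -> exists2 Cm : R,
  circle_mean (fun y => (f y)%:E) z w = Cm%:E &
  forall e : R, 0 < e -> exists N0, forall N, (N0 <= N)%N -> `|Cm - dm N f z w| <= e.
Proof.
move=> cf; have cF := @Fc_cts f z w cf; have p20 := pi20.
have [G dG IG] := primitive cF p20.
exists ((2 * pi)^-1 * (G (2 * pi) - G 0)).
  by rewrite EFinM -IG.
move=> e e0.
have [d d0 dP] := unif_cont (@compact_nr_le R n (nr z + nr w)) (fun y _ => cf y) e0.
have w10 : 0 < nr w + 1 by rewrite ltr_wpDl ?nr_ge0.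
have [N0 N0P] := archi_inv (divr_gt0 d0 (mulr_gt0 (pi_gt0 R) w10)).
exists N0 => N /N0P NP.
pose M : R := (4 * N.+1)%:R.
have M0' : 0 < M by rewrite ltr0n.
pose x (j : nat) : R := 2 * pi * (j%:R / M).
have x0 : x 0%N = 0 by rewrite /x mul0r mulr0.
have xM : x (4 * N.+1)%N = 2 * pi by rewrite /x divff ?gt_eqF// mulr1.
have xS j : x j.+1 - x j = 2 * pi / M.
  by rewrite /x -natr1; field; rewrite gt_eqF.
have xle j : x j <= x j.+1 by rewrite -subr_ge0 xS divr_ge0// ltW.
have xr j : (j <= 4 * N.+1)%N -> 0 <= x j <= 2 * pi.
  move=> jN; rewrite /x mulr_ge0 ?divr_ge0 ?(ltW M0') ?(ltW p20)//=.
  by rewrite ler_piMr ?(ltW p20)// ler_pdivrMr// mul1r ler_nat.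
have step (j : 'I_(4 * N.+1)) : `|(2 * pi)^-1 * (G (x j.+1) - G (x j)) - M^-1 * f (z + rt N j *: w)| <= M^-1 * e.
  have [|s /andP[s1 s2] E] := mvt (xle j) (f := G) (df := Fc f z w).
    move=> y /andP[y1 y2]; apply: dG.
    have /andP[a1 _] := xr j (ltnW (ltn_ord j)); have /andP[_ a2] := xr j.+1 (ltn_ord j).
    by rewrite (le_trans a1 y1) (le_trans y2 a2).
  have -> : (2 * pi)^-1 * (G (x j.+1) - G (x j)) = M^-1 * Fc f z w s.
    rewrite E xS; have alg (p m q : R) : p != 0 -> m != 0 -> (2 * p)^-1 * (q * (2 * p / m)) = m^-1 * q.
      by move=> p1 m1; field; rewrite p1 m1.
    by apply: alg; rewrite gt_eqF// pi_gt0.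
  rewrite -mulrBr normrM ger0_norm ?invr_ge0 ?(ltW M0')//.
  apply: ler_wpM2l; first by rewrite invr_ge0 ltW.
  apply: ltW; apply: dP => /=.
    apply: le_trans (nrD _ _) _; rewrite lerD2l nrZ cnorm_rt mul1r; exact: lexx.
  have -> : z + cis s *: w - (z + rt N j *: w) = (cis s - cis (x j)) *: w.
    by rewrite opprD addrACA subrr add0r -scalerBl.
  rewrite nrZ; apply: (@le_lt_trans _ _ (2 * (2 * pi / M) * nr w)).
    apply: ler_wpM2r; first exact: nr_ge0.
    apply: le_trans (cis_lip _ _) _; rewrite ler_wpM2l// ger0_norm ?subr_ge0//.
    by rewrite -(xS j) lerD2r.
  have -> : 2 * (2 * pi / M) * nr w = N.+1%:R^-1 * (pi * nr w) :> R.
    rewrite /M natrM; have y0 : N.+1%:R != 0 :> R by rewrite pnatr_eq0.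
    by move: (N.+1%:R : R) y0 => y y0; field.
  move: NP; rewrite ltr_pdivlMr ?mulr_gt0 ?pi_gt0//; apply: le_lt_trans.
  by rewrite ler_wpM2l ?invr_ge0// ler_wpM2l ?lerDl// ltW// pi_gt0.
have tel : G (2 * pi) - G 0 = \sum_(j < 4 * N.+1) (G (x j.+1) - G (x j)).
  rewrite -xM -[X in _ - G X]x0 -(big_mkord xpredT (fun j => G (x j.+1) - G (x j))).
  by rewrite telescope_sumr.
rewrite tel /dm !mulr_sumr -sumrB; apply: le_trans (ler_norm_sum _ _ _) _.
apply: (@le_trans _ _ (\sum_(j < 4 * N.+1) M^-1 * e)); first by apply: ler_sum => j _; exact: step.
by rewrite -mulr_sumr mean_cst.
Qed.

Lemma disc_abs D z w : (forall s : Cplx R, `|s| <= 1 -> D (z + s *: w)) <-> disc D z w.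
Proof.
split=> h s s1; apply: h.
  by rewrite cnormE -rC1 Cplx_le.
by move: s1; rewrite cnormE -rC1 Cplx_le.
Qed.

Lemma psh_sub D (u : V -> \bar R) f z w : psh D u -> continuous f -> disc D z w ->
  (forall c, cnorm c <= 1 -> u (z + c *: w) = (f (z + c *: w))%:E) -> sub f z w.
Proof.
move=> [_ up _] cf /disc_abs dzw uf; have := up z w dzw.
have -> : u z = (f z)%:E.
  by have := uf 0; rewrite scale0r addr0; apply; rewrite /cnorm expr2 mul0r addr0 sqrtr0.
have -> : circle_mean u z w = circle_mean (fun y => (f y)%:E) z w.
  rewrite /circle_mean; congr (_ * _)%E; apply: eq_integral => t _.
  by apply: uf; rewrite cnorm_circle.
have [Cm -> CmP] := circle_dm z w cf; rewrite lee_fin => h e e0.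
have [N0 NP] := CmP e e0; exists N0 => N /NP; rewrite ler_norml => /andP[_ h2].
by apply: le_trans h _; rewrite addrC -lerBlDr.
Qed.

Lemma sub_circle f z w : continuous f -> sub f z w -> ((f z)%:E <= circle_mean (fun y => (f y)%:E) z w)%E.
Proof.
move=> cf fs; have [Cm -> CmP] := circle_dm z w cf; rewrite lee_fin.
apply/ler_addgt0Pr => e e0; have e20 : 0 < e / 2 by rewrite divr_gt0.
have [N1 P1] := fs _ e20; have [N2 P2] := CmP _ e20.
have h1 := P1 (maxn N1 N2) (leq_maxl _ _); have := P2 (maxn N1 N2) (leq_maxr _ _).
by rewrite ler_norml; move: h1; lra.
Qed.

(** Monotone convergence for the nonnegative functions -v_j on the circle. *)
Lemma lim_circle (v : nat -> V -> R) (u : V -> \bar R) z w :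
  (forall j, continuous (v j)) -> (forall j, sub (v j) z w) -> (forall j y, v j y <= 0) ->
  (forall j k y, (j <= k)%N -> v k y <= v j y) ->
  (forall y, (fun j => (v j y)%:E) @ \oo --> u y) -> (u z <= circle_mean u z w)%E.
Proof.
move=> cv sv v0 vd vu.
have uv j y : (u y <= (v j y)%:E)%E.
  apply: (cvge_le _ (vu y)); exists j => // k /= jk; rewrite lee_fin; exact: vd.
have u0 y : (u y <= 0)%E by apply: le_trans (uv 0%N y) _; rewrite lee_fin.
pose g j (t : R) : \bar R := (- v j (z + cis t *: w))%:E.
pose Iv j := (\int[mu]_(t in `[0%R, (2 * pi)%R]) g j t)%E.
have g0 j t : `[0%R, (2 * pi)%R]%classic t -> (0 <= g j t)%E by move=> _; rewrite lee_fin oppr_ge0.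
have ndg t : `[0%R, (2 * pi)%R]%classic t -> {homo g^~ t : j k / (j <= k)%N >-> (j <= k)%E}.
  by move=> _ j k jk; rewrite lee_fin lerN2; exact: vd.
have limg t : limn (g^~ t) = (- u (z + cis t *: w)%R)%E.
  apply/cvg_lim => //; have -> : g^~ t = (fun j => - (v j (z + cis t *: w)%R)%:E)%E by apply/funext => j; rewrite /g EFinN.
    by apply: cvgeN; exact: (vu (z + cis t *: w)).
have cI : (fun j => \int[mu]_(t in `[0%R, (2 * pi)%R]) g j t)%E @ \oo -->
    (\int[mu]_(t in `[0%R, (2 * pi)%R]) limn (g^~ t))%E.
  have mi : measurable (`[0%R, (2 * pi)%R]%classic : set R) by exact: measurable_itv.
  refine (@cvg_monotone_convergence _ _ R mu _ mi g _ g0 ndg) => j.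
   apply/measurable_realfun.measurable_EFinP; apply: measurable_funTS; apply: measurable_realfun.continuous_measurable_fun => t.
  by apply: cvgN; exact: (@Fc_cts (v j) z w (cv j)).
have E : (\int[mu]_(t in `[0%R, (2 * pi)%R]) limn (g^~ t) = \int[mu]_(t in `[0%R, (2 * pi)%R]) (- u (z + cis t *: w)%R))%E.
  by apply: eq_integral => t _; exact: limg.
rewrite E in cI.
have c0 : (0 <= ((2 * pi)^-1 : R)%:E)%E by rewrite lee_fin invr_ge0 ltW ?pi20.
have bd j : (((2 * pi)^-1 : R)%:E * Iv j <= - u z)%E.
  have := sub_circle (cv j) (sv j); rewrite /circle_mean.
  have -> : (\int[mu]_(t in `[0%R, (2 * pi)%R]) (v j (z + rC (cos t) (sin t) *: w)%R)%:E = - Iv j)%E.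
    rewrite /Iv -integral_ge0N; last by move=> t ht; exact: g0.
    by apply: eq_integral => t _; rewrite /g -EFinN opprK.
  by rewrite muleN leeNr => h; apply: le_trans h _; rewrite leeN2; exact: uv.
have cI2 : (fun j => ((2 * pi)^-1 : R)%:E * Iv j)%E @ \oo -->
    (((2 * pi)^-1 : R)%:E * \int[mu]_(t in `[0%R, (2 * pi)%R]) (- u (z + cis t *: w)%R))%E.
  exact: cvgeZl.
have : (((2 * pi)^-1 : R)%:E * \int[mu]_(t in `[0%R, (2 * pi)%R]) (- u (z + cis t *: w)%R) <= - u z)%E.
  by apply: (cvge_le _ cI2); exists 0%N => // j _; exact: bd.
rewrite leeNr -muleN; congr (_ <= _ * _)%E.
rewrite -integral_ge0N; last by move=> t _; rewrite leeNr oppe0.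
by apply: eq_integral => t _; rewrite oppeK.
Unshelve. all: by end_near.
Qed.

End circle_mean_link.

(** * The envelope below an obstacle: regularity and maximality *)

Section envelope.
Context {R : realType} {n : nat}.
Local Notation V := (Cspace R n).
Local Notation idx := ('I_n * bool)%type.
Implicit Types (v g h : V -> R) (z w xi : V).
(** f is at most -c0; L bounds the first differences of f and of the obstacle, La their second
    differences; d0 is the distance kept between the support of ρ and the complement of D. *)
Variables (D : set V) (f rho : V -> R) (c0 L La d0 : R).
Hypotheses (n0 : (0 < n)%N) (oD : open D) (c00 : 0 < c0) (L0 : 0 <= L) (d00 : 0 < d0).
Hypotheses (fcont : continuous f) (fneg : forall z, f z <= - c0) (fP : PC D f).
Hypotheses (fL : forall z xi, f (z + xi) - f z <= L * nr xi).
Hypotheses (f2 : forall z xi, f (z + xi) + f (z - xi) - 2 * f z <= La * nr xi ^+ 2).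
Hypotheses (rho01 : forall z, 0 <= rho z <= 1) (Kc : compact (supp rho)).
Hypothesis KD : forall x y, supp rho x -> nr (y - x) < d0 -> D y.

(** The obstacle: f off the support of ρ, which forces competitors to equal f there, and 0 where ρ =
    1, which is no constraint for negative functions. *)
Definition Hob z := (1 - rho z) * f z.

Hypotheses (HL : forall z xi, Hob (z + xi) - Hob z <= L * nr xi).
Hypotheses (H2 : forall z xi, Hob (z + xi) + Hob (z - xi) - 2 * Hob z <= La * nr xi ^+ 2).

Definition Fam v := [/\ continuous v, forall z, f z <= v z, forall z, v z <= Hob z & PC D v].

Lemma f_Hob z : f z <= Hob z.
Proof.
have := rho01 z; have := fneg z; rewrite /Hob; move: (f z) (rho z) => x y h /andP[h1 h2].
have : 0 <= y * - x by apply: mulr_ge0 => //; move: c00; lra.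
by move=> h3; rewrite mulrBl mul1r; move: h3; rewrite mulrN; lra.
Qed.

Lemma Hob_out z : ~ supp rho z -> Hob z = f z.
Proof. by move=> oz; rewrite /Hob supp_out// subr0 mul1r. Qed.

Lemma Fam_out v z : Fam v -> ~ supp rho z -> v z = f z.
Proof.
move=> [_ h1 h2 _] oz; apply/eqP; rewrite eq_le h1 andbT; apply: le_trans (h2 z) _.
by rewrite Hob_out.
Qed.

Lemma Fam_f : Fam f.
Proof. by split => // z; exact: f_Hob. Qed.

Lemma Fam_loc v : continuous v -> (forall z, f z <= v z) -> (forall z, v z <= Hob z) -> loc D v -> Fam v.
Proof. by move=> cv h1 h2 lv; split => //; exact: loc_glob. Qed.

Lemma KsubD z : supp rho z -> D z.
Proof. by move=> Kz; apply: (KD Kz); rewrite subrr nr0. Qed.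

Lemma sub_of_eq g v z w : v z = g z -> (forall y, v y <= g y) -> sub v z w -> sub g z w.
Proof. by move=> e h s; apply: (sub_le e s) => c _; exact: h. Qed.

Lemma cts_trans g xi : continuous g -> continuous (fun z => g (z + xi)).
Proof.
move=> cg z; apply/cvg_nrP => e e0; have /cvg_nrP/(_ e e0)[d d1 dP] := cg (z + xi).
by exists d => // y yz; apply: dP; rewrite opprD addrACA subrr addr0.
Qed.

(** A translate lowered by L|ξ| lies below the obstacle, and its maximum with f is again a
    competitor; where the translate would leave the support of ρ, f already dominates. This gives
    the Lipschitz bound for the envelope. *)
Lemma Fam_shift v xi : Fam v -> Fam (fun z => Num.max (v (z + xi) - L * nr xi) (f z)).
Proof.
move=> Fv; have [cv fv vH vP] := Fv; apply: Fam_loc.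
- apply: cts_max => //; apply: ctsB; [exact: cts_trans|exact: cts_cst].
- by move=> z; rewrite le_max lexx orbT.
- move=> z; rewrite ge_max f_Hob andbT lerBlDr.
  by apply: le_trans (vH _) _; rewrite -lerBlDl; exact: HL.
move=> z Dz; have [r1 r10 r1P] := PC_loc oD fP Dz.
have fcase w : Num.max (v (z + xi) - L * nr xi) (f z) = f z -> nr w < r1 ->
    sub (fun z => Num.max (v (z + xi) - L * nr xi) (f z)) z w.
  move=> e wr; apply: (@sub_of_eq _ f) => [|y|]; first by rewrite e.
    by rewrite le_max lexx orbT.
  exact: r1P.
have [Kx|oK] := pselect (supp rho (z + xi)); last first.
  exists r1 => // w; apply: fcase; apply/max_idPr; rewrite (Fam_out Fv oK) lerBlDl -lerBlDr.
  exact: fL.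
have [r2 r20 r2P] := PC_loc oD vP (KsubD Kx).
exists (Num.min r1 r2); first by rewrite lt_min r10.
move=> w; rewrite lt_min => /andP[wr1 wr2].
have [e|e] := leP (v (z + xi) - L * nr xi) (f z); first by apply: fcase => //; exact/max_idPr.
apply: (@sub_of_eq _ (fun y => 1 * v (y + xi) + (- (L * nr xi)))) => [|y|].
- by rewrite mul1r (max_idPl _)// ltW.
- by rewrite mul1r le_max lexx.
- by apply: sub_lin => //; [apply: sub_shift; exact: r2P|exact: sub_cst].
Qed.

Definition vs z : R := sup [set v z | v in Fam].

Lemma vs_has z : has_sup [set v z | v in Fam].
Proof.
split; first by exists (f z), f => //; exact: Fam_f.
by exists (Hob z) => _ [v [_ _ h _] <-].
Qed.

Lemma vs_ub v z : Fam v -> v z <= vs z.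
Proof. by move=> Fv; apply: ub_le_sup; [case: (vs_has z)|exists v]. Qed.

Lemma vs_near z (e : R) : 0 < e -> exists2 v, Fam v & vs z - e < v z.
Proof.
move=> e0; have [_ [v Fv <-] h] := sup_adherent e0 (vs_has z); by exists v.
Qed.

Lemma vs_le z (b : R) : (forall v, Fam v -> v z <= b) -> vs z <= b.
Proof.
by move=> h; apply: ge_sup; [case: (vs_has z)|move=> _ [v Fv <-]; exact: h].
Qed.

Lemma vs_lip z xi : vs (z + xi) - vs z <= L * nr xi.
Proof.
rewrite lerBlDr; apply: vs_le => v Fv; rewrite -lerBlDl.
apply: le_trans (vs_ub z (Fam_shift xi Fv)); by rewrite le_max lexx.
Qed.

Lemma vs_lip2 z y : `|vs y - vs z| <= L * nr (y - z).
Proof.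
have h1 := vs_lip z (y - z); have h2 := vs_lip y (z - y).
have e1 : z + (y - z) = y by rewrite addrC subrK.
have e2 : y + (z - y) = z by rewrite addrC subrK.
rewrite e1 in h1; rewrite e2 nrB in h2.
by rewrite ler_norml h1 andbT -lerN2 opprK opprB.
Qed.

Lemma vs_cts : continuous vs.
Proof.
move=> z; apply/cvg_nrP => e e0; have L1 : 0 < L + 1 by move: L0; lra.
exists (e / (L + 1)); first by rewrite divr_gt0.
move=> y; rewrite ltr_pdivlMr// => h; apply: le_lt_trans (vs_lip2 _ _) _.
by apply: le_lt_trans h; rewrite mulrC ler_wpM2l ?nr_ge0// lerDl.
Qed.

Lemma Fam_vs : Fam vs.
Proof.
split; [exact: vs_cts|by move=> z; exact: vs_ub Fam_f|by move=> z; apply: vs_le => v []|].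
move=> z w dzw e e0; have e20 : 0 < e / 2 by rewrite divr_gt0.
have [v Fv vz] := vs_near z e20; have [_ _ _ vP] := Fv.
have [N0 NP] := vP z w dzw _ e20; exists N0 => N /NP h.
have h2 : dm N v z w <= dm N vs z w by apply: dm_le => c _; exact: vs_ub.
by move: vz h h2; move: (vs z) (v z) (dm _ _ _ _) (dm _ _ _ _) => *; lra.
Qed.

(** The mean of two opposite translates of the envelope, lowered by half of La|ξ|^2, lies below the
    obstacle. Its maximum with f is a competitor, hence at most the envelope. *)
Lemma vs_semi z xi : 2 * nr xi < d0 -> vs (z + xi) + vs (z - xi) - 2 * vs z <= La * nr xi ^+ 2.
Proof.
move=> xd; have [cv fv vH vP] := Fam_vs.
pose cc := La * nr xi ^+ 2 / 2.
pose g y := 2^-1 * vs (y + xi) + (2^-1 * vs (y - xi) + (- cc)).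
suff Fg : Fam (fun y => Num.max (g y) (f y)).
  have : g z <= vs z by apply: le_trans (vs_ub z Fg); rewrite le_max lexx.
  by rewrite /g /cc; move: (La * _) (vs _) (vs _) (vs _) => *; lra.
have gf z' : ~ supp rho (z' + xi) -> ~ supp rho (z' - xi) -> g z' <= f z'.
  move=> o1 o2; rewrite /g (Fam_out Fam_vs o1) (Fam_out Fam_vs o2) /cc.
  by have := f2 z' xi; move: (La * _) (f _) (f _) (f _) => *; lra.
apply: Fam_loc.
- apply: cts_max => //; apply: ctsD; first by apply: ctsMl; exact: cts_trans.
  by apply: ctsD; [apply: ctsMl; exact: cts_trans|exact: cts_cst].
- by move=> y; rewrite le_max lexx orbT.
- move=> y; rewrite ge_max f_Hob andbT /g /cc.
  by have := H2 y xi; have := vH (y + xi); have := vH (y - xi);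
    move: (La * _) (Hob _) (Hob _) (Hob _) (vs _) (vs _) => *; lra.
move=> y Dy; have [r1 r10 r1P] := PC_loc oD fP Dy.
have [e|e] := leP (g y) (f y).
  exists r1 => // w wr; apply: (@sub_of_eq _ f) => [|y'|]; [by rewrite (max_idPr _)| |exact: r1P].
  by rewrite le_max lexx orbT.
(* By [gf] one of y ± ξ lies in the support of ρ; the other is at distance at most 2|ξ| < d0 from
   it, so both belong to D. *)
have [D1 D2] : D (y + xi) /\ D (y - xi).
  have n2 : nr (xi + xi) < d0.
    apply: le_lt_trans (nrD _ _) _; by rewrite -mulr2n -mulr_natl.
  have [Kx|o1] := pselect (supp rho (y + xi)).
    split; first exact: KsubD.
    apply: (KD Kx); rewrite opprD addrACA subrr add0r -opprD nrN; exact: n2.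
  have [Kx|o2] := pselect (supp rho (y - xi)); last by have := gf y o1 o2; rewrite leNgt e.
  split; last exact: KsubD.
  by apply: (KD Kx); rewrite opprD opprK addrACA subrr add0r.
have [r2 r20 r2P] := PC_loc oD vP D1; have [r3 r30 r3P] := PC_loc oD vP D2.
exists (Num.min r2 r3); first by rewrite lt_min r20.
move=> w; rewrite lt_min => /andP[w2 w3].
apply: (@sub_of_eq _ g) => [|y'|]; [by rewrite (max_idPl _)// ltW|by rewrite le_max lexx|].
have i2 : 0 <= 2^-1 :> R by rewrite invr_ge0.
apply: (@sub_lin R n _ (fun y => vs (y + xi))) => //; first by apply: sub_shift; exact: r2P.
apply: (@sub_lin R n _ (fun y => vs (y - xi))) => //; first by apply: sub_shift; exact: r3P.
exact: sub_cst.
Qed.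

(** The maximum principle on the support of ρ, off which the envelope equals f. *)
Lemma vs_neg z : vs z <= - c0.
Proof.
have [cv fv vH vP] := Fam_vs.
have out y : ~ supp rho y -> vs y <= - c0 by move=> oy; rewrite (Fam_out Fam_vs oy).
have [Kz|/out//] := pselect (supp rho z).
apply: (@maxp R n (supp rho) set0 vs) => // y Ky _.
have [r r0 rP] := PC_loc oD vP (KsubD Ky).
exists r => // w wr; split; first exact: rP.
by move=> c _; have [|/out] := pselect (supp rho (y + c *: w)); [left|right].
Qed.

Lemma sub_quad (r : R) (l : idx -> R) (M : idx -> idx -> R) z w :
  (forall x, 0 <= levi M x) -> sub (quad r l M) z w.
Proof.
move=> M0 e e0; exists 0%N => N _; rewrite dm_quad -addrA lerDl addr_ge0 ?(ltW e0)//.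
by rewrite divr_ge0.
Qed.

Lemma quad_pert (a b g : R) l (M : idx -> idx -> R) y :
  quad (a + b) l (fun s t => - (2 * g) * delta s t + M s t) y = quad a l M y + b - g * N2 y.
Proof.
have bE : bil (fun s t => - (2 * g) * delta s t + M s t) (cov y) (cov y) =
    - (2 * g) * N2 y + bil M (cov y) (cov y).
  rewrite /bil /N2 mulr_sumr -big_split; apply: eq_bigr => s _ /=.
  rewrite (eq_bigr (fun t => delta s t * (- (2 * g) * co s y * co t y) + cov y s * M s t * cov y t)).
    by rewrite big_split/= sumr_delta; congr (_ + _); rewrite expr2; ring.
  by move=> t _; rewrite /cov; ring.
by rewrite /quad bE; move: (bil _ _ _) (\sum_s _) (N2 y) => *; field.
Qed.

(** If the envelope were close on a ball to a polynomial with Levi form at least 4γ|x|^2, then this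
    polynomial minus γ [N2] and raised by b would still be plurisubharmonic, above the envelope at
    the centre and below it on the sphere. Gluing by a maximum yields a competitor larger than the
    envelope. *)
Lemma no_bump (z0 : V) (r sg ga a : R) (l : idx -> R) (M : idx -> idx -> R) : 0 < r -> 0 < ga ->
  (forall y, nr (y - z0) <= r -> D y /\ rho y = 1) ->
  (forall x, 4 * ga * (\sum_s x s ^+ 2) <= levi M x) ->
  2 * sg < ga * r ^+ 2 -> ga * r ^+ 2 <= c0 ->
  (forall y, nr (y - z0) <= r -> `|vs y - quad a l M (y - z0)| <= sg) -> False.
Proof.
move=> r0 ga0 zB ML s1 s2 vq; have [cv fv vH vP] := Fam_vs.
(* Half of γ r^2: the gain b at the centre and the loss γ r^2 - b on the sphere both exceed the
   error [sg]. *)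
pose b := ga * r ^+ 2 / 2.
pose M' s t := - (2 * ga) * delta s t + M s t.
pose q y := quad (a + b) l M' (y - z0).
have qE y : q y = quad a l M (y - z0) + b - ga * N2 (y - z0) by exact: quad_pert.
have M'0 x : 0 <= levi M' x.
  by rewrite levi_lin levi_delta; have := ML x; move: (\sum_s _) (levi _ _) => X Y h => *; lra.
have qs z w : sub q z w.
  by apply: (@sub_shift R n (quad (a + b) l M') z w (- z0)); exact: sub_quad.
have qle y : nr (y - z0) <= r -> q y <= vs y + ga * r ^+ 2.
  move=> yr; have := vq y yr; rewrite ler_norml qE => /andP[h _].
  have : 0 <= ga * N2 (y - z0) by rewrite mulr_ge0 ?N2_ge0// ltW.
  by move: h s1; rewrite /b; move: (quad _ _ _ _) (vs y) (ga * N2 _) (ga * r ^+ 2) => *; lra.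
have qlt y : nr (y - z0) = r -> q y < vs y.
  move=> yr; have := vq y; rewrite yr lexx => /(_ isT); rewrite ler_norml qE => /andP[h _].
  have : ga * r ^+ 2 <= ga * N2 (y - z0) by rewrite ler_wpM2l ?(ltW ga0)// -yr; exact: nr_N2.
  by move: h s1; rewrite /b; move: (quad _ _ _ _) (vs y) (ga * N2 _) (ga * r ^+ 2) => *; lra.
pose h y := if nr (y - z0) < r then Num.max (vs y) (q y) else vs y.
have vh y : vs y <= h y by rewrite /h; case: ifP => _ //; rewrite le_max lexx.
have cq : continuous q.
  apply: cts_trans; rewrite /quad; apply: ctsD.
    by apply: ctsD; [exact: cts_cst|apply: cts_sum => s; apply: ctsMl; exact: (Ck_cont (Ck_co 0 s))].
  have -> : (fun y => bil M' (cov y) (cov y) / 2) = (fun y : V => \sum_s \sum_t 2^-1 * (co s y * M' s t * co t y)).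
    apply/funext => y; rewrite /bil mulr_suml; apply: eq_bigr => s _; rewrite mulr_suml.
    by apply: eq_bigr => t _; rewrite mulrC.
  apply: cts_sum => s; apply: cts_sum => t; apply: ctsMl; apply: ctsM; last exact: (Ck_cont (Ck_co 0 t)).
  by apply: ctsM; [exact: (Ck_cont (Ck_co 0 s))|exact: cts_cst].
have cm : continuous (fun y => Num.max (vs y) (q y)) by exact: cts_max.
have ch : continuous h.
  move=> y; apply/cvg_nrP => e e0; have [yr|ry|yr] := ltgtP (nr (y - z0)) r.
  - have /cvg_nrP/(_ e e0)[d d0' dP] := cm y.
    exists (Num.min d (r - nr (y - z0))); first by rewrite lt_min d0' subr_gt0.
    move=> x; rewrite lt_min => /andP[x1 x2].
    have xr : nr (x - z0) < r.
      by apply: le_lt_trans (nr_triangle _ y _) _; rewrite -ltrBrDr.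
    by rewrite /h yr xr; exact: dP.
  - have /cvg_nrP/(_ e e0)[d d0' dP] := cv y.
    exists (Num.min d (nr (y - z0) - r)); first by rewrite lt_min d0' subr_gt0.
    move=> x; rewrite lt_min => /andP[x1 x2].
    have xr : (nr (x - z0) < r) = false.
      apply/negbTE; rewrite -leNgt; have := nr_triangle y x z0; rewrite (nrB y x).
      by move: x2; move: (nr _) (nr _) (nr _) => *; lra.
    by rewrite /h (ltNge (nr (y - z0))) (ltW ry) xr; exact: dP.
  - have g0 : 0 < (vs y - q y) / 2 by rewrite divr_gt0// subr_gt0 qlt.
    have /cvg_nrP/(_ e e0)[d1 d10 d1P] := cv y.
    have /cvg_nrP/(_ _ g0)[d2 d20 d2P] := cv y.
    have /cvg_nrP/(_ _ g0)[d3 d30 d3P] := cq y.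
    exists (Num.min d1 (Num.min d2 d3)); first by rewrite !lt_min d10 d20.
    move=> x; rewrite !lt_min => /and3P[/d1P x1 /d2P x2 /d3P x3].
    have qx : q x <= vs x.
      by move: x2 x3; rewrite !ltr_distl => /andP[x2 _] /andP[_ x3]; lra.
    by rewrite /h yr ltxx (max_idPl qx) if_same.
have Fh : Fam h.
  apply: Fam_loc => //; first by move=> y; exact: le_trans (fv y) (vh y).
    move=> y; rewrite /h; case: ifP => [yr|_]; last exact: vH.
    (* Where ρ = 1 the obstacle is 0, and q is at most -c0 + γ r^2 ≤ 0. *)
    rewrite ge_max vH /=; have [_ r1] := zB y (ltW yr).
    rewrite /Hob r1 subrr mul0r; apply: le_trans (qle y (ltW yr)) _.
    by have := vs_neg y; move: s2; lra.
  move=> z Dz; have [r1 r10 r1P] := PC_loc oD vP Dz.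
  have vcase w : h z = vs z -> nr w < r1 -> sub h z w.
    by move=> e wr; apply: (@sub_of_eq _ vs) => //; exact: r1P.
  have [zr|zr] := ltP (nr (z - z0)) r; last first.
    by exists r1 => // w; apply: vcase; rewrite /h ltNge zr.
  have [e|e] := leP (q z) (vs z).
    by exists r1 => // w; apply: vcase; rewrite /h zr (max_idPl e).
  exists (r - nr (z - z0)); first by rewrite subr_gt0.
  move=> w wr; apply: (@sub_le _ _ q); [|exact: qs|].
    by rewrite /h zr (max_idPr (ltW e)).
  move=> c c1; rewrite /h; have -> : nr (z + c *: w - z0) < r.
    have -> : z + c *: w - z0 = z - z0 + c *: w by rewrite addrAC.
    by apply: le_lt_trans (nrD _ _) _; rewrite nrZ c1 mul1r -ltrBrDl.
  by rewrite le_max lexx orbT.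
have := vs_ub z0 Fh; rewrite /h subrr nr0 r0 ge_max => /andP[_].
have := vq z0; rewrite subrr nr0 => /(_ (ltW r0)); rewrite ler_norml qE subrr => /andP[_ h1].
have N20 : N2 (0 : V) = 0 by rewrite /N2 big1// => s _; rewrite co0 expr2 mul0r.
rewrite N20 mulr0 subr0; move: h1 s1; rewrite /b; move: (quad _ _ _ _) (vs z0) (ga * r ^+ 2) => *; lra.
Qed.

End envelope.

(** * Second derivatives in mean square *)

Section square_integral.
Context {R : realType} {n : nat}.
Local Notation V := (Cspace R n).
Local Notation idx := ('I_n * bool)%type.
Local Notation I := (@Cintegral R n).
Implicit Types (f g u v rho kap : V -> R) (z w h : V).

Definition S2 u : R := I (fun z => u z ^+ 2).

Lemma Cc_sq u : Cc u -> Cc (fun z => u z ^+ 2).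
Proof. by move=> uc; apply: (CcMc uc); case: uc. Qed.

Lemma S2_par u v : Cc u -> Cc v -> S2 (fun z => u z - v z) + S2 (fun z => u z + v z) = 2 * S2 u + 2 * S2 v.
Proof.
move=> uc vc; have c1 := Cc_sq (CcB uc vc); have c2 := Cc_sq (CcD uc vc).
have c3 := Cc_sq uc; have c4 := Cc_sq vc.
rewrite /S2 -I_D// -!I_Ml// -I_D; [|exact: CcMl|exact: CcMl].
by congr I; apply/funext => z; ring.
Qed.

Lemma S2Z (r : R) u : Cc u -> S2 (fun z => r * u z) = r ^+ 2 * S2 u.
Proof.
move=> uc; rewrite /S2 -I_Ml; last exact: Cc_sq.
by congr I; apply/funext => z; rewrite exprMn.
Qed.

Lemma S2_shift u h : Cc u -> S2 (fun z => u (z + h)) = S2 u.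
Proof. by move=> uc; rewrite /S2 -(I_shift h (Cc_sq uc)). Qed.

Lemma S2_close (M B : R) : exists2 C : R, 0 <= C & forall u v (t : R), Cc u -> Cc v -> bsupp M u -> bsupp M v ->
  (forall z, `|u z| <= B) -> (forall z, `|v z| <= B) -> 0 <= t -> (forall z, `|u z - v z| <= t) ->
  S2 u <= S2 v + C * t.
Proof.
have [C C0 CP] := @I_bound R n M.
exists (C * (2 * `|B|)); first by rewrite !mulr_ge0.
move=> u v t uc vc uM vM uB vB t0 uv.
have c : Cc (fun z => u z ^+ 2 - v z ^+ 2) by apply: CcB; exact: Cc_sq.
have := CP _ (2 * `|B| * t) c; rewrite I_B; [|exact: Cc_sq|exact: Cc_sq].
move=> h; rewrite -lerBlDl -!mulrA [2 * _]mulrA; apply: le_trans (ler_norm _) _; apply: h.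
  by move=> z Mz; rewrite uM// vM// subrr.
move=> z; have -> : u z ^+ 2 - v z ^+ 2 = (u z + v z) * (u z - v z) by ring.
rewrite normrM; apply: ler_pM => //; apply: le_trans (ler_normD _ _) _.
rewrite mulr2n mulrDl mul1r; apply: lerD; [apply: le_trans (uB z) _|apply: le_trans (vB z) _]; exact: ler_norm.
Qed.

Lemma sq_convex (J : eqType) (s : seq J) (c x : J -> R) : (forall j, 0 <= c j) -> \sum_(j <- s) c j = 1 ->
  (\sum_(j <- s) c j * x j) ^+ 2 <= \sum_(j <- s) c j * x j ^+ 2.
Proof.
move=> c0 c1; set m := \sum_(j <- s) c j * x j.
have h : 0 <= \sum_(j <- s) c j * (x j - m) ^+ 2.
  by apply: sumr_ge0 => j _; rewrite mulr_ge0// sqr_ge0.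
have e : \sum_(j <- s) c j * (x j - m) ^+ 2 = \sum_(j <- s) c j * x j ^+ 2 - 2 * m * m + m ^+ 2 * 1.
  transitivity (\sum_(j <- s) (c j * x j ^+ 2 + ((- (2 * m)) * (c j * x j) + m ^+ 2 * c j))).
    by apply: eq_bigr => j _; ring.
  by rewrite big_split/= big_split/= -!mulr_sumr c1 -/m; ring.
by move: h; rewrite e; move: (\sum_(j <- s) _) => X; nra.
Qed.

Definition unifm (d t : R) u := forall x y, nr (y - x) < d -> `|u y - u x| <= t.

Lemma cnv_close (e t : R) rho u v : mollifier e rho -> continuous u -> continuous v ->
  (forall z, `|u z - v z| <= t) -> forall z, `|cnv rho u z - cnv rho v z| <= t.
Proof.
move=> m cu cv uv z; have rc := moll_Cc m.
have ge (f g : V -> R) : continuous f -> continuous g -> (forall z, f z <= g z + t) ->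
    cnv rho f z <= cnv rho g z + t.
  move=> cf cg fg; have ct : continuous (fun _ : V => t) by exact: cts_cst.
  have := @conv_le R n rho f (fun w => g w + t) z rc (moll_ge0 m) cf (ctsD cg ct).
  rewrite (convD z rc cg ct).
  by rewrite (conv_cst t z rc (moll_I m)); apply => w _; exact: fg.
rewrite ler_norml; apply/andP; split.
  rewrite lerBrDr addrC; have := ge _ _ cv cu; rewrite -lerBlDr => h; apply: h => y.
  by have := uv y; rewrite ler_norml; lra.
by rewrite lerBlDl; apply: ge => // y; have := uv y; rewrite ler_norml; lra.
Qed.

Lemma cnv_unifm (e d t : R) rho u : mollifier e rho -> continuous u -> unifm d t u -> unifm d t (cnv rho u).
Proof.
move=> m cu uu x y xy.
have -> : cnv rho u y = cnv rho (fun w => u (w + (y - x))) x by rewrite conv_shift addrC subrK.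
have c1 : continuous (fun w => u (w + (y - x))).
  move=> z; apply/cvg_nrP => r r0; have /cvg_nrP/(_ r r0)[d' d0 dP] := cu (z + (y - x)).
  by exists d' => // z' zz; apply: dP; rewrite opprD addrACA subrr addr0.
apply: (cnv_close m c1 cu) => z; apply: uu.
by rewrite addrAC subrr add0r.
Qed.

Lemma cnv_bounded (e B : R) rho u : mollifier e rho -> continuous u -> (forall z, `|u z| <= B) ->
  forall z, `|cnv rho u z| <= B.
Proof.
move=> m cu uB z; have c0 : continuous (fun _ : V => 0 : R) by exact: cts_cst.
have := @cnv_close e B rho u (fun=> 0) m cu c0 _ z.
rewrite (conv_cst 0 z (moll_Cc m) (moll_I m)) subr0; apply => y; by rewrite subr0.
Qed.

Lemma Cc_unifm u (t : R) : Cc u -> 0 < t -> exists2 d : R, 0 < d & unifm d t u.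
Proof.
move=> uc t0; have [d d0 dP] := Cc_unif uc t0; exists d => // x y xy.
by apply: ltW; exact: dP.
Qed.

Lemma ler_eps (x y : R) (C : R) : 0 <= C -> (forall t, 0 < t -> x <= y + C * t) -> x <= y.
Proof.
move=> C0 h; apply/ler_addgt0Pr => e e0; have C1 : 0 < C + 1 by lra.
apply: le_trans (h (e / (C + 1)) (divr_gt0 e0 C1)) _; rewrite lerD2l.
by rewrite mulrA ler_pdivrMr// [C * e]mulrC ler_pM2l// lerDl.
Qed.

(** Jensen's inequality for the finite averages of translates that approximate the mollification. *)
Lemma S2_cnv (e : R) rho u : mollifier e rho -> Cc u -> S2 (cnv rho u) <= S2 u.
Proof.
move=> m uc; have [cu [M uM]] := uc; have [B B0 uB] := Cc_bounded uc.
have rc := moll_Cc m; have rM := moll_bsupp m.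
have cM := conv_bsupp rM uM; have cc := conv_Cc rc uc.
have [C C0 CP] := S2_close (e + M) B.
have cB := cnv_bounded m cu uB.
apply: (ler_eps C0) => t t0; have [d d0 dP] := Cc_unifm uc t0.
have [s [c [c0 c1 sE cP]]] := conv_average m d0.
pose A z := \sum_(w <- s) c w * u (z + w).
have us w : Cc (fun z => u (z + w)) by exact: Cc_shift.
have Ac : Cc A by apply: Cc_sum => w; exact: CcMl.
have AM : bsupp (e + M) A.
  move=> z Mz; rewrite /A big_seq big1// => w ws; rewrite uM ?mulr0//.
  have := nr_ler_sub z (- w); rewrite opprK nrN => h; apply: le_trans h.
  by have := sE w ws; move: Mz; lra.
have AB z : `|A z| <= B.
  apply: le_trans (ler_norm_sum _ _ _) _; rewrite -[leRHS]mul1r -c1 mulr_suml.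
  by apply: ler_sum => w _; rewrite normrM (ger0_norm (c0 w)) ler_wpM2l.
have h := CP _ _ t cc Ac cM AM cB AB (ltW t0) (fun z => cP u t cu dP z).
apply: le_trans h _; rewrite lerD2r.
have -> : S2 u = \sum_(w <- s) c w * S2 (fun z => u (z + w)).
  rewrite (eq_bigr (fun w => c w * S2 u)); last by move=> w _; rewrite S2_shift.
  by rewrite -mulr_suml c1 mul1r.
have -> : \sum_(w <- s) c w * S2 (fun z => u (z + w)) = I (fun z => \sum_(w <- s) c w * u (z + w) ^+ 2).
  rewrite I_sum; last by move=> w; apply: CcMl; exact: (Cc_sq (us w)).
  by apply: eq_bigr => w _; rewrite I_Ml//; exact: (Cc_sq (us w)).
apply: I_le; first exact: Cc_sq.
  by apply: Cc_sum => w; apply: CcMl; exact: (Cc_sq (us w)).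
by move=> z; exact: sq_convex.
Qed.

(** One mollification is replaced by a finite average of translates, which commutes with the
    other. *)
Lemma cnv_comm (e1 e2 : R) r1 r2 u : mollifier e1 r1 -> mollifier e2 r2 -> Cc u ->
  cnv r1 (cnv r2 u) = cnv r2 (cnv r1 u).
Proof.
move=> m1 m2 uc; have cu : continuous u by case: uc.
have c1 := conv_Cc (moll_Cc m1) uc; have c2 := conv_Cc (moll_Cc m2) uc.
have cu1 : continuous (cnv r1 u) by case: c1.
have cu2 : continuous (cnv r2 u) by case: c2.
apply/funext => z; apply/eqP; rewrite -subr_eq0 -normr_le0.
apply: (@ler_eps _ _ 2) => // t t0; have [d d0 dP] := Cc_unifm uc t0.
have [s [c [c0 c1' sE cP]]] := conv_average m1 d0.
have us w : continuous (fun z => u (z + w)) by case: (Cc_shift w uc).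
have E : \sum_(w <- s) c w * cnv r2 u (z + w) = cnv r2 (fun y => \sum_(w <- s) c w * u (y + w)) z.
  rewrite (@conv_sum R n r2 V s c (fun w y => u (y + w)) z (moll_Cc m2) us).
  by apply: eq_bigr => w _; rewrite conv_shift.
have h1 := cP _ t cu2 (cnv_unifm m2 cu dP) z.
have cA : continuous (fun y : V => \sum_(w <- s) c w * u (y + w)) by apply: cts_sum => w; exact: ctsMl.
have h2 := cnv_close m2 cu1 cA (fun y => cP u t cu dP y) z.
rewrite E in h1; rewrite add0r mulr2n mulrDl mul1r.
apply: le_trans (ler_distD (cnv r2 (fun y => \sum_(w <- s) c w * u (y + w)) z) _ _) _.
by apply: lerD => //; rewrite distrC.
Qed.

Definition H2 u : R := \sum_(p : idx * idx) S2 (fun z => hs u z p.1 p.2).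

Lemma hs_cnv (e : R) rho u z a b : mollifier e rho -> Ck 2 u -> Cc u ->
  hs (cnv rho u) z b a = cnv rho (fun y => hs u y b a) z.
Proof.
move=> m uC uc; have rc := moll_Cc m; have u1 : Ck 1 u := CkW (isT : (1 <= 2)%N) uC.
have e1 : pderiv a (cnv rho u) = cnv rho (pderiv a u).
  by apply/funext => y; exact: (pderiv_conv a y rc u1 uc).
have [c1 _] := Cc_pderiv a u1 uc.
by rewrite /hs e1 (pderiv_conv b z rc (Ck_pderiv a uC) c1).
Qed.

Lemma H2_cnv (e : R) rho u : mollifier e rho -> Ck 2 u -> Cc u -> H2 (cnv rho u) <= H2 u.
Proof.
move=> m uC uc; apply: ler_sum => p _.
have -> : (fun z => hs (cnv rho u) z p.1 p.2) = cnv rho (fun y => hs u y p.1 p.2).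
  apply/funext => z; exact: (hs_cnv z p.2 p.1 m uC uc).
by apply: (S2_cnv m); exact: Cc_hs.
Qed.

Lemma hsB u v z : Ck 2 u -> Ck 2 v -> hs (fun z => u z - v z) z = (fun b a => hs u z b a - hs v z b a).
Proof.
move=> uC vC; have := @hs_lin R n (-1) v u z vC uC.
have -> : (fun z => -1 * v z + u z) = (fun z => u z - v z) by apply/funext => y; ring.
have alg (x y : R) : -1 * x + y = y - x by ring.
by move=> ->; apply/funext => b; apply/funext => a; exact: alg.
Qed.

Lemma lin2 (J : finType) (c : R) (F G : J -> R) : \sum_j (c * F j + c * G j) = c * \sum_j F j + c * \sum_j G j.
Proof. by rewrite big_split/= -!mulr_sumr. Qed.

Lemma H2_par u v : Ck 2 u -> Cc u -> Ck 2 v -> Cc v ->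
  H2 (fun z => u z - v z) + 4 * H2 (fun z => 2^-1 * u z + 2^-1 * v z) = 2 * H2 u + 2 * H2 v.
Proof.
move=> uC uc vC vc.
have E (p : idx * idx) : S2 (fun z => hs (fun z => u z - v z) z p.1 p.2) +
    4 * S2 (fun z => hs (fun z => 2^-1 * u z + 2^-1 * v z) z p.1 p.2) =
    2 * S2 (fun z => hs u z p.1 p.2) + 2 * S2 (fun z => hs v z p.1 p.2); last first.
  rewrite /H2 [4 * _]mulr_sumr -[LHS]big_split/= (eq_bigr _ (fun p _ => E p)).
  exact: (lin2 _ (fun p : idx * idx => S2 (fun z => hs u z p.1 p.2)) (fun p => S2 (fun z => hs v z p.1 p.2))).
have c1 := Cc_hs p.2 p.1 uC uc; have c2 := Cc_hs p.2 p.1 vC vc.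
rewrite -(S2_par c1 c2); congr (_ + _).
  by congr S2; apply/funext => z; rewrite hsB.
have -> : (fun z => hs (fun z => 2^-1 * u z + 2^-1 * v z) z p.1 p.2) =
    (fun z => 2^-1 * (hs u z p.1 p.2 + hs v z p.1 p.2)).
  apply/funext => z; rewrite (@hs_lin R n 2^-1 u (fun z => 2^-1 * v z) z uC (CkMl _ vC)).
  have := @hs_lin R n 2^-1 v (fun=> 0) z vC (Ck_cst 2 0).
  have -> : (fun z => 2^-1 * v z + 0) = (fun z => 2^-1 * v z) by apply/funext => y; rewrite addr0.
  move=> ->; have -> : hs (fun=> 0 : R) z p.1 p.2 = 0.
    rewrite /hs; have -> : pderiv p.2 (fun=> 0 : R) = (fun=> 0) by apply/funext => y; exact: pderiv_cst.
    exact: pderiv_cst.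
  have alg (c x y : R) : c * x + (c * y + 0) = c * (x + y) by ring.
  exact: alg.
rewrite S2Z; last exact: CcD.
by rewrite mulrA (_ : 4 * 2^-1 ^+ 2 = 1) ?mul1r//; field.
Qed.

Lemma moll_avg (e : R) r1 r2 : mollifier e r1 -> mollifier e r2 ->
  mollifier e (fun z => 2^-1 * r1 z + 2^-1 * r2 z).
Proof.
move=> m1 m2; have c1 := moll_Cc m1; have c2 := moll_Cc m2.
have i2 : 0 <= 2^-1 :> R by rewrite invr_ge0.
split.
- have /smoothP s1 := moll_smooth m1; have /smoothP s2 := moll_smooth m2.
  by apply/smoothP => k; apply: CkD; exact: CkMl.
- by move=> w; rewrite addr_ge0// mulr_ge0// ?(moll_ge0 m1)// (moll_ge0 m2).
- rewrite I_D; [|exact: CcMl|exact: CcMl]; rewrite !I_Ml// (moll_I m1) (moll_I m2); by field.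
- move=> w; have [h1|h1] := eqVneq (r1 w) 0; last by move=> _; exact: (moll_supp m1).
  have [h2|h2] := eqVneq (r2 w) 0; last by move=> _; exact: (moll_supp m2).
  by rewrite h1 h2 !mulr0 addr0 eqxx.
Qed.

Lemma cnv_avg (e : R) r1 r2 u z : mollifier e r1 -> mollifier e r2 -> continuous u ->
  cnv (fun z => 2^-1 * r1 z + 2^-1 * r2 z) u z = 2^-1 * cnv r1 u z + 2^-1 * cnv r2 u z.
Proof.
move=> m1 m2 cu; have c1 := conv_Cc_integrand z (moll_Cc m1) cu.
have c2 := conv_Cc_integrand z (moll_Cc m2) cu.
rewrite /cnv -!I_Ml// -I_D; [|exact: CcMl|exact: CcMl].
by congr I; apply/funext => w; rewrite mulrDl !mulrA.
Qed.

Lemma moll_wider (e e' : R) r : e <= e' -> mollifier e (r : V -> R) -> mollifier e' r.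
Proof.
move=> ee [h1 h2 h3 h4]; split => // w rw; exact: lt_le_trans (h4 w rw) ee.
Qed.

Lemma smooth_Ck k u : smooth u -> Ck k u. Proof. by move=> /smoothP. Qed.

Lemma H2_cnv_lim u : Ck 2 u -> Cc u -> forall t : R, 0 < t -> exists2 e : R, 0 < e &
  forall e' rho, e' <= e -> mollifier e' rho -> H2 u <= H2 (cnv rho u) + t.
Proof.
move=> uC uc t t0; have [M uM] : exists M, bsupp M u by case: uc.
have hM p : bsupp (M + 1 + 1) (fun z => hs u z p.1 p.2).
  have [c1 b1] := Cc_pderiv p.2 (CkW (isT : (1 <= 2)%N) uC) uc.
  have [c2 b2] := Cc_pderiv p.1 (Ck_pderiv p.2 uC) c1.
  by apply: b2; apply: b1.
pose m : R := #|{: idx * idx}|%:R + 1.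
have m0 : 0 < m by rewrite ltr_wpDl.
have [e e0 eP] : exists2 e : R, 0 < e & forall (p : idx * idx) e', e' < e -> forall rho, mollifier e' rho ->
    S2 (fun z => hs u z p.1 p.2) <= S2 (cnv rho (fun z => hs u z p.1 p.2)) + t / m.
  have pos (P : idx * idx -> R -> Prop) : (forall j, exists2 r : R, 0 < r & forall t, t < r -> P j t) ->
      exists2 r : R, 0 < r & forall j t, t < r -> P j t.
    move=> h; have /choice[r rP] : forall j, exists r : R, 0 < r /\ forall t, t < r -> P j t.
      by move=> j; have [r r0 rP] := h j; exists r.
    have r0 j : 0 < r j by have [] := rP j.
    have S0 : 0 <= \sum_j (r j)^-1 by apply: sumr_ge0 => j _; rewrite invr_ge0 ltW.
    have S1 : 0 < 1 + \sum_j (r j)^-1 by lra.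
    exists (1 + \sum_j (r j)^-1)^-1; first by rewrite invr_gt0.
    move=> j t' tr; have [_] := rP j; apply; apply: lt_le_trans tr _.
    rewrite -[leRHS]invrK lef_pV2 ?posrE ?invr_gt0//.
    rewrite (bigD1 j)//= addrCA lerDl addr_ge0//.
    by apply: sumr_ge0 => i _; rewrite invr_ge0 ltW.
  apply: pos => p; have hc := Cc_hs p.2 p.1 uC uc.
  have [B B0 hB] := Cc_bounded hc.
  have [C C0 CP] := S2_close (1 + (M + 1 + 1)) B.
  have C1 : 0 < C + 1 by lra.
  have tm : 0 < t / m / (C + 1) by rewrite !divr_gt0.
  have [e e0 eP] := conv_approx hc tm.
  exists (Num.min e 1); first by rewrite lt_min e0 ltr01.
  move=> e'; rewrite lt_min => /andP[e1 e2] rho mm.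
  have rc := moll_Cc mm.
  have w1 := moll_wider (ltW e2) mm.
  apply: le_trans (CP _ (cnv rho (fun z => hs u z p.1 p.2)) (t / m / (C + 1)) hc (conv_Cc rc hc) _ _ hB _ (ltW tm) _) _.
  - by move=> z Mz; apply: (hM p); apply: le_trans Mz; lra.
  - by apply: conv_bsupp; [exact: (moll_bsupp w1)|exact: hM].
  - by apply: (cnv_bounded mm) => //; case: hc.
  - by move=> z; rewrite distrC; apply: (eP _ e' (ltW e1)).
  rewrite lerD2l mulrA ler_pdivrMr// [C * _]mulrC ler_pM2l ?divr_gt0//; lra.
exists (e / 2); first by rewrite divr_gt0.
move=> e' rho e'e mm; have e'lt : e' < e by apply: le_lt_trans e'e _; rewrite ltr_pdivrMr// ltr_pMr// ltr1n.
apply: (@le_trans _ _ (\sum_(p : idx * idx) (S2 (cnv rho (fun z => hs u z p.1 p.2)) + t / m))).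
  by apply: ler_sum => p _; exact: eP e'lt rho mm.
rewrite big_split/= sumr_const; apply: lerD.
  by apply: ler_sum => p _; rewrite le_eqVlt; apply/orP; left; apply/eqP; congr S2; apply/funext => z; rewrite (hs_cnv _ _ _ mm).
rewrite -(mulr_natl (t / m)) mulrA ler_pdivrMr// mulrC ler_pM2l// /m lerDl; exact: ler01.
Qed.

(** A mollifier r0 almost attains the supremum S of [H2 (cnv rho F)]. For r1, r2 supported near 0,
    mollifying [cnv r0 F] further by their mean hardly lowers its [H2]; by commutation and [H2_cnv]
    the mean of the two mollifications of F then has [H2] close to S, and the parallelogram identity
    makes that of their difference small. Neither weak derivatives nor completeness of L^2 enter. *)
Lemma L2_cauchy F (e0 B : R) : Cc F -> 0 < e0 -> (forall e rho, e <= e0 -> mollifier e rho -> H2 (cnv rho F) <= B) ->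
  forall t : R, 0 < t -> exists2 e1 : R, 0 < e1 & forall e r1 r2, e <= e1 -> mollifier e r1 -> mollifier e r2 ->
    H2 (fun z => cnv r1 F z - cnv r2 F z) <= t.
Proof.
move=> Fc e00 HB t t0; have cF : continuous F by case: Fc.
pose S := sup [set x | exists rho, mollifier e0 rho /\ x = H2 (cnv rho F)].
have hS : has_sup [set x | exists rho, mollifier e0 rho /\ x = H2 (cnv rho F)].
  split; first by have [rho m] := @mollifier_exists R n e0 e00; exists (H2 (cnv rho F)), rho.
  by exists B => _ [rho [m ->]]; exact: (HB e0).
have t10 : 0 < t / 16 by rewrite divr_gt0.
have [_ [r0 [m0 ->]] r0S] := sup_adherent t10 hS.
have sm e rho : mollifier e rho -> Ck 2 (cnv rho F) /\ Cc (cnv rho F).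
  move=> m; split; first by apply: smooth_Ck; exact: conv_smooth m Fc.
  exact: conv_Cc (moll_Cc m) Fc.
have [C0 c0] := sm _ _ m0.
have [e1 e10 e1P] := H2_cnv_lim C0 c0 t10.
exists (Num.min e0 e1); first by rewrite lt_min e00.
move=> e r1 r2; rewrite le_min => /andP[ee0 ee1] m1 m2.
have [C1 c1] := sm _ _ m1; have [C2 c2] := sm _ _ m2.
have le1 : H2 (cnv r1 F) <= S by apply: ub_le_sup; [case: hS|exists r1; split => //; exact: moll_wider m1].
have le2 : H2 (cnv r2 F) <= S by apply: ub_le_sup; [case: hS|exists r2; split => //; exact: moll_wider m2].
have ma := moll_avg m1 m2; have [Ca ca] := sm _ _ ma.
have := H2_par C1 c1 C2 c2.
have -> : (fun z => 2^-1 * cnv r1 F z + 2^-1 * cnv r2 F z) = cnv (fun z => 2^-1 * r1 z + 2^-1 * r2 z) F.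
  by apply/funext => z; rewrite (cnv_avg z m1 m2 cF).
have h1 := e1P _ _ ee1 ma.
have h2 := H2_cnv m0 Ca ca.
rewrite (cnv_comm m0 ma Fc) in h2.
rewrite -/S in r0S; move: h1 h2 le1 le2 r0S.
move: (H2 _) (H2 _) (H2 _) (H2 _) (H2 _) (H2 _) => x1 x2 x3 x4 x5 x6 *; lra.
Qed.

(** The second derivative enters through its samples at N points, so that the remainder can later be
    squared and integrated term by term. *)
Lemma taylor_sum (g dg ddg : R -> R) (N : nat) (e : R) : (0 < N)%N ->
  (forall t, 0 <= t <= 1 -> dv g t (dg t)) -> (forall t, 0 <= t <= 1 -> dv dg t (ddg t)) ->
  g 0 = 0 -> dg 0 = 0 ->
  (forall (k : nat) t, (k < N)%N -> k%:R / N%:R <= t <= k.+1%:R / N%:R -> `|ddg t - ddg (k%:R / N%:R)| <= e) ->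
  `|g 1| <= N%:R^-1 * (\sum_(k < N) `|ddg (k%:R / N%:R)|) + e.
Proof.
move=> N0 gd dgd g0 dg0 H.
have Nr : 0 < N%:R :> R by rewrite ltr0n.
have e0 : 0 <= e by have := H 0%N 0 N0; rewrite mul0r lexx divr_ge0// subrr normr0; apply.
pose x (k : nat) : R := k%:R / N%:R.
have x0 : x 0%N = 0 by rewrite /x mul0r.
have xN : x N = 1 by rewrite /x divff// gt_eqF.
have xS k : x k.+1 - x k = N%:R^-1 by rewrite /x -mulrBl -natr1 addrC addKr mul1r.
have xle k : x k <= x k.+1 by rewrite -subr_ge0 xS invr_ge0 ltW.
have x01 k : (k <= N)%N -> 0 <= x k <= 1.
  by move=> kN; rewrite /x divr_ge0 ?(ltW Nr)//= ler_pdivrMr// mul1r ler_nat.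
pose c k := N%:R^-1 * (`|ddg (x k)| + e).
have c0 k : 0 <= c k by rewrite mulr_ge0 ?invr_ge0 ?(ltW Nr)// addr_ge0.
have in01 k t : (k < N)%N -> x k <= t <= x k.+1 -> 0 <= t <= 1.
  move=> kN /andP[t1 t2]; have /andP[a1 _] := x01 k (ltnW kN); have /andP[_ a2] := x01 _ kN.
  by rewrite (le_trans a1 t1) (le_trans t2 a2).
have dstep k t : (k < N)%N -> x k <= t <= x k.+1 -> `|dg t - dg (x k)| <= c k.
  move=> kN /andP[t1 t2]; have [|s /andP[s1 s2] E] := mvt t1 (f := dg) (df := ddg).
    by move=> s /andP[s1 s2]; apply: dgd; apply: (in01 k) => //; rewrite s1 (le_trans s2 t2).
  rewrite E normrM mulrC; apply: ler_pM => //.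
    by rewrite ger0_norm ?subr_ge0// -(xS k) lerD2r.
  have := H k s kN; rewrite -/(x k) -/(x k.+1) s1 (le_trans s2 t2) => /(_ isT) h.
  by rewrite -[X in `|X|](subrK (ddg (x k))) addrC; apply: le_trans (ler_normD _ _) _; rewrite lerD2l.
have dgb k : (k <= N)%N -> `|dg (x k)| <= \sum_(j < k) c j.
  elim: k => [|k IH] kN; first by rewrite x0 dg0 normr0 big_ord0.
  rewrite big_ord_recr/= -[X in `|X|](subrK (dg (x k))) addrC; apply: le_trans (ler_normD _ _) _.
  by apply: lerD; [apply: dstep; rewrite // xle lexx|exact: IH (ltnW kN)].
pose B := \sum_(j < N) c j.
have dgB k t : (k < N)%N -> x k <= t <= x k.+1 -> `|dg t| <= B.
  move=> kN tk; rewrite -[X in `|X|](subrK (dg (x k))) addrC; apply: le_trans (ler_normD _ _) _.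
  apply: (@le_trans _ _ (\sum_(j < k.+1) c j)).
    by rewrite big_ord_recr/=; apply: lerD; [exact: dgb (ltnW kN)|exact: dstep].
  rewrite /B -(big_mkord xpredT c) -(big_mkord xpredT c) (big_cat_nat (leq0n k.+1) kN)//= lerDl.
  by apply: sumr_ge0.
have gb k : (k <= N)%N -> `|g (x k)| <= k%:R * (N%:R^-1 * B).
  elim: k => [|k IH] kN; first by rewrite x0 g0 normr0 mul0r.
  rewrite -[X in `|X|](subrK (g (x k))) addrC; apply: le_trans (ler_normD _ _) _.
  rewrite -natr1 mulrDl mul1r; apply: lerD; first exact: IH (ltnW kN).
  have [|s sk E] := mvt (xle k) (f := g) (df := dg); first by move=> s sk; apply: gd; exact: (in01 k).
  rewrite E xS normrM mulrC ger0_norm ?invr_ge0 ?(ltW Nr)//.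
  by apply: ler_wpM2l; [rewrite invr_ge0 ltW|exact: (dgB k)].
have := gb N (leqnn _); rewrite xN mulrA divff ?gt_eqF// mul1r => h; apply: le_trans h _.
rewrite /B /c -mulr_sumr big_split/= sumr_const card_ord mulrDr lerD2l.
by rewrite -(mulr_natl e) mulrA mulVf ?gt_eqF// mul1r.
Qed.

End square_integral.

(** * Second order Taylor remainders in mean square *)

Section second_order.
Context {R : realType} {n : nat}.
Local Notation V := (Cspace R n).
Local Notation idx := ('I_n * bool)%type.
Local Notation form := {ffun {set idx} -> R^o}.
Local Notation I := (@Cintegral R n).
Implicit Types (F G kap chi : V -> R) (z w h : V) (E : set V).

Lemma cnv_transl kap F h z : Cc kap -> continuous F -> cnv (fun w => kap (w - h)) F z = cnv kap F (z + h).
Proof.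
move=> kc cF; rewrite (convE z (Cc_shift (- h) kc) cF) (convE (z + h) kc cF); congr I.
by apply/funext => w; rewrite opprD addrA.
Qed.

Lemma moll_transl (e : R) kap h : mollifier e kap -> mollifier (e + nr h) (fun w => kap (w - h)).
Proof.
move=> m; have kc := moll_Cc m; split.
- by apply/smoothP => k; apply: Ck_shift; have /smoothP := moll_smooth m.
- by move=> w; exact: (moll_ge0 m).
- by rewrite (I_shift (- h) kc) (moll_I m).
- move=> w /(moll_supp m) we; have := nrD (w - h) h; rewrite subrK => hh.
  by apply: le_lt_trans hh _; rewrite ltrD2r.
Qed.

Lemma hs_shift G w z b a : hs (fun y => G (y + w)) z b a = hs G (z + w) b a.
Proof.
rewrite /hs; have -> : pderiv a (fun y => G (y + w)) = (fun y => pderiv a G (y + w)).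
  by apply/funext => y; exact: pderiv_shift.
exact: pderiv_shift.
Qed.

Lemma sumK (J : finType) (x : R) : \sum_(j : J) x = #|J|%:R * x.
Proof. by rewrite sumr_const mulr_natl. Qed.

Lemma sumsq (J : finType) (x : J -> R) : (\sum_j x j) ^+ 2 <= #|J|%:R * \sum_j x j ^+ 2.
Proof.
set S := \sum_j x j ^+ 2.
have E : \sum_i \sum_j 2^-1 * (x i ^+ 2 + x j ^+ 2) = #|J|%:R * S.
  transitivity (\sum_i 2^-1 * (#|J|%:R * x i ^+ 2 + S)).
    by apply: eq_bigr => i _; rewrite -mulr_sumr big_split/= sumK.
  rewrite -mulr_sumr big_split/= -mulr_sumr sumK -/S.
  have alg (a b : R) : 2^-1 * (a * b + a * b) = a * b by field.
  exact: alg.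
rewrite -E expr2 mulr_suml; apply: ler_sum => i _; rewrite mulr_sumr; apply: ler_sum => j _.
have alg (a b : R) : a * b <= 2^-1 * (a ^+ 2 + b ^+ 2) by have := sqr_ge0 (a - b); nra.
exact: alg.
Qed.

Lemma D2_diff G z w h : D2 G (z + w) h - D2 G z h =
  \sum_(p : idx * idx) (co p.2 h * co p.1 h) * (hs G (z + w) p.1 p.2 - hs G z p.1 p.2).
Proof.
rewrite -(pair_bigA _ (fun b a => (co a h * co b h) * (hs G (z + w) b a - hs G z b a)))/= exchange_big/=.
rewrite /D2 -sumrB; apply: eq_bigr => a _; rewrite -sumrB; apply: eq_bigr => b _.
exact: esym (mulrBr _ _ _).
Qed.

Lemma D2_Cc G h : Ck 2 G -> Cc G -> Cc (fun z => D2 G z h).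
Proof.
move=> GC Gc; apply: Cc_sum => a; apply: Cc_sum => b; apply: CcMl; exact: (Cc_hs a b GC Gc).
Qed.

Lemma D1_Cc G h : Ck 2 G -> Cc G -> Cc (fun z => D1 G z h).
Proof.
move=> GC Gc; apply: Cc_sum => a; apply: CcMl.
by have [] := Cc_pderiv a (CkW (isT : (1 <= 2)%N) GC) Gc.
Qed.

Local Notation K2 := (#|{: idx * idx}|%:R : R).

Lemma S2_DD G w h : Ck 2 G -> Cc G ->
  S2 (fun z => D2 G (z + w) h - D2 G z h) <= K2 * nr h ^+ 4 * H2 (fun z => G (z + w) - G z).
Proof.
move=> GC Gc; pose g z := G (z + w) - G z.
have gC : Ck 2 g by exact: (CkB (Ck_shift w GC) GC).
have gc : Cc g by exact: (CcB (Cc_shift w Gc) Gc).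
have hsg z b a : hs g z b a = hs G (z + w) b a - hs G z b a.
  by rewrite /g (@hsB R n (fun y => G (y + w)) G z (Ck_shift w GC) GC) hs_shift.
have xc (p : idx * idx) : Cc (fun z => hs g z p.1 p.2) by exact: (Cc_hs p.2 p.1 gC gc).
have -> : K2 * nr h ^+ 4 * H2 g = I (fun z => K2 * nr h ^+ 4 * \sum_(p : idx * idx) hs g z p.1 p.2 ^+ 2).
  rewrite I_Ml; last by apply: Cc_sum => p; exact: (Cc_sq (xc p)).
  by rewrite I_sum// => p; exact: (Cc_sq (xc p)).
apply: I_le.
- apply: Cc_sq; apply: CcB; last exact: D2_Cc.
  exact: (Cc_shift w (D2_Cc h GC Gc)).
- by apply: CcMl; apply: Cc_sum => p; exact: (Cc_sq (xc p)).
move=> z; rewrite D2_diff -mulrA; apply: le_trans (sumsq _) _; rewrite ler_wpM2l// mulr_sumr.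
apply: ler_sum => p _; rewrite exprMn -hsg; apply: ler_wpM2r; first exact: sqr_ge0.
have h1 := co_le_nr p.1 h; have h2 := co_le_nr p.2 h; have h0 := nr_ge0 h.
rewrite -real_normK ?num_real// normrM.
have -> : nr h ^+ 4 = (nr h * nr h) ^+ 2 by rewrite -expr2 -exprM.
by rewrite lerXn2r ?nnegrE ?mulr_ge0// ler_pM.
Qed.

Lemma rem_pt G z h (N : nat) (d s : R) : Ck 2 G -> (0 < N)%N -> N%:R^-1 * nr h < d -> unifm d s (fun y => D2 G y h) ->
  `|G (z + h) - tquad G z h| <= N%:R^-1 * (\sum_(k < N) `|D2 G (z + rC (k%:R / N%:R) 0 *: h) h - D2 G z h|) + s.
Proof.
move=> GC N0 Nd us; have G1 := CkW (isT : (1 <= 2)%N) GC; have Nr : 0 < N%:R :> R by rewrite ltr0n.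
pose c1 := D1 G z h; pose c2 := D2 G z h.
pose g t := G (z + rC t 0 *: h) + (- G z + (- c1 * t + - (c2 / 2) * (t * t))).
pose dg t := D1 G (z + rC t 0 *: h) h + (- c1 + - c2 * t).
pose ddg t := D2 G (z + rC t 0 *: h) h - c2.
have H1 t : 0 <= t <= 1 -> dv g t (dg t).
  move=> _; apply: dv_eq (dvD (C1_line z h t G1) (dvD (dv_cst (- G z) t)
    (dvD (dvMl (- c1) (dv_id t)) (dvMl (- (c2 / 2)) (dvM (dv_id t) (dv_id t)))))) _.
  rewrite /dg; have alg (x a b : R) : x + (0 + (- a * 1 + - (b / 2) * (1 * t + t * 1))) = x + (- a + - b * t) by field.
  exact: alg.
have H2' t : 0 <= t <= 1 -> dv dg t (ddg t).
  move=> _; apply: dv_eq (dvD (C2_line z h t GC) (dvD (dv_cst (- c1) t) (dvMl (- c2) (dv_id t)))) _.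
  by rewrite /ddg mulr1 add0r.
have g0 : g 0 = 0 by rewrite /g rC0Z addr0; have alg (x a b : R) : x + (- x + (a * 0 + b * (0 * 0))) = 0 by ring; exact: alg.
have dg0 : dg 0 = 0 by rewrite /dg rC0Z addr0; have alg (x b : R) : x + (- x + b * 0) = 0 by ring; exact: alg.
have g1 : g 1 = G (z + h) - tquad G z h.
  rewrite /g rC1Z tquadE; have alg (x y a b : R) : x + (- y + (- a * 1 + - (b / 2) * (1 * 1))) = x - (y + a + b / 2) by ring.
  exact: alg.
rewrite -g1; apply: (@taylor_sum R g dg ddg N s N0 H1 H2' g0 dg0) => k t kN /andP[t1 t2].
rewrite /ddg; have alg (x y a : R) : x - a - (y - a) = x - y by ring.
rewrite alg; apply: us; have -> : z + rC t 0 *: h - (z + rC (k%:R / N%:R) 0 *: h) = rC (t - k%:R / N%:R) 0 *: h.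
  by rewrite opprD addrACA subrr add0r rC_addZ rCNZ.
apply: le_lt_trans Nd; rewrite nrZr ler_wpM2r ?nr_ge0// ger0_norm ?subr_ge0// lerBlDl.
by apply: le_trans t2 _; rewrite -natr1 mulrDl mul1r.
Qed.

(** The remainder at z is an average along the segment of differences of second derivatives between
    a translate of z and z ([rem_pt]); integrating the squares leaves the L^2 norms of these
    differences. *)
Lemma rem_S2 G h (T : R) : Ck 2 G -> Cc G ->
  (forall t, 0 <= t <= 1 -> H2 (fun z => G (z + rC t 0 *: h) - G z) <= T) ->
  S2 (fun z => G (z + h) - tquad G z h) <= 2 * (K2 * nr h ^+ 4 * T).
Proof.
move=> GC Gc HT; have dc := D2_Cc h GC Gc.
have Rc : Cc (fun z => G (z + h) - tquad G z h).
  have -> : (fun z => G (z + h) - tquad G z h) = (fun z => G (z + h) - (G z + D1 G z h + 2^-1 * D2 G z h)).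
    by apply/funext => z; rewrite tquadE mulrC.
  by apply: CcB; [exact: Cc_shift|apply: CcD; [apply: CcD => //; exact: D1_Cc|exact: CcMl]].
have [_ [M1 RM]] := Rc; have [_ [M2 dM]] := dc.
pose M := Num.max M1 (M2 + nr h).
have [C C0 CP] := @I_bound R n M.
apply: (ler_eps C0) => t t0; pose s := Num.min t 1 / 2.
have s0 : 0 < s by rewrite divr_gt0// lt_min t0 ltr01.
have st : 2 * (s * s) <= t.
  have h1 : Num.min t 1 <= t by rewrite ge_min lexx.
  have h2 : Num.min t 1 <= 1 by rewrite ge_min lexx orbT.
  have : 0 < Num.min t 1 by rewrite lt_min t0 ltr01.
  by rewrite /s; move: h1 h2; move: (Num.min t 1) => x *; nra.
have [d d0 us] := Cc_unifm dc s0.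
have hd : 0 < d / (nr h + 1) by rewrite divr_gt0// ltr_wpDl ?nr_ge0.
have [N0 N0P] := archi_inv hd; pose N := N0.+1.
have Nr : 0 < N%:R :> R by rewrite ltr0n.
have Nd : N%:R^-1 * nr h < d.
  have := N0P N0 (leqnn _); rewrite ltr_pdivlMr ?ltr_wpDl ?nr_ge0// -/N => hh.
  by apply: le_lt_trans hh; rewrite ler_wpM2l ?invr_ge0 ?(ltW Nr)// lerDl.
pose DD (k : 'I_N) z := D2 G (z + rC (k%:R / N%:R) 0 *: h) h - D2 G z h.
have DDc k : Cc (DD k) by exact: (CcB (Cc_shift _ dc) dc).
pose A z := N%:R^-1 * \sum_(k < N) DD k z ^+ 2.
have Ac : Cc A by apply: CcMl; apply: Cc_sum => k; exact: Cc_sq.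
have k01 (k : 'I_N) : 0 <= (k%:R / N%:R : R) <= 1.
  by rewrite divr_ge0//= ler_pdivrMr// mul1r ler_nat ltnW.
have pt z : (G (z + h) - tquad G z h) ^+ 2 <= 2 * A z + t.
  have r1 := rem_pt z GC (ltn0Sn N0) Nd us.
  have r2 : (N%:R^-1 * \sum_(k < N) `|DD k z|) ^+ 2 <= A z.
    rewrite exprMn /A expr2 -mulrA ler_wpM2l ?invr_ge0 ?(ltW Nr)//.
    rewrite ler_pdivrMl//; apply: le_trans (sumsq _) _; rewrite card_ord ler_wpM2l ?(ltW Nr)//.
    by apply: ler_sum => k _; rewrite real_normK ?num_real.
  have r0 : 0 <= N%:R^-1 * \sum_(k < N) `|DD k z|.
    by rewrite mulr_ge0 ?invr_ge0 ?(ltW Nr)//; apply: sumr_ge0.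
  rewrite -real_normK ?num_real//; move: r1 r2 r0 (normr_ge0 (G (z + h) - tquad G z h)).
  rewrite -/N; move: (N%:R^-1 * _) (A z) (`|_|) => a b x *.
  have : 0 <= (a - s) ^+ 2 by exact: sqr_ge0.
  nra.
pose u z := (G (z + h) - tquad G z h) ^+ 2 - 2 * A z.
have uc : Cc u by apply: CcB; [exact: Cc_sq|exact: CcMl].
have uM z : M <= nr z -> u z = 0.
  move=> Mz; have m1 : M1 <= nr z by apply: le_trans Mz; rewrite /M le_max lexx.
  have m2 : M2 + nr h <= nr z by apply: le_trans Mz; rewrite /M le_max lexx orbT.
  rewrite /u RM// /A big1 ?mulr0 ?expr0n ?subr0//= => k _.
  have h0 := nr_ge0 h.
  rewrite /DD !dM ?subrr ?expr0n//; first by move: m2; lra.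
  have := nr_ler_sub z (- (rC (k%:R / N%:R) 0 *: h)); rewrite opprK nrN nrZr => hh.
  apply: le_trans hh; have /andP[k0 k1] := k01 k; rewrite (ger0_norm k0).
  by have := ler_wpM2r h0 k1; move: m2; lra.
have cm : Cc (fun z => Num.max (u z) 0).
  split; first by apply: cts_max; [case: uc|exact: cts_cst].
  by exists M => z /uM ->; rewrite maxxx.
have Im : I (fun z => Num.max (u z) 0) <= C * t.
  apply: le_trans (ler_norm _) _; apply: CP => //; first by move=> z /uM ->; rewrite maxxx.
  move=> z; rewrite ger0_norm; last by rewrite le_max lexx orbT.
  by rewrite ge_max (ltW t0) andbT /u lerBlDl; exact: pt.
have IA : I A <= K2 * nr h ^+ 4 * T.
  rewrite /A I_Ml; last by apply: Cc_sum => k; exact: Cc_sq.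
  rewrite I_sum; last by move=> k; exact: Cc_sq.
  rewrite ler_pdivrMl//; apply: (@le_trans _ _ (\sum_(k < N) (K2 * nr h ^+ 4 * T))).
    apply: ler_sum => k _; apply: le_trans (S2_DD _ h GC Gc) _.
    by apply: ler_wpM2l; [rewrite mulr_ge0// exprn_ge0 ?nr_ge0|exact: HT].
  by rewrite sumK card_ord.
rewrite /S2; apply: (@le_trans _ _ (I (fun z => 2 * A z + Num.max (u z) 0))).
  apply: I_le; [exact: Cc_sq|by apply: CcD => //; exact: CcMl|move=> z].
  by rewrite -lerBlDl le_max lexx.
rewrite I_D//; last exact: CcMl.
by apply: lerD => //; rewrite I_Ml// ler_wpM2l.
Qed.

Local Notation K1 := (#|{: idx}|%:R : R).

Lemma pderiv_lip G a z y (B : R) : Ck 2 G -> (forall w c b, `|hs G w c b| <= B) ->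
  `|pderiv a G (z + y) - pderiv a G z| <= K1 * B * nr y.
Proof.
move=> GC GB; have GaC := Ck_pderiv a GC.
have [|t _] := @mvt R (fun s => pderiv a G (z + rC s 0 *: y)) (fun s => D1 (pderiv a G) (z + rC s 0 *: y) y) 0 1 ler01.
  by move=> x _; exact: C1_line.
rewrite rC0Z rC1Z addr0 subr0 mulr1 => ->.
apply: le_trans (ler_norm_sum _ _ _) _; rewrite -mulrA -sumK.
apply: ler_sum => b _; rewrite normrM mulrC; apply: ler_pM => //; [exact: GB|exact: co_le_nr].
Qed.

(** The remainder is Lipschitz in h with a constant proportional to r, so a finite net of
    directions, independent of r after scaling, controls the whole ball. *)
Lemma rem_lip G z h h' (r B : R) : Ck 2 G -> (forall w c b, `|hs G w c b| <= B) -> nr h <= r -> nr h' <= r ->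
  `|(G (z + h) - tquad G z h) - (G (z + h') - tquad G z h')| <= 4 * (K1 * K1 * B) * r * nr (h - h').
Proof.
move=> GC GB hr h'r; have G1 := CkW (isT : (1 <= 2)%N) GC; pose k := h - h'.
have nk : 0 <= nr k by exact: nr_ge0.
have r0 : 0 <= r by exact: le_trans (nr_ge0 h) hr.
have kr : nr k <= 2 * r by have := nrD h (- h'); rewrite nrN; move: hr h'r; rewrite -/k; lra.
have e1 : `|G (z + h) - G (z + h') - D1 G z k| <= 3 * (K1 * K1 * B) * r * nr k.
  have [|t /andP[t0 t1]] := @mvt R (fun s => G (z + h' + rC s 0 *: k)) (fun s => D1 G (z + h' + rC s 0 *: k) k) 0 1 ler01.
    by move=> x _; exact: C1_line.
  rewrite rC0Z rC1Z addr0 subr0 mulr1 -addrA (_ : h' + k = h); last by rewrite /k addrC subrK.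
  move=> ->; rewrite /D1 -sumrB.
  apply: le_trans (ler_norm_sum _ _ _) _.
  have -> : 3 * (K1 * K1 * B) * r * nr k = \sum_(a : idx) nr k * (K1 * B * (3 * r)).
    rewrite sumK; have alg (x b c d : R) : 3 * (x * x * b) * c * d = x * (d * (x * b * (3 * c))) by ring.
    exact: alg.
  apply: ler_sum => a _; rewrite -mulrBr normrM; apply: ler_pM => //; first exact: co_le_nr.
  rewrite -addrA; apply: le_trans (pderiv_lip a z _ GC GB) _.
  have B0 : 0 <= K1 * B by rewrite mulr_ge0//; exact: le_trans (normr_ge0 _) (GB z a a).
  apply: ler_wpM2l => //; apply: le_trans (nrD _ _) _; rewrite nrZr (ger0_norm t0).
  by have := ler_wpM2r nk t1; move: kr h'r; lra.
have e2 : `|D2 G z h - D2 G z h'| <= 2 * (K1 * K1 * B) * r * nr k.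
  rewrite /D2 -sumrB; apply: le_trans (ler_norm_sum _ _ _) _.
  have -> : 2 * (K1 * K1 * B) * r * nr k = \sum_(a : idx) \sum_(b : idx) (2 * r * nr k * B).
    rewrite (eq_bigr _ (fun a _ => sumK _ _)) sumK.
    have alg (x b c d : R) : 2 * (x * x * b) * c * d = x * (x * (2 * c * d * b)) by ring.
    exact: alg.
  apply: ler_sum => a _; rewrite -sumrB; apply: le_trans (ler_norm_sum _ _ _) _; apply: ler_sum => b _.
  rewrite -mulrBl normrM; apply: ler_pM => //; last exact: GB.
  have -> : co a h * co b h - co a h' * co b h' = co a k * co b h + co a h' * co b k.
    rewrite /k !coD !coN; have alg (x y u v : R) : x * u - y * v = (x - y) * u + y * (u - v) by ring.
    exact: alg.
  apply: le_trans (ler_normD _ _) _; rewrite !normrM.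
  have h1 := co_le_nr a k; have h2 := co_le_nr b k.
  have h3 := le_trans (co_le_nr b h) hr; have h4 := le_trans (co_le_nr a h') h'r.
  have := ler_pM (normr_ge0 _) (normr_ge0 _) h1 h3; have := ler_pM (normr_ge0 _) (normr_ge0 _) h4 h2.
  lra.
rewrite !tquadE.
have D1B : D1 G z k = D1 G z h - D1 G z h'.
  by rewrite /D1 -sumrB; apply: eq_bigr => a _; rewrite /k coD coN mulrBl.
rewrite D1B in e1.
have alg (x y g a b c d : R) : x - (g + a + c / 2) - (y - (g + b + d / 2)) = (x - y - (a - b)) - (c - d) / 2 by field.
rewrite alg; apply: le_trans (ler_normB _ _) _; rewrite normrM (ger0_norm (_ : 0 <= 2^-1)) ?invr_ge0//.
move: e1 e2; rewrite -/k; move: (`|_|) (`|D2 G z h - _|) => x y.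
have -> : 4 * (K1 * K1 * B) * r * nr k = 3 * (K1 * K1 * B) * r * nr k + K1 * K1 * B * r * nr k.
  have alg2 (u b c d : R) : 4 * (u * u * b) * c * d = 3 * (u * u * b) * c * d + u * u * b * c * d by ring.
  exact: alg2.
have -> : 2 * (K1 * K1 * B) * r * nr k = 2 * (K1 * K1 * B * r * nr k).
  have alg2 (u b c d : R) : 2 * (u * u * b) * c * d = 2 * (u * u * b * c * d) by ring.
  exact: alg2.
move: (3 * _ * _ * _) (K1 * _ * _ * _ * _) => p q; lra.
Qed.

Lemma iterQ_bounded (k : nat) (B : R) : 0 <= B -> exists2 C : R, 0 <= C & forall L S,
  (forall a b, `|L a b| <= B) -> `|(iter k (Q L) fone : form) S| <= C.
Proof.
move=> B0; elim: k => [|k [C C0 IH]].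
  by exists 1 => // L S _; rewrite ffunE; case: eqP => _; rewrite ?normr1 ?normr0.
exists (\sum_(a : idx) \sum_(b : idx) (B * C)); first by apply: sumr_ge0 => a _; apply: sumr_ge0 => b _; rewrite mulr_ge0.
move=> L S LB; rewrite iterS Q_coords; apply: le_trans (ler_norm_sum _ _ _) _.
apply: ler_sum => a _; apply: le_trans (ler_norm_sum _ _ _) _; apply: ler_sum => b _.
rewrite normrM; apply: ler_pM => //.
  by rewrite normrM normrX normrN1 expr1n mul1r.
have h : bounded_form C (iter k (Q L) fone) by move=> S'; exact: IH.
exact: (ext_bounded b C0 (ext_bounded (conj_idx a) C0 h)).
Qed.

Lemma seq_sum_ge (s : seq V) (f : V -> R) x : (forall y, 0 <= f y) -> x \in s -> f x <= \sum_(y <- s) f y.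
Proof. by move=> f0 xs; rewrite (big_rem x)//= lerDl; apply: sumr_ge0. Qed.

(** A translate of a mollification is a mollification by the translated kernel, so [L2_cauchy]
    compares the two. *)
Lemma transl_close F (e0 B : R) : Cc F -> 0 < e0 -> (forall e kap, e <= e0 -> mollifier e kap -> H2 (cnv kap F) <= B) ->
  forall t : R, 0 < t -> exists2 e1 : R, 0 < e1 & forall e kap h, e <= e1 -> nr h <= e1 -> mollifier e kap ->
    H2 (fun z => cnv kap F (z + h) - cnv kap F z) <= t.
Proof.
move=> Fc e00 HB t t0; have cF : continuous F by case: Fc.
have [e1 e10 eP] := L2_cauchy Fc e00 HB t0.
have e20 : 0 < e1 / 2 by rewrite divr_gt0.
exists (e1 / 2) => // e kap h ee he m.
have -> : (fun z => cnv kap F (z + h) - cnv kap F z) = (fun z => cnv (fun w => kap (w - h)) F z - cnv kap F z).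
  by apply/funext => z; rewrite (cnv_transl h z (moll_Cc m) cF).
apply: (eP e1) => //; first by apply: moll_wider (moll_transl h m); move: ee he; lra.
by apply: moll_wider m; move: ee; lra.
Qed.

Lemma H2_bounded F (e0 C2 : R) : Cc F -> 0 < e0 -> 0 <= C2 ->
  (forall e kap z a b, e <= e0 -> mollifier e kap -> `|hs (cnv kap F) z a b| <= C2) ->
  exists B : R, forall e kap, e <= e0 -> mollifier e kap -> H2 (cnv kap F) <= B.
Proof.
move=> Fc e00 C20 Hb; have [_ [M FM]] := Fc.
have [C C0 CP] := @I_bound R n (e0 + M + 1 + 1).
exists (\sum_(p : idx * idx) C * (C2 * C2)) => e kap ee m; apply: ler_sum => p _.
have m0 := moll_wider ee m.
have GC : Ck 2 (cnv kap F) by apply: smooth_Ck; exact: conv_smooth m Fc.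
have Gc := conv_Cc (moll_Cc m) Fc.
have GM := conv_bsupp (moll_bsupp m0) FM.
have [c1 b1] := Cc_pderiv p.2 (CkW (isT : (1 <= 2)%N) GC) Gc.
have [c2 b2] := Cc_pderiv p.1 (Ck_pderiv p.2 GC) c1.
have hM := b2 _ (b1 _ GM).
apply: le_trans (ler_norm _) _; apply: CP.
- by apply: Cc_sq; exact: (Cc_hs p.2 p.1 GC Gc).
- by move=> z /hM; rewrite /hs => ->; rewrite expr0n.
move=> z; rewrite normrX expr2; apply: ler_pM => //; exact: (Hb e).
Qed.

(* If the top power exceeds [m] at [z], the Levi form is bounded below there, so a second order
   expansion with small remainder is excluded by [Hn]; the remainder is small except on a set
   controlled in mean square. *)
Lemma ma_zero F chi E (C2 e0 r0 c0 : R) : Cc F -> 0 < e0 -> 0 < r0 -> 0 < c0 -> 0 <= C2 ->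
  (forall e kap z a b, e <= e0 -> mollifier e kap -> `|hs (cnv kap F) z a b| <= C2) ->
  (forall e kap z, e <= e0 -> mollifier e kap -> E z -> forall x, 0 <= levi (hs (cnv kap F) z) x) ->
  (forall z0 (r sg ga a : R) (l : idx -> R) (M : idx -> idx -> R), E z0 -> 0 < r -> r <= r0 -> 0 < ga ->
    (forall x, 4 * ga * (\sum_s x s ^+ 2) <= levi M x) -> 2 * sg < ga * r ^+ 2 -> ga * r ^+ 2 <= c0 ->
    (forall y, nr (y - z0) <= r -> `|F y - quad a l M (y - z0)| <= sg) -> False) ->
  Cc chi -> (forall z, 0 <= chi z) -> (forall z, ~ E z -> chi z = 0) ->
  forall t : R, 0 < t -> exists2 e1 : R, 0 < e1 & forall e kap, e <= e1 -> mollifier e kap ->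
    I (fun z => chi z * top (Xf n 0 (cnv kap F) z)) <= t.
Proof.
move=> Fc e00 r00 c00 C20 Hb Hp Hn chc ch0 chE t t0.
have X0 : 0 <= I chi by exact: I_ge0.
(* Points where the determinant is at most m contribute at most t/2. *)
pose m := t / 2 / (I chi + 1).
have m0 : 0 < m by rewrite /m !divr_gt0// ltr_wpDl.
have mX : m * I chi <= t / 2.
  rewrite /m mulrAC ler_pdivrMr ?ltr_wpDl//; apply: ler_wpM2l; first by rewrite divr_ge0// ltW.
  by rewrite lerDl.
have [c c'0 cP] := @levi_lower R n C2 m C20 m0.
(* Where the determinant exceeds m the Levi form is at least c = 4 ga, as [Hn] demands. *)
pose ga := c / 4; have ga0 : 0 < ga by rewrite divr_gt0.
pose CL : R := 4 * (K1 * K1 * C2).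
have CL0 : 0 <= CL by rewrite !mulr_ge0.
(* Mesh of the net of directions: passing to a neighbouring direction changes the remainder by at
   most (ga/8) r^2. *)
pose mu := ga / 8 / (CL + 1).
have mu0 : 0 < mu by rewrite !divr_gt0// ltr_wpDl.
have CLmu : CL * mu <= ga / 8.
  rewrite /mu mulrA ler_pdivrMr ?ltr_wpDl// mulrC; apply: ler_wpM2l; first by rewrite divr_ge0// ltW.
  by rewrite lerDl.
pose eta := ga / 16; have eta0 : 0 < eta by rewrite divr_gt0.
have [s [s1 sP]] := @finite_net R n [set z : V | nr z <= 1] mu (@compact_nr_le R n 1) mu0.
have [Ct Ct0 CtP] := @iterQ_bounded n C2 C20.
have [Cx Cx0 CxP] := Cc_bounded chc.
(* The constant in Chebyshev's inequality: [Cx * Ct] bounds the integrand, and a remainder of size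
   [eta * r ^+ 2] counts as large. *)
pose W := Cx * Ct / eta ^+ 2.
have W0 : 0 <= W by rewrite divr_ge0 ?exprn_ge0 ?(ltW eta0)// mulr_ge0// ltW.
pose K3 : R := 2 * (W * (size s)%:R * K2).
have K30 : 0 <= K3 by apply: mulr_ge0 => //; apply: mulr_ge0 => //; exact: mulr_ge0.
pose T := t / 2 / (K3 + 1).
have T0 : 0 < T by rewrite !divr_gt0// ltr_wpDl.
have KT : K3 * T <= t / 2.
  rewrite /T mulrA ler_pdivrMr ?ltr_wpDl// mulrC; apply: ler_wpM2l; first by rewrite divr_ge0// ltW.
  by rewrite lerDl.
have [B HB] := H2_bounded Fc e00 C20 Hb.
have [e1 e10 e1P] := transl_close Fc e00 HB T0.
pose r := Num.min (Num.min r0 e1) (Num.min 1 (c0 / ga)).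
have rr : 0 < r by rewrite !lt_min r00 e10 ltr01 divr_gt0.
have [ra rb rc rd] : [/\ r <= r0, r <= e1, r <= 1 & r <= c0 / ga].
  by rewrite /r; split; rewrite !ge_min lexx ?orbT.
have gr : ga * r ^+ 2 <= c0.
  move: rd; rewrite ler_pdivlMr// mulrC => rd; apply: le_trans rd; rewrite ler_pM2l// expr2.
  by rewrite ler_piMr// ltW.
have er0 : 0 < eta * r ^+ 2 by rewrite mulr_gt0// exprn_gt0.
have [e2 e20 e2P] := conv_approx Fc er0.
exists (Num.min e0 (Num.min e1 e2)); first by rewrite !lt_min e00 e10 e20.
move=> e kap; rewrite !le_min => /andP[ee0 /andP[ee1 ee2]] mk.
pose G := cnv kap F.
have GC : Ck 2 G by apply: smooth_Ck; exact: conv_smooth mk Fc.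
have Gc : Cc G := conv_Cc (moll_Cc mk) Fc.
have GB z a b : `|hs G z a b| <= C2 by exact: (Hb e).
pose Rm h z := G (z + h) - tquad G z h.
have Rc h : Cc (Rm h).
  have -> : Rm h = (fun z => G (z + h) - (G z + D1 G z h + 2^-1 * D2 G z h)).
    by apply/funext => z; rewrite /Rm tquadE [_ / 2]mulrC.
  apply: CcB; [exact: Cc_shift|apply: CcD; [apply: CcD => //; exact: D1_Cc|apply: CcMl; exact: D2_Cc]].
pose sc (w : V) : V := rC r 0 *: w.
pose P z := \sum_(w <- s) Rm (sc w) z ^+ 2.
have Pc : Cc P by apply: Cc_sum => w; exact: Cc_sq.
have scn w : w \in s -> nr (sc w) <= r.
  by move=> /s1 /= w1; rewrite nrZr gtr0_norm// ler_piMr// ltW.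
have SP : I P <= (size s)%:R * (2 * (K2 * r ^+ 4 * T)).
  rewrite /P I_sum; last by move=> w; exact: Cc_sq.
  apply: (@le_trans _ _ (\sum_(w <- s) 2 * (K2 * r ^+ 4 * T))).
    rewrite big_seq [leRHS]big_seq; apply: ler_sum => w ws.
    have nw := scn w ws.
    have HT x : 0 <= x <= 1 -> H2 (fun z => G (z + rC x 0 *: sc w) - G z) <= T.
      move=> /andP[x0 x1]; apply: (e1P e) => //; rewrite nrZr ger0_norm//.
      by apply: le_trans rb; apply: le_trans nw; rewrite ler_piMl ?nr_ge0.
    apply: le_trans (rem_S2 GC Gc HT) _; rewrite ler_pM2l// ler_wpM2r ?(ltW T0)// ler_wpM2l//.
    by rewrite lerXn2r ?nnegrE ?nr_ge0 ?(ltW rr).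
  by rewrite big_const_seq count_predT iter_addr addr0 [leRHS]mulr_natl.
have pt z : chi z * top (Xf n 0 G z) <= m * chi z + W / r ^+ 4 * P z.
  have P0 : 0 <= P z by apply: sumr_ge0 => w _; exact: sqr_ge0.
  have Wr : 0 <= W / r ^+ 4 by rewrite divr_ge0// exprn_ge0// ltW.
  have [Ez|/chE ->] := pselect (E z); last by rewrite mul0r mulr0 add0r mulr_ge0.
  have [tm|mt] := leP (top (Xf n 0 G z)) m.
    by rewrite [m * _]mulrC; have := ler_wpM2l (ch0 z) tm; have := mulr_ge0 Wr P0; lra.
  have [[w ws wb]|nb] := pselect (exists2 w, w \in s & (eta * r ^+ 2) ^+ 2 <= Rm (sc w) z ^+ 2).
    have h1 : chi z * top (Xf n 0 G z) <= Cx * Ct.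
      apply: le_trans (ler_norm _) _; rewrite normrM; apply: ler_pM => //.
      by apply: CtP => a b; exact: GB.
    have h2 : (eta * r ^+ 2) ^+ 2 <= P z.
      by apply: le_trans wb _; apply: (@seq_sum_ge s (fun w => Rm (sc w) z ^+ 2)) => // y; exact: sqr_ge0.
    have h3 : Cx * Ct = W / r ^+ 4 * (eta * r ^+ 2) ^+ 2.
      by rewrite /W; field; rewrite !gt_eqF.
    have := ler_wpM2l Wr h2; rewrite -h3; have := mulr_ge0 (ltW m0) (ch0 z); move: h1; lra.
  (* With all remainders small on the net, F is within [sgm] of the Taylor polynomial on the ball.
     The three terms are the mollification error, the remainder on the net, and the passage to other
     directions. *)
  exfalso; pose sgm := (eta + (eta + CL * mu)) * r ^+ 2.
  apply: (Hn z r sgm ga (G z) (fun a => pderiv a G z) (hs G z) Ez rr ra ga0 _ _ gr).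
  - move=> x; have -> : 4 * ga = c by rewrite /ga; field.
    apply: cP; [exact: hs_sym|exact: (Hp e)|exact: GB|exact: ltW].
  - rewrite /sgm mulrA ltr_pM2r ?exprn_gt0//.
    by move: CLmu ga0; rewrite /eta; lra.
  move=> y yz; pose h := y - z.
  have zh : z + h = y by rewrite /h addrC subrK.
  have [w ws wh] : exists2 w, w \in s & nr (rC r^-1 0 *: h - w) < mu.
    apply: sP => /=; rewrite nrZr gtr0_norm ?invr_gt0// mulrC ler_pdivrMr// mul1r; exact: yz.
  have hw : nr (h - sc w) <= r * mu.
    have -> : h - sc w = rC r 0 *: (rC r^-1 0 *: h - w).
      by rewrite scalerBr -rC_mulZ divff ?gt_eqF// rC1Z.
    by rewrite nrZr gtr0_norm// ler_pM2l// ltW.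
  have b1 : `|Rm (sc w) z| <= eta * r ^+ 2.
    have [//|lt] := leP (`|Rm (sc w) z|) (eta * r ^+ 2).
    exfalso; apply: nb; exists w => //; rewrite -[leRHS]real_normK ?num_real//.
    by rewrite lerXn2r ?nnegrE ?(ltW er0)// ltW.
  have b2 : `|Rm h z - Rm (sc w) z| <= CL * mu * r ^+ 2.
    apply: le_trans (rem_lip z GC GB yz (scn w ws)) _.
    have -> : CL * mu * r ^+ 2 = CL * r * (r * mu) by ring.
    by apply: ler_wpM2l => //; rewrite mulr_ge0// ltW.
  have b3 := e2P kap e ee2 mk y; rewrite distrC in b3.
  have b4 : F y - tquad G z h = (F y - G y) + ((Rm h z - Rm (sc w) z) + Rm (sc w) z).
    by rewrite subrK /Rm zh addrA subrK.
  rewrite -/(tquad G z) -/h b4.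
  apply: le_trans (ler_normD _ _) _; apply: le_trans (lerD b3 (le_trans (ler_normD _ _) (lerD b2 b1))) _.
  by rewrite /sgm; have alg (u1 u2 u3 : R) : u1 * u3 + (u2 * u3 + u1 * u3) <= (u1 + (u1 + u2)) * u3 by lra; exact: alg.
have Gt : Cc (fun z => chi z * top (Xf n 0 G z)) by exact: Cc_top.
apply: (@le_trans _ _ (I (fun z => m * chi z + W / r ^+ 4 * P z))).
  by apply: I_le => //; apply: CcD; exact: CcMl.
rewrite I_D; [|exact: CcMl|exact: CcMl]; rewrite !I_Ml//.
have r4 : 0 < r ^+ 4 by rewrite exprn_gt0.
have : W / r ^+ 4 * I P <= K3 * T.
  apply: (@le_trans _ _ (W / r ^+ 4 * ((size s)%:R * (2 * (K2 * r ^+ 4 * T))))).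
    by apply: ler_wpM2l => //; rewrite divr_ge0// ltW.
  rewrite le_eqVlt; apply/orP; left; apply/eqP; rewrite /K3.
  have alg (u q u1 u2 x : R) : 0 < q -> u / q * (u1 * (2 * (u2 * q * x))) = 2 * (u * u1 * u2) * x.
    by move=> q0; field; rewrite gt_eqF.
  exact: alg.
move: mX KT; lra.
Qed.

End second_order.

(** * The envelope has no Monge-Ampère mass *)

Section envelope_zero.
Context {R : realType} {n : nat}.
Local Notation V := (Cspace R n).
Local Notation idx := ('I_n * bool)%type.
Local Notation I := (@Cintegral R n).
Implicit Types (v g F G kap chi : V -> R) (z w h xi : V).

Lemma D2Z G z (t : R) h : D2 G z (rC t 0 *: h) = t ^+ 2 * D2 G z h.
Proof.
rewrite /D2 mulr_sumr; apply: eq_bigr => a _; rewrite mulr_sumr; apply: eq_bigr => b _; rewrite !coZ.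
have alg (x y u : R) : t * x * (t * y) * u = t ^+ 2 * (x * y * u) by ring.
exact: alg.
Qed.

Lemma tquad_sym G z h : tquad G z h + tquad G z (- h) - 2 * G z = D2 G z h.
Proof.
have e1 : D1 G z (- h) = - D1 G z h by rewrite /D1 -sumrN; apply: eq_bigr => a _; rewrite coN mulNr.
have e2 : D2 G z (- h) = D2 G z h by have := D2Z G z (-1) h; rewrite rCNZ rC1Z sqrrN expr1n mul1r.
rewrite !tquadE e1 e2; have alg (g a d : R) : g + a + d / 2 + (g - a + d / 2) - 2 * g = d by field.
exact: alg.
Qed.

(** Bounds on small second differences give bounds on the second derivative; the sign s treats upper
    and lower bounds alike. *)
Lemma sd_D2 G z h (s A d : R) : Ck 2 G -> `|s| <= 1 -> 0 < d ->
  (forall xi, nr xi < d -> s * (G (z + xi) + G (z - xi) - 2 * G z) <= A * nr xi ^+ 2) ->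
  s * D2 G z h <= A * nr h ^+ 2.
Proof.
move=> GC s1 d0 H; have C0 : 0 <= 2 * nr h ^+ 2 by rewrite mulr_ge0// exprn_ge0 ?nr_ge0.
apply: (ler_eps C0) => e e0; have [d1 d10 dP] := taylor_quad z GC e0.
have h1 : 0 < nr h + 1 by rewrite ltr_wpDl ?nr_ge0.
pose t := Num.min d d1 / (nr h + 1).
have t0 : 0 < t by rewrite divr_gt0// lt_min d0.
pose xi : V := rC t 0 *: h.
have nx : nr xi = t * nr h by rewrite nrZr gtr0_norm.
have xd : nr xi < Num.min d d1.
  rewrite nx /t mulrAC ltr_pdivrMr// ltr_pM2l ?lt_min ?d0//; lra.
have [x1 x2] : nr xi < d /\ nr xi < d1 by move: xd; rewrite lt_min => /andP[].
have p1 := dP xi x2; have p2 := dP (- xi); rewrite nrN in p2; have {}p2 := p2 x2.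
have p3 := H xi x1; have e3 := tquad_sym G z xi.
have t20 : 0 < t ^+ 2 by rewrite exprn_gt0.
rewrite -(ler_pM2l t20) mulrCA -D2Z -/xi.
have -> : t ^+ 2 * (A * nr h ^+ 2 + 2 * nr h ^+ 2 * e) = A * nr xi ^+ 2 + 2 * (e * nr xi ^+ 2) by rewrite nx; ring.
have E : D2 G z xi = (G (z + xi) + G (z - xi) - 2 * G z) - ((G (z + xi) - tquad G z xi) + (G (z - xi) - tquad G z (- xi))).
  rewrite -e3; have alg (a b c x y : R) : x + y - c = a + b - c - (a - x + (b - y)) by ring.
  exact: alg.
rewrite E mulrBr; have q : `|s * ((G (z + xi) - tquad G z xi) + (G (z - xi) - tquad G z (- xi)))| <= 2 * (e * nr xi ^+ 2).
  rewrite normrM; apply: (@le_trans _ _ (1 * `|(G (z + xi) - tquad G z xi) + (G (z - xi) - tquad G z (- xi))|)).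
    by apply: ler_wpM2r.
  rewrite mul1r; apply: le_trans (ler_normD _ _) _; move: p1 p2; lra.
move: q p3; rewrite ler_norml => /andP[q1 q2]; move: q1; move: (s * _) (s * _) (e * _) (A * _) => *; lra.
Qed.

Lemma cnv_sd kap F z xi (s c e : R) : mollifier e kap -> Cc F ->
  (forall w, kap w != 0 -> s * (F (z + w + xi) + F (z + w - xi) - 2 * F (z + w)) <= c) ->
  s * (cnv kap F (z + xi) + cnv kap F (z - xi) - 2 * cnv kap F z) <= c.
Proof.
move=> m Fc H; have kc := moll_Cc m.
pose r : seq (V * R) := [:: (xi, s); (- xi, s); (0, - (2 * s))].
have Fs (p : V * R) : continuous (fun y : V => F (y + p.1)) by have [] := Cc_shift p.1 Fc.
have E := @conv_sum R n kap _ r (fun p => p.2) (fun p y => F (y + p.1)) z kc Fs.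
have cc : continuous (fun _ : V => c) by exact: cts_cst.
have cs : continuous (fun y : V => \sum_(p <- r) p.2 * F (y + p.1)) by apply: cts_sum => p; exact: ctsMl.
have alg (x y u : R) : s * x + (s * y + (- (2 * s) * u + 0)) = s * (x + y - 2 * u) by ring.
have := @conv_le R n kap (fun y => \sum_(p <- r) p.2 * F (y + p.1)) (fun=> c) z kc (moll_ge0 m) cs cc.
rewrite (conv_cst c z kc (moll_I m)) E /r !big_cons big_nil/= !conv_shift (addr0 z) alg; apply => w kw.
by rewrite !big_cons big_nil/= (addr0 (z + w)) alg; exact: H.
Qed.

Lemma bil_delta (M : idx -> idx -> R) a b : bil M (delta a) (delta b) = M a b.
Proof.
rewrite /bil -[RHS](sumr_delta (fun c => M c b) a); apply: eq_bigr => c _.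
rewrite -[in RHS](sumr_delta (fun d => M c d) b) mulr_sumr; apply: eq_bigr => d _.
by rewrite -mulrA [M c d * _]mulrC.
Qed.

(** Polarisation: off-diagonal entries are read from the value of the form on a sum of two basis
    vectors. *)
Lemma bil_entries (M : idx -> idx -> R) (A : R) : 0 <= A -> (forall a b, M a b = M b a) ->
  (forall x, `|bil M x x| <= A * \sum_a x a ^+ 2) -> forall a b, `|M a b| <= 3 * A.
Proof.
move=> A0 Ms H a b.
have d1 (c : idx) : \sum_s (delta c s : R) ^+ 2 = 1.
  transitivity (\sum_s (delta c s : R) * delta c s); first by apply: eq_bigr => s _; rewrite expr2.
  by rewrite (sumr_delta (fun s => delta c s) c) /delta eqxx.
have h1 (c : idx) : `|M c c| <= A by have := H (delta c); rewrite bil_delta d1 mulr1.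
pose x : idx -> R := fun c => \sum_(p <- [:: a; b]) 1 * delta p c.
have xE : bil M x x = M a a + 2 * M a b + M b b.
  rewrite /x bil_suml !big_cons big_nil !bil_sumr !big_cons !big_nil !bil_delta (Ms b a).
  have alg (u v w : R) : 1 * (1 * u + (1 * v + 0)) + (1 * (1 * v + (1 * w + 0)) + 0) = u + 2 * v + w by ring.
  exact: alg.
have xs : \sum_s x s ^+ 2 <= 4.
  apply: (@le_trans _ _ (\sum_s (2 * (delta a s : R) ^+ 2 + 2 * (delta b s : R) ^+ 2))).
    apply: ler_sum => s _; rewrite /x !big_cons big_nil addr0 !mul1r.
    by move: (delta a s : R) (delta b s : R) => u v; have := sqr_ge0 (u - v); nra.
  by rewrite big_split/= -!mulr_sumr !d1; lra.
have := H x; rewrite xE => h2; have h3 : A * (\sum_s x s ^+ 2) <= A * 4 by rewrite ler_wpM2l.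
have h4 := le_trans h2 h3; have := h1 a; have := h1 b; move: h4; rewrite !ler_norml.
by move=> /andP[? ?] /andP[? ?] /andP[? ?]; apply/andP; split; lra.
Qed.

Lemma sum_Jv (x : idx -> R) : \sum_a (Jv x a) ^+ 2 = \sum_a x a ^+ 2.
Proof.
rewrite [RHS](reindex_inj (inv_inj (@conj_idxK n)))/=; apply: eq_bigr => a _; rewrite /Jv exprMn.
by case: (a.2); rewrite ?sqrrN expr1n mul1r.
Qed.

Variables (D : set V) (f rho : V -> R) (c0 L La d0 m0 : R).
Hypotheses (n0 : (0 < n)%N) (oD : open D) (c00 : 0 < c0) (L0 : 0 <= L) (d00 : 0 < d0).
Hypotheses (fcont : continuous f) (fneg : forall z, f z <= - c0) (fP : PC D f).
Hypotheses (fL : forall z xi, f (z + xi) - f z <= L * nr xi).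
Hypotheses (f2 : forall z xi, `|f (z + xi) + f (z - xi) - 2 * f z| <= La * nr xi ^+ 2).
Hypotheses (rho01 : forall z, 0 <= rho z <= 1) (Kc : compact (supp rho)).
Hypothesis KD : forall x y, supp rho x -> nr (y - x) < d0 -> D y.
Hypotheses (HL : forall z xi, Hob f rho (z + xi) - Hob f rho z <= L * nr xi).
Hypotheses (Hb2 : forall z xi, Hob f rho (z + xi) + Hob f rho (z - xi) - 2 * Hob f rho z <= La * nr xi ^+ 2).
Hypothesis fm : Cc (fun z => f z + m0).
Local Notation v := (vs D f rho).
Local Notation F := (fun z => v z + m0).

Let f2' z xi : f (z + xi) + f (z - xi) - 2 * f z <= La * nr xi ^+ 2.
Proof. exact: le_trans (ler_norm _) (f2 _ _). Qed.

Let FamV : Fam D f rho v. Proof. exact: (Fam_vs oD c00 L0 d00 fcont fneg fP fL rho01 KD HL). Qed.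

Let vcts : continuous v. Proof. exact: (vs_cts oD c00 L0 d00 fcont fneg fP fL rho01 KD HL). Qed.

Let vsd z xi : 2 * nr xi < d0 -> v (z + xi) + v (z - xi) - 2 * v z <= La * nr xi ^+ 2.
Proof. exact: (vs_semi oD c00 L0 d00 fcont fneg fP fL f2' rho01 KD HL Hb2). Qed.

Lemma vs_Cc : Cc F.
Proof.
split.
  have cm : continuous (fun _ : V => m0) by exact: cts_cst.
  exact: ctsD vcts cm.
have [_ [M fM]] := fm; have [M' KM] := compact_nr_bounded Kc.
exists (Num.max M M') => z; rewrite ge_max => /andP[z1 z2].
have oz : ~ supp rho z by move=> /KM; rewrite ltNge z2.
by rewrite (Fam_out FamV oz); exact: fM.
Qed.

Let near_supp z := exists2 x, supp rho x & nr (z - x) < d0 / 2.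

Lemma cnv_levi e kap z : e <= d0 / 4 -> mollifier e kap -> near_supp z -> forall x, 0 <= levi (hs (cnv kap F) z) x.
Proof.
move=> ed m [x0 Kx0 zx]; have Fc := vs_Cc; have cF : continuous F by case: Fc.
have uF : unifc F by move=> t t0; exact: (Cc_unifm Fc t0).
have FPC : PC D F.
  move=> y w dyw; have [_ _ _ vP] := FamV.
  have := sub_lin ler01 (vP y w dyw) (sub_cst m0 y w).
  by apply: sub_ext => y'; rewrite mul1r.
have GPC : PC near_supp (cnv kap F).
  apply: (conv_PC m cF uF _ FPC) => y h [x Kx yx] he; apply: (KD Kx).
  have -> : y + h - x = (y - x) + h by rewrite addrAC.
  by apply: le_lt_trans (nrD _ _) _; move: yx he ed d00; lra.
pose r := d0 / 2 - nr (z - x0); have r0 : 0 < r by rewrite subr_gt0.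
have GC : Ck 2 (cnv kap F) by apply: smooth_Ck; exact: conv_smooth m Fc.
apply: (sub_levi GC r0) => w wr; apply: GPC => c c1; exists x0 => //.
have -> : z + c *: w - x0 = (z - x0) + c *: w by rewrite addrAC.
apply: le_lt_trans (nrD _ _) _; rewrite nrZ.
have := ler_wpM2r (nr_ge0 w) c1; move: wr; rewrite /r mul1r; lra.
Qed.

(** The upper bound comes from [vs_semi]. Near the support of ρ the Levi form is nonnegative, so the
    second derivative along h is at least minus that along ih; away from it the envelope is f, whose
    second differences are bounded on both sides. *)
Lemma cnv_hess e kap z a b : e <= d0 / 8 -> mollifier e kap -> `|hs (cnv kap F) z a b| <= 3 * `|La|.
Proof.
move=> ed m; have Fc := vs_Cc; pose G := cnv kap F.
have GC : Ck 2 G by apply: smooth_Ck; exact: conv_smooth m Fc.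
have d80 : 0 < d0 / 8 by rewrite divr_gt0.
have up h : D2 G z h <= La * nr h ^+ 2.
  rewrite -[D2 G z h]mul1r; apply: (sd_D2 h GC _ d80); first by rewrite normr1.
  move=> xi xid; apply: (cnv_sd m Fc) => w _; rewrite mul1r.
  have := @vsd (z + w) xi; have -> : 2 * nr xi < d0 by move: xid d00; lra.
  move=> /(_ isT); lra.
have N2v x : N2 (vco x) = \sum_s x s ^+ 2.
  by rewrite -[in RHS](cov_vco x).
have upx x : bil (hs G z) x x <= `|La| * \sum_s x s ^+ 2.
  have := up (vco x); rewrite -bil_D2 cov_vco => h; apply: le_trans h _.
  apply: le_trans (_ : `|La| * nr (vco x) ^+ 2 <= _).
    by apply: ler_wpM2r; [rewrite exprn_ge0// nr_ge0|exact: ler_norm].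
  by rewrite ler_wpM2l// -N2v; exact: nr_N2.
have hsy : forall a b, hs G z a b = hs G z b a by exact: hs_sym.
apply: (bil_entries (normr_ge0 La) hsy) => x; rewrite ler_norml upx andbT.
have [nz|nz] := pselect (near_supp z).
  have e4 : e <= d0 / 4 by move: ed d00; lra.
  have := cnv_levi e4 m nz x; rewrite /levi -/G; have := upx (Jv x); rewrite sum_Jv; lra.
have lo h : -1 * D2 G z h <= `|La| * nr h ^+ 2.
  apply: (sd_D2 h GC _ d80); first by rewrite normrN1.
  move=> xi xid; apply: (cnv_sd m Fc) => w kw; have we := moll_supp m kw.
  have far y : nr (y - z) < d0 / 4 -> v y = f y.
    move=> yz; apply: (Fam_out FamV) => Ky; apply: nz; exists y => //; rewrite nrB; move: yz d00; lra.
  have n1 y : nr (z + w + y - z) <= nr w + nr y.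
    have -> : z + w + y - z = w + y by rewrite addr2K.
    exact: nrD.
  have f0 : v (z + w) = f (z + w).
    by apply: far; have := n1 0; rewrite addr0 nr0; move: we ed d00; lra.
  have fp : v (z + w + xi) = f (z + w + xi).
    by apply: far; apply: le_lt_trans (n1 _) _; move: we xid ed d00; lra.
  have fn : v (z + w - xi) = f (z + w - xi).
    by apply: far; apply: le_lt_trans (n1 _) _; rewrite nrN; move: we xid ed d00; lra.
  rewrite f0 fp fn.
  have := f2 (z + w) xi; rewrite ler_norml => /andP[h1 _].
  have h2 : La * nr xi ^+ 2 <= `|La| * nr xi ^+ 2.
    by apply: ler_wpM2r; [rewrite exprn_ge0// nr_ge0|exact: ler_norm].
  move: h1 h2; lra.
have := lo (vco x); rewrite -bil_D2 cov_vco mulN1r lerNl => h; apply: le_trans h.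
rewrite lerN2 ler_wpM2l// -N2v; exact: nr_N2.
Qed.

Lemma env_zero chi (r1 : R) : 0 < r1 -> Cc chi -> (forall z, 0 <= chi z) ->
  (forall z y, chi z != 0 -> nr (y - z) <= r1 -> rho y = 1) ->
  forall t : R, 0 < t -> exists2 e1 : R, 0 < e1 & forall e kap, e <= e1 -> mollifier e kap ->
    I (fun z => chi z * top (Xf n 0 (cnv kap F) z)) <= t.
Proof.
move=> r10 chc ch0 chr.
have Ks y : rho y = 1 -> supp rho y.
  by move=> r1'; apply: subset_closure => /=; rewrite r1' oner_neq0.
have d80 : 0 < d0 / 8 by rewrite divr_gt0.
apply: (@ma_zero R n F chi [set z | forall y, nr (y - z) <= r1 -> rho y = 1] (3 * `|La|) (d0 / 8) r1 c0) => //.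
- exact: vs_Cc.
- by move=> e kap z a b; exact: cnv_hess.
- move=> e kap z ed m Ez; apply: (cnv_levi _ m); first by move: ed d00; lra.
  by exists z; [apply: Ks; apply: Ez; rewrite subrr nr0 ltW|rewrite subrr nr0 divr_gt0].
- move=> z0 r sg ga a l M Ez r0 rr1 ga0 HM sgr gar Hq.
  apply: (@no_bump R n D f rho c0 L d0 n0 oD c00 L0 d00 fcont fneg fP fL rho01 Kc KD HL
    z0 r sg ga (a - m0) l M r0 ga0 _ HM sgr gar).
    move=> y yr; have r1y := Ez y (le_trans yr rr1); split => //.
    by apply: (KD (Ks _ r1y)); rewrite subrr nr0.
  move=> y yr; have := Hq y yr; rewrite /quad.
  have -> : v y + m0 - (a + \sum_a0 l a0 * co a0 (y - z0) + bil M (cov (y - z0)) (cov (y - z0)) / 2) =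
    v y - (a - m0 + \sum_a0 l a0 * co a0 (y - z0) + bil M (cov (y - z0)) (cov (y - z0)) / 2).
    have alg (x u p q : R) : x + m0 - (u + p + q) = x - (u - m0 + p + q) by ring.
    exact: alg.
  by [].
move=> z nE; apply/eqP; apply: contrapT => /negP cz; apply: nE => y; exact: chr.
Qed.

End envelope_zero.

(** * From currents defined inductively to forms of mollifications *)

Section link.
Context {R : realType} {n : nat}.
Local Notation V := (Cspace R n).
Local Notation idx := ('I_n * bool)%type.
Local Notation form := {ffun {set idx} -> R^o}.
Local Notation I := (@Cintegral R n).
Implicit Types (phi psi kap : V -> R) (z w h : V) (S : {set idx}).

Lemma closed_supp phi : closed (supp phi).
Proof. exact: closed_closure. Qed.

Lemma supp_subset phi psi : (forall z, ~ supp phi z -> psi z = 0) -> supp psi `<=` supp phi.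
Proof.
move=> h; have -> : supp phi = closure (supp phi) by apply/(closure_id _).1; exact: closed_closure.
apply: closure_subset => z /= pz; apply: contrapT => /h e; by rewrite e eqxx in pz.
Qed.

Lemma test_cont_sub D K psi : continuous psi -> compact K -> K `<=` D -> closed K ->
  (forall z, ~ K z -> psi z = 0) -> test_cont D psi.
Proof.
move=> cp cK KD clK h.
have sK : supp psi `<=` K.
  rewrite (closure_id K).1//; apply: closure_subset => z /= pz; apply: contrapT => /h e; by rewrite e eqxx in pz.
split => //; last exact: (subset_trans sK).
by apply: (subclosed_compact _ cK sK); exact: closed_closure.
Qed.

Lemma iter_delta_Xf (k m : nat) (f : V -> R) z : iter m (Q (@delta R n)) (Xf k 0 f z) = Xf k m f z.
Proof. by elim: m => [//|m IH]; rewrite iterS IH Q_delta_Xf. Qed.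

Variables (D1 : set V) (F : V -> R).
Hypotheses (oD1 : open D1) (Fc : Cc F) (FP : PC D1 F).

Definition nbd (K : set V) (d : R) : set V := [set z | exists2 x, K x & nr (z - x) < d].

Lemma open_nbd K d : open (nbd K d).
Proof.
rewrite openE => z [x Kx zx]; apply/nbhs_nrP; exists (d - nr (z - x)); first by rewrite subr_gt0.
move=> y yz; exists x => //; apply: le_lt_trans (nr_triangle _ z _) _; move: yz; lra.
Qed.

Lemma nbd_self K d : 0 < d -> K `<=` nbd K d.
Proof. by move=> d0 z Kz; exists z => //; rewrite subrr nr0. Qed.

Lemma cnv_psh2 K d e kap : 0 < d -> (forall x y, K x -> nr (y - x) < d -> D1 y) -> e <= d / 2 ->
  mollifier e kap -> psh2 (nbd K (d / 2)) (cnv kap F).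
Proof.
move=> d0 KD ed m z [x0 Kx0 zx]; have cF : continuous F by case: Fc.
have uF : unifc F by move=> t t0; exact: (Cc_unifm Fc t0).
have GPC : PC (nbd K (d / 2)) (cnv kap F).
  apply: (conv_PC m cF uF _ FP) => y h [x Kx yx] he; apply: (KD x) => //.
  have -> : y + h - x = (y - x) + h by rewrite addrAC.
  by apply: le_lt_trans (nrD _ _) _; move: yx he ed; lra.
pose r := d / 2 - nr (z - x0); have r0 : 0 < r by rewrite subr_gt0.
have GC : Ck 2 (cnv kap F) by have /smoothP := conv_smooth m Fc.
apply: (sub_levi GC r0) => w wr; apply: GPC => c c1; exists x0 => //.
have -> : z + c *: w - x0 = (z - x0) + c *: w by rewrite addrAC.
apply: le_lt_trans (nrD _ _) _; rewrite nrZ.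
have := ler_wpM2r (nr_ge0 w) c1; move: wr; rewrite /r mul1r; lra.
Qed.

(** An order zero bound, uniform in the mollification: coefficients are dominated by the trace
    measure ([form_coef]), whose mass is bounded by [cln]. *)
Lemma mass K (k : nat) : compact K -> K `<=` D1 -> (k <= n)%N -> exists2 C : R, 0 <= C & exists2 e0 : R, 0 < e0 &
  forall e kap, e <= e0 -> mollifier e kap -> forall phi (A : R) S, Cc phi -> (forall z, ~ K z -> phi z = 0) ->
    (forall z, `|phi z| <= A) -> `|I (fun z => phi z * Xf k 0 (cnv kap F) z S)| <= C * A.
Proof.
move=> cK KD1 kn; have [chi [[cs cc cD] c01 [d' d'0 d'P]]] := cutoff cK oD1 KD1.
have [d d0 dP] := compact_margin cc oD1 cD.
have d20 : 0 < d / 2 by rewrite divr_gt0.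
have tchi : test_smooth (nbd (supp chi) (d / 2)) chi by split => //; exact: nbd_self.
have [Mb Mb0 FM] := Cc_bounded Fc.
have cF : continuous F by case: Fc.
have chi0 z : 0 <= chi z by have /andP[] := c01 z.
have [C0 C0P] := cln (@open_nbd (supp chi) (d / 2)) kn (ltW Mb0) tchi chi0.
pose c : R := (2 * n%:R) ^+ (2 * k).
have c0 : 0 <= c by rewrite exprn_ge0.
exists (c * `|C0|); first by rewrite mulr_ge0.
exists (d / 2) => // e kap ed m phi A S pc pK pA.
have A0 : 0 <= A by exact: le_trans (normr_ge0 _) (pA 0).
pose w := cnv kap F; have wC k' : Ck k' w by have /smoothP := conv_smooth m Fc.
have wp : psh2 (nbd (supp chi) (d / 2)) w by exact: (cnv_psh2 d0 dP ed m).
have wM z : nbd (supp chi) (d / 2) z -> `|w z| <= Mb.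
  by move=> _; exact: (cnv_bounded m cF FM).
have h1 := C0P w (wC 3%N) wp wM.
have tc : Cc (fun z => chi z * top (Xf k (n - k) w z)) by apply: Cc_top => //; exact: test_Cc tchi.
have Xc : continuous (fun z => Xf k 0 w z S) by exact: Xf_C.
apply: (@le_trans _ _ (I (fun z => A * c * (chi z * top (Xf k (n - k) w z))))).
  apply: I_abs; [exact: (CcMc pc Xc)|exact: CcMl|move=> z].
  have top0 : 0 <= chi z * top (Xf k (n - k) w z).
    have [->|cz] := eqVneq (chi z) 0; first by rewrite mul0r.
    apply: mulr_ge0 => //; apply: (Xf_ge0 (wC 2%N) wp); last by rewrite subnKC.
    by apply: nbd_self => //; exact: suppP.
  have [Kz|nK] := pselect (K z); last first.
    by rewrite pK// mul0r normr0; apply: mulr_ge0 => //; exact: mulr_ge0.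
  have cz : chi z = 1 by apply: (d'P z z Kz); rewrite subrr nr0.
  have Dz : nbd (supp chi) (d / 2) z by apply: nbd_self => //; apply: suppP; rewrite cz oner_neq0.
  rewrite cz mul1r normrM -mulrA; apply: ler_pM => //.
  have := @form_coef R n (hs w z) k S (hs_sym z (wC 2%N)) (wp z Dz) kn.
  by rewrite -[iter k _ fone]/(Xf k 0 w z) iter_delta_Xf.
rewrite I_Ml// mulrC -mulrA [A * c]mulrC.
have := ler_wpM2r (mulr_ge0 c0 A0) (le_trans h1 (ler_norm C0)).
have alg (x : R) : x * (c * A) = c * (x * A) by ring.
by move=> hh; rewrite -(alg `|C0|); exact: hh.
Qed.

Variables (Ut : set V) (u : V -> R) (m0 : R).
Hypotheses (DUt : D1 `<=` Ut) (Fu : forall z, D1 z -> F z = u z + m0).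

Let test_mono phi : test_cont D1 phi -> test_cont Ut phi.
Proof. by move=> [h1 h2 h3]; split => //; exact: (subset_trans h3). Qed.

Let approx (k : nat) (T : current) := forall S phi, test_cont D1 phi -> forall t : R, 0 < t ->
  exists2 e0 : R, 0 < e0 & forall e kap, e <= e0 -> mollifier e kap ->
    `|T S phi - I (fun z => phi z * Xf k 0 (cnv kap F) z S)| <= t.

Lemma sum_close (P : idx -> pred idx) (c X Y : idx -> idx -> R) (t : R) : 0 <= t -> (forall a b, `|c a b| <= 1) ->
  (forall a b, `|X a b - Y a b| <= t / (#|{: idx}|%:R * #|{: idx}|%:R + 1)) ->
  `|\sum_(a : idx) \sum_(b : idx | P a b) c a b * X a b - \sum_(a : idx) \sum_(b : idx | P a b) c a b * Y a b| <= t.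
Proof.
move=> t0 c1; set K1 : R := #|{: idx}|%:R; set t' := t / _ => XY.
have K10 : 0 < K1 * K1 + 1 by rewrite ltr_wpDl// mulr_ge0.
have t'0 : 0 <= t' by rewrite divr_ge0// ltW.
apply: (@le_trans _ _ (\sum_(a : idx) \sum_(b : idx) t')); last first.
  rewrite (eq_bigr _ (fun a _ => sumK _ _)) sumK -/K1 mulrA /t' mulrA ler_pdivrMr//.
  by rewrite mulrC ler_wpM2l// lerDl.
rewrite -sumrB; apply: le_trans (ler_norm_sum _ _ _) _; apply: ler_sum => a _; rewrite -sumrB.
apply: le_trans (ler_norm_sum _ _ _) _; rewrite [leRHS](bigID (P a))/=.
apply: ler_wpDr; first by apply: sumr_ge0 => b _.
apply: ler_sum => b _; rewrite -mulrBr normrM -[leRHS]mul1r.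
by apply: ler_pM => //; exact: XY.
Qed.

(** Subtracting the constant c does not change dd^c w; it is there because F is only u + m0 on
    [D1]. *)
Lemma step_ibp (k : nat) (w phi : V -> R) (c : R) S : Ck 3 w -> Ck 2 phi -> Cc phi ->
  I (fun z => phi z * Xf k.+1 0 w z S) = I (fun z => (w z - c) * Q (hs phi z) (Xf k 0 w z) S).
Proof.
move=> w3 p2 pc; have w2 : Ck 2 w := CkW (isT : (2 <= 3)%N) w3.
have gC : Ck 2 (fun z => w z - c) := CkB w2 (Ck_cst 2 c).
have hsc z : hs (fun=> c : R) z = (fun _ _ => 0) :> (idx -> idx -> R).
  apply/funext => b; apply/funext => a.
  rewrite /hs; have -> : pderiv a (fun=> c : R) = (fun=> 0) by apply/funext => y; exact: pderiv_cst.
  exact: pderiv_cst.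
have hsg z : hs (fun z => w z - c) z = hs w z.
  rewrite (hsB z w2 (Ck_cst 2 c)) hsc; apply/funext => b; apply/funext => a; exact: subr0.
have EQ z : Q (hs (fun z => w z - c) z) (Xf k 0 w z) = Xf k.+1 0 w z :=
  etrans (congr1 (fun L => Q L (Xf k 0 w z)) (hsg z)) (Q_Xf k 0 w z).
have E3 : (fun z => Xf k.+1 0 w z) = (fun z => Q (hs (fun z => w z - c) z) (Xf k 0 w z)).
  by apply/funext => z; rewrite EQ.
have E4 := congr1 (fun G : V -> form => I (fun z => phi z * (G z) S)) E3.
exact: (etrans E4 (esym (ibp2 S gC p2 pc (Xf_closed k 0 w3)))).
Qed.

(** On smooth φ both sides are finite sums of integrals of second derivatives of φ times u, or times
    the mollification. The induction hypothesis is applied to the continuous test functions obtained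
    with u, and [mass] absorbs the uniformly small difference between u and its mollification. *)
Lemma smooth_step (k : nat) (T T' : @current R n) : (k < n)%N -> approx k T' ->
  (forall S phi, test_smooth Ut phi -> T S phi = ddc_mul u T' S phi) ->
  forall S phi, test_smooth D1 phi -> forall t : R, 0 < t ->
  exists2 e0 : R, 0 < e0 & forall e kap, e <= e0 -> mollifier e kap ->
    `|T S phi - I (fun z => phi z * Xf k.+1 0 (cnv kap F) z S)| <= t.
Proof.
move=> kn IH TT S phi tphi t t0; have [ps pc pD] := tphi.
have phiC k' : Ck k' phi by exact: test_Ck tphi.
have phic : Cc phi := test_Cc tphi.
have cF : continuous F by case: Fc.
have cm : continuous (fun _ : V => m0) by exact: cts_cst.
have cFm : continuous (fun z : V => F z - m0) by exact: ctsB cF cm.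
have tU : test_smooth Ut phi by split => //; exact: (subset_trans pD).
have clp : closed (supp phi) by exact: closed_supp.
(* On the support of φ, F - m0 is u; written with F the product is continuous on the whole space. *)
pose psi (p : idx * idx) z := hs phi z p.1 p.2 * (F z - m0).
have hc (p : idx * idx) : Cc (fun z => hs phi z p.1 p.2) by exact: (Cc_hs p.2 p.1 (phiC 2%N) phic).
have hout (p : idx * idx) z : ~ supp phi z -> hs phi z p.1 p.2 = 0.
  by move=> /hs_out ->.
have tpsi p : test_cont D1 (psi p).
  apply: (test_cont_sub _ pc pD clp); first by have [] := CcMc (hc p) cFm.
  by move=> z oz; rewrite /psi (hout p z oz) mul0r.
have psiE p : (fun z => u z * pderiv p.1 (pderiv p.2 phi) z) = psi p.
  apply/funext => z; rewrite /psi -[pderiv p.1 _ z]/(hs phi z p.1 p.2).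
  have [sz|oz] := pselect (supp phi z); last by rewrite (hout p z oz) mul0r mulr0.
  rewrite (Fu (pD z sz)); have alg (x y : R) : x * y = y * (x + m0 - m0) by ring.
  exact: alg.
pose K1 : R := #|{: idx}|%:R.
pose t' := t / (K1 * K1 + 1).
have K10 : 0 < K1 * K1 + 1 by rewrite ltr_wpDl// mulr_ge0.
have t'0 : 0 < t' by rewrite divr_gt0.
have t20 : 0 < t' / 2 by rewrite divr_gt0.
pose S' (p : idx * idx) := (S :\ p.1 :\ conj_idx p.2)%SET.
have [C C0 [e1 e10 mP]] := mass pc pD (ltnW kn).
have [B B0 hB] := hs_bounded (phiC 2%N) phic.
have CB : 0 < C * B + 1 by rewrite ltr_wpDl// mulr_ge0.
have s0 : 0 < t' / 2 / (C * B + 1) by rewrite divr_gt0.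
have [e2 e20 aP] := conv_approx Fc s0.
have [e3 e30 eP] : exists2 r : R, 0 < r & forall (p : idx * idx) e, e < r -> forall kap, mollifier e kap ->
    `|T' (S' p) (psi p) - I (fun z => (cnv kap F z - m0) * hs phi z p.1 p.2 * Xf k 0 (cnv kap F) z (S' p))| <= t'.
  apply: fin_pos => p; have [e4 e40 e4P] := IH (S' p) (psi p) (tpsi p) _ t20.
  exists (Num.min e4 (Num.min e1 e2)); first by rewrite !lt_min e40 e10.
  move=> e; rewrite !lt_min => /andP[l4 /andP[l1 l2]] kap m.
  have wC k' : Ck k' (cnv kap F) by have /smoothP := conv_smooth m Fc.
  have cw := Ck_cont (wC 0%N).
  have cwm : continuous (fun z : V => cnv kap F z - m0) by exact: ctsB cw cm.
  have Xc : continuous (fun z => Xf k 0 (cnv kap F) z (S' p)) by exact: Xf_C.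
  have q1 := e4P e kap (ltW l4) m.
  pose dl z := hs phi z p.1 p.2 * (F z - cnv kap F z).
  have cd : continuous (fun z : V => F z - cnv kap F z) by exact: ctsB cF cw.
  have dlc : Cc dl := CcMc (hc p) cd.
  have dlA z : `|dl z| <= B * (t' / 2 / (C * B + 1)).
    by rewrite /dl normrM; apply: ler_pM => //; rewrite distrC; apply: (aP kap e (ltW l2) m).
  have dlo z : ~ supp phi z -> dl z = 0 by move=> oz; rewrite /dl (hout p z oz) mul0r.
  have q2 := mP e kap (ltW l1) m dl _ (S' p) dlc dlo dlA.
  have {}q2 : `|I (fun z => dl z * Xf k 0 (cnv kap F) z (S' p))| <= t' / 2.
    apply: le_trans q2 _.
    rewrite mulrA mulrCA mulrA ler_pdivrMr//.
    have alg (a b x : R) : 0 <= x -> x * (a * b) <= x * (a * b + 1) by move=> x0; nra.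
    exact: (alg C B _ (ltW t20)).
  have cwh : Cc (fun z => (cnv kap F z - m0) * hs phi z p.1 p.2).
    have -> : (fun z => (cnv kap F z - m0) * hs phi z p.1 p.2) = (fun z => hs phi z p.1 p.2 * (cnv kap F z - m0)).
      by apply/funext => z; exact: mulrC.
    exact: (CcMc (hc p) cwm).
  have E : I (fun z => psi p z * Xf k 0 (cnv kap F) z (S' p)) =
      I (fun z => dl z * Xf k 0 (cnv kap F) z (S' p)) +
      I (fun z => (cnv kap F z - m0) * hs phi z p.1 p.2 * Xf k 0 (cnv kap F) z (S' p)).
    rewrite -I_D; [|exact: (CcMc dlc Xc)|exact: (CcMc cwh Xc)].
    congr I; apply/funext => z; rewrite /psi /dl.
    have alg (x f g y : R) : x * (f - m0) * y = x * (f - g) * y + (g - m0) * x * y by ring.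
    exact: alg.
  rewrite E in q1; move: q1 q2; rewrite !ler_norml => /andP[? ?] /andP[? ?]; apply/andP; split; lra.
exists (e3 / 2); first by rewrite divr_gt0.
move=> e kap ee m; have e3e : e < e3 by move: ee e30; lra.
pose w := cnv kap F.
have wC k' : Ck k' w by have /smoothP := conv_smooth m Fc.
have gC0 : Ck 0 (fun z => w z - m0) by exact: CkB (wC 0%N) (Ck_cst 0 m0).
have E1 := step_ibp k m0 S (wC 3%N) (phiC 2%N) phic.
pose sgn (p : idx * idx) : R := (-1) ^+ p.2.2 * wedge_sign p.1 (S :\ p.1)%SET * wedge_sign (conj_idx p.2) (S :\ p.1 :\ conj_idx p.2)%SET.
have sgn1 p : `|sgn p| <= 1.
  by rewrite /sgn /wedge_sign !normrM !normrX !normrN1 !expr1n !mulr1.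
have Jc (p : idx * idx) : Cc (fun z => (w z - m0) * hs phi z p.1 p.2 * Xf k 0 w z (S' p)).
  have Xc : continuous (fun z => Xf k 0 w z (S' p)) by apply: Xf_C; exact: wC.
  have cwm : continuous (fun z : V => w z - m0) by exact: Ck_cont gC0.
  have -> : (fun z => (w z - m0) * hs phi z p.1 p.2 * Xf k 0 w z (S' p)) =
     (fun z => hs phi z p.1 p.2 * (w z - m0) * Xf k 0 w z (S' p)).
    by apply/funext => z; congr (_ * _); exact: mulrC.
  exact: (CcMc (CcMc (hc p) cwm) Xc).
have E2 : I (fun z => (w z - m0) * Q (hs phi z) (Xf k 0 w z) S) =
  \sum_(a : idx) \sum_(b : idx | (b \in S) && (conj_idx a \in S :\ b)%SET)
    sgn (b, a) * I (fun z => (w z - m0) * hs phi z b a * Xf k 0 w z (S' (b, a))).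
  transitivity (I (fun z => \sum_(a : idx) \sum_(b : idx | (b \in S) && (conj_idx a \in S :\ b)%SET)
    sgn (b, a) * ((w z - m0) * hs phi z b a * Xf k 0 w z (S' (b, a))))).
    congr I; apply/funext => z; rewrite Q_coef mulr_sumr; apply: eq_bigr => a _; rewrite mulr_sumr; apply: eq_bigr => b _.
    have alg (x s h y : R) : x * (s * (h * y)) = s * (x * h * y) by ring.
    exact: alg.
  rewrite I_sum; last by move=> a; apply: Cc_sum => b; apply: CcMl; exact: (Jc (b, a)).
  apply: eq_bigr => a _; rewrite I_sum; last by move=> b; apply: CcMl; exact: (Jc (b, a)).
  by apply: eq_bigr => b _; exact: (I_Ml (sgn (b, a)) (Jc (b, a))).
pose X (a b : idx) : R := T' (S' (b, a)) (psi (b, a)).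
pose Y (a b : idx) : R := I (fun z => (w z - m0) * hs phi z b a * Xf k 0 w z (S' (b, a))).
have E0 : T S phi = \sum_(a : idx) \sum_(b : idx | (b \in S) && (conj_idx a \in S :\ b)%SET) sgn (b, a) * X a b.
  rewrite (TT S phi tU) /ddc_mul; apply: eq_bigr => a _; apply: eq_bigr => b _.
  exact: (congr1 (fun f => sgn (b, a) * T' (S' (b, a)) f) (psiE (b, a))).
have XY a b : `|X a b - Y a b| <= t' by exact: (eP (b, a) e e3e kap m).
have := @sum_close (fun a b => (b \in S) && (conj_idx a \in S :\ b)%SET) (fun a b => sgn (b, a)) X Y t (ltW t0)
  (fun a b => sgn1 (b, a)) XY.
rewrite -E0; apply: le_trans; rewrite le_eqVlt; apply/orP; left; apply/eqP.
exact: (congr1 (fun x => `|T S phi - x|) (etrans E1 E2)).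
Qed.

(** The passage from smooth to continuous φ mollifies φ. *)
Lemma link (k : nat) T : (k <= n)%N -> is_ddc_power Ut u k T -> approx k T.
Proof.
elim: k T => [|k IH] T kn.
  move=> [TB T0] S phi tp t t0; exists 1 => // e kap _ m.
  rewrite (T0 S phi (test_mono tp)).
  have -> : (fun z => phi z * Xf 0 0 (cnv kap F) z S) = (fun z => phi z * (S == finset.set0)%:R).
    by apply/funext => z; rewrite /Xf/= ffunE.
  case: eqP => _.
    have -> : (fun z => phi z * 1%:R) = phi by apply/funext => z; exact: mulr1.
    by rewrite subrr normr0 ltW.
  have -> : (fun z => phi z * 0%:R) = (fun=> 0) by apply/funext => z; exact: mulr0.
  by rewrite I_0 subr0 normr0 ltW.
move=> [TB [T' HT' TT]] S phi tp t t0; have [cp pc pD] := tp.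
have phic : Cc phi.
  have [M KM] := compact_nr_bounded pc; split => //; exists M => z Mz; apply: supp_out => /KM.
  by rewrite ltNge Mz.
have SS := smooth_step kn (IH T' (ltnW kn) HT') TT.
have [chi [[cs cc cD] c01 [d d0 dP]]] := cutoff pc oD1 pD.
have [Tlin Tbd] := TB S.
have [C1 C1P] := Tbd (supp chi) cc (subset_trans cD DUt).
have [C2 C20 [e2 e20 mP]] := mass cc cD kn.
have C10 : 0 <= `|C1| by [].
have CC : 0 < `|C1| + C2 + 1 by lra.
pose s := t / 2 / (`|C1| + C2 + 1).
have s0 : 0 < s by rewrite !divr_gt0.
have CCs : `|C1| * s + C2 * s <= t / 2.
  rewrite -mulrDl /s mulrA ler_pdivrMr// mulrC; apply: ler_wpM2l; first by rewrite divr_ge0// ltW.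
  by rewrite lerDl.
have [e4 e40 aP] := conv_approx phic s0.
pose q := Num.min e4 d; have q0 : 0 < q by rewrite lt_min e40.
have [q4 qd] : q <= e4 /\ q <= d by rewrite /q !ge_min !lexx orbT.
have [rho mr] := @mollifier_exists R n q q0.
pose ph := cnv rho phi.
have phout z : ~ supp chi z -> ph z = 0.
  move=> oz; rewrite /ph /cnv -[RHS](@I_0 R n); congr I; apply/funext => w.
  have [->|rw] := eqVneq (rho w) 0; first by rewrite mul0r.
  have e : phi (z + w) = 0.
    apply: (@supp_out R n phi) => sw; apply: oz; apply: suppP.
    have zw : nr (z - (z + w)) < d.
      have -> : z - (z + w) = - w by rewrite opprD addrA subrr add0r.
      by rewrite nrN; exact: lt_le_trans (moll_supp mr rw) qd.
    by rewrite (dP (z + w) z sw zw) oner_neq0.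
  by rewrite e mulr0.
have phc : Cc ph := conv_Cc (moll_Cc mr) phic.
have tph : test_cont D1 ph.
  have cph : continuous ph by case: phc.
  exact: (test_cont_sub cph cc cD (@closed_supp chi) phout).
have tphs : test_smooth D1 ph by have [h1 h2 h3] := tph; split => //; exact: conv_smooth mr phic.
have t20 : 0 < t / 2 by rewrite divr_gt0.
have [e5 e50 SP] := SS S ph tphs _ t20.
exists (Num.min e2 e5); first by rewrite lt_min e20.
move=> e kap; rewrite le_min => /andP[ee2 ee5] m.
(* The difference is uniformly at most s; it is negligible for T because T has order zero, and for
   the smooth forms by [mass]. *)
pose df z := -1 * ph z + phi z.
have dfs z : `|df z| <= s by rewrite /df mulN1r addrC distrC; exact: (aP rho q).
have dfc : Cc df by apply: CcD => //; exact: CcMl.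
have dfout z : ~ supp chi z -> df z = 0.
  move=> oz; rewrite /df (phout z oz) mulr0 add0r; apply: (@supp_out R n phi) => sz; apply: oz; apply: suppP.
  have zz : nr (z - z) < d by rewrite subrr nr0.
  by rewrite (dP z z sz zz) oner_neq0.
have tdf : test_cont Ut df.
  have cdf : continuous df by case: dfc.
  exact: (test_cont_sub cdf cc (subset_trans cD DUt) (@closed_supp chi) dfout).
have h1 : `|T S df| <= `|C1| * s.
  have sd : supp df `<=` supp chi by exact: supp_subset.
  by apply: le_trans (C1P df s tdf sd dfs) _; apply: ler_wpM2r; [exact: ltW|exact: ler_norm].
have h2 : T S df = -1 * T S ph + T S phi by apply: Tlin; exact: test_mono.
have h3 := mP e kap ee2 m df s S dfc dfout dfs.
have Xc : continuous (fun z => Xf k.+1 0 (cnv kap F) z S).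
  by apply: Xf_C; have /smoothP := conv_smooth m Fc.
have h4 : I (fun z => df z * Xf k.+1 0 (cnv kap F) z S) =
    -1 * I (fun z => ph z * Xf k.+1 0 (cnv kap F) z S) + I (fun z => phi z * Xf k.+1 0 (cnv kap F) z S).
  rewrite -I_Ml; last exact: (CcMc phc Xc).
  rewrite -I_D; [|by apply: CcMl; exact: (CcMc phc Xc)|exact: (CcMc phic Xc)].
  congr I; apply/funext => z; rewrite /df; have alg (a b x : R) : (-1 * a + b) * x = -1 * (a * x) + b * x by ring.
  exact: alg.
have h5 := SP e kap ee5 m.
move: h1 h3 h5 CCs; rewrite h2 h4 !ler_norml.
move: (T S ph) (T S phi) (I _) (I _) => x1 x2 x3 x4 /andP[? ?] /andP[? ?] /andP[? ?] ?.
by apply/andP; split; lra.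
Qed.

End link.

(** * Bounding the integral against the given measure *)

Section monge_ampere_integral.
Context {R : realType} {n : nat}.
Local Notation V := (Cspace R n).
Local Notation idx := ('I_n * bool)%type.
Local Notation I := (@Cintegral R n).
Implicit Types (phi psi kap : V -> R) (z w h : V) (S : {set idx}).

Lemma cts_measurable (f : Bspace R n -> R) : continuous (f : V -> R) -> measurable_fun [set: Bspace R n] f.
Proof.
move=> cf; apply: (measurability _ (measurable_realfun.RGenOInfty.measurableE R)) => //.
move=> /= _ [_ [a ->] <-]; rewrite setTI; apply: sub_sigma_algebra.
by move/continuousP: cf; apply; exact: interval_open.
Qed.

Lemma open_Bmeasurable (A : set V) : open A -> measurable (A : set (Bspace R n)).
Proof. by move=> oA; apply: sub_sigma_algebra. Qed.

Lemma powRN_le (x y r : R) : 0 < x -> x <= y -> 0 <= r -> y `^ (- r) <= x `^ (- r).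
Proof.
move=> x0 xy r0; have y0 : 0 < y by exact: lt_le_trans xy.
rewrite !powRN lef_pV2 ?posrE ?powR_gt0//.
by apply: ge0_ler_powR => //; rewrite nnegrE ltW.
Qed.

Lemma integral_Pw_le (mu : {measure set (Bspace R n) -> \bar R}) (Ut U K : set V) (u g chi : V -> R) (al a c0 : R) :
  open Ut -> open U -> U `<=` K -> compact K -> K `<=` Ut -> (mu K < +oo)%E ->
  continuous g -> (forall z, g z <= - c0) -> 0 < c0 -> 0 < al -> al <= a ->
  continuous chi -> (forall z, 0 <= chi z <= 1) -> (forall z, U z -> chi z = 1) -> (forall z, ~ K z -> chi z = 0) ->
  (forall z, U z -> u z = g z) ->
  (\int[mu]_(z in U) (`|u z| `^ (- a))%:E <=
    (c0 `^ (al - a) * \int[mu]_(z in Ut) (chi z * Pw (- al) g z))%:E)%E.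
Proof.
move=> oUt oU UK cK KUt muK cg gc c00 al0 ala cchi c01 chi1 chi0 ug.
have mU := open_Bmeasurable oU; have mUt := open_Bmeasurable oUt.
have g0 z : g z < 0 by apply: le_lt_trans (gc z) _; rewrite oppr_lt0.
have cP (r : R) : continuous (Pw r g).
  by apply: (@Ck_cont R n 0); apply: Ck_Pw.
pose psi z := chi z * Pw (- al) g z.
have cpsi : continuous psi by exact: ctsM.
have psi0 z : 0 <= psi z by have /andP[h _] := c01 z; rewrite mulr_ge0// powR_ge0.
pose B := c0 `^ (- al).
have PB z : Pw (- al) g z <= B.
  by apply: powRN_le => //; [rewrite lerNr|exact: ltW].
have psiB z : psi z <= B.
  have /andP[h1 h2] := c01 z; rewrite /psi -[leRHS]mul1r; apply: ler_pM => //; exact: powR_ge0.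
have B0 : 0 <= B by exact: powR_ge0.
have mK : measurable (K : set (Bspace R n)).
  have oK : open (~` K) by apply: closed_openC; apply: compact_closed => //; exact: norm_hausdorff.
  by rewrite -[K]setCK; apply: measurableC; exact: open_Bmeasurable.
have mc (D : set (Bspace R n)) (f : Bspace R n -> R) : continuous (f : V -> R) -> measurable_fun D f.
  by move=> cf; apply: measurable_funTS; exact: cts_measurable.
have fin : (\int[mu]_(z in Ut) (psi z)%:E < +oo)%E.
  have -> : (\int[mu]_(z in Ut) (psi z)%:E = \int[mu]_(z in K) (psi z)%:E)%E.
    rewrite [RHS]integral_mkcond [LHS]integral_mkcond; apply: eq_integral => z _; rewrite /patch.
    have [Kz|nK] := pselect (K z).
      by rewrite !mem_set//; exact: KUt.
    by rewrite [in RHS]memNset//; case: ifPn => // _; rewrite /psi (chi0 _ nK) mul0r.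
  apply: le_lt_trans (_ : \int[mu]_(z in K) (cst B%:E z) < +oo)%E.
    refine (@ge0_le_integral _ _ R mu K mK _ _ _ _ _ _).
    - by move=> z _; rewrite lee_fin.
    - by apply/measurable_realfun.measurable_EFinP; exact: mc.
    - exact: measurable_cst.
    - by move=> z _; rewrite lee_fin.
  by rewrite integral_cst//; apply: lte_mul_pinfty => //; rewrite lee_fin.
have fE : (\int[mu]_(z in Ut) (psi z)%:E = (\int[mu]_(z in Ut) psi z)%:E)%E.
  rewrite /Rintegral fineK// ge0_fin_numE//; apply: integral_ge0 => z _; by rewrite lee_fin.
rewrite EFinM -[(\int[mu]_(z in Ut) _)%:E]fE.
have cc0 : 0 <= c0 `^ (al - a) by exact: powR_ge0.
rewrite -ge0_integralZl//; first last.
- by move=> z _; rewrite lee_fin.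
- by apply/measurable_realfun.measurable_EFinP; exact: mc.
have -> : (\int[mu]_(z in U) (`|u z| `^ (- a))%:E = \int[mu]_(z in U) (Pw (- a) g z)%:E)%E.
  apply: eq_integral => z; rewrite inE => Uz; rewrite (ug z Uz) /Pw ltr0_norm//.
apply: (@le_trans _ _ (\int[mu]_(z in U) ((c0 `^ (al - a))%:E * (psi z)%:E))%E).
  refine (@ge0_le_integral _ _ R mu U mU _ _ _ _ _ _).
  - by move=> z _; rewrite lee_fin powR_ge0.
  - by apply/measurable_realfun.measurable_EFinP; apply: mc; exact: cP.
  - by apply: measurable_funeM; apply/measurable_realfun.measurable_EFinP; exact: mc.
  move=> z Uz; rewrite -EFinM lee_fin /psi (chi1 z Uz) mul1r /Pw.
  have ng : 0 < - g z by rewrite oppr_gt0.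
  have E : (- g z) `^ (- a) = (- g z) `^ (al - a) * (- g z) `^ (- al).
    rewrite -powRD; last by apply/implyP => _; rewrite gt_eqF.
    by rewrite addrAC subrr add0r.
  rewrite E.
  rewrite ler_wpM2r ?powR_ge0//.
  have -> : al - a = - (a - al) by rewrite opprB.
  by apply: powRN_le => //; [rewrite lerNr|rewrite subr_ge0].
refine (@ge0_subset_integral _ _ R mu U Ut mU mUt _ _ _ _).
- by apply: measurable_funeM; apply/measurable_realfun.measurable_EFinP; exact: mc.
- by move=> z _; rewrite -EFinM lee_fin mulr_ge0.
- exact: subset_trans UK KUt.
Qed.

Lemma ma_upper (Ut D1 U K : set V) (u F chi : V -> R) (mu : {measure set (Bspace R n) -> \bar R}) (m0 c0 al a : R) :
  open Ut -> open D1 -> D1 `<=` Ut -> open U -> U `<=` K -> compact K -> K `<=` D1 -> Cc F -> PC D1 F ->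
  (forall z, D1 z -> F z = u z + m0) -> (forall z, F z - m0 <= - c0) -> 0 < c0 -> 0 < al -> al <= a ->
  continuous chi -> (forall z, 0 <= chi z <= 1) -> (forall z, U z -> chi z = 1) -> (forall z, ~ K z -> chi z = 0) ->
  is_monge_ampere Ut u mu -> forall t : R, 0 < t ->
  exists2 e0 : R, 0 < e0 & forall e kap, e <= e0 -> mollifier e kap ->
   (\int[mu]_(z in U) (`|u z| `^ (- a))%:E <= (c0 `^ (al - a) *
     (I (fun z => chi z * Pw (- al) (fun z => F z - m0)%R z * top (Xf n 0 (cnv kap F) z)) + t))%:E)%E.
Proof.
move=> oUt oD1 D1U oU UK cK KD1 Fc FP Fu Fc0 c00 al0 ala cchi c01 chi1 chi0 [mK [T HT TE]] t t0.
have cF : continuous F by case: Fc.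
have cg : continuous (fun z : V => F z - m0).
  have cm : continuous (fun _ : V => m0) by exact: cts_cst.
  exact: ctsB cF cm.
have clK : closed K by apply: compact_closed => //; exact: norm_hausdorff.
have g0 z : F z - m0 < 0 by apply: le_lt_trans (Fc0 z) _; rewrite oppr_lt0.
pose psi z := chi z * Pw (- al) (fun z => F z - m0) z.
have cpsi : continuous psi.
  by apply: ctsM => //; apply: (@Ck_cont R n 0); apply: Ck_Pw => //; split.
have po z : ~ K z -> psi z = 0 by move=> /chi0 e; rewrite /psi e mul0r.
have tp1 : test_cont D1 psi := test_cont_sub cpsi cK KD1 clK po.
have tp : test_cont Ut psi := test_cont_sub cpsi cK (subset_trans KD1 D1U) clK po.
have [e0 e00 H] := link oD1 Fc FP D1U Fu (leqnn n) HT finset.setT tp1 t0.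
exists e0 => // e kap ee m; have := H e kap ee m; rewrite (TE psi tp) ler_norml => /andP[_ h].
have ug z : U z -> u z = F z - m0 by move=> /UK/KD1/Fu ->; rewrite addrK.
have KU := subset_trans KD1 D1U.
apply: le_trans (integral_Pw_le oUt oU UK cK KU (mK K cK KU) cg Fc0 c00 al0 ala cchi c01 chi1 chi0 ug) _.
rewrite lee_fin; apply: ler_wpM2l; first exact: powR_ge0.
by move: h; rewrite /psi /top lerBlDl addrC.
Qed.

End monge_ampere_integral.

(** * The set where u is -oo has empty interior *)

Section finiteness.
Context {R : realType} {n : nat}.
Local Notation V := (Cspace R n).
Local Notation mu := (@lebesgue_measure R).
Implicit Types (u : V -> \bar R) (z w y : V).

Lemma cis0 : cis 0 = 1 :> Cplx R.
Proof. by rewrite /cis cos0 sin0 rC1. Qed.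

Lemma lte_oppr1 (x : \bar R) (b : R) : (b%:E < - x)%E -> (x < (- b)%:E)%E.
Proof. by rewrite lteNr EFinN. Qed.

Lemma lte_oppr2 (x : \bar R) (b : R) : (x < (- b)%:E)%E -> (b%:E < - x)%E.
Proof. by rewrite lteNr EFinN. Qed.

(** An arc of positive length where u is -oo makes the whole mean -oo, as u is bounded above by
    0. *)
Lemma circle_minf u y w (tau : R) : (forall t, (u (y + cis t *: w)%R <= 0)%E) ->
  lower_semicontinuous (fun t : R => - u (y + cis t *: w)%R)%E -> 0 < tau -> tau <= 2 * pi ->
  (forall t, 0 <= t <= tau -> u (y + cis t *: w) = -oo%E) -> circle_mean u y w = -oo%E.
Proof.
move=> u0 lu tau0 taupi um; pose h (t : R) := (- u (y + cis t *: w)%R)%E.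
have h0 t : (0 <= h t)%E by rewrite /h leeNr oppe0.
have mh := measurable_realfun.lower_semicontinuous_measurable lu.
have m1 : measurable (`[0%R, (2 * pi)%R]%classic : set R) by exact: measurable_itv.
have m2 : measurable (`[0%R, tau]%classic : set R) by exact: measurable_itv.
have sub : `[0%R, tau]%classic `<=` (`[0%R, (2 * pi)%R]%classic : set R).
  by move=> t /=; rewrite !in_itv/= => /andP[-> /le_trans]; apply.
have H1 : (\int[mu]_(t in `[0%R, tau]) h t <= \int[mu]_(t in `[0%R, (2 * pi)%R]) h t)%E.
  refine (@ge0_subset_integral _ _ R mu _ _ m2 m1 h _ _ sub); first by move=> mD Y mY; have := mh measurableT Y mY; rewrite setTI => hh; exact: measurableI.
  by move=> t _; exact: h0.
have H2 : (\int[mu]_(t in `[0%R, tau]) h t = +oo)%E.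
  have -> : (\int[mu]_(t in `[0%R, tau]) h t = \int[mu]_(t in `[0%R, tau]) (cst +oo t))%E.
    by apply: eq_integral => t; rewrite inE/= in_itv/= => tt; rewrite /h um.
  rewrite integral_cst//= lebesgue_measure_itv/= lte_fin tau0 -EFinB subr0.
  by rewrite gt0_mulye// lte_fin.
rewrite H2 leye_eq in H1; move/eqP: H1 => H1.
rewrite /circle_mean; have -> : (\int[mu]_(t in `[0%R, (2 * pi)%R]) u (y + rC (cos t) (sin t) *: w)%R = - \int[mu]_(t in `[0%R, (2 * pi)%R]) h t)%E.
  rewrite -integral_ge0N; last by move=> t _; exact: h0.
  by apply: eq_integral => t _; rewrite /h oppeK.
by rewrite H1 gt0_muleNy// lte_fin invr_gt0 pi20.
Qed.

(** The interior of the set where u is -oo is open and relatively closed in the domain; by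
    connectedness it would be everything, against the definition of [psh]. *)
Lemma no_minf Omega u : domain Omega -> psh Omega u -> (forall z, Omega z -> (u z < 0)%E) ->
  forall z0 (r : R), 0 < r -> (forall y, nr (y - z0) < r -> Omega y /\ u y = -oo%E) -> False.
Proof.
move=> [oO cO O0] [usc circ nm] uneg z0 r r0 H.
pose A := [set z | exists2 r : R, 0 < r & forall y, nr (y - z) < r -> Omega y /\ u y = -oo%E].
have zz z (d : R) : 0 < d -> nr (z - z) < d by rewrite subrr nr0.
have AO : A `<=` Omega by move=> z [d d0 dP]; have [] := dP z (zz z d d0).
have Az z : A z -> u z = -oo%E by move=> [d d0 dP]; have [] := dP z (zz z d d0).
have A0 : A z0 by exists r.
have oA : open A.
  rewrite openE => z [d d0 dP]; apply/nbhs_nrP; exists (d / 2); first by rewrite divr_gt0.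
  move=> y yz; exists (d / 2); first by rewrite divr_gt0.
  by move=> x xy; apply: dP; apply: le_lt_trans (nr_triangle _ y _) _; move: xy yz; lra.
suff cA z : Omega z -> closure A z -> A z.
  have AE : A = Omega.
    apply: (cO A); first by exists z0.
      by exists A => //; rewrite setIidr.
    exists (closure A); first exact: closed_closure.
    by apply/seteqP; split => z; [move=> Az'; split; [exact: AO|exact: subset_closure]|move=> [h1 h2]; exact: cA].
  have [y yc] := nm z0 (AO _ A0); apply/negP; rewrite negbK; apply/eqP; apply: Az.
  by rewrite AE; exact: (connected_component_sub yc).
move=> Oz clz; have /nbhs_nrP[r3 r30 r3P] : nbhs z Omega by move: oO; rewrite openE; apply.
pose q := r3 / 4; have q0 : 0 < q by rewrite divr_gt0.
have [a [Aa az]] : A `&` [set y | nr (y - z) < q] !=set0.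
  by apply: clz; apply/nbhs_nrP; exists q.
have [s s0 sP] := Aa.
exists q => // y yz; have Oy : Omega y by apply: r3P; move: yz; rewrite /q; lra.
(* The circle about y through a has an arc near a on which u is -oo, and its disc lies in Omega; the
   sub-mean inequality then gives u y = -oo. *)
split => //; pose w := a - y.
have ww : nr w < 2 * q by have := nr_triangle a z y; rewrite (nrB z y); move: az yz; rewrite /w/=; lra.
have dO c : cnorm c <= 1 -> Omega (y + c *: w).
  move=> c1; apply: r3P; have -> : y + c *: w - z = (y - z) + c *: w by rewrite addrAC.
  apply: le_lt_trans (nrD _ _) _; rewrite nrZ; have := ler_wpM2r (nr_ge0 w) c1.
  by move: ww yz; rewrite /q mul1r; lra.
have dist t t' : nr (y + cis t *: w - (y + cis t' *: w)) <= 2 * `|t - t'| * nr w.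
  have -> : y + cis t *: w - (y + cis t' *: w) = (cis t - cis t') *: w.
    by rewrite opprD addrACA subrr add0r scalerBl.
  by rewrite nrZ ler_wpM2r ?nr_ge0//; exact: cis_lip.
have nw : 0 < nr w + 1 by rewrite ltr_wpDl ?nr_ge0.
have ucis t : Omega (y + cis t *: w) by apply: dO; rewrite cnorm_cis.
have lsc : lower_semicontinuous (fun t : R => - u (y + cis t *: w)%R)%E.
  move=> t b /lte_oppr1 ub; have [_ uscz] := usc (y + cis t *: w) (ucis t).
  have /nbhs_nrP[d d0 dP] := uscz _ ub.
  have dw : 0 < d / (2 * (nr w + 1)) by rewrite divr_gt0// mulr_gt0.
  exists (ball t (d / (2 * (nr w + 1)))); first exact: nbhsx_ballx.
  move=> t'; rewrite /ball/= ltr_pdivlMr ?mulr_gt0// => tt; apply: lte_oppr2; apply: dP; last exact: ucis.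
  apply: le_lt_trans (dist t' t) _; apply: le_lt_trans tt; rewrite distrC.
  have := normr_ge0 (t - t'); have := nr_ge0 w; nra.
have s4 : 0 < s / (4 * (nr w + 1)) by rewrite divr_gt0// mulr_gt0.
pose tau := Num.min 1 (s / (4 * (nr w + 1))).
have tau0 : 0 < tau by rewrite lt_min ltr01.
have [tau1 tau2] : tau <= 1 /\ tau <= s / (4 * (nr w + 1)) by rewrite /tau !ge_min !lexx orbT.
have taupi : tau <= 2 * pi by have := pi_ge2 R; lra.
have um t : 0 <= t <= tau -> u (y + cis t *: w) = -oo%E.
  move=> /andP[t0 tt]; have [] // := sP (y + cis t *: w).
  have -> : a = y + cis 0 *: w by rewrite cis0 scale1r /w addrC subrK.
  apply: le_lt_trans (dist t 0) _; rewrite subr0 ger0_norm//.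
  have h1 := le_trans tt tau2; rewrite ler_pdivlMr ?mulr_gt0// in h1.
  have := nr_ge0 w; nra.
have u0 t : (u (y + cis t *: w)%R <= 0)%E by apply: ltW; apply: uneg.
have cm := circle_minf u0 lsc tau0 taupi um.
by have := circ y w ((disc_abs _ _ _).2 dO); rewrite cm leeNy_eq => /eqP.
Qed.

End finiteness.

(** * Local L^1 bounds *)

Section L1.
Context {R : realType} {n : nat}.
Local Notation V := (Cspace R n).
Local Notation I := (@Cintegral R n).
Implicit Types (F G kap xi : V -> R) (z w h p : V) (D : set V).

Lemma N2_rot (c : Cplx R) w : cnorm c = 1 -> N2 (c *: w) = N2 w.
Proof.
move=> c1; have := levi_rot (@delta R n) w c1; rewrite !levi_delta.
by move/(mulfI (_ : 2 != 0 :> R)); apply; rewrite pnatr_eq0.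
Qed.

(** Invariance under unit scalars serves the sub-mean inequality; the lower bound m near 0 serves to
    dominate cutoffs by translates of the kernel. *)
Lemma radial_mollifier (e : R) : 0 < e -> exists kap (d m : R), [/\ mollifier e kap,
  forall c h, cnorm c = 1 -> kap (c *: h) = kap h, 0 < d, 0 < m & forall h, nr h < d -> m <= kap h].
Proof.
move=> e0; pose r := e ^+ 2 / 4.
have r0 : 0 < r by rewrite divr_gt0// exprn_gt0.
pose b : V -> R := sbump r 0.
have bs : smooth b by apply/smoothP => k; exact: Ck_sbump.
have bsupp' w : b w != 0 -> nr w < e.
  move=> /(sbump_neq0 r0); rewrite subr0 => h.
  rewrite -(ltr_pXn2r (n := 2))// ?nnegrE ?nr_ge0 ?ltW//.
  apply: le_lt_trans (nr_N2 w) (lt_trans h _); rewrite /r.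
  have : 0 < e ^+ 2 by rewrite exprn_gt0.
  lra.
have bc : Cc b.
  split; first by have := (smoothP b).1 bs 0%N; case.
  by exists e => z ez; apply/eqP; apply: contrapT => /negP/bsupp'; rewrite ltNge ez.
have b0 w : 0 <= b w by exact: step_ge0.
pose d := Num.min 1 (r / (2 * n%:R + 1)).
have n1 : 0 < 2 * n%:R + 1 :> R by rewrite ltr_wpDl// mulr_ge0.
have d0 : 0 < d by rewrite lt_min ltr01 divr_gt0.
have [d1 d2] : d <= 1 /\ d <= r / (2 * n%:R + 1) by rewrite /d !ge_min !lexx orbT.
have b1 h : nr h < d -> b h = 1.
  move=> hd; apply: sbump_eq1 => //; rewrite subr0; apply: le_trans (N2_le h) _.
  have h0 := nr_ge0 h; have h1 : nr h ^+ 2 <= d.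
    rewrite expr2; apply: (@le_trans _ _ (1 * d)); last by rewrite mul1r.
    by apply: ler_pM => //; move: hd d1; lra.
  rewrite ler_pdivlMr// mulrC in d2; apply: le_trans d2; rewrite [leRHS]mulrC [leLHS]mulrC.
  by apply: ler_pM; rewrite ?exprn_ge0 ?mulr_ge0 ?lerDl ?nr_ge0 ?h1.
have Ib : 0 < I b by apply: (haar_gt0 (Cintegral_haar R n) bc b0 (z0 := 0)); rewrite b1// nr0.
exists (fun w => (I b)^-1 * b w), d, (I b)^-1; split.
- split.
  + by apply/smoothP => k; apply: CkMl; exact: ((smoothP b).1 bs).
  + by move=> w; rewrite mulr_ge0// invr_ge0 ltW.
  + by rewrite I_Ml// mulVf// gt_eqF.
  + by move=> w; rewrite mulf_eq0 negb_or => /andP[_]; exact: bsupp'.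
- by move=> c h c1; rewrite /b /sbump !subr0 (N2_rot h c1).
- exact: d0.
- by rewrite invr_gt0.
- by move=> h /b1 ->; rewrite mulr1.
Qed.

Lemma seq_eventually (s : seq V) (P : V -> nat -> Prop) :
  (forall w, w \in s -> exists N0, forall N, (N0 <= N)%N -> P w N) ->
  exists N0, forall w, w \in s -> forall N, (N0 <= N)%N -> P w N.
Proof.
elim: s => [|x s IH] h; first by exists 0%N.
have [N1 H1] := h x (mem_head _ _).
have [|N2' H2] := IH; first by move=> w ws; apply: h; rewrite inE ws orbT.
exists (maxn N1 N2') => w; rewrite inE => /orP[/eqP ->|ws] N; rewrite geq_max => /andP[a1 a2]; [exact: H1|exact: H2].
Qed.

Lemma cnv_submean (e : R) kap F p : mollifier e kap -> (forall c h, cnorm c = 1 -> kap (c *: h) = kap h) ->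
  Cc F -> (forall w, nr w <= e -> sub F p w) -> F p <= cnv kap F p.
Proof.
move=> m kr Fc Fs; have kc := moll_Cc m; have cF : continuous F by case: Fc.
apply: (@ler_eps R _ _ 2) => // t t0; have [d d0 dP] := Cc_unifm Fc t0.
have [s [c [c0 c1 sE cP]]] := conv_average m d0.
have [N HN] : exists N, forall w, w \in s -> F p <= dm N F p w + t.
  have [w ws|N0 HN0] := @seq_eventually s (fun w N => F p <= dm N F p w + t); first exact: (Fs w (sE w ws)).
  by exists N0 => w ws; exact: HN0.
(* The mean of F over rotations of y about p has, by invariance of the kernel, the same
   mollification at p as F, and it is at least F p - t at the sample points. *)
pose f y := dm N F p (y - p).
have iso j x y : nr (p + rt N j *: (y - p) - (p + rt N j *: (x - p))) = nr (y - x).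
  have -> : p + rt N j *: (y - p) - (p + rt N j *: (x - p)) = rt N j *: (y - x).
    by rewrite opprD addrACA subrr add0r -scalerBr; congr (_ *: _); rewrite opprB addrA subrK.
  by rewrite nrZ cnorm_rt mul1r.
have cf : continuous f.
  apply: (@ctsMl R V); apply: cts_sum => j x; apply/cvg_nrP => q q0.
  have /cvg_nrP/(_ q q0)[d' d'0 d'P] := cF (p + rt N j *: (x - p)).
  by exists d' => // y yx; apply: d'P; rewrite iso.
have N40 : 0 <= ((4 * N.+1)%:R^-1 : R) by rewrite invr_ge0.
have fu : unifm d t f.
  move=> x y xy; rewrite /f /dm -mulrBr -sumrB normrM (ger0_norm N40) -[leRHS](mean_cst N t) ler_wpM2l//.
  apply: le_trans (ler_norm_sum _ _ _) _; apply: ler_sum => j _; apply: dP; by rewrite iso.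
have E : cnv kap f p = cnv kap F p.
  have Gc : Cc (fun h => kap h * F (p + h)) by exact: conv_Cc_integrand.
  have Gr j : Cc (fun h => kap (rt N j *: h) * F (p + rt N j *: h)).
    have cs : cos (2 * pi * (j%:R / (4 * N.+1)%:R)) ^+ 2 + sin (2 * pi * (j%:R / (4 * N.+1)%:R)) ^+ 2 = 1 :> R by exact: cos2Dsin2.
    exact: (Cc_rot cs Gc).
  have Ir j : I (fun h => kap (rt N j *: h) * F (p + rt N j *: h)) = cnv kap F p.
    have cs : cos (2 * pi * (j%:R / (4 * N.+1)%:R)) ^+ 2 + sin (2 * pi * (j%:R / (4 * N.+1)%:R)) ^+ 2 = 1 :> R by exact: cos2Dsin2.
    exact: (haar_rot (Cintegral_haar R n) cs Gc).
  transitivity (I (fun h => (4 * N.+1)%:R^-1 * \sum_(j < 4 * N.+1) kap (rt N j *: h) * F (p + rt N j *: h))).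
    congr I; apply/funext => h; rewrite /f /dm addrAC subrr add0r mulrCA; congr (_ * _).
    by rewrite mulr_sumr; apply: eq_bigr => j _; rewrite kr// cnorm_rt.
  rewrite I_Ml; last by apply: Cc_sum => j; exact: Gr.
  rewrite I_sum; last by move=> j; exact: Gr.
  by rewrite (eq_bigr (fun=> cnv kap F p)) ?mean_cst// => j _; exact: Ir.
have := cP f t cf fu p; rewrite E ler_norml => /andP[h1 _].
have h2 : F p <= \sum_(w <- s) c w * f (p + w) + t.
  have -> : F p = \sum_(w <- s) c w * F p by rewrite -mulr_suml c1 mul1r.
  rewrite -[X in _ + X]mul1r -c1 mulr_suml -big_split/= big_seq [leRHS]big_seq; apply: ler_sum => w ws.
  by rewrite -mulrDr ler_wpM2l// /f addrAC subrr add0r; exact: HN.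
move: h1 h2; move: (\sum_(w <- s) _) => x *; lra.
Qed.

(** The cutoff is dominated by A/m times a sum of kernels centred near a net of K at points where u
    is finite. There [cnv_submean] bounds each integral by m0 - F, hence by -u, independently of
    F. *)
Lemma L1_bound Omega (u : V -> \bar R) D K : domain Omega -> psh Omega u -> (forall z, Omega z -> (u z < 0)%E) ->
  open D -> D `<=` Omega -> compact K -> K `<=` D -> exists B : R, forall F xi (m0 A : R), Cc F -> PC D F ->
   (forall z, F z < m0) -> (forall z, D z -> (u z <= (F z - m0)%:E)%E) -> Cc xi -> (forall z, ~ K z -> xi z = 0) ->
   (forall z, 0 <= xi z <= A) -> I (fun z => xi z * - (F z - m0)) <= A * B.
Proof.
move=> dO pu uneg oD DO cK KD; have [r r0 rP] := compact_margin cK oD KD.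
have r4 : 0 < r / 4 by rewrite divr_gt0.
have [kap [d [m [mk kr d0 m0' km]]]] := radial_mollifier r4.
pose q := Num.min (d / 2) (r / 4).
have q0 : 0 < q by rewrite lt_min r4 divr_gt0.
have [q1 q2] : q <= d / 2 /\ q <= r / 4 by rewrite /q !ge_min !lexx orbT.
have [s [sK sP]] := finite_net cK q0.
(* Each net point has arbitrarily close points where u is finite, by [no_minf]. *)
have /choice[pp ppP] : forall x, exists p, K x -> nr (p - x) < q /\ u p != -oo%E.
  move=> x; have [Kx|nK] := pselect (K x); last by exists 0.
  apply: contrapT => /forallNP H; apply: (no_minf dO pu uneg (z0 := x) q0) => y yx; split.
    by apply: DO; apply: (rP x) => //; move: yx q2 r0; lra.
  by apply/eqP; apply: contrapT => /negP uy; apply: (H y).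
have Dp x : K x -> D (pp x).
  by move=> Kx; have [h _] := ppP x Kx; apply: (rP x) => //; move: h q2 r0; lra.
exists (m^-1 * \sum_(x <- s) - fine (u (pp x))) => F xi m0 A Fc FP Fm uF xc xK xA.
have A0 : 0 <= A by have /andP[h1 h2] := xA 0; exact: le_trans h2.
have cF : continuous F by case: Fc.
have kc := moll_Cc mk.
have cN : continuous (fun z : V => - (F z - m0)).
  have cm : continuous (fun _ : V => m0) by exact: cts_cst.
  by apply: ctsN; exact: ctsB cF cm.
have N0 z : 0 <= - (F z - m0) by have := Fm z; lra.
have ksc x : Cc (fun z => kap (z - pp x) * - (F z - m0)).
  exact: (CcMc (Cc_shift (- pp x) kc) cN).
pose P z := \sum_(x <- s) kap (z - pp x) * - (F z - m0).
have Pc : Cc P by apply: Cc_sum => x; exact: ksc.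
have t0 x z : 0 <= kap (z - pp x) * - (F z - m0) by rewrite mulr_ge0// (moll_ge0 mk).
apply: (@le_trans _ _ (I (fun z => A * m^-1 * P z))).
  apply: I_le; [exact: (CcMc xc cN)|exact: CcMl|move=> z].
  have Am : 0 <= A * m^-1 by rewrite mulr_ge0// invr_ge0 ltW.
  have [Kz|nK] := pselect (K z); last first.
    by rewrite xK// mul0r mulr_ge0//; apply: sumr_ge0 => x _.
  have [x xs zx] := sP z Kz; have [px _] := ppP x (sK x xs).
  have zp : nr (z - pp x) < d.
    by have := nr_triangle z x (pp x); rewrite (nrB x); move: zx px q1; lra.
  apply: (@le_trans _ _ (A * m^-1 * (kap (z - pp x) * - (F z - m0)))); last first.
    by apply: ler_wpM2l => //; apply: (@seq_sum_ge R n s (fun x => kap (z - pp x) * - (F z - m0))).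
  rewrite mulrA; apply: ler_wpM2r => //; have /andP[_ xz] := xA z; apply: le_trans xz _.
  by rewrite -mulrA -[leLHS]mulr1 ler_wpM2l// ler_pdivlMl// mulr1; exact: km.
rewrite I_Ml// -mulrA; apply: ler_wpM2l => //; apply: ler_wpM2l; first by rewrite invr_ge0 ltW.
rewrite /P I_sum; last by move=> x; exact: ksc.
rewrite big_seq [leRHS]big_seq; apply: ler_sum => x xs; have Kx := sK x xs; have [px up] := ppP x Kx.
have FPp : F (pp x) <= cnv kap F (pp x).
  apply: (cnv_submean mk kr Fc) => w wr; apply: FP => c c1; apply: (rP x) => //.
  have -> : pp x + c *: w - x = (pp x - x) + c *: w by rewrite addrAC.
  apply: le_lt_trans (nrD _ _) _; rewrite nrZ; have := ler_wpM2r (nr_ge0 w) c1; move: px q2 wr r0; rewrite mul1r; lra.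
have E : I (fun z => kap (z - pp x) * - (F z - m0)) = m0 - cnv kap F (pp x).
  have sc := Cc_shift (- pp x) kc.
  rewrite (convE (pp x) kc cF) -[X in X - _]mulr1 -(moll_I mk) -(I_shift (- pp x) kc) -I_Ml// -I_B; [|exact: CcMl|exact: (CcMc sc cF)].
  by congr I; apply/funext => z; have alg (a b : R) : a * - (b - m0) = m0 * a - a * b by ring; exact: alg.
rewrite E; have := uF (pp x) (Dp x Kx); have uneg' := uneg _ (DO _ (Dp x Kx)).
case: (u (pp x)) up uneg' => [b| |]//= _ _; rewrite lee_fin; move: FPp; lra.
Qed.

Lemma smooth_lip G : Ck 2 G -> Cc G -> exists2 L : R, 0 <= L &
  (forall z (xi : V), G (z + xi) - G z <= L * nr xi) /\
  (forall z (xi : V), `|G (z + xi) + G (z - xi) - 2 * G z| <= L * nr xi ^+ 2).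
Proof.
move=> GC Gc; have G1 := CkW (isT : (1 <= 2)%N) GC.
have [B B0 hB] := hs_bounded GC Gc.
have [P P0 PP] : exists2 P : R, 0 <= P & forall (a : 'I_n * bool) z, `|pderiv a G z| <= P.
  apply: (@fin_bound R n _ (fun a => pderiv a G)) => a.
  have [c _] := Cc_pderiv a G1 Gc; have [M _ MP] := Cc_bounded c; by exists M.
pose K1 : R := #|{: 'I_n * bool}|%:R; have K10 : 0 <= K1 by [].
have K2P : 0 <= 2 * (K1 * (K1 * B)) by rewrite !mulr_ge0.
have inc z (xi : V) : exists2 t : R, 0 <= t <= 1 & G (z + xi) - G z = D1 G (z + rC t 0 *: xi) xi.
  have [|t t01] := @mvt R (fun s => G (z + rC s 0 *: xi)) (fun s => D1 G (z + rC s 0 *: xi) xi) 0 1 ler01.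
    by move=> x _; exact: C1_line.
  by rewrite rC0Z rC1Z addr0 subr0 mulr1 => e; exists t.
exists (K1 * P + 2 * (K1 * (K1 * B))); first by rewrite addr_ge0// mulr_ge0.
split=> z xi; have x0 := nr_ge0 xi.
  have [t _ ->] := inc z xi; rewrite mulrDl; apply: ler_wpDr; first by rewrite mulr_ge0.
  apply: le_trans (ler_norm _) _; apply: le_trans (ler_norm_sum _ _ _) _.
  rewrite -mulrA -sumK; apply: ler_sum => a _; rewrite normrM mulrC; apply: ler_pM => //; exact: co_le_nr.
have [t /andP[t0 t1] e1] := inc z xi; have [t' /andP[t'0 t'1] e2] := inc z (- xi).
have alg (a b c x y : R) : a - c = x -> b - c = y -> a + b - 2 * c = x + y by lra.
rewrite (alg _ _ _ _ _ e1 e2) mulrDl; apply: ler_wpDl; first by rewrite mulr_ge0 ?exprn_ge0// mulr_ge0.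
have -> : D1 G (z + rC t 0 *: xi) xi + D1 G (z + rC t' 0 *: - xi) (- xi) =
    \sum_a co a xi * ((pderiv a G (z + rC t 0 *: xi) - pderiv a G z) - (pderiv a G (z + rC t' 0 *: - xi) - pderiv a G z)).
  rewrite /D1 -big_split/=; apply: eq_bigr => a _; rewrite coN.
  have alg2 (x a' b c : R) : x * a' + - x * b = x * ((a' - c) - (b - c)) by ring.
  exact: alg2.
apply: le_trans (ler_norm_sum _ _ _) _.
have -> : 2 * (K1 * (K1 * B)) * nr xi ^+ 2 = \sum_(a : 'I_n * bool) nr xi * (2 * (K1 * B * nr xi)).
  by rewrite sumK -/K1 expr2; have alg3 (k b x : R) : 2 * (k * (k * b)) * (x * x) = k * (x * (2 * (k * b * x))) by ring; exact: alg3.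
apply: ler_sum => a _; rewrite normrM; apply: ler_pM => //; first exact: co_le_nr.
have KB : 0 <= K1 * B by rewrite mulr_ge0.
have b1 := pderiv_lip a z (rC t 0 *: xi) GC hB; have b2 := pderiv_lip a z (rC t' 0 *: - xi) GC hB.
rewrite !nrZr ?nrN (ger0_norm t0) in b1; rewrite nrZr nrN (ger0_norm t'0) in b2.
apply: le_trans (ler_normB _ _) _.
have c1 : K1 * B * (t * nr xi) <= K1 * B * nr xi by rewrite ler_wpM2l// ler_piMl.
have c2 : K1 * B * (t' * nr xi) <= K1 * B * nr xi by rewrite ler_wpM2l// ler_piMl.
rewrite mulr2n mulrDl mul1r; exact: lerD (le_trans b1 c1) (le_trans b2 c2).
Qed.

End L1.

(** * Convergence of the energies *)

Section core.
Context {R : realType} {n : nat}.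
Local Notation V := (Cspace R n).
Local Notation I := (@Cintegral R n).
Implicit Types (z w y : V) (g kap : V -> R).

Lemma hs_addc g (c : R) z : Ck 2 g -> hs (fun y => g y + c) z = hs g z.
Proof.
move=> gC; have := @hs_lin R n 1 g (fun=> c) z gC (Ck_cst 2 c).
have -> : (fun y => 1 * g y + c) = (fun y => g y + c) by apply/funext => y; rewrite mul1r.
move=> ->; apply/funext => b; apply/funext => a.
have -> : hs (fun=> c : R) z b a = 0.
  rewrite /hs; have -> : pderiv a (fun=> c : R) = (fun=> 0) by apply/funext => y; exact: pderiv_cst.
  exact: pderiv_cst.
have alg (x : R) : 1 * x + 0 = x by ring.
exact: alg.
Qed.

Lemma Xf_addc (k m : nat) g (c : R) z : Ck 2 g -> Xf k m (fun y => g y + c) z = Xf k m g z.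
Proof. by move=> gC; rewrite /Xf (hs_addc c z gC). Qed.

Lemma psh2_addc (D : set V) g (c : R) : Ck 2 g -> psh2 D g -> psh2 D (fun y => g y + c).
Proof. by move=> gC gp z Dz x; rewrite (hs_addc c z gC); exact: gp. Qed.

Lemma addrBK2 (x a b : R) : x + (a - b) + (b - a) = x.
Proof. by ring. Qed.

Lemma le_half2 (x y z s : R) : x <= y + s / 2 -> y <= z + s / 2 -> x <= z + s.
Proof. by lra. Qed.

Lemma le_thirds (a b c d e g t : R) : a + b <= c + d -> d <= e -> e <= g + t / 3 -> g <= b + t / 3 -> c <= t / 3 -> a <= t.
Proof. by lra. Qed.

Lemma dec_cauchy (A : nat -> R) (B t : R) : (forall j, - B <= A j) -> 0 < t -> exists i, forall j, A i <= A j + t.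
Proof.
move=> AB t0; have hi : has_inf (range A).
  by split; [exists (A 0%N), 0%N|exists (- B) => _ [j _ <-]].
have [_ [i _ <-] h] := inf_adherent t0 hi; exists i => j.
have : inf (range A) <= A j by apply: ge_inf; [case: hi|exists j].
move: h; lra.
Qed.

Lemma ball_component (G : set V) z (r : R) : (forall y, nr (y - z) < r -> G y) ->
  forall y, nr (y - z) < r -> connected_component G z y.
Proof.
move=> Gr y yr; pose p (t : R) : V := z + rC t 0 *: (y - z).
have nyz := nr_ge0 (y - z).
have cp : continuous p.
  move=> t A /nbhs_nrP[d d0 dP].
  have d1 : 0 < d / (nr (y - z) + 1) by rewrite divr_gt0// ltr_wpDl.
  exists (d / (nr (y - z) + 1)) => // t' /=; rewrite ltr_pdivlMr ?ltr_wpDl// => tt; apply: dP.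
  have -> : p t' - p t = rC (t' - t) 0 *: (y - z).
    by rewrite /p opprD addrACA subrr add0r rC_addZ rCNZ.
  rewrite nrZr distrC; apply: le_lt_trans tt; rewrite ler_wpM2l// lerDl; exact: ler01.
have cI : connected (p @` `[0%R, 1%R]%classic).
  apply: connected_continuous_connected; last exact: continuous_subspaceT.
  exact: segment_connected.
exists (p @` `[0%R, 1%R]%classic); last first.
  by exists 1; rewrite ?/p /= ?in_itv/= ?ler01 ?lexx// rC1Z addrC subrK.
split => //.
  by exists 0; rewrite ?/p /= ?in_itv/= ?ler01 ?lexx// rC0Z addr0.
move=> _ [t ti <-]; move: ti => /=; rewrite in_itv/= => /andP[t0 t1]; apply: Gr.
have -> : p t - z = rC t 0 *: (y - z) by rewrite /p addrAC subrr add0r.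
by rewrite nrZr ger0_norm//; apply: le_lt_trans yr; rewrite ler_piMl.
Qed.

Variables (Omega : set V) (u : V -> \bar R).
Hypotheses (n0 : (0 < n)%N) (dO : domain Omega) (umax : maximal_psh Omega u)
  (uneg : forall z, Omega z -> (u z < 0)%E).
(** On [D1] the functions F_j - m0 decrease to u; [K1] contains the support of η; [dl j] bounds the
    error of the j-th mollification. *)
Variables (D1 K1 K2 : set V) (F : nat -> V -> R) (m0 d2 : R) (eta : V -> R).
Hypotheses (oD1 : open D1) (D1K : D1 `<=` K2) (cK2 : compact K2) (K2O : K2 `<=` Omega).
Hypotheses (m00 : 0 < m0) (d20 : 0 < d2).
Hypotheses (Fc : forall j, Cc (F j)) (FP : forall j, PC D1 (F j)) (F0 : forall j z, F j z <= 0).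
Hypotheses (Fd : forall j z, F j.+1 z <= F j z).
Hypotheses (Fu : forall z, D1 z -> (fun j => (F j z - m0)%:E) @ \oo --> u z).
Hypotheses (cK1 : compact K1) (KD1 : forall x y, K1 x -> nr (y - x) < d2 -> D1 y).
Hypotheses (etaS : smooth eta) (etaK : supp eta `<=` K1) (eta01 : forall z, 0 <= eta z <= 1).
Variables (dl e_ : nat -> R) (kap : nat -> V -> R).
Hypotheses (dl0 : forall j, 0 < dl j) (dlS : forall j, dl j.+1 = dl j / 2) (dlm : forall j, 8 * dl j <= m0).
Hypotheses (mk : forall j, mollifier (e_ j) (kap j)) (ek : forall j, e_ j <= d2 / 2).
Hypotheses (kF : forall j z, `|cnv (kap j) (F j) z - F j z| <= dl j).
Variable al : R.
Hypotheses (al1 : n%:R - 1 < al) (al2 : al < n%:R).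

(** Raising by 3 [dl j] makes the mollifications decrease: f_j lies between F_j - m0 + 2 [dl j] and
    F_j - m0 + 4 [dl j], and 4 [dl j.+1] = 2 [dl j]. *)
Definition fj j z := cnv (kap j) (F j) z + (3 * dl j - m0).

Local Notation f := fj.
Local Notation D := (nbd K1 (d2 / 2)).

Let GC j k : Ck k (cnv (kap j) (F j)).
Proof. by have /smoothP := conv_smooth (mk j) (Fc j). Qed.

Let Gc j : Cc (cnv (kap j) (F j)).
Proof. exact: conv_Cc (moll_Cc (mk j)) (Fc j). Qed.

Let fC j k : Ck k (f j). Proof. exact: CkD (GC j k) (Ck_cst k _). Qed.

Lemma f_bounds j z : F j z - m0 + 2 * dl j <= f j z /\ f j z <= F j z - m0 + 4 * dl j.
Proof. by have := kF j z; rewrite ler_norml /f => /andP[? ?]; split; lra. Qed.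

Lemma f_dec j z : f j.+1 z <= f j z.
Proof.
have [h1 _] := f_bounds j z; have [_ h2] := f_bounds j.+1 z; have h3 := Fd j z.
by move: h1 h2 h3; rewrite dlS; lra.
Qed.

Lemma f_dec2 j k z : (j <= k)%N -> f k z <= f j z.
Proof.
move=> /subnK <-; elim: (k - j)%N => [//|i IH]; rewrite addSn; exact: le_trans (f_dec _ _) IH.
Qed.

Let c00 : 0 < m0 / 2. Proof. by rewrite divr_gt0. Qed.

Lemma f_neg j z : f j z <= - (m0 / 2).
Proof. by have [_ h] := f_bounds j z; have := F0 j z; have := dlm j; move: h; lra. Qed.

Lemma F_dec2 j k z : (j <= k)%N -> F k z <= F j z.
Proof. by move=> /subnK <-; elim: (k - j)%N => [//|i IH]; rewrite addSn; exact: le_trans (Fd _ _) IH. Qed.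

Lemma u_le_F j z : D1 z -> (u z <= (F j z - m0)%:E)%E.
Proof.
move=> Dz; apply: (cvge_le _ (Fu Dz)); exists j => // k /= jk.
by rewrite lee_fin lerD2r; exact: F_dec2.
Qed.

Lemma u_le_f j z : D1 z -> (u z <= (f j z)%:E)%E.
Proof.
move=> Dz; apply: le_trans (u_le_F j Dz) _; rewrite lee_fin.
by have [h _] := f_bounds j z; have := dl0 j; move: h; lra.
Qed.

Let DD1 : D `<=` D1.
Proof. by move=> z [x Kx zx]; apply: (KD1 Kx); move: zx d20; lra. Qed.

Let oD : open D. Proof. exact: open_nbd. Qed.

Lemma f_PC j : PC D (f j).
Proof.
have cF : continuous (F j) by case: (Fc j).
have uF : unifc (F j) by move=> t t0; exact: (Cc_unifm (Fc j) t0).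
have GPC : PC D (cnv (kap j) (F j)).
  apply: (conv_PC (mk j) cF uF _ (FP j)) => y h [x Kx yx] he; apply: (KD1 Kx).
  have -> : y + h - x = (y - x) + h by rewrite addrAC.
  by apply: le_lt_trans (nrD _ _) _; have := ek j; move: yx he; lra.
move=> z w dzw; have := sub_lin ler01 (GPC z w dzw) (sub_cst (3 * dl j - m0) z w).
by apply: sub_ext => y; rewrite mul1r.
Qed.

(** The left side, with the weight of the unmollified function, is what [ma_upper] produces. As f_j
    ≥ F_j - m0, the weight of f_j is larger. *)
Lemma Wi_ge j : I (fun z => eta z ^+ 2 * Pw (- al) (fun z => F j z - m0) z * top (Xf n 0 (cnv (kap j) (F j)) z)) <=
  I (Wi al n eta (f j)).
Proof.
have n1 : (1 : R) <= n%:R by rewrite ler1n.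
have al0 : 0 <= al by move: al1 n1; lra.
have etc : Cc eta.
  have [M KM] := compact_nr_bounded cK1; split; first by have /smoothP/(_ 0%N) := etaS; case.
  by exists M => z Mz; apply: supp_out => /etaK/KM; rewrite ltNge Mz.
have e2c : Cc (fun z => eta z ^+ 2) := Cc_sq etc.
have Tc : Cc (fun z => eta z ^+ 2 * top (Xf n 0 (cnv (kap j) (F j)) z)) by exact: Cc_top (GC j 2) e2c.
have fn z : f j z < 0 by apply: le_lt_trans (f_neg j z) _; rewrite oppr_lt0.
have Fn z : F j z - m0 < 0 by have := F0 j z; move: m00; lra.
have cF : continuous (F j) by case: (Fc j).
have cm : continuous (fun _ : V => m0) by exact: cts_cst.
have cFm : Ck 0 (fun z : V => F j z - m0) by split => //; exact: ctsB cF cm.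
have cP1 : continuous (Pw (- al) (fun z => F j z - m0)) by apply: (@Ck_cont R n 0); exact: Ck_Pw.
have cP2 : continuous (Pw (- al) (f j)) by apply: (@Ck_cont R n 0); exact: Ck_Pw.
have p2 := cnv_psh2 (Fc j) (FP j) d20 KD1 (ek j) (mk j).
have E1 : Wi al n eta (f j) = (fun z => eta z ^+ 2 * top (Xf n 0 (cnv (kap j) (F j)) z) * Pw (- al) (f j) z).
  apply/funext => z; have bqn : @bq R n al n = al by rewrite /bq subrK.
  have sgn1 : sg n = 1 :> R by move: n0; case: (n).
  rewrite /Wi bqn sgn1 subnn (Xf_addc n 0 (3 * dl j - m0) z (GC j 2)).
  have alg (x y p : R) : 1 * (x * y * p) = x * p * y by ring.
  exact: alg.
have -> : (fun z => eta z ^+ 2 * Pw (- al) (fun z => F j z - m0) z * top (Xf n 0 (cnv (kap j) (F j)) z)) =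
  (fun z => eta z ^+ 2 * top (Xf n 0 (cnv (kap j) (F j)) z) * Pw (- al) (fun z => F j z - m0) z).
  by apply/funext => z; exact: mulrAC.
rewrite E1; apply: I_le; [exact: (CcMc Tc cP1)|exact: (CcMc Tc cP2)|move=> z].
apply: ler_wpM2l.
  have [->|ez] := eqVneq (eta z) 0; first by rewrite expr0n mul0r.
  apply: mulr_ge0; first exact: sqr_ge0.
  apply: (Xf_ge0 (GC j 2) p2); last exact: addn0.
  by apply: nbd_self; [rewrite divr_gt0|apply: etaK; exact: suppP].
apply: powRN_le => //; first by rewrite oppr_gt0.
by rewrite lerN2; have [h _] := f_bounds j z; have := dl0 j; move: h; lra.
Qed.

Lemma rho_exists : exists rho : V -> R, exists d0 r1 : R, [/\ test_smooth D rho, forall z, 0 <= rho z <= 1,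
  0 < d0 /\ (forall x y, supp rho x -> nr (y - x) < d0 -> D y) & 0 < r1 /\ forall x y, K1 x -> nr (y - x) <= r1 -> rho y = 1].
Proof.
have K1D : K1 `<=` D by apply: nbd_self; rewrite divr_gt0.
have [rho [tr r01 [r r0 rP]]] := cutoff cK1 oD K1D.
have [sr cr sD] := tr; have [d0 d00 dP] := compact_margin cr oD sD.
exists rho, d0, (r / 2); split => //; split; first by rewrite divr_gt0.
by move=> x y Kx yx; apply: (rP x) => //; move: yx r0; lra.
Qed.

Variables (rho : V -> R) (d0 r1 : R).
Hypotheses (tr : test_smooth D rho) (rho01 : forall z, 0 <= rho z <= 1) (d00 : 0 < d0)
  (KD : forall x y, supp rho x -> nr (y - x) < d0 -> D y) (r10 : 0 < r1)
  (rho1 : forall x y, K1 x -> nr (y - x) <= r1 -> rho y = 1).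
Local Notation G := (nbd (supp rho) (d0 / 2)).

Definition vj j := vs D (f j) rho.

Local Notation v := vj.

Let Kc : compact (supp rho). Proof. by case: tr. Qed.

Let fcts j : continuous (f j). Proof. exact: Ck_cont (fC j 0). Qed.

Lemma env_hyps j : exists2 L : R, 0 <= L & [/\ forall z xi, f j (z + xi) - f j z <= L * nr xi,
  forall z xi, `|f j (z + xi) + f j (z - xi) - 2 * f j z| <= L * nr xi ^+ 2,
  forall z xi, Hob (f j) rho (z + xi) - Hob (f j) rho z <= L * nr xi &
  forall z xi, Hob (f j) rho (z + xi) + Hob (f j) rho (z - xi) - 2 * Hob (f j) rho z <= L * nr xi ^+ 2].
Proof.
pose c := 3 * dl j - m0.
have rc : Cc rho := test_Cc tr; have rC2 : Ck 2 rho := test_Ck 2 tr.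
pose q z := cnv (kap j) (F j) z - rho z * f j z.
have qC : Ck 2 q by exact: CkB (GC j 2) (CkM rC2 (fC j 2)).
have qc : Cc q := CcB (Gc j) (CcMc rc (@fcts j)).
have [L1 L10 [a1 a2]] := smooth_lip (GC j 2) (Gc j).
have [L2 L20 [b1 b2]] := smooth_lip qC qc.
have HE z : Hob (f j) rho z = q z + c.
  have alg (x r : R) : (1 - r) * (x + c) = x - r * (x + c) + c by ring.
  exact: alg.
have fE z : f j z = cnv (kap j) (F j) z + c by [].
have x0 (xi : V) : 0 <= nr xi by exact: nr_ge0.
have x2 (xi : V) : 0 <= nr xi ^+ 2 by rewrite exprn_ge0.
exists (L1 + L2); first by rewrite addr_ge0.
split=> z xi; rewrite (mulrDl L1 L2).
- have := a1 z xi; have := mulr_ge0 L20 (x0 xi); rewrite !fE; lra.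
- have := a2 z xi; have := mulr_ge0 L20 (x2 xi); rewrite !fE.
  have alg (x y s : R) : x + c + (y + c) - 2 * (s + c) = x + y - 2 * s by ring.
  by rewrite alg; lra.
- have := b1 z xi; have := mulr_ge0 L10 (x0 xi); rewrite !HE; lra.
- have := le_trans (ler_norm _) (b2 z xi); have := mulr_ge0 L10 (x2 xi); rewrite !HE; lra.
Qed.

Let vF j : Fam D (f j) rho (v j).
Proof.
have [L L0 [h1 h2 h3 h4]] := env_hyps j.
exact: (Fam_vs oD c00 L0 d00 (@fcts j) (f_neg j) (@f_PC j) h1 rho01 KD h3).
Qed.

Let vc j : Cc (fun z => v j z + (m0 - 3 * dl j)).
Proof.
have [L L0 [h1 h2 h3 h4]] := env_hyps j.
have fm : Cc (fun z => f j z + (m0 - 3 * dl j)).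
  have -> : (fun z => f j z + (m0 - 3 * dl j)) = cnv (kap j) (F j) by apply/funext => z; exact: addrBK2.
  exact: Gc.
exact: (vs_Cc oD c00 L0 d00 (@fcts j) (f_neg j) (@f_PC j) h1 rho01 Kc KD h3 fm).
Qed.

Let vneg j z : v j z <= - (m0 / 2).
Proof.
have [L L0 [h1 h2 h3 h4]] := env_hyps j.
exact: (vs_neg n0 oD c00 L0 d00 (@fcts j) (f_neg j) (@f_PC j) h1 rho01 Kc KD h3).
Qed.

Let vcts j : continuous (v j). Proof. by case: (vF j). Qed.

Let v_ge j z : f j z <= v j z. Proof. by case: (vF j). Qed.

Let v_PC j : PC D (v j). Proof. by case: (vF j). Qed.

Let v_out j z : ~ supp rho z -> v j z = f j z. Proof. exact: Fam_out (vF j). Qed.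

(** The maximum of v_(j+1) and f_j is a competitor for the index j, since the obstacles decrease
    with j. *)
Lemma v_dec j z : v j.+1 z <= v j z.
Proof.
have [_ _ vH _] := vF j.+1.
have Fm : Fam D (f j) rho (fun z => Num.max (v j.+1 z) (f j z)).
  split.
  - by apply: cts_max; [exact: vcts|exact: fcts].
  - by move=> y; rewrite le_max lexx orbT.
  - move=> y; rewrite ge_max (f_Hob c00 (f_neg j) rho01) andbT; apply: le_trans (vH y) _.
    rewrite /Hob; apply: ler_wpM2l; last exact: f_dec.
    by have /andP[_ h] := rho01 y; rewrite subr_ge0.
  move=> y w dyw; have [h|h] := leP (v j.+1 y) (f j y).
    apply: (sub_le _ (@f_PC j y w dyw)); first by apply/esym/max_idPr.
    by move=> c _; rewrite le_max lexx orbT.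
  apply: (sub_le _ (@v_PC j.+1 y w dyw)); first by apply/esym/max_idPl; exact: ltW.
  by move=> c _; rewrite le_max lexx.
apply: le_trans (vs_ub c00 (@fcts j) (f_neg j) (@f_PC j) rho01 z Fm).
by rewrite le_max lexx.
Qed.

Lemma v_dec2 j k z : (j <= k)%N -> v k z <= v j z.
Proof. by move=> /subnK <-; elim: (k - j)%N => [//|i IH]; rewrite addSn; exact: le_trans (v_dec _ _) IH. Qed.

Let w z : \bar R := ereal_inf (range (fun j => (v j z)%:E)).

Let w_le j z : (w z <= (v j z)%:E)%E.
Proof. by apply: ereal_inf_lbound; exists j. Qed.

Let w_cvg z : (fun j => (v j z)%:E) @ \oo --> w z.
Proof. by apply: ereal_nonincreasing_cvgn => j k jk; rewrite lee_fin; exact: v_dec2. Qed.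

Let u_le_w z : D1 z -> (u z <= w z)%E.
Proof.
move=> Dz; apply: le_ereal_inf_tmp => _ [j _ <-]; apply: le_trans (u_le_f j Dz) _.
by rewrite lee_fin; exact: v_ge.
Qed.

Let dl_cvg0 : (fun j => (4 * dl j)%:E) @ \oo --> (0 : \bar R).
Proof.
have E j : dl j = dl 0 * 2^-1 ^+ j.
  by elim: j => [|j IH]; rewrite ?expr0 ?mulr1// dlS IH exprSr mulrA.
apply: cvg_EFin; first by apply: nearW.
have -> : fine \o (fun j => (4 * dl j)%:E) = (fun j => (4 * dl 0) * 2^-1 ^+ j).
  by apply/funext => j /=; rewrite E mulrA.
have := @cvg_geometric R (4 * dl 0) 2^-1; apply.
by rewrite ger0_norm ?invr_ge0// invf_lt1// ltr1n.
Qed.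

Let w_out z : D1 z -> ~ supp rho z -> (w z <= u z)%E.
Proof.
move=> Dz oz.
have c1 : (fun j => ((F j z - m0)%:E + (4 * dl j)%:E)%E) @ \oo --> (u z + 0)%E.
  apply: cvgeD; [by rewrite fin_num_adde_defl|exact: Fu|exact: dl_cvg0].
rewrite adde0 in c1; apply: (cvge_ge _ c1); apply: nearW => j.
apply: le_trans (w_le j z) _; rewrite -EFinD lee_fin v_out//.
by have [_ h] := f_bounds j z.
Qed.

Let GD z : nbd (supp rho) d0 z -> D z.
Proof. by move=> [x Kx zx]; exact: (KD Kx). Qed.

Let clG z : closure G z -> D z.
Proof.
move=> cz; apply: GD; have d4 : 0 < d0 / 4 by rewrite divr_gt0.
have [y [[x Kx yx] yz]] : G `&` [set y | nr (y - z) < d0 / 4] !=set0.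
  by apply: cz; apply/nbhs_nrP; exists (d0 / 4).
exists x => //; have := nr_triangle z y x; rewrite (nrB z y); move: yx yz => /=; lra.
Qed.

Let GG : G `<=` closure G. Proof. exact: subset_closure. Qed.

(** The only use of the comparison property of u: w is a decreasing limit of plurisubharmonic
    functions, and on the boundary of G, which lies off the support of ρ, v_j = f_j gives w ≤ u. *)
Lemma w_le_u z : G z -> (w z <= u z)%E.
Proof.
have [pu mx] := umax; have [usc circ nm] := pu.
have uscw (A : set V) : usc_on A w.
  move=> y Ay; split; first exact: le_lt_trans (w_le 0 y) (ltry _).
  move=> b wb; have [_ [j _ <-] vb] := ereal_inf_lt wb.
  rewrite lte_fin in vb; have vb0 : 0 < b - v j y by rewrite subr_gt0.
  have /cvg_nrP/(_ _ vb0)[d dd dP] := @vcts j y.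
  apply/nbhs_nrP; exists d => // x /dP; rewrite ltr_norml => /andP[_ h] _.
  by apply: le_lt_trans (w_le j x) _; rewrite lte_fin; move: h; lra.
apply: (mx G w).
- exact: open_nbd.
- have s1 : closure G `<=` K2 by move=> y /clG/DD1/D1K.
  split; last exact: subset_trans s1 K2O.
  by apply: (subclosed_compact _ cK2 s1); exact: closed_closure.
- exact: uscw.
- split; first exact: uscw.
    move=> y x dyx; apply: (@lim_circle R n v).
    + exact: vcts.
    + by move=> j; apply: v_PC => c c1; apply/clG/GG; exact: ((disc_abs _ _ _).1 dyx).
    + by move=> j y'; apply: le_trans (vneg j y') _; move: m00; lra.
    + by move=> j k y' jk; exact: v_dec2.
    + by move=> y'; exact: w_cvg.
  move=> y Gy; have oG : open G by exact: open_nbd.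
  have /nbhs_nrP[r r0 rP] : nbhs y G by move: oG; rewrite openE; apply.
  (* Since u ≤ w, a ball on which w is -oo would be one on which u is. *)
  apply: contrapT => H; apply: (no_minf dO pu uneg (z0 := y) r0) => x xy.
  have Gx := rP x xy; have D1x : D1 x by apply: DD1; apply: clG; exact: GG.
  split; first by apply: K2O; exact: D1K.
  apply/eqP; apply: contrapT => /negP ux; apply: H; exists x; first exact: (ball_component rP).
  by apply: contra ux => /eqP wx; rewrite -leeNy_eq -wx; exact: u_le_w.
- move=> y [cy nGy]; apply: w_out; first by apply: DD1; exact: clG.
  by move=> sy; apply: nGy; apply: nbd_self => //; rewrite divr_gt0.
Qed.

(** On the support of ρ, w ≤ u ≤ f_i, so the decreasing v_j fall below f_i + s uniformly there by
    compactness; elsewhere v_j = f_j. *)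
Lemma dini i (s : R) : 0 < s -> exists2 j0, (i <= j0)%N & forall j z, (j0 <= j)%N -> v j z <= f i z + s.
Proof.
move=> s0; suff [j0 H] : exists j0, forall z, supp rho z -> v j0 z <= f i z + s.
  exists (maxn i j0); first exact: leq_maxl.
  move=> j z; rewrite geq_max => /andP[ij jj]; have [Kz|oz] := pselect (supp rho z).
    exact: le_trans (v_dec2 _ jj) (H z Kz).
  rewrite v_out//; apply: le_trans (f_dec2 z ij) _; by rewrite lerDl ltW.
apply: contrapT => /forallNP H.
have /choice[x xP] : forall j, exists x, supp rho x /\ f i x + s < v j x.
  move=> j; have /existsNP[x /not_implyP[Kx /negP]] := H j; rewrite -ltNge => h; by exists x.
have [z Kz zP] := compact_seq Kc (fun j => proj1 (xP j)).
have Gz : G z by apply: nbd_self => //; rewrite divr_gt0.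
have Dz : D1 z by apply: DD1; apply: clG; exact: GG.
have wf : (w z < (f i z + s)%:E)%E.
  by apply: le_lt_trans (le_trans (w_le_u Gz) (u_le_f i Dz)) _; rewrite lte_fin ltrDl.
have [_ [k _ <-] vk] := ereal_inf_lt wf; rewrite lte_fin in vk.
have ch : continuous (fun y : V => v k y - f i y) by exact: ctsB (@vcts k) (@fcts i).
have vs0 : 0 < s - (v k z - f i z) by move: vk; lra.
have /cvg_nrP/(_ _ vs0)[d dd dP] := ch z.
have [j kj jd] := zP d k dd; have := dP _ jd; rewrite ltr_norml => /andP[_ h].
have [_ h2] := xP j; have := v_dec2 (x j) kj; move: h h2; lra.
Qed.

Let cG : cutfun G eta.
Proof.
split; last by move=> z; have /andP[] := eta01 z.
have sK : supp eta `<=` supp rho.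
  move=> z /etaK Kz; apply: suppP; rewrite (rho1 Kz) ?oner_neq0// subrr nr0 ltW//.
split => //.
  by apply: (subclosed_compact _ Kc sK); exact: closed_closure.
by apply: (subset_trans sK); apply: nbd_self; rewrite divr_gt0.
Qed.

Let good_f j : good G (f j).
Proof.
split; first exact: fC.
  by move=> z; apply: le_lt_trans (f_neg j z) _; rewrite oppr_lt0.
have h := cnv_psh2 (Fc j) (FP j) d20 KD1 (ek j) (mk j).
have := psh2_addc (3 * dl j - m0) (GC j 2) h.
by move=> h2 z Gz; apply: h2; apply: clG; exact: GG.
Qed.

Let L1_f (et : V -> R) : cutfun G et -> exists B : R, forall j, I (fun z => et z ^+ 2 * - f j z) <= B.
Proof.
move=> [tet et0]; have [es ec eG] := tet; have etc := test_Cc tet.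
have e2c : Cc (fun z => et z ^+ 2) := Cc_sq etc.
have eD : supp et `<=` D1 by move=> z /eG/GG/clG/DD1.
have [pu _] := umax.
have [B BP] := L1_bound dO pu uneg oD1 (subset_trans D1K K2O) ec eD.
have [A A0 AP] := Cc_bounded e2c.
exists (A * B) => j.
have cF : continuous (F j) by case: (Fc j).
have cFm : continuous (fun z : V => - (F j z - m0)).
  have cm : continuous (fun _ : V => m0) by exact: cts_cst.
  by apply: ctsN; exact: ctsB cF cm.
have cf : continuous (fun z : V => - f j z) by apply: ctsN; exact: fcts.
apply: le_trans (BP (F j) (fun z => et z ^+ 2) m0 A (Fc j) (@FP j) _ _ e2c _ _).
- apply: I_le; [exact: (CcMc e2c cf)|exact: (CcMc e2c cFm)|move=> z].
  rewrite ler_wpM2l ?sqr_ge0// lerN2; have [h _] := f_bounds j z; have := dl0 j; move: h; lra.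
- by move=> z; exact: le_lt_trans (F0 j z) m00.
- by move=> z; exact: u_le_F.
- by move=> z oz; rewrite (supp_out oz) expr0n.
- by move=> z; rewrite sqr_ge0/=; apply: le_trans (ler_norm _) (AP z).
Qed.

(** g is a mollification of v_j, slightly raised. Its mass is small by [env_zero], and its weight is
    bounded because g ≤ -m0/4. *)
Lemma top_small j (t s : R) : 0 < t -> 0 < s -> exists g, [/\ good G g, forall z, v j z <= g z <= v j z + s &
  I (Wi al n eta g) <= t].
Proof.
move=> t0 s0; have [L L0 [h1 h2 h3 h4]] := env_hyps j.
pose m' := m0 - 3 * dl j.
have fm : Cc (fun z => f j z + m').
  have -> : (fun z => f j z + m') = cnv (kap j) (F j) by apply/funext => z; exact: addrBK2.
  exact: Gc.
have [[tets etc' etG] et0] := cG.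
have etc : Cc eta by apply: (@test_Cc R n G).
have e2c : Cc (fun z => eta z ^+ 2) := Cc_sq etc.
have e2r z y : eta z ^+ 2 != 0 -> nr (y - z) <= r1 -> rho y = 1.
  by rewrite sqrf_eq0 => ez; apply: rho1; apply: etaK; exact: suppP.
pose B := (m0 / 4) `^ (- al).
have B0 : 0 < B + 1 by rewrite ltr_wpDl// powR_ge0.
have t1 : 0 < t / (B + 1) by rewrite divr_gt0.
have e20 z : 0 <= eta z ^+ 2 by exact: sqr_ge0.
have [e1 e10 e1P] := env_zero n0 oD c00 L0 d00 (@fcts j) (f_neg j) (@f_PC j) h1 h2 rho01 Kc KD h3 h4 fm r10 e2c e20 e2r t1.
(* Raising by s' compensates the mollification error; v_j ≤ -m0/2 and s' ≤ m0/8 keep g below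
   -m0/4. *)
pose s' := Num.min (s / 2) (m0 / 8).
have s'0 : 0 < s' by rewrite lt_min !divr_gt0.
have [s'1 s'2] : s' <= s / 2 /\ s' <= m0 / 8 by rewrite /s' !ge_min !lexx orbT.
have [e3 e30 e3P] := conv_approx (vc j) s'0.
pose e := Num.min e1 (Num.min e3 (d0 / 4)).
have e0 : 0 < e by rewrite !lt_min e10 e30 divr_gt0.
have [a1 a2 a3] : [/\ e <= e1, e <= e3 & e <= d0 / 4] by rewrite /e; split; rewrite !ge_min !lexx ?orbT.
have [ka mka] := @mollifier_exists R n e e0.
pose g0 := cnv ka (fun z => v j z + m').
have g0C k : Ck k g0 by have /smoothP := conv_smooth mka (vc j).
pose c := s' - m'.
have gb z : v j z <= g0 z + c <= v j z + s.
  have := e3P ka e a2 mka z; rewrite -/m' -/g0 ler_norml /c => /andP[? ?].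
  by apply/andP; split; move: s'1; lra.
have gneg z : g0 z + c <= - (m0 / 4).
  have := e3P ka e a2 mka z; have := vneg j z; rewrite -/m' -/g0 ler_norml /c => ? /andP[? ?].
  by move: s'2; lra.
have p2 : psh2 G g0.
  move=> z Gz; exact: (cnv_levi oD c00 L0 d00 (@fcts j) (f_neg j) (@f_PC j) h1 rho01 Kc KD h3 fm a3 mka Gz).
have gg : good G (fun z => g0 z + c).
  split; first exact: CkD (g0C 3) (Ck_cst 3 c).
    by move=> z; apply: le_lt_trans (gneg z) _; rewrite oppr_lt0 divr_gt0.
  exact: psh2_addc (g0C 2) p2.
exists (fun z => g0 z + c); split => //.
have XE z : Xf n (n - n) (fun y => g0 y + c) z = Xf n 0 g0 z by rewrite subnn (Xf_addc _ _ c z (g0C 2)).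
have bqn : @bq R n al n = al by rewrite /bq subrK.
have sgn1 : sg n = 1 :> R by move: n0; case: (n).
have n1 : (1 : R) <= n%:R by rewrite ler1n.
have n10 : 0 <= al by move: al1 n1; lra.
have Tc : Cc (fun z => eta z ^+ 2 * top (Xf n 0 g0 z)) by exact: Cc_top (g0C 2) e2c.
have gC2 : Ck 2 (fun z => g0 z + c) := CkD (g0C 2) (Ck_cst 2 c).
have gn z : g0 z + c < 0 by exact: gd_neg gg z.
have cP : continuous (Pw (- al) (fun z => g0 z + c)).
  by apply: (@Ck_cont R n 0); apply: Ck_Pw => //; exact: CkD (g0C 0) (Ck_cst 0 c).
apply: (@le_trans _ _ (I (fun z => B * (eta z ^+ 2 * top (Xf n 0 g0 z))))).
  have -> : Wi al n eta (fun z => g0 z + c) = (fun z => eta z ^+ 2 * top (Xf n 0 g0 z) * Pw (- al) (fun z => g0 z + c) z).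
    apply/funext => z; rewrite /Wi XE bqn sgn1.
    have alg (x y p : R) : 1 * (x * y * p) = x * p * y by ring.
    exact: alg.
  apply: I_le; [exact: (CcMc Tc cP)|exact: CcMl|move=> z].
  rewrite mulrC; apply: ler_wpM2r.
    have [->|ez] := eqVneq (eta z) 0; first by rewrite expr0n mul0r.
    apply: mulr_ge0 => //; apply: (Xf_ge0 (g0C 2) p2); last exact: addn0.
    by apply: etG; exact: suppP.
  rewrite /Pw /B; apply: powRN_le => //; first by rewrite divr_gt0.
  by have := gneg z; lra.
rewrite I_Ml//; apply: (@le_trans _ _ (B * (t / (B + 1)))).
  by apply: ler_wpM2l; [exact: powR_ge0|exact: (e1P e ka a1 mka)].
by rewrite mulrCA ger_pMr// ler_pdivrMr// mul1r lerDl.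
Qed.

Theorem Wi_cvg0 (t : R) : 0 < t -> exists j0, forall j, (j0 <= j)%N -> I (Wi al n eta (f j)) <= t.
Proof.
move=> t0; have t3 : 0 < t / 3 by rewrite divr_gt0.
have oG : open G by exact: open_nbd.
have [A [dA [aA AP]]] := functional_mono al1 al2 oG n0 cG.
have [|et cet|B BP] := @adm_lower R n al G al1 al2 A dA (range f) aA.
- by move=> _ [j _ <-]; exact: good_f.
- by have [B BP] := L1_f cet; exists B => _ [j _ <-]; exact: BP.
(* At the index i the correction A is within t/3 of its infimum over all f_j, which is finite by
   [adm_lower]. *)
have [i iP] : exists i, forall j, I (A (f i)) <= I (A (f j)) + t / 3.
  by apply: (@dec_cauchy _ B) => // j; apply: BP; exists j.
have m40 : 0 < m0 / 4 by rewrite divr_gt0.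
have fs z : f i z + m0 / 4 < 0 by have := f_neg i z; move: m00; lra.
have [s [s0 s1 gs sP]] := adm_shift aA (good_f i) m40 fs t3.
have s20 : 0 < s / 2 by rewrite divr_gt0.
have [j0 ij0 jP] := dini i s20.
exists j0 => j jj; have [g [gg gb gW]] := top_small j t3 s20.
have [_ k2] := AP (f j) g (good_f j) gg (fun z _ => le_trans (v_ge j z) (proj1 (andP (gb z)))).
have gfs z : G z -> g z <= f i z + s.
  by move=> _; exact: le_half2 (proj2 (andP (gb z))) (jP j z jj).
have [k3 _] := AP g _ gg gs gfs.
(* W(f_j) + A(f_j) ≤ W(g) + A(g), while A(g) ≤ A(f_i + s) ≤ A(f_i) + t/3 ≤ A(f_j) + 2t/3 and W(g) ≤
   t/3. *)
exact: le_thirds k2 k3 sP (iP j) gW.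
Qed.

End core.

(** * Limits, extension by cutoff, and the theorem *)

Section limits.
Context {R : realType} {n : nat}.
Local Notation V := (Cspace R n).
Implicit Types (z w : V) (K D : set V).

Lemma cvge0_eps (x : nat -> \bar R) : (forall j, (0 <= x j)%E) ->
  (forall e : R, 0 < e -> exists j0, forall j, (j0 <= j)%N -> (x j <= e%:E)%E) -> x @ \oo --> 0%E.
Proof.
move=> x0 h; apply/fine_cvgP; split.
  have [j0 H] := h 1 ltr01; exists j0 => // j /= jj.
  by rewrite ge0_fin_numE//; apply: le_lt_trans (H j jj) (ltry 1).
apply/cvgrPdist_le => e e0; have [j0 H] := h e e0; exists j0 => // j /= jj.
have xf : x j \is a fin_num by rewrite ge0_fin_numE//; apply: le_lt_trans (H j jj) (ltry e).
by rewrite sub0r normrN ger0_norm ?fine_ge0// -lee_fin fineK//; exact: H.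
Qed.

Lemma compact_neg K (f : V -> R) : compact K -> (forall z, K z -> {for z, continuous f}) -> (forall z, K z -> f z < 0) ->
  exists2 m : R, 0 < m & forall z, K z -> f z <= - m.
Proof.
move=> cK cf fneg; suff [k H] : exists k : nat, forall z, K z -> f z <= - k.+1%:R^-1.
  by exists k.+1%:R^-1 => //; rewrite invr_gt0.
apply: contrapT => /forallNP H.
have /choice[x xP] : forall k : nat, exists x, K x /\ - k.+1%:R^-1 < f x.
  move=> k; have /existsNP[x /not_implyP[Kx /negP]] := H k; rewrite -ltNge => h; by exists x.
have [z Kz zP] := compact_seq cK (fun k => proj1 (xP k)).
have fz : 0 < - f z / 2 by rewrite divr_gt0// oppr_gt0 fneg.
have /cvg_nrP/(_ _ fz)[d dd dP] := cf z Kz.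
have [N NP] := archi_inv fz; have [k kN kd] := zP d N dd.
have := dP _ kd; have := NP k kN; have [_] := xP k; rewrite ltr_norml => h1 h2 /andP[_ h3].
move: h1 h2 h3; move: (k.+1%:R^-1) => q *; lra.
Qed.

Lemma cut_cts D (chi g : V -> R) : test_smooth D chi -> (forall z, D z -> {for z, continuous g}) ->
  continuous (fun z => chi z * g z).
Proof.
move=> tc cg z; have [cc _] := test_Cc tc; have [_ _ cD] := tc.
have [Dz|nD] := pselect (D z); first exact: (cvgM (cc z) (cg z Dz)).
have oz : nbhs z (~` supp chi).
  have oc : open (~` supp chi) by apply: closed_openC; exact: closed_closure.
  by move: oc; rewrite openE; apply => /cD.
have /nbhs_nrP[d d0 dP] := oz; apply/cvg_nrP => e e0; exists d => // y yz.
have zz : nr (z - z) < d by rewrite subrr nr0.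
by rewrite (supp_out (dP y yz)) (supp_out (dP z zz)) !mul0r subrr normr0.
Qed.

End limits.

Theorem theorem0p4 (R : realType) (n : nat) (hn : (2 <= n)%N)
  (Omega : set (Cspace R n)) (hOmega : domain Omega)
  (bOmega : bounded_set Omega)
  (u : Cspace R n -> \bar R) (umax : maximal_psh Omega u)
  (uneg : forall z, Omega z -> (u z < 0)%E)
  (U Ut : set (Cspace R n)) (oU : open U) (oUt : open Ut)
  (UUt : relatively_compact U Ut) (UtOmega : relatively_compact Ut Omega)
  (uj : nat -> Cspace R n -> R)
  (uj_psh : forall j, psh_neg Ut (fun z => (uj j z)%:E))
  (uj_cont : forall j, {within Ut, continuous (uj j)})
  (uj_decr : forall z, Ut z -> forall j k, (j <= k)%N -> uj k z <= uj j z)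
  (uj_cvg : forall z, Ut z -> (fun j => (uj j z)%:E) @ \oo --> u z)
  (mu : nat -> {measure set (Bspace R n) -> \bar R})
  (mu_MA : forall j, is_monge_ampere Ut (uj j) (mu j))
  (a : R) (ha : n%:R - 1 < a) :
  (fun j => \int[mu j]_(z in U) (`|uj j z| `^ (- a))%:E)%E @ \oo --> 0%E.
Proof.
have n0 : (0 < n)%N by exact: ltnW.
have n2 : (2 : R) <= n%:R by rewrite (ler_nat R 2 n).
(* An exponent in ]n-1, n[ not exceeding a; the excess a - al is absorbed by the lower bound on
   |u_j|. *)
pose al := Num.min a (n%:R - 1 / 2).
have al1 : n%:R - 1 < al by rewrite lt_min ha/=; lra.
have [ala al2'] : al <= a /\ al <= n%:R - 1 / 2 by rewrite /al !ge_min !lexx orbT.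
have al2 : al < n%:R by move: al2'; lra.
have al0 : 0 < al by move: al1 n2; lra.
have [cK0 K0Ut] := UUt; have [_ UtO] := UtOmega.
have ujc j z : Ut z -> {for z, continuous (uj j)}.
  move=> Uz; have := uj_cont j; rewrite (continuous_open_subspace _ oUt) => h; apply: h; exact: mem_set.
have [eta [[etaS ck1 kd1] eta01 [d1 d10 d1P]]] := cutoff cK0 oUt K0Ut.
have [chi [tchi chi01 [d2 d20 d2P]]] := cutoff ck1 oUt kd1.
have [_ cK2 K2Ut] := tchi.
have [m0 m00 um0] : exists2 m : R, 0 < m & forall z, supp chi z -> uj 0%N z <= - m.
  apply: compact_neg => // z /K2Ut Uz; first exact: ujc.
  by have [_ h] := uj_psh 0%N; have := h z Uz; rewrite lte_fin.
pose D1 := nbd (supp eta) d2.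
have oD1 : open D1 by exact: open_nbd.
have chi1 z : D1 z -> chi z = 1 by move=> [x Kx zx]; exact: (d2P x).
have D1K : D1 `<=` supp chi by move=> z /chi1 e; apply: suppP; rewrite e oner_neq0.
have D1U : D1 `<=` Ut := subset_trans D1K K2Ut.
have K2O : supp chi `<=` Omega by move=> z /K2Ut Uz; apply: UtO; exact: subset_closure.
(* As u_j ≤ u_0 ≤ -m0 on the support of χ, this is a nonpositive continuous function of compact
   support; F_j - m0 is u_j on [D1] and at most -m0 everywhere. *)
pose F j z := chi z * (uj j z + m0).
have Fc j : Cc (F j).
  split.
    apply: (@cut_cts R n Ut chi (fun z => uj j z + m0) tchi) => z Uz; exact: (cvgD (ujc j z Uz) (cvg_cst m0)).
  by have [_ [M cM]] := test_Cc tchi; exists M => z /cM; rewrite /F => ->; rewrite mul0r.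
have ch z : 0 <= chi z by have /andP[] := chi01 z.
have chU z : chi z != 0 -> Ut z by move=> /suppP/K2Ut.
have F0 j z : F j z <= 0.
  have [e|ne] := eqVneq (chi z) 0; first by rewrite /F e mul0r.
  rewrite /F mulr_ge0_le0//; have := uj_decr z (chU z ne) 0%N j (leq0n _).
  by have := um0 z (suppP ne); lra.
have Fd j z : F j.+1 z <= F j z.
  have [e|ne] := eqVneq (chi z) 0; first by rewrite /F e !mul0r.
  by rewrite /F ler_wpM2l// lerD2r; apply: uj_decr => //; exact: chU.
have FE j z : D1 z -> F j z = uj j z + m0 by move=> /chi1 e; rewrite /F e mul1r.
have Fu z : D1 z -> (fun j => (F j z - m0)%:E) @ \oo --> u z.
  move=> Dz; have -> : (fun j => (F j z - m0)%:E) = (fun j => (uj j z)%:E).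
    by apply/funext => j; rewrite (FE j z Dz) addrK.
  exact: uj_cvg (D1U z Dz).
have FP j : PC D1 (F j).
  move=> z w dzw; have [pj _] := uj_psh j.
  have cFm : continuous (fun y : Cspace R n => F j y - m0).
    have cF : continuous (F j) by case: (Fc j).
    have cm : continuous (fun _ : Cspace R n => m0) by exact: cts_cst.
    exact: ctsB cF cm.
  have dU : disc Ut z w by move=> c c1; exact: D1U (dzw c c1).
  have uE c : cnorm c <= 1 -> ((uj j (z + c *: w))%:E = (F j (z + c *: w) - m0)%:E)%E.
    by move=> c1; rewrite (FE j _ (dzw c c1)) addrK.
  have s1 := psh_sub pj cFm dU uE.
  have := sub_lin ler01 s1 (sub_cst m0 z w); apply: sub_ext => y.
  by rewrite mul1r subrK.
have KD1 x y : supp eta x -> nr (y - x) < d2 -> D1 y by move=> Kx yx; exists x.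
have K1D1 : supp eta `<=` D1 by exact: nbd_self.
have e1 z : closure U z -> eta z = 1 by move=> Kz; apply: (d1P z z Kz); rewrite subrr nr0.
have UK1 : U `<=` supp eta.
  by move=> z Uz; apply: suppP; rewrite e1 ?oner_neq0//; exact: subset_closure.
pose chi' z := eta z ^+ 2.
have cchi' : continuous chi'.
  have ce : continuous eta by have /smoothP/(_ 0%N) := etaS; case.
  exact: (ctsM ce ce).
have chi'01 z : 0 <= chi' z <= 1.
  by have /andP[h1 h2] := eta01 z; rewrite /chi' exprn_ge0//= exprn_ile1.
have chi'1 z : U z -> chi' z = 1 by move=> Uz; rewrite /chi' e1 ?expr1n//; exact: subset_closure.
have chi'0 z : ~ supp eta z -> chi' z = 0 by move=> oz; rewrite /chi' (supp_out oz) expr0n.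
have Fm j z : F j z - m0 <= - m0 by have := F0 j z; lra.
(* The errors halve at each step, which makes the f_j decrease; being at most m0/8, they keep f_j ≤
   -m0/2. *)
pose dl (j : nat) : R := m0 / 8 * 2^-1 ^+ j.
have dl0 j : 0 < dl j by rewrite mulr_gt0 ?divr_gt0// exprn_gt0// invr_gt0.
have dlS j : dl j.+1 = dl j / 2 by rewrite /dl exprSr mulrA.
have dlm j : 8 * dl j <= m0.
  have : dl j <= m0 / 8 by rewrite /dl ler_piMr ?divr_ge0 ?(ltW m00)// exprn_ile1 ?invr_ge0// invf_le1// ler1n.
  lra.
pose C := m0 `^ (al - a).
(* One mollifier for each j serves both the transfer from the measure, with error 1/(j+1), and the
   uniform approximation of F_j within [dl j]. *)
have /choice[p pP] : forall j, exists p : R * (Cspace R n -> R), [/\ mollifier p.1 p.2, p.1 <= d2 / 2,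
   forall z, `|cnv p.2 (F j) z - F j z| <= dl j &
   (\int[mu j]_(z in U) (`|uj j z| `^ (- a))%:E <= (C *
     (Cintegral (fun z => chi' z * Pw (- al) (fun z => F j z - m0)%R z * top (Xf n 0 (cnv p.2 (F j)) z)) + j.+1%:R^-1))%:E)%E].
  move=> j; have j0 : 0 < j.+1%:R^-1 :> R by rewrite invr_gt0.
  have [e2 e20 H2] := ma_upper oUt oD1 D1U oU UK1 ck1 K1D1 (Fc j) (FP j) (FE j) (Fm j) m00 al0 ala cchi' chi'01 chi'1 chi'0 (mu_MA j) j0.
  have [e3 e30 H3] := conv_approx (Fc j) (dl0 j).
  pose e := Num.min e2 (Num.min e3 (d2 / 2)).
  have e0 : 0 < e by rewrite !lt_min e20 e30 divr_gt0.
  have [a1 a2 a3] : [/\ e <= e2, e <= e3 & e <= d2 / 2] by rewrite /e; split; rewrite !ge_min !lexx ?orbT.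
  have [ka mka] := @mollifier_exists R n e e0.
  by exists (e, ka); split => //=; [exact: H3 mka|exact: (H2 e)].
pose kap j := (p j).2; pose e_ j := (p j).1.
have mk j : mollifier (e_ j) (kap j) by case: (pP j).
have ek j : e_ j <= d2 / 2 by case: (pP j).
have kF j z : `|cnv (kap j) (F j) z - F j z| <= dl j by case: (pP j).
have [rho [d0 [r1 [tr rho01 [d00 KD] [r10 rho1]]]]] := @rho_exists R n (supp eta) d2 d20 ck1.
have WC := @Wi_cvg0 R n Omega u n0 hOmega umax uneg D1 (supp eta) (supp chi) F m0 d2 eta oD1 D1K cK2 K2O m00 d20
  Fc FP F0 Fd Fu KD1 etaS (@subset_refl _ _) eta01 dl e_ kap dl0 dlS dlm mk ek kF al al1 al2 rho d0 r1 tr rho01 d00 KD r10 rho1.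
have WG := @Wi_ge R n n0 D1 (supp eta) F m0 d2 eta m00 d20 Fc FP F0 ck1 KD1 etaS (@subset_refl _ _) dl e_ kap dl0 dlm mk ek kF al al1.
apply: cvge0_eps => [j|e e0].
  by apply: integral_ge0 => z _; rewrite lee_fin powR_ge0.
have C0 : 0 <= C by exact: powR_ge0.
have C1 : 0 < C + 1 by rewrite ltr_wpDl.
have t0 : 0 < e / (C + 1) / 2 by rewrite !divr_gt0.
have [j1 H1] := WC _ t0; have [j2 H2] := archi_inv t0.
exists (maxn j1 j2) => j; rewrite geq_max => /andP[jj1 jj2].
have [_ _ _ h] := pP j; apply: le_trans h _; rewrite lee_fin.
have q1 := WG j; have q2 := H1 j jj1; have q3 := ltW (H2 j jj2).
apply: (@le_trans _ _ (C * (e / (C + 1)))); last first.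
  by rewrite mulrCA ger_pMr// ler_pdivrMr// mul1r lerDl.
apply: ler_wpM2l => //; rewrite [leRHS]splitr; apply: lerD => //.
exact: le_trans q1 q2.
Qed.
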